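(* The three two-dimensional Jellium energies coincide: $e_{\mathrm{Jel}} = e_{\mathrm{per}} = e_{\mathrm{UEG}}$. (In particular, the limit defining $e_{\mathrm{per}}$ exists.)
   Context: Work in $\mathbb{R}^2$ with Coulomb interaction $-\log|x|$. Jellium: for a domain $\Omega_N\subset\mathbb{R}^2$ with $|\Omega_N|=N$ and points $x_1,\dots,x_N\in\mathbb{R}^2$, $$\mathcal{E}_{\mathrm{Jel}}(\Omega_N,x_1,\dots,x_N)= -\sum_{j<k}\log|x_j-x_k|+\sum_{j=1}^N\int_{\Omega_N}\log|x_j-y|\,dy-\frac12\iint_{\Omega_N\times\Omega_N}\log|x-y|\,dx\,dy,$$ and $e_{\mathrm{Jel}}=\lim_{\Omega_N\nearrow\mathbb{R}^2}\min_{x_1,\dots,x_N}\mathcal{E}_{\mathrm{Jel}}(\Omega_N,x_1,\dots,x_N)/|\Omega_N|$, a thermodynamic limit known to exist (and be independent of the sequence) e.g. for $\Omega_N=N^{1/2}\Omega$ with $\Omega$ a fixed convex set of area $1$. Periodic Jellium: let $G_1$ be the $\mathbb{Z}^2$-periodic function with $-\Delta G_1=2\pi(\sum_{z\in\mathbb{Z}^2}\delta_z-1)$ and $\int_{(-1/2,1/2)^2}G_1=0$; let $G_\ell(x)=G_1(x/\ell)=\frac{2\pi}{\ell^2}\sum_{k\in\frac{2\pi}{\ell}\mathbb{Z}^2\setminus\{0\}}\frac{e^{ik\cdot x}}{|k|^2}$, and $C_{\mathrm{mad}}=\lim_{x\to0}(G_1(x)+\log|x|)$. For $n=\ell^2$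 points $x_1,\dots,x_n$ in the torus of side $\ell$, set $\mathcal{E}_{\mathrm{per},\ell}(x_1,\dots,x_n)=\sum_{j<k}G_\ell(x_j-x_k)+\frac n2(\log\ell+C_{\mathrm{mad}})$ and $e_{\mathrm{per}}=\lim_{\ell\to\infty}\min_{x_1,\dots,x_n}\mathcal{E}_{\mathrm{per},\ell}(x_1,\dots,x_n)/\ell^2$. Uniform electron gas: for a probability measure $\mathbb{P}$ on $(\mathbb{R}^2)^N$ let $\rho_{\mathbb{P}}$ be the sum of its $N$ one-particle marginals, and $$\mathcal{E}_{\mathrm{Ind}}(\mathbb{P})=-\int\sum_{j<k}\log|x_j-x_k|\,d\mathbb{P}(x_1,\dots,x_N)+\frac12\iint\log|x-y|\rho_{\mathbb{P}}(x)\rho_{\mathbb{P}}(y)\,dx\,dy.$$ For a density $\rho$ with $\int\rho=N$ set $\mathcal{E}_{\mathrm{Ind}}(\rho)=\min_{\mathbb{P}:\rho_{\mathbb{P}}=\rho}\mathcal{E}_{\mathrm{Ind}}(\mathbb{P})$, and $e_{\mathrm{UEG}}=\lim_{\Omega_N\nearrow\mathbb{R}^2}\mathcal{E}_{\mathrm{Ind}}(\mathbbm{1}_{\Omega_N})/|\Omega_N|$ (this thermodynamic limit is known to exist). *)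

(* Defs.v *)
From HB Require Import structures.
From mathcomp Require Import all_boot all_order all_algebra.
From mathcomp Require Import all_classical all_reals all_analysis.
Set Implicit Arguments. Unset Strict Implicit. Unset Printing Implicit Defensive.
Import Order.TTheory GRing.Theory Num.Theory.
Import numFieldNormedType.Exports.
Local Open Scope classical_set_scope.
Local Open Scope ring_scope.

Section Jellium2D.
Variable R : realType.

Definition psub (x y : R * R) : R * R := (x.1 - y.1, x.2 - y.2).
Definition dist2 (x y : R * R) : R :=
  Num.sqrt ((x.1 - y.1) ^+ 2 + (x.2 - y.2) ^+ 2).

Definition leb2 := (@lebesgue_measure R \x @lebesgue_measure R)%E.
Definition Rint2 (A : set (R * R)) (f : R * R -> R) : R := Rintegral leb2 A f.

(* closed square of side a centred at 0; Omega_N = N^(1/2) Omega with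
   Omega = [-1/2,1/2]^2 is sq (sqrt N), of area N *)
Definition sq (a : R) : set (R * R) :=
  `[- (a / 2), a / 2]%classic `*` `[- (a / 2), a / 2]%classic.
Definition cell : set (R * R) := sq 1.

Definition distinct (N : nat) (x : 'I_N -> R * R) : Prop :=
  forall j k : 'I_N, j != k -> x j <> x k.

Definition EJel (N : nat) (Om : set (R * R)) (x : 'I_N -> R * R) : R :=
  - (\sum_(j < N) \sum_(k < N | (j < k)%N) ln (dist2 (x j) (x k)))
  + \sum_(j < N) Rint2 Om (fun y => ln (dist2 (x j) y))
  - 2^-1 * Rint2 Om (fun y => Rint2 Om (fun z => ln (dist2 y z))).

Definition minJel (N : nat) : \bar R :=
  ereal_inf [set (EJel (sq (Num.sqrt N%:R)) x)%:E | x in [set x | @distinct N x]].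

Definition jel_seq (N : nat) : \bar R := (minJel N * (N%:R^-1)%:E)%E.

Definition on_lattice (x : R * R) : Prop :=
  exists m1 m2 : int, x = (m1%:~R, m2%:~R).

(* G1 : the Z^2-periodic solution of -Delta G1 = 2 pi (sum_z delta_z - 1)
   with zero mean on the unit cell, characterised by: periodicity,
   continuity away from Z^2, integrability on the cell and its Fourier
   coefficients  hat G1(m) = 1/(2 pi |m|^2) (m <> 0), hat G1(0) = 0. *)
Definition IsG1 (G1 : R * R -> R) : Prop :=
  [/\ (forall (x : R * R) (m1 m2 : int),
         G1 (x.1 + m1%:~R, x.2 + m2%:~R) = G1 x),
      (forall x : R * R, ~ on_lattice x -> {for x, continuous G1}),
      leb2.-integrable cell (fun x => (G1 x)%:E),
      (forall m1 m2 : int,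
         Rint2 cell (fun x => G1 x * cos (2 * pi * (m1%:~R * x.1 + m2%:~R * x.2)))
         = (if (m1 == 0) && (m2 == 0) then 0
            else (2 * pi * (m1%:~R ^+ 2 + m2%:~R ^+ 2))^-1))
    & (forall m1 m2 : int,
         Rint2 cell (fun x => G1 x * sin (2 * pi * (m1%:~R * x.1 + m2%:~R * x.2)))
         = 0)].

Definition IsCmad (G1 : R * R -> R) (Cmad : R) : Prop :=
  (fun x : R * R => G1 x + ln (dist2 x (0, 0))) @ (((0 : R), (0 : R)))^'
    --> Cmad.

Definition Gl (G1 : R * R -> R) (l : R) (x : R * R) : R :=
  G1 (x.1 / l, x.2 / l).

Definition Eper (G1 : R * R -> R) (Cmad : R) (n : nat) (x : 'I_n -> R * R) : R :=
  let l := Num.sqrt n%:R in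
  \sum_(j < n) \sum_(k < n | (j < k)%N) Gl G1 l (psub (x j) (x k))
  + n%:R / 2 * (ln l + Cmad).

(* configurations of n = l^2 distinct points of the torus of side l,
   represented in the fundamental domain [0,l)^2 *)
Definition torus_conf (n : nat) (x : 'I_n -> R * R) : Prop :=
  let l := Num.sqrt n%:R in
  distinct x /\ (forall j, x j \in `[0, l[%classic `*` `[0, l[%classic).

Definition minPer (G1 : R * R -> R) (Cmad : R) (n : nat) : \bar R :=
  ereal_inf [set (Eper G1 Cmad x)%:E | x in [set x | @torus_conf n x]].

Definition per_seq G1 Cmad (n : nat) : \bar R :=
  (minPer G1 Cmad n * (n%:R^-1)%:E)%E.

Definition mlog (x y : R * R) : \bar R :=
  if x == y then +oo%E else (- ln (dist2 x y))%:E.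

Definition interaction (N : nat) (x : N.-tuple (R * R)) : \bar R :=
  (\sum_(j < N) \sum_(k < N | (j < k)%N) mlog (tnth x j) (tnth x k))%E.

Definition has_density_indicator (N : nat) (A : set (R * R))
    (P : probability (N.-tuple (R * R)) R) : Prop :=
  forall B : set (R * R), measurable B ->
    (\sum_(j < N) P [set x | tnth x j \in B])%E = leb2 (B `&` A).

Definition EInd (N : nat) (A : set (R * R))
    (P : probability (N.-tuple (R * R)) R) : \bar R :=
  (\int[P]_x interaction x
   + (2^-1 * Rint2 A (fun y => Rint2 A (fun z => ln (dist2 y z))))%:E)%E.

Definition minUEG (N : nat) : \bar R :=
  ereal_inf [set @EInd N (sq (Num.sqrt N%:R)) P
            | P in [set P | @has_density_indicator N (sq (Num.sqrt N%:R)) P]].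

Definition ueg_seq (N : nat) : \bar R := (minUEG N * (N%:R^-1)%:E)%E.

End Jellium2D.

(* Main.v *)
(** The common value is e0, the infimum over m of the energy per area of a state of m^2
    particles whose density is exactly 1 on a square of side m. States are built from single
    particles, independent products and mixtures, and their energy is the expectation of the
    pair interaction.

    Upper bounds: optimal squares of unit density are neutral and do not interact on average,
    so they can be placed side by side, independent particles filling what remains. Realizing
    the state as a law on N-tuples bounds the energy of the uniform electron gas, hence that of
    jellium; choosing the points one after the other bounds the periodic energy, because the
    periodic kernel is - ln |x| + constant at short distance and has mean zero.

    Lower bounds: a jellium configuration is first confined to a disc (balayage onto a circle
    through Moebius images of roots of unity). Smeared, averaged over rotations and surrounded
    by optimal squares it becomes a tile of almost unit density with almost no field outside.
    A large floating array of such tiles, mixed with independent particles of slightly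
    corrected density, is a competitor for e0. For the periodic problem, a large piece of the
    crystal of a periodic configuration is a jellium configuration whose energy per cell
    converges to the periodic energy. There the periodic kernel enters as the lattice sum of
    the potential of a neutral point-plus-cell charge, and is identified with G1 by its
    Fourier coefficients and its logarithmic singularity. *)
Require Import Defs.
From HB Require Import structures.
From mathcomp Require Import all_boot all_order all_algebra.
From mathcomp Require Import all_classical all_reals all_analysis.
From mathcomp Require Import measurable_realfun.
From mathcomp Require Import ring lra zify.
Set Implicit Arguments.
Unset Strict Implicit.
Unset Printing Implicit Defensive.
Import Order.TTheory GRing.Theory Num.Theory.
Import numFieldNormedType.Exports.
Local Open Scope classical_set_scope.
Local Open Scope ring_scope.

(** * Integration in the plane *)

(** That jellium lies below the electron gas is plain averaging. The difficulty is the converse: a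
    minimizing configuration has no prescribed density, whereas a competitor for [e0] must have
    density exactly 1. A state carries its energy as a function of the kernel, so that one
    construction serves both the plane and the torus; tile densities are constant on a mesh, so that
    finite mixtures of shifts can flatten them. The long range of the logarithm shapes the argument:
    the number of pairs of tiles grows like the square of the area, so the field outside a tile must
    be made small after the size of the array is fixed, while the energy of the tile and its inner
    potential stay bounded. For the torus the danger is that lattice sums of dipole or quadrupole
    potentials depend on the order of summation and shift the energy per cell. Centring removes the
    dipole and the quarter-turn symmetry of the square the quadrupole; the potentials left decay
    like [|x|^-4], and the second moments that survive, all proportional to [alpha (1, 0)], cancel
    between particles and background. *)

HB.instance Definition _ (R : realType) := Measure.on (@leb2 R).
Lemma leb2_sigma_finite (R : realType) : sigma_finite setT (@leb2 R).
Proof.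
have /sigma_finiteP[F [TF ndF Foo]] := sigma_finiteT (@lebesgue_measure R).
exists (fun n => F n `*` F n).
  rewrite -setXTT TF predeqE => -[x y]; split.
    move=> [/= [n _ Fnx] [k _ Gky]]; exists (maxn n k) => //; split.
    - by move: x Fnx; exact/subsetPset/ndF/leq_maxl.
    - by move: y Gky; exact/subsetPset/ndF/leq_maxr.
  by move=> [n _ []/= ? ?]; split; exists n.
move=> k; have [? ?] := Foo k.
split; first exact: measurableX.
by rewrite [X in (X < _)%E]product_measure1E// lte_mul_pinfty// ge0_fin_numE.
Qed.
HB.instance Definition _ (R : realType) :=
  Measure_isSigmaFinite.Build _ _ _ (@leb2 R) (@leb2_sigma_finite R).

HB.lock Definition I2 {R : realType} (f : R * R -> R) : R := Rint2 setT f.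

Section Integration.
Context {R : realType}.
Local Notation R2 := (R * R)%type.
Implicit Types (f g : R2 -> R) (x y z : R2).

Definition ig f : Prop := (@leb2 R).-integrable setT (EFin \o f).

Lemma ig_meas f : ig f -> measurable_fun setT f.
Proof. by move=> /integrableP[/measurable_EFinP]. Qed.

Lemma ig_lty f : ig f -> (\int[@leb2 R]_x `|f x|%:E < +oo)%E.
Proof. by move=> /integrableP[_]. Qed.

Lemma ig_of f : measurable_fun setT f ->
  (\int[@leb2 R]_x `|f x|%:E < +oo)%E -> ig f.
Proof. by move=> mf h; apply/integrableP; split => //; apply/measurable_EFinP. Qed.

Lemma I2E f : ig f -> (\int[@leb2 R]_x (f x)%:E)%E = (I2 f)%:E.
Proof.
by move=> h; rewrite I2.unlock /Rint2 /Rintegral fineK// (integrable_fin_num _ h).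
Qed.

Lemma igD f g : ig f -> ig g -> ig (fun x => f x + g x).
Proof. by move=> hf hg; exact: (integrableD _ hf hg). Qed.
Lemma igN f : ig f -> ig (fun x => - f x).
Proof. by move=> hf; exact: (integrableN hf). Qed.
Lemma igB f g : ig f -> ig g -> ig (fun x => f x - g x).
Proof. by move=> hf hg; apply: igD => //; exact: igN. Qed.
Lemma igZ c f : ig f -> ig (fun x => c * f x).
Proof. by move=> hf; exact: (integrableZl _ c hf). Qed.
Lemma ig0 : ig (fun _ => 0).
Proof. exact: integrable0. Qed.
Lemma ig_abs f : ig f -> ig (fun x => `|f x|).
Proof. by move=> hf; exact: (integrable_norm hf). Qed.
Lemma ig_le f g : measurable_fun setT f -> (forall x, `|f x| <= g x) -> ig g -> ig f.
Proof.
move=> mf h; apply: le_integrable => //; first exact/measurable_EFinP.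
by move=> x _ /=; rewrite lee_fin (le_trans (h x))// ler_norm.
Qed.
Lemma ig_sum (I : Type) (s : seq I) (P : pred I) (F : I -> R2 -> R) :
  (forall i, ig (F i)) -> ig (fun x => \sum_(i <- s | P i) F i x).
Proof.
move=> h; elim: s => [|i s ih].
  by under eq_fun do rewrite big_nil; exact: ig0.
under eq_fun do rewrite big_cons.
by case: (P i) => //; apply: igD.
Qed.

Lemma eq_ig f g : f =1 g -> ig f -> ig g.
Proof. by move=> /funext->. Qed.
Lemma eq_I2 f g : f =1 g -> I2 f = I2 g.
Proof. by move=> /funext->. Qed.

Lemma I2D f g : ig f -> ig g -> I2 (fun x => f x + g x) = I2 f + I2 g.
Proof. by move=> hf hg; rewrite I2.unlock; exact: (RintegralD _ hf hg). Qed.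
Lemma I2Z c f : ig f -> I2 (fun x => c * f x) = c * I2 f.
Proof. by move=> hf; rewrite I2.unlock; exact: RintegralZl. Qed.
Lemma I2N f : ig f -> I2 (fun x => - f x) = - I2 f.
Proof.
by move=> hf; rewrite -mulN1r -I2Z//; apply: eq_I2 => x; rewrite mulN1r.
Qed.
Lemma I2B f g : ig f -> ig g -> I2 (fun x => f x - g x) = I2 f - I2 g.
Proof. by move=> hf hg; rewrite I2D ?I2N//; exact: igN. Qed.
Lemma I20 : I2 (fun _ : R2 => 0 : R) = 0.
Proof. by have := I2Z 0 ig0; rewrite !mul0r. Qed.
Lemma I2_sum (I : Type) (s : seq I) (P : pred I) (F : I -> R2 -> R) :
  (forall i, ig (F i)) ->
  I2 (fun x => \sum_(i <- s | P i) F i x) = \sum_(i <- s | P i) I2 (F i).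
Proof.
move=> h; elim: s => [|i s ih].
  by rewrite big_nil; under eq_I2 do rewrite big_nil; exact: I20.
rewrite big_cons; under eq_I2 do rewrite big_cons.
by case: (P i) => //; rewrite I2D ?ih//; exact: ig_sum.
Qed.
Lemma I2_le f g : ig f -> ig g -> (forall x, f x <= g x) -> I2 f <= I2 g.
Proof. by move=> hf hg h; rewrite I2.unlock; apply: le_Rintegral. Qed.
Lemma I2_ge0 f : (forall x, 0 <= f x) -> 0 <= I2 f.
Proof. by move=> h; rewrite I2.unlock; apply: Rintegral_ge0. Qed.
Lemma I2_abs f : ig f -> `|I2 f| <= I2 (fun x => `|f x|).
Proof. by move=> hf; rewrite I2.unlock; apply: le_normr_Rintegral. Qed.

Lemma Rint2_I2 (A : set R2) f : Rint2 A f = I2 (fun x => \1_A x * f x).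
Proof.
rewrite I2.unlock /Rint2 Rintegral_mkcond; congr Rintegral; apply/funext => x.
by rewrite patchE indicE; case: ifP => _; rewrite ?mul1r ?mul0r.
Qed.

Section swap.
Variable F : R2 -> R2 -> R.
Hypothesis mF : measurable_fun setT (fun p : R2 * R2 => F p.1 p.2).

Lemma tonelli_abs :
  (\int[@leb2 R]_x \int[@leb2 R]_y `|F x y|%:E =
   \int[@leb2 R]_y \int[@leb2 R]_x `|F x y|%:E)%E.
Proof.
apply: (@fubini_tonelli _ _ _ _ _ (@leb2 R) (@leb2 R) (fun p => `|F p.1 p.2|%:E)).
  by apply/measurable_EFinP; exact: measurableT_comp.
by move=> p; rewrite lee_fin.
Qed.

Hypothesis fF : (\int[@leb2 R]_x \int[@leb2 R]_y `|F x y|%:E < +oo)%E.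

Let iF : ((@leb2 R) \x (@leb2 R))%E.-integrable setT (EFin \o (fun p : R2 * R2 => F p.1 p.2)).
Proof. by apply/integrable12ltyP => //; exact/measurable_EFinP. Qed.

Lemma ig_inner : (forall x, ig (F x)) -> ig (fun x => I2 (F x)).
Proof.
move=> h; have := integrable_fubini_F iF.
by apply: eq_integrable => // x _; rewrite /fubini_F /= I2E.
Qed.

Lemma ig_inner2 : (forall y, ig (F^~ y)) -> ig (fun y => I2 (F^~ y)).
Proof.
move=> h; apply/ig_of.
  apply/measurable_EFinP; have := measurable_fubini_G iF.
  by apply: eq_measurable_fun => x _; rewrite /fubini_G /= I2E.
move: fF; rewrite tonelli_abs; apply: le_lt_trans; apply: ge0_le_integral => //.
- apply/measurable_EFinP/measurableT_comp => //.
  apply/measurable_EFinP; have := measurable_fubini_G iF.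
  by apply: eq_measurable_fun => x _; rewrite /fubini_G /= I2E.
- have := @measurable_fun_fubini_tonelli_G _ _ _ _ _ (@leb2 R) (fun p => `|F p.1 p.2|%:E).
  by apply => //; apply/measurable_EFinP; exact: measurableT_comp.
- move=> y _; have := I2E (ig_abs (h y)) => /= ->.
  by rewrite lee_fin; exact: I2_abs.
Qed.

Lemma I2_swap : (forall x, ig (F x)) -> (forall y, ig (F^~ y)) ->
  I2 (fun x => I2 (F x)) = I2 (fun y => I2 (F^~ y)).
Proof.
move=> h1 h2; have := Fubini iF.
have -> : (fun x => \int[leb2 (R:=R)]_y (EFin \o (fun p : R2 * R2 => F p.1 p.2)) (x, y))%E =
          (fun x => (I2 (F x))%:E).
  by apply/funext => x; rewrite -I2E.
have -> : (fun y => \int[leb2 (R:=R)]_x (EFin \o (fun p : R2 * R2 => F p.1 p.2)) (x, y))%E =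
          (fun y => (I2 (F^~ y))%:E).
  by apply/funext => x; rewrite -I2E.
rewrite !I2E; [by case| exact: ig_inner2| exact: ig_inner].
Qed.
End swap.
End Integration.

(** * Translations, shears and complex multiplication as changes of variables *)

Section Invariance.
Context {R : realType}.
Local Notation R2 := (R * R)%type.
Local Notation leb := (@lebesgue_measure R).

Lemma measurable_affine (a b : R) : measurable_fun setT (fun x : R => a * x + b).
Proof. by apply: measurable_funD => //; apply: measurable_funM. Qed.

(** Uniqueness of Lebesgue measure: [|a|] times the push-forward under the affine map gives every
    interval []p, q]] its length. The sign of [a] decides which end of the preimage is closed. *)
Lemma leb_affine (a b : R) (A : set R) : a != 0 -> measurable A ->
  leb ((fun x : R => a * x + b)%R @^-1` A) = ((`|a|^-1)%:E * leb A)%E.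
Proof.
move=> a0 mA.
have ma := measurable_affine a b.
pose mp : {measure set (measurableTypeR R) -> \bar R} :=
  pushforward leb (fun x : measurableTypeR R => a * x + b : measurableTypeR R).
pose m : {measure set (measurableTypeR R) -> \bar R} :=
  mscale (NngNum (normr_ge0 a)) (mp ma).
suff -> : leb A = m A.
  by rewrite /m /= /mscale /= muleA -EFinM mulVf ?normr_eq0// mul1e.
apply: lebesgue_measure_unique => // X [[p q] /= pq <-].
rewrite /m /= /mscale /= /mp /pushforward /=.
have [a_gt0|a_lt0|/eqP] := ltgtP 0 a; last by rewrite eq_sym (negbTE a0).
- have -> : (fun x : R => a * x + b) @^-1` `]p, q] = `](p - b) / a, (q - b) / a]%classic.
    apply/seteqP; split => x /=; rewrite !in_itv/= -ltrBlDr -lerBrDr ltr_pdivrMr// ler_pdivlMr//;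
    by rewrite mulrC.
  rewrite !lebesgue_measure_itv/= !lte_fin ltr_pM2r ?invr_gt0// ltrD2r.
  case: ifP => _; last by rewrite mule0.
  by rewrite gtr0_norm// -!EFinD -EFinM; congr EFin; field.
- have -> : (fun x : R => a * x + b) @^-1` `]p, q] = `[(q - b) / a, (p - b) / a[%classic.
    apply/seteqP; split => x /=; rewrite !in_itv/= -ltrBlDr -lerBrDr ltr_ndivlMr// ler_ndivrMr//;
    by rewrite mulrC andbC.
  rewrite !lebesgue_measure_itv/= !lte_fin ltr_nM2r ?invr_lt0// ltrD2r.
  case: ifP => _; last by rewrite mule0.
  by rewrite ltr0_norm// -!EFinD -EFinM; congr EFin; field.
Qed.

Lemma ge0_leb_affine (a b : R) (f : R -> \bar R) : a != 0 ->
  measurable_fun setT f -> (forall x, 0 <= f x)%E ->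
  (\int[leb]_x f (a * x + b)%R = (`|a|^-1)%:E * \int[leb]_x f x)%E.
Proof.
move=> a0 mf f0.
have ma := measurable_affine a b.
pose mp : {measure set (measurableTypeR R) -> \bar R} :=
  pushforward leb (fun x : measurableTypeR R => a * x + b : measurableTypeR R).
have nn : 0 <= `|a|^-1 by rewrite invr_ge0.
have <- : (\int[mp ma]_x f x = \int[leb]_x f (a * x + b)%R)%E.
  rewrite ge0_integral_pushforward// preimage_setT; apply: eq_integral => //.
rewrite -[(`|a|^-1)%:E]/((NngNum nn)%:num%:E) -ge0_integral_mscale//.
apply: eq_measure_integral => A mA _.
exact: (leb_affine b a0 mA).
Qed.

(** [c] is the inverse of the Jacobian of [T]. Restricting to nonnegative functions avoids carrying
    integrability through compositions. *)
Definition ge0_inv (T : R2 -> R2) (c : R) := forall f : R2 -> \bar R,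
  measurable_fun setT f -> (forall x, 0 <= f x)%E ->
  (\int[@leb2 R]_x f (T x) = c%:E * \int[@leb2 R]_x f x)%E.

Lemma tonelli1 (f : R2 -> \bar R) : measurable_fun setT f -> (forall x, 0 <= f x)%E ->
  (\int[@leb2 R]_x f x = \int[leb]_x \int[leb]_y f (x, y))%E.
Proof. by move=> mf f0; exact: fubini_tonelli1. Qed.
Lemma tonelli2 (f : R2 -> \bar R) : measurable_fun setT f -> (forall x, 0 <= f x)%E ->
  (\int[@leb2 R]_x f x = \int[leb]_y \int[leb]_x f (x, y))%E.
Proof. by move=> mf f0; exact: fubini_tonelli2. Qed.

Lemma measurable_sec1 (f : R2 -> \bar R) (x : R) : measurable_fun setT f ->
  measurable_fun setT (fun y => f (x, y)).
Proof. by move=> mf; apply: measurableT_comp => //; exact: measurable_fun_pair. Qed.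
Lemma measurable_sec2 (f : R2 -> \bar R) (y : R) : measurable_fun setT f ->
  measurable_fun setT (fun x => f (x, y)).
Proof. by move=> mf; apply: measurableT_comp => //; exact: measurable_fun_pair. Qed.

(** Tonelli reduces to the affine change of variable on each vertical line; the offset may be any
    measurable function of the first coordinate, which covers shears. *)
Lemma ge0_inv_snd (a : R) (h : R -> R) : a != 0 -> measurable_fun setT h ->
  ge0_inv (fun p => (p.1, a * p.2 + h p.1)) (`|a|^-1).
Proof.
move=> a0 mh f mf f0.
have mT : measurable_fun setT (fun p : R2 => (p.1, a * p.2 + h p.1)).
  apply: measurable_fun_pair => //; apply: measurable_funD; first exact: measurable_funM.
  exact: measurableT_comp.
rewrite tonelli1//; last exact: measurableT_comp.
under eq_integral => x _.
  rewrite /= (ge0_leb_affine (h x) a0 (measurable_sec1 x mf))//; over.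
rewrite ge0_integralZl//; first by rewrite -tonelli1.
- exact: measurable_fun_fubini_tonelli_F.
- by move=> x _; exact: integral_ge0.
Qed.

Lemma ge0_inv_fst (a : R) (h : R -> R) : a != 0 -> measurable_fun setT h ->
  ge0_inv (fun p => (a * p.1 + h p.2, p.2)) (`|a|^-1).
Proof.
move=> a0 mh f mf f0.
have mT : measurable_fun setT (fun p : R2 => (a * p.1 + h p.2, p.2)).
  apply: measurable_fun_pair => //; apply: measurable_funD; first exact: measurable_funM.
  exact: measurableT_comp.
rewrite tonelli2//; last exact: measurableT_comp.
under eq_integral => x _.
  rewrite /= (ge0_leb_affine (h x) a0 (measurable_sec2 x mf))//; over.
rewrite ge0_integralZl//; first by rewrite -tonelli2.
- exact: measurable_fun_fubini_tonelli_G.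
- by move=> x _; exact: integral_ge0.
Qed.

Lemma ge0_inv_comp (S T : R2 -> R2) c d : measurable_fun setT T ->
  ge0_inv S c -> ge0_inv T d -> ge0_inv (T \o S) (c * d).
Proof.
move=> mT hS hT f mf f0.
have -> : (fun x => f ((T \o S) x)) = (fun x => (f \o T) (S x)) by [].
rewrite hS; [|exact: (measurableT_comp mf mT)|by move=> x; exact: f0].
by rewrite /= hT// EFinM muleA.
Qed.

(** Complex multiplication on pairs; [nsq] below is the squared modulus. *)
Definition cm (u v : R2) : R2 := (u.1 * v.1 - u.2 * v.2, u.1 * v.2 + u.2 * v.1).
Definition nsq (u : R2) : R := u.1 ^+ 2 + u.2 ^+ 2.

Lemma ge0_inv_trans (b : R2) : ge0_inv (fun p => p + b) 1.
Proof.
have mT : measurable_fun setT (fun p : R2 => (1 * p.1 + b.1, p.2)).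
  by apply: measurable_fun_pair => //; apply: measurable_funD => //; exact: measurable_funM.
have := ge0_inv_comp mT (@ge0_inv_snd 1 (fun=> b.2) (oner_neq0 _) (measurable_cst _))
  (@ge0_inv_fst 1 (fun=> b.1) (oner_neq0 _) (measurable_cst _)).
rewrite normr1 invr1 mulr1; congr ge0_inv; apply/funext => -[x y] /=.
by rewrite !mul1r; case: b {mT}.
Qed.

Lemma measurable_cm (u : R2) : measurable_fun setT (cm u).
Proof.
apply: measurable_fun_pair => /=.
  by apply: measurable_funB; apply: measurable_funM.
by apply: measurable_funD; apply: measurable_funM.
Qed.

Lemma ge0_inv_cm (u : R2) : nsq u != 0 -> ge0_inv (cm u) (nsq u)^-1.
Proof.
move=> u0.
have mh c : measurable_fun setT (fun x : R => c * x).
  by apply: measurable_funM.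
have key (a b : R) : a != 0 -> ge0_inv (cm (a, b)) (nsq (a, b))^-1.
  move=> a0.
  have n0 : a ^+ 2 + b ^+ 2 != 0.
    rewrite gt_eqF// ltr_wpDr ?sqr_ge0// exprn_even_gt0//.
  (* Multiplication by [(a, b)] is a product of two shears. *)
  have mT : measurable_fun setT (fun p : R2 => (p.1, ((a^+2 + b^+2) / a) * p.2 + b / a * p.1)).
    apply: measurable_fun_pair => //.
    by apply: measurable_funD; apply: measurable_funM.
  have d0 : (a^+2 + b^+2) / a != 0 by rewrite mulf_neq0// invr_neq0.
  have := ge0_inv_comp mT (@ge0_inv_fst a _ a0 (mh (- b)))
    (@ge0_inv_snd ((a^+2 + b^+2) / a) _ d0 (mh (b / a))).
  have -> : `|a|^-1 * `|(a ^+ 2 + b ^+ 2) / a|^-1 = (nsq (a, b))^-1.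
    rewrite -invfM -normrM mulrC divfK// ger0_norm// addr_ge0 ?sqr_ge0//.
  congr ge0_inv; apply/funext => -[x y] /=; rewrite /cm /=; congr pair; first by ring.
  by field.
have [u1|] := eqVneq u.1 0; last first.
  by case: u u0 => a b u0 /= a0; exact: key.
have b0 : u.2 != 0.
  by apply: contra_neq u0 => h; rewrite /nsq u1 h expr0n/= addr0.
(* The shear factorization divides by the real part. A purely imaginary [i b] is instead the product
   of [(1 + i) / 2] and [b + i b], both with nonzero real part. *)
have h2 : (2^-1 : R) != 0 by rewrite invr_neq0.
have := ge0_inv_comp (measurable_cm (u.2, u.2)) (key 2^-1 2^-1 h2) (key u.2 u.2 b0).
have -> : (nsq (2^-1, 2^-1))^-1 * (nsq (u.2, u.2))^-1 = (nsq u)^-1.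
  by rewrite /nsq /= u1 expr0n /= add0r -invfM; congr (_^-1); field.
by congr ge0_inv; apply/funext => -[x y]; rewrite /cm /= u1; congr pair; field.
Qed.

Lemma I2_inv T c (f : R2 -> R) : ge0_inv T c -> measurable_fun setT T -> 0 < c ->
  ig f -> ig (fun x => f (T x)) /\ I2 (fun x => f (T x)) = c * I2 f.
Proof.
move=> hT mT c0 hf.
have mf := ig_meas hf.
have hc : ig (fun x => f (T x)).
  apply: ig_of; first exact: (measurableT_comp mf mT).
  rewrite (hT (fun x => `|f x|%:E)).
  - by rewrite lte_mul_pinfty// ?lee_fin ?(ltW c0)//; exact: ig_lty.
  - by apply/measurable_EFinP; exact: measurableT_comp.
  - by move=> x; rewrite lee_fin.
split => //.
have mE : measurable_fun setT (EFin \o f) by exact/measurable_EFinP.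
have hp := hT _ (measurable_funepos mE) (fun x => funepos_ge0 _ x).
have hn := hT _ (measurable_funeneg mE) (fun x => funeneg_ge0 _ x).
have fp := integrable_pos_fin_num measurableT hf; have fn := integrable_neg_fin_num measurableT hf.
apply: EFin_inj; rewrite EFinM -(I2E hc) -(I2E hf) integralE [in RHS]integralE.
rewrite muleBr//; last by rewrite fin_num_adde_defr// fin_numN.
have -> : ((fun x => (f (T x))%:E)^\+ = (fun x => (EFin \o f)^\+ (T x)))%E.
  by apply/funext => x; rewrite !funeposE.
have -> : ((fun x => (f (T x))%:E)^\- = (fun x => (EFin \o f)^\- (T x)))%E.
  by apply/funext => x; rewrite !funenegE.
by rewrite hp hn.
Qed.

Lemma measurable_trans (b : R2) : measurable_fun setT (fun x : R2 => x + b).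
Proof. by apply: measurable_fun_pair; apply: measurable_funD. Qed.
Lemma I2_trans b (f : R2 -> R) : ig f -> I2 (fun x => f (x + b)) = I2 f.
Proof.
by move=> hf; have [_ ->] := I2_inv (ge0_inv_trans b) (@measurable_trans b) ltr01 hf; rewrite mul1r.
Qed.
Lemma ig_trans b (f : R2 -> R) : ig f -> ig (fun x => f (x + b)).
Proof.
by move=> hf; have [] := I2_inv (ge0_inv_trans b) (@measurable_trans b) ltr01 hf.
Qed.
Lemma nsq_ge0 (u : R2) : 0 <= nsq u. Proof. by rewrite addr_ge0 ?sqr_ge0. Qed.
Lemma I2_cm u (f : R2 -> R) : nsq u != 0 -> ig f -> I2 (fun x => f (cm u x)) = (nsq u)^-1 * I2 f.
Proof.
move=> u0 hf; have c0 : 0 < (nsq u)^-1 by rewrite invr_gt0 lt_neqAle eq_sym u0 nsq_ge0.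
by have [_ ->] := I2_inv (ge0_inv_cm u0) (measurable_cm u) c0 hf.
Qed.
Lemma ig_cm u (f : R2 -> R) : nsq u != 0 -> ig f -> ig (fun x => f (cm u x)).
Proof.
move=> u0 hf; have c0 : 0 < (nsq u)^-1 by rewrite invr_gt0 lt_neqAle eq_sym u0 nsq_ge0.
by have [] := I2_inv (ge0_inv_cm u0) (measurable_cm u) c0 hf.
Qed.
Lemma cmN1 (x : R2) : cm (-1, 0) x = - x.
Proof. by case: x => a b; congr pair => /=; ring. Qed.
Lemma I2_opp (f : R2 -> R) : ig f -> I2 (fun x => f (- x)) = I2 f.
Proof.
have n1 : nsq (-1, 0) = 1 by rewrite /nsq /= expr0n /= addr0 sqrrN expr1n.
move=> hf; have := @I2_cm (-1, 0) f; rewrite n1 invr1 mul1r => /(_ (oner_neq0 _) hf) <-.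
by apply: eq_I2 => x; rewrite cmN1.
Qed.
Lemma ig_opp (f : R2 -> R) : ig f -> ig (fun x => f (- x)).
Proof.
have n1 : nsq (-1, 0) = 1 by rewrite /nsq /= expr0n /= addr0 sqrrN expr1n.
move=> hf; have := @ig_cm (-1, 0) f; rewrite n1 => /(_ (oner_neq0 _) hf).
by apply: eq_ig => x; rewrite cmN1.
Qed.
End Invariance.

(** * The logarithmic kernel *)
Section LogKernel.
Context {R : realType}.
Local Notation R2 := (R * R)%type.
Implicit Types (u v x y z : R2) (f g K : R2 -> R).

Definition nrm u : R := Num.sqrt (nsq u).
Definition rinv u : R := (nrm u)^-1.
(** Since [ln 0 = 0], the kernel vanishes at the origin instead of being infinite. Kernel estimates
    therefore exclude coinciding points, which are null for the integrals. *)
Definition lg u : R := ln (nrm u).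

Lemma nrm_ge0 u : 0 <= nrm u. Proof. exact: sqrtr_ge0. Qed.
Lemma nrmE u : nrm u ^+ 2 = nsq u. Proof. by rewrite /nrm sqr_sqrtr//; exact: nsq_ge0. Qed.
Lemma nrmN u : nrm (- u) = nrm u.
Proof. by rewrite /nrm /nsq /= !sqrrN. Qed.
Lemma nrmBC u v : nrm (u - v) = nrm (v - u). Proof. by rewrite -nrmN opprB. Qed.
Lemma nrm0 : nrm 0 = 0. Proof. by rewrite /nrm /nsq /= expr0n /= addr0 sqrtr0. Qed.
Lemma nsq_eq0 u : (nsq u == 0) = (u == 0).
Proof. by case: u => a b; rewrite /nsq paddr_eq0 ?sqr_ge0//= !sqrf_eq0. Qed.
Lemma nrm_eq0 u : (nrm u == 0) = (u == 0).
Proof. by rewrite -nsq_eq0 -nrmE sqrf_eq0. Qed.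
Lemma nrm_gt0 u : (0 < nrm u) = (u != 0).
Proof. by rewrite lt_neqAle nrm_ge0 andbT eq_sym nrm_eq0. Qed.
Lemma nsq_cm u v : nsq (cm u v) = nsq u * nsq v.
Proof. by rewrite /nsq /cm /=; ring. Qed.
Lemma nrm_cm u v : nrm (cm u v) = nrm u * nrm v.
Proof. by rewrite /nrm nsq_cm sqrtrM//; exact: nsq_ge0. Qed.
Lemma cm_eq0 u v : (cm u v == 0) = (u == 0) || (v == 0).
Proof. by rewrite -nrm_eq0 nrm_cm mulf_eq0 !nrm_eq0. Qed.
Lemma cmC u v : cm u v = cm v u. Proof. by rewrite /cm; congr pair; ring. Qed.
Lemma cmA u v x : cm u (cm v x) = cm (cm u v) x.
Proof. by rewrite /cm /=; congr pair; ring. Qed.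
Lemma cmDr u v x : cm u (v + x) = cm u v + cm u x.
Proof. by rewrite /cm /=; congr pair => /=; ring. Qed.
Lemma cmNr u v : cm u (- v) = - cm u v.
Proof. by rewrite /cm /=; congr pair => /=; ring. Qed.
Lemma cmBr u v x : cm u (v - x) = cm u v - cm u x. Proof. by rewrite cmDr cmNr. Qed.
Lemma cm1 u : cm (1, 0) u = u.
Proof. by case: u => a b; rewrite /cm /=; congr pair; ring. Qed.
Lemma cm0 u : cm u 0 = 0. Proof. by rewrite /cm /=; congr pair => /=; ring. Qed.

Lemma nrmD u v : nrm (u + v) <= nrm u + nrm v.
Proof.
rewrite -ler_sqr ?nnegrE ?addr_ge0 ?nrm_ge0// sqrrD !nrmE.
have h : u.1 * v.1 + u.2 * v.2 <= nrm u * nrm v.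
  apply: (le_trans (ler_norm _)).
  rewrite -ler_sqr ?nnegrE ?mulr_ge0 ?nrm_ge0// exprMn !nrmE -normrX ger0_norm ?sqr_ge0//.
  rewrite -subr_ge0 /nsq.
  have -> : (u.1 ^+ 2 + u.2 ^+ 2) * (v.1 ^+ 2 + v.2 ^+ 2) - (u.1 * v.1 + u.2 * v.2) ^+ 2 =
    (u.1 * v.2 - u.2 * v.1) ^+ 2 by ring.
  exact: sqr_ge0.
have -> : nsq (u + v) = nsq u + nsq v + 2 * (u.1 * v.1 + u.2 * v.2) by rewrite /nsq /=; ring.
by move: h; rewrite -mulr_natl; lra.
Qed.
Lemma nrmB u v : nrm (u - v) <= nrm u + nrm v.
Proof. by rewrite (le_trans (nrmD _ _))// nrmN. Qed.
Lemma nrm_lb u v : nrm u - nrm v <= nrm (u - v).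
Proof. by rewrite lerBlDr -{1}(subrK v u) nrmD. Qed.
Lemma nrm_ge1 u : `|u.1| <= nrm u.
Proof.
by rewrite -ler_sqr ?nnegrE ?nrm_ge0// nrmE real_normK ?num_real// lerDl sqr_ge0.
Qed.
Lemma nrm_ge2 u : `|u.2| <= nrm u.
Proof.
by rewrite -ler_sqr ?nnegrE ?nrm_ge0// nrmE real_normK ?num_real// lerDr sqr_ge0.
Qed.
Lemma nrm_le u : nrm u <= `|u.1| + `|u.2|.
Proof.
rewrite -ler_sqr ?nnegrE ?nrm_ge0 ?addr_ge0// nrmE sqrrD !real_normK ?num_real//.
by rewrite /nsq -addrA [_ *+ _ + _]addrC addrA lerDl mulrn_wge0 ?mulr_ge0.
Qed.

Lemma measurable_nsq : measurable_fun (setT : set R2) (@nsq R).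
Proof. by apply: measurable_funD; apply: measurable_funX. Qed.
Lemma measurable_nrm : measurable_fun (setT : set R2) nrm.
Proof.
rewrite (_ : nrm = (@powR R ^~ 2^-1) \o (@nsq R)).
  exact: (measurableT_comp (@measurable_powR R 2^-1) measurable_nsq).
by apply/funext => u /=; rewrite powR12_sqrt//; exact: nsq_ge0.
Qed.
Lemma measurable_rinv : measurable_fun (setT : set R2) rinv.
Proof.
rewrite (_ : rinv = (@powR R ^~ (-1)) \o nrm).
  exact: (measurableT_comp (@measurable_powR R (-1)) measurable_nrm).
by apply/funext => u /=; rewrite powR_inv1// nrm_ge0.
Qed.
Lemma measurable_lg : measurable_fun (setT : set R2) lg.
Proof. exact: (measurableT_comp (@measurable_ln R) measurable_nrm). Qed.

Lemma rinv_ge0 u : 0 <= rinv u. Proof. by rewrite invr_ge0 nrm_ge0. Qed.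
Lemma lg0 : lg 0 = 0. Proof. by rewrite /lg nrm0 ln0. Qed.
Lemma lgN u : lg (- u) = lg u. Proof. by rewrite /lg nrmN. Qed.
Lemma lg_cm u v : u != 0 -> v != 0 -> lg (cm u v) = lg u + lg v.
Proof. by move=> u0 v0; rewrite /lg nrm_cm lnM// posrE nrm_gt0. Qed.

(** This is [ln (1 + t) <= t] at [t = |u| / |v| - 1]. Smearing and projection errors below rest on
    it: moving a charge by [h] changes a potential by [h] times an integrable singularity. *)
Lemma lg_lip u v : u != 0 -> v != 0 -> lg u - lg v <= nrm (u - v) * rinv v.
Proof.
move=> u0 v0; rewrite /lg -ln_div ?posrE ?nrm_gt0//.
have -> : nrm u / nrm v = 1 + (nrm u / nrm v - 1) by ring.
apply: (le_trans (le_ln1Dx _)).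
  by rewrite ltrBrDl subrr divr_gt0 ?nrm_gt0.
have n0 : 0 < nrm v by rewrite nrm_gt0.
rewrite (_ : nrm u / nrm v - 1 = (nrm u - nrm v) / nrm v); last by rewrite mulrBl divff ?gt_eqF.
rewrite /rinv.
by rewrite ler_wpM2r ?invr_ge0 ?nrm_ge0// nrm_lb.
Qed.
Lemma lg_lip_abs u v : u != 0 -> v != 0 ->
  `|lg u - lg v| <= nrm (u - v) * (rinv u + rinv v).
Proof.
move=> u0 v0; rewrite ler_norml mulrDr; apply/andP; split.
  have := lg_lip v0 u0; rewrite nrmBC => h.
  have : 0 <= nrm (u - v) * rinv v by rewrite mulr_ge0 ?nrm_ge0 ?rinv_ge0.
  by lra.
have := lg_lip u0 v0.
have : 0 <= nrm (u - v) * rinv u by rewrite mulr_ge0 ?nrm_ge0 ?rinv_ge0.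
by lra.
Qed.
Lemma lg_abs u : `|lg u| <= nrm u + rinv u.
Proof.
have [->|u0] := eqVneq u 0; first by rewrite lg0 normr0 addr_ge0 ?nrm_ge0 ?rinv_ge0.
have n0 : 0 < nrm u by rewrite nrm_gt0.
rewrite ler_norml; apply/andP; split.
  have := ln_sublinear (x := (nrm u)^-1); rewrite invr_gt0 => /(_ n0).
  by rewrite lnV ?posrE// -/(lg u) -/(rinv u); move: (nrm_ge0 u); lra.
by have := ln_sublinear n0; rewrite -/(lg u); move: (rinv_ge0 u); lra.
Qed.

Definition bx (r : R) : set R2 := [set x | `|x.1| <= r /\ `|x.2| <= r].
Lemma bxE r : bx r = `[- r, r]%classic `*` `[- r, r]%classic.
Proof.
by apply/seteqP; split => -[a b] /=; rewrite /bx /= !in_itv /= !ler_norml.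
Qed.
Lemma measurable_bx r : measurable (bx r).
Proof. by rewrite bxE; exact: measurableX. Qed.
Lemma leb2_bx r : 0 <= r -> (@leb2 R) (bx r) = ((2 * r) ^+ 2)%:E.
Proof.
move=> r0; rewrite bxE [LHS]product_measure1E//= lebesgue_measure_itv/= lte_fin.
have -> : (- r < r) = (0 < r) by apply/idP/idP; lra.
case: ltgtP r0 => // [r0 _|<- _]; last by rewrite mule0 mulr0 expr0n.
by rewrite -EFinD -EFinM; congr EFin; ring.
Qed.
Lemma measurable_ind (A : set R2) : measurable A -> measurable_fun setT (\1_A : R2 -> R).
Proof. exact: measurable_indic. Qed.
Lemma ig_ind (A : set R2) : measurable A -> ((@leb2 R) A < +oo)%E -> ig (\1_A : R2 -> R).
Proof.
move=> mA fA; apply: ig_of; first exact: measurable_ind.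
under eq_integral do rewrite ger0_norm ?indicE ?ler0n// -indicE.
by rewrite integral_indic// setIT.
Qed.
Lemma I2_ind (A : set R2) : measurable A -> I2 (\1_A : R2 -> R) = fine ((@leb2 R) A).
Proof. by move=> mA; rewrite I2.unlock /Rint2 /Rintegral integral_indic// setIT. Qed.
Lemma ind_ge0 (A : set R2) x : 0 <= (\1_A x : R). Proof. by rewrite indicE ler0n. Qed.
Lemma ind_le1 (A : set R2) x : (\1_A x : R) <= 1. Proof. by rewrite indicE lern1; case: (_ \in _). Qed.
Lemma indT (A : set R2) x : A x -> \1_A x = 1 :> R.
Proof. by move=> h; rewrite indicE mem_set. Qed.
Lemma indF (A : set R2) x : ~ A x -> \1_A x = 0 :> R.
Proof. by move=> h; rewrite indicE memNset. Qed.
Lemma ind_sub (A B : set R2) x : A `<=` B -> (\1_A x : R) <= \1_B x.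
Proof.
move=> AB; have [/AB h|h] := pselect (A x); first by rewrite (indT h) ind_le1.
by rewrite (indF h) ind_ge0.
Qed.
Lemma bx_sub r s : r <= s -> bx r `<=` bx s.
Proof. by move=> rs x [h1 h2]; split; rewrite (le_trans _ rs). Qed.
Lemma ig_bx r : ig (\1_(bx r) : R2 -> R).
Proof.
apply: ig_ind; first exact: measurable_bx.
apply: (@le_lt_trans _ _ ((@leb2 R) (bx `|r|))); last by rewrite leb2_bx// ltry.
apply: le_measure; rewrite ?inE; try exact: measurable_bx.
by apply: bx_sub; exact: ler_norm.
Qed.
Lemma bx_nrm r x : nrm x <= r -> bx r x.
Proof. by move=> h; split; apply: le_trans h; [exact: nrm_ge1|exact: nrm_ge2]. Qed.
Lemma nrm_bx r x : bx r x -> nrm x <= 2 * r.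
Proof. by move=> [h1 h2]; apply: (le_trans (nrm_le _)); move: h1 h2; lra. Qed.

Lemma geom_eseries : (\sum_(n <oo) ((8 * 2^-1 ^+ n : R))%:E < +oo)%E.
Proof.
have : (series (geometric (8 : R) 2^-1)) @ \oo --> (8 * (1 - 2^-1)^-1 : R).
  by apply: cvg_geometric_series; rewrite ger0_norm ?invr_ge0// invf_lt1// ltr1n.
move=> h; have -> : (\sum_(n <oo) ((8 * 2^-1 ^+ n : R))%:E = (8 * (1 - 2^-1)^-1 : R)%:E)%E.
  apply/cvg_lim => //.
  have -> : (fun n => \sum_(0 <= i < n) ((8 * 2^-1 ^+ i : R))%:E)%E =
    EFin \o series (geometric (8 : R) 2^-1).
    by apply/funext => n /=; rewrite sumEFin.
  by apply: cvg_EFin => //; exact: nearW.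
exact: ltry.
Qed.

Definition bxn n : set R2 := bx (2^-1 ^+ n).
(** A point whose sup norm lies between [2^-(k+1)] and [2^-k] has [1/|x|] at most the [k]-th term.
    The [n]-th term has integral [8 * 2^-n], so [1/|x|] is locally integrable without polar
    coordinates. *)
Lemma rinv_dyadic x : ((\1_(bx 1) x * rinv x)%:E <=
  \sum_(n <oo) ((2 * 2 ^+ n : R) * \1_(bxn n) x)%:E)%E.
Proof.
have ge0 : (0 <= \sum_(n <oo) ((2 * 2 ^+ n : R) * \1_(bxn n) x)%:E)%E.
  by apply: nneseries_ge0 => n _ _; rewrite lee_fin mulr_ge0 ?ind_ge0// mulr_ge0// exprn_ge0.
have [x1|/indF->] := pselect (bx 1 x); last by rewrite mul0r.
rewrite (indT x1) mul1r.
have [x0|x0] := eqVneq x 0; first by rewrite (_ : rinv x = 0)// x0 /rinv nrm0 invr0.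
pose m := Num.max `|x.1| `|x.2|.
have m0 : 0 < m.
  rewrite lt_max !normr_gt0; apply: contraNT x0; rewrite negb_or !negbK.
  by case: x {x1 ge0 m} => a b /= /andP[/eqP-> /eqP->].
have bxm r : bx r x <-> m <= r by rewrite /bx /m /= ge_max; split => [[-> ->]|/andP[]].
have mx : m <= nrm x by rewrite ge_max nrm_ge1 nrm_ge2.
have [n n1] : exists n, (2^-1 : R) ^+ n < m.
  have : (fun n => (2^-1 : R) ^+ n) @ \oo --> (0 : R).
    by apply: cvg_expr; rewrite ger0_norm ?invr_ge0// invf_lt1// ltr1n.
  move=> /cvgr0Pnorm_lt /(_ _ m0) [N _ /(_ N (leqnn N))] /=.
  by rewrite ger0_norm ?exprn_ge0 ?invr_ge0//; exists N.
have : exists n, (2^-1 : R) ^+ n < m by exists n.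
move=> /ex_minnP[[|k] kP kmin]; first by move/bxm: x1; rewrite expr0 in kP; move/lt_geF: kP => ->.
have km : m <= 2^-1 ^+ k by rewrite leNgt; apply/negP => /kmin; rewrite ltnn.
apply: (@le_trans _ _ ((2 * 2 ^+ k : R) * \1_(bxn k) x)%:E).
  rewrite lee_fin (indT ((bxm _).2 km)) mulr1.
  rewrite /rinv (le_trans (y := m^-1))// ?lef_pV2 ?posrE// ?(lt_le_trans m0)//.
  rewrite -[leRHS]invrK lef_pV2 ?posrE// ?invr_gt0 ?mulr_gt0 ?exprn_gt0//.
  by rewrite invfM -exprVn -exprS ltW.
rewrite (@nneseriesD1 _ _ k)//.
rewrite leeDl//; apply: nneseries_ge0 => i _ _.
by rewrite lee_fin mulr_ge0 ?ind_ge0// mulr_ge0// exprn_ge0.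
Qed.

Lemma rinv_lint1 : ig (fun x => \1_(bx 1) x * rinv x).
Proof.
apply: ig_of.
  apply: measurable_funM; last exact: measurable_rinv.
  by apply: measurable_ind; apply: measurable_bx.
apply: le_lt_trans geom_eseries.
have nn n x : (0 <= ((2 * 2 ^+ n : R) * \1_(bxn n) x)%:E)%E.
  by rewrite lee_fin mulr_ge0 ?ind_ge0// mulr_ge0// exprn_ge0.
have mn n : measurable_fun setT (fun x : R2 => ((2 * 2 ^+ n : R) * \1_(bxn n) x)%:E).
  apply/measurable_EFinP/measurable_funM => //.
  by apply: measurable_ind; apply: measurable_bx.
apply: (@le_trans _ _ (\int[@leb2 R]_x \sum_(n <oo) ((2 * 2 ^+ n : R) * \1_(bxn n) x)%:E)%E).
  apply: ge0_le_integral => //.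
  - apply/measurable_EFinP/measurableT_comp => //.
    apply: measurable_funM; last exact: measurable_rinv.
    by apply: measurable_ind; apply: measurable_bx.
  - apply: (@ge0_emeasurable_sum _ _ _ _
      (fun n x => ((2 * 2 ^+ n : R) * \1_(bxn n) x)%:E) xpredT).
      by move=> *; exact: nn.
    by move=> *; exact: mn.
  - move=> x _; rewrite ger0_norm ?mulr_ge0 ?ind_ge0 ?rinv_ge0//; exact: rinv_dyadic.
rewrite integral_nneseries//.
apply: lee_nneseries => [n _ _|n _]; first exact: integral_ge0.
rewrite I2E; last by apply: igZ; exact: ig_bx.
rewrite I2Z; last exact: ig_bx.
rewrite I2_ind; last exact: measurable_bx.
rewrite leb2_bx ?exprn_ge0 ?invr_ge0//= lee_fin.
have -> : (2 * 2 ^+ n : R) * (2 * 2^-1 ^+ n) ^+ 2 = 8 * (2 ^+ n * 2^-1 ^+ n) * 2^-1 ^+ n by ring.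
by rewrite -exprMn divff// expr1n mulr1.
Qed.

Lemma rinv_lint r : ig (fun x => \1_(bx r) x * rinv x).
Proof.
apply: (@ig_le _ _ (fun x => \1_(bx 1) x * rinv x + \1_(bx r) x)).
- apply: measurable_funM; last exact: measurable_rinv.
  by apply: measurable_ind; apply: measurable_bx.
- move=> x; rewrite ger0_norm ?mulr_ge0 ?ind_ge0 ?rinv_ge0//.
  have [x1|x1] := pselect (bx 1 x).
    rewrite (indT x1) mul1r.
    have : (\1_(bx r) x : R) * rinv x <= 1 * rinv x by rewrite ler_wpM2r ?rinv_ge0 ?ind_le1.
    have := ind_ge0 (bx r) x; lra.
  rewrite (indF x1) mul0r add0r ler_piMr ?ind_ge0//.
  have n1 : 1 < nrm x by rewrite ltNge; apply/negP => /bx_nrm.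
  by rewrite /rinv invf_le1 ?(ltW n1)// (lt_trans ltr01).
- by apply: igD; [exact: rinv_lint1|exact: ig_bx].
Qed.
End LogKernel.

(** * Densities, kernels and their bilinear forms *)

HB.lock Definition I4 {R : realType} (K f g : R * R -> R) : R :=
  I2 (fun x => f x * I2 (fun y => K (x - y) * g y)).

Section Kernels.
Context {R : realType}.
Local Notation R2 := (R * R)%type.
Implicit Types (u v x y z : R2) (f g h K V : R2 -> R).

(** Bounded with bounded support; a single constant serves for the bound and for the half-side of
    the supporting square. *)
Definition good f := measurable_fun setT f /\ exists C : R, forall x, `|f x| <= C * \1_(bx C) x.

Lemma good_meas f : good f -> measurable_fun setT f. Proof. by case. Qed.
Lemma goodC f : good f -> exists2 C : R, 0 < C & forall D, C <= D -> forall x, `|f x| <= D * \1_(bx D) x.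
Proof.
move=> [mf [C fC]]; exists (Num.max C 1); first by rewrite lt_max ltr01 orbT.
move=> D; rewrite ge_max => /andP[CD D1] x; apply: (le_trans (fC x)).
have [C0|C0] := lerP 0 C.
  apply: ler_pM; rewrite ?ind_ge0//.
  by apply/ind_sub/bx_sub.
rewrite (le_trans (y := 0))// ?mulr_ge0 ?ind_ge0 ?(le_trans ler01 D1)//.
by rewrite mulr_le0_ge0 ?ind_ge0 ?ltW.
Qed.
Lemma good_ig f : good f -> ig f.
Proof.
move=> [mf [C fC]]; apply: (ig_le mf fC); apply: igZ; exact: ig_bx.
Qed.
Lemma goodD f g : good f -> good g -> good (fun x => f x + g x).
Proof.
move=> hf hg; split; first by apply: measurable_funD; exact: good_meas.
have [C C0 fC] := goodC hf; have [D D0 gD] := goodC hg.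
have h0 : (0 : R) <= \1_(bx (C + D)) _ by move=> ?; exact: ind_ge0.
exists (C + D + (C + D)) => x.
have c1 : C <= C + D by lra. have d1 : D <= C + D by lra.
apply: (le_trans (ler_normD _ _)); rewrite mulrDl lerD//.
  apply: (le_trans (fC _ c1 x)); rewrite ler_wpM2l ?addr_ge0 ?(ltW C0) ?(ltW D0)//.
  by apply/ind_sub/bx_sub; lra.
apply: (le_trans (gD _ d1 x)); rewrite ler_wpM2l ?addr_ge0 ?(ltW C0) ?(ltW D0)//.
by apply/ind_sub/bx_sub; lra.
Qed.
Lemma goodMb f g (c : R) : good f -> measurable_fun setT g -> (forall x, `|g x| <= c) ->
  good (fun x => g x * f x).
Proof.
move=> hf mg gc; split; first by apply: measurable_funM => //; exact: good_meas.
have [C C0 fC] := goodC hf.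
have c0 : 0 <= c by rewrite (le_trans _ (gc 0)).
exists ((c + 1) * (C + 1)) => x.
rewrite normrM.
apply: (@le_trans _ _ (c * ((C + 1) * \1_(bx (C + 1)) x))).
  apply: ler_pM => //; apply: fC; lra.
rewrite mulrA; apply: ler_pM; rewrite ?mulr_ge0 ?ind_ge0//; try nra.
by apply/ind_sub/bx_sub; nra.
Qed.
Lemma goodZ c f : good f -> good (fun x => c * f x).
Proof. by move=> hf; apply: (@goodMb f (fun=> c) `|c|). Qed.
Lemma goodN f : good f -> good (fun x => - f x).
Proof. by move=> /(goodZ (-1)); under eq_fun do rewrite mulN1r. Qed.
Lemma goodB f g : good f -> good g -> good (fun x => f x - g x).
Proof. by move=> hf hg; apply: goodD => //; exact: goodN. Qed.
Lemma good0 : good (fun=> 0).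
Proof. by split => //; exists 0 => x; rewrite normr0 mul0r. Qed.
Lemma good_sum (I : Type) (s : seq I) (P : pred I) (F : I -> R2 -> R) :
  (forall i, good (F i)) -> good (fun x => \sum_(i <- s | P i) F i x).
Proof.
move=> hF; elim: s => [|i s ih].
  by under eq_fun do rewrite big_nil; exact: good0.
under eq_fun do rewrite big_cons.
by case: (P i) => //; apply: goodD.
Qed.
Lemma good_ind (A : set R2) r : measurable A -> A `<=` bx r -> good (\1_A).
Proof.
move=> mA Ar; split; first exact: measurable_ind.
exists (Num.max r 1) => x; rewrite ger0_norm ?ind_ge0//.
apply: (le_trans (ind_sub _ (B := bx (Num.max r 1)) _)).
  by move=> y /Ar; apply: bx_sub; rewrite le_max lexx.
by rewrite ler_peMl ?ind_ge0// le_max lexx orbT.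
Qed.
Lemma good_bx r : good (\1_(bx r)).
Proof. by apply: (@good_ind _ r) => //; exact: measurable_bx. Qed.
Lemma good_trans f b : good f -> good (fun x => f (x + b)).
Proof.
move=> hf; split; first exact: (measurableT_comp (good_meas hf) (@measurable_trans _ b)).
have [C C0 fC] := goodC hf; exists (C + nrm b) => x.
have nb := nrm_ge0 b.
have [h|h] := pselect (bx (C + nrm b) x); last first.
  rewrite (indF h) mulr0; apply: (le_trans (fC _ (lexx _) _)).
  rewrite (_ : \1_ _ _ = 0) ?mulr0//; apply: indF => -[h1 h2]; apply: h.
  have := nrm_ge1 b; have := nrm_ge2 b; rewrite /bx /= in h1 h2 *.
  rewrite -(addrK b.1 x.1) -(addrK b.2 x.2).
  have := ler_normB (x.1 + b.1) b.1; have := ler_normB (x.2 + b.2) b.2.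
  by split; lra.
rewrite (indT h) mulr1; apply: (le_trans (fC _ (lexx _) _)).
by rewrite (le_trans (y := C * 1)) ?ler_wpM2l ?ind_le1 ?(ltW C0)// mulr1; lra.
Qed.
(** Local integrability, tested against [good] functions. *)
Definition lint V := forall f, good f -> ig (fun x => f x * V x).

Lemma lintD V W : lint V -> lint W -> lint (fun x => V x + W x).
Proof. by move=> hV hW f hf; under eq_fun do rewrite mulrDr; apply: igD; [exact: hV|exact: hW]. Qed.
Lemma lintZ c V : lint V -> lint (fun x => c * V x).
Proof. by move=> hV f hf; under eq_fun do rewrite mulrCA; apply: igZ; exact: hV. Qed.
Lemma lint_sum (I : Type) (s : seq I) (F : I -> R2 -> R) :
  (forall i, lint (F i)) -> lint (fun x => \sum_(i <- s) F i x).
Proof.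
move=> hF f hf; under eq_fun do rewrite mulr_sumr.
by apply: ig_sum => i; exact: hF.
Qed.
Lemma lint_cst c : lint (fun=> c).
Proof. by move=> f hf; under eq_fun do rewrite mulrC; apply: igZ; exact: good_ig. Qed.
Lemma lint_trans V b : lint V -> lint (fun x => V (x + b)).
Proof.
move=> hV f hf.
have := ig_trans b (hV _ (good_trans (- b) hf)).
by apply: eq_ig => x; rewrite addrK.
Qed.
Lemma lint_bx V : measurable_fun setT V -> (forall r, ig (fun x => \1_(bx r) x * V x)) -> lint V.
Proof.
move=> mV h f hf; have [C C0 fC] := goodC hf.
apply: (@ig_le _ _ (fun x => C * `|\1_(bx C) x * V x|)).
- by apply: measurable_funM => //; exact: good_meas.
- move=> x; rewrite !normrM [`|\1_ _ _|]ger0_norm ?ind_ge0// mulrA.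
  by rewrite ler_wpM2r// fC.
- by apply: igZ; apply: ig_abs.
Qed.

(** What is needed for [I4 K] to be a finite symmetric bilinear form on [good] functions. The
    logarithm, its regularization and the kernel of the torus all qualify. *)
Definition ker K := [/\ measurable_fun setT K, (forall x, K (- x) = K x) & lint K].

Lemma ker_lg : ker lg.
Proof.
split; [exact: measurable_lg|exact: lgN|].
apply: lint_bx => [|r]; first exact: measurable_lg.
apply: (@ig_le _ _ (fun x => (2 * r) * \1_(bx r) x + \1_(bx r) x * rinv x)).
- apply: measurable_funM; last exact: measurable_lg.
  exact: (good_meas (good_bx r)).
- move=> x; rewrite normrM [`|\1_ _ _|]ger0_norm ?ind_ge0//.
  have [h|h] := pselect (bx r x); last by rewrite (indF h) !mulr0 !mul0r addr0.
  rewrite (indT h) !mul1r mulr1; apply: (le_trans (lg_abs _)).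
  by rewrite lerD2r nrm_bx.
- by apply: igD; [apply: igZ; exact: ig_bx|exact: rinv_lint].
Qed.
Lemma ker_rinv : ker rinv.
Proof.
split; [exact: measurable_rinv|by move=> x; rewrite /rinv nrmN|].
by apply: lint_bx => [|r]; [exact: measurable_rinv|exact: rinv_lint].
Qed.
Lemma kerD K L : ker K -> ker L -> ker (fun x => K x + L x).
Proof.
move=> [m1 s1 l1] [m2 s2 l2]; split; [exact: measurable_funD| |exact: lintD].
by move=> x; rewrite s1 s2.
Qed.
Lemma kerZ c K : ker K -> ker (fun x => c * K x).
Proof.
move=> [m1 s1 l1]; split; [exact: measurable_funM| |exact: lintZ].
by move=> x; rewrite s1.
Qed.
Lemma ker_cst c : ker (fun=> c).
Proof. by split => //; exact: lint_cst. Qed.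

Definition pot K g x := I2 (fun y => K (x - y) * g y).
Lemma I4E K f g : I4 K f g = I2 (fun x => f x * pot K g x).
Proof. by rewrite I4.unlock. Qed.

Section one.
Variable K : R2 -> R.
Hypothesis kK : ker K.
Let mK : measurable_fun setT K := let: And3 m _ _ := kK in m.
Let sK : forall x, K (- x) = K x := let: And3 _ s _ := kK in s.
Let lK : lint K := let: And3 _ _ l := kK in l.

Lemma kerBC x y : K (x - y) = K (y - x). Proof. by rewrite -sK opprB. Qed.

Lemma lint_ker x : lint (fun y => K (x - y)).
Proof.
move=> f hf; have := lint_trans (- x) lK hf.
by apply: eq_ig => y; rewrite kerBC.
Qed.
Lemma ig_pot g x : good g -> ig (fun y => K (x - y) * g y).
Proof. by move=> hg; have := lint_ker x hg; apply: eq_ig => y; rewrite mulrC. Qed.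
Lemma ig_potC g x : good g -> ig (fun y => g y * K (x - y)).
Proof. exact: lint_ker. Qed.

Lemma measurable_ker2 f g : measurable_fun setT f -> measurable_fun setT g ->
  measurable_fun setT (fun p : R2 * R2 => f p.1 * (K (p.1 - p.2) * g p.2)).
Proof.
move=> mf mg.
have mB : measurable_fun setT (fun p : R2 * R2 => p.1 - p.2).
  apply: measurable_fun_pair => /=; apply: measurable_funB;
    by apply: measurableT_comp => //; exact: measurableT_comp.
apply: measurable_funM; first exact: (measurableT_comp mf measurable_fst).
apply: measurable_funM; first exact: (measurableT_comp mK mB).
exact: (measurableT_comp mg measurable_snd).
Qed.

(** For [x] and [y] in the supports the difference stays in a fixed square, on which [K] is
    integrable; the inner integral is bounded by [D * M] uniformly in [x]. This is the hypothesis of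
    Fubini behind the symmetry of [I4]. *)
Lemma ker2_lty f g : good f -> good g ->
  (\int[@leb2 R]_x \int[@leb2 R]_y `|f x * (K (x - y) * g y)|%:E < +oo)%E.
Proof.
move=> hf hg.
have [C C0 fC] := goodC hf; have [D D0 gD] := goodC hg.
pose M := I2 (fun y => `|\1_(bx (C + D)) y * K y|).
have M0 : 0 <= M by apply: I2_ge0.
have iM : ig (fun y => `|\1_(bx (C + D)) y * K y|) by apply/ig_abs/lK/good_bx.
have b x : I2 (fun y => `|f x * (K (x - y) * g y)|) <= C * \1_(bx C) x * (D * M).
  apply: (@le_trans _ _ (I2 (fun y => C * \1_(bx C) x * (D * `|\1_(bx (C + D)) (- y + x) * K (- y + x)|)))).
    apply: I2_le.
    - by apply/ig_abs/igZ; exact: ig_pot.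
    - by apply/igZ/igZ; apply: (ig_opp (f := fun y => `|\1_(bx (C + D)) (y + x) * K (y + x)|)); apply: (ig_trans x iM).
    - move=> y; rewrite !normrM [`|\1_ _ _|]ger0_norm ?ind_ge0//.
      have [xC|xC] := pselect (bx C x); last first.
        have := fC _ (lexx _) x; rewrite (indF xC) mulr0 normr_le0 => /eqP->.
        by rewrite normr0 !mul0r.
      have [yD|yD] := pselect (bx D y); last first.
        have := gD _ (lexx _) y; rewrite (indF yD) mulr0 normr_le0 => /eqP->.
        rewrite normr0 !mulr0 mulr_ge0 ?mulr_ge0 ?(ltW C0) ?(ltW D0) ?ind_ge0//.
      have -> : \1_(bx (C + D)) (- y + x) = 1 :> R.
        apply: indT; case: xC yD => [? ?] [? ?]; split => /=; apply: (le_trans (ler_normD _ _));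
        by rewrite normrN addrC lerD.
      rewrite mul1r [- y + x]addrC [`|K _| * `|g y|]mulrC !mulrA; apply: ler_wpM2r => //.
      apply: ler_pM; rewrite ?mulr_ge0//; last by have := gD _ (lexx _) y; rewrite (indT yD) mulr1.
      exact: fC.
  rewrite I2Z; last first.
    by apply/igZ; apply: (ig_opp (f := fun y => `|\1_(bx (C + D)) (y + x) * K (y + x)|)); apply: (ig_trans x iM).
  rewrite I2Z; last first.
    by apply: (ig_opp (f := fun y => `|\1_(bx (C + D)) (y + x) * K (y + x)|)); apply: (ig_trans x iM).
  rewrite (I2_opp (f := fun y => `|\1_(bx (C + D)) (y + x) * K (y + x)|)); last exact: (ig_trans x iM).
  by rewrite (I2_trans x iM).
apply: (@le_lt_trans _ _ (\int[@leb2 R]_x (C * \1_(bx C) x * (D * M))%:E)%E).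
  apply: ge0_le_integral => //.
  - by move=> x _; apply: integral_ge0 => y _; rewrite lee_fin.
  - apply: (@measurable_fun_fubini_tonelli_F _ _ _ _ _ (@leb2 R) (fun p => `|f p.1 * (K (p.1 - p.2) * g p.2)|%:E)).
      by apply/measurable_EFinP/measurableT_comp => //; apply: measurable_ker2; exact: good_meas.
    by move=> p; rewrite lee_fin.
  - apply/measurable_EFinP; apply: measurable_funM => //; apply: measurable_funM => //.
    exact: (good_meas (good_bx C)).
  - move=> x _; have := I2E (ig_abs (igZ (f x) (ig_pot x hg))) => /= ->.
    by rewrite lee_fin b.
have i : ig (fun x => C * \1_(bx C) x * (D * M)).
  apply: (@eq_ig _ (fun x => (D * M) * (C * \1_(bx C) x))); first by move=> x; rewrite mulrC.
  by apply: igZ; apply: igZ; exact: ig_bx.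
by rewrite (I2E i) ltry.
Qed.

Lemma pot_lint g : good g -> lint (pot K g).
Proof.
move=> hg f hf.
have := @ig_inner _ (fun x y => f x * (K (x - y) * g y))
  (measurable_ker2 (good_meas hf) (good_meas hg)) (ker2_lty hf hg) (fun x => igZ (f x) (ig_pot x hg)).
by apply: eq_ig => x; rewrite I2Z//; exact: ig_pot.
Qed.

Lemma I4C f g : good f -> good g -> I4 K f g = I4 K g f.
Proof.
move=> hf hg; rewrite !I4E.
have e x : I2 (fun y => f x * (K (x - y) * g y)) = f x * pot K g x by rewrite I2Z//; exact: ig_pot.
transitivity (I2 (fun x => I2 (fun y => f x * (K (x - y) * g y)))).
  by apply: eq_I2 => x; rewrite e.
rewrite (@I2_swap _ (fun x y => f x * (K (x - y) * g y)) (measurable_ker2 (good_meas hf) (good_meas hg)) (ker2_lty hf hg) (fun x => igZ (f x) (ig_pot x hg))); last first.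
  move=> y; have := igZ (g y) (ig_pot y hf); apply: eq_ig => x.
  by rewrite kerBC; ring.
apply: eq_I2 => y; rewrite /pot -I2Z; last exact: ig_pot.
by apply: eq_I2 => x; rewrite kerBC; ring.
Qed.

Lemma potD f g x : good f -> good g -> pot K (fun y => f y + g y) x = pot K f x + pot K g x.
Proof.
by move=> hf hg; rewrite /pot -I2D; [apply: eq_I2 => y; rewrite mulrDr|exact: ig_pot|exact: ig_pot].
Qed.
Lemma potZ c g x : good g -> pot K (fun y => c * g y) x = c * pot K g x.
Proof. by move=> hg; rewrite /pot -I2Z; [apply: eq_I2 => y; rewrite mulrCA|exact: ig_pot]. Qed.
Lemma pot_sum (I : Type) (s : seq I) (F : I -> R2 -> R) x : (forall i, good (F i)) ->
  pot K (fun y => \sum_(i <- s) F i y) x = \sum_(i <- s) pot K (F i) x.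
Proof.
move=> hF; rewrite /pot -I2_sum; last by move=> i; exact: ig_pot.
by apply: eq_I2 => y; rewrite mulr_sumr.
Qed.

Lemma I4Dr f g h : good f -> good g -> good h -> I4 K f (fun x => g x + h x) = I4 K f g + I4 K f h.
Proof.
move=> hf hg hh; rewrite !I4E -I2D; [|exact: pot_lint|exact: pot_lint].
by apply: eq_I2 => x; rewrite potD// mulrDr.
Qed.
Lemma I4Dl f g h : good f -> good g -> good h -> I4 K (fun x => g x + h x) f = I4 K g f + I4 K h f.
Proof. by move=> hf hg hh; rewrite (I4C (goodD hg hh) hf) (I4Dr hf hg hh) (I4C hf hg) (I4C hf hh). Qed.
Lemma I4Zr c f g : good f -> good g -> I4 K f (fun x => c * g x) = c * I4 K f g.
Proof.
move=> hf hg; rewrite !I4E -I2Z; last exact: pot_lint.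
by apply: eq_I2 => x; rewrite potZ// mulrCA.
Qed.
Lemma I4Zl c f g : good f -> good g -> I4 K (fun x => c * f x) g = c * I4 K f g.
Proof.
move=> hf hg; rewrite !I4E -I2Z; last exact: pot_lint.
by apply: eq_I2 => x; rewrite mulrA.
Qed.
Lemma I4Nr f g : good f -> good g -> I4 K f (fun x => - g x) = - I4 K f g.
Proof. move=> hf hg; rewrite -mulN1r -(I4Zr _ hf hg); congr I4; apply/funext => x.
by rewrite mulN1r. Qed.
Lemma I4Nl f g : good f -> good g -> I4 K (fun x => - f x) g = - I4 K f g.
Proof. by move=> hf hg; rewrite (I4C (goodN hf) hg) (I4Nr hg hf) (I4C hg hf). Qed.
Lemma I4Br f g h : good f -> good g -> good h -> I4 K f (fun x => g x - h x) = I4 K f g - I4 K f h.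
Proof. by move=> hf hg hh; rewrite (I4Dr hf hg (goodN hh)) (I4Nr hf hh). Qed.
Lemma I4Bl f g h : good f -> good g -> good h -> I4 K (fun x => g x - h x) f = I4 K g f - I4 K h f.
Proof. by move=> hf hg hh; rewrite (I4Dl hf hg (goodN hh)) (I4Nl hh hf). Qed.
Lemma I4_sumr (I : Type) (s : seq I) (F : I -> R2 -> R) f : good f -> (forall i, good (F i)) ->
  I4 K f (fun y => \sum_(i <- s) F i y) = \sum_(i <- s) I4 K f (F i).
Proof.
move=> hf hF; rewrite I4E; under [RHS]eq_bigr do rewrite I4E.
rewrite -I2_sum; last by move=> i; exact: pot_lint.
by apply: eq_I2 => y; rewrite pot_sum// mulr_sumr.
Qed.
Lemma I4_suml (I : Type) (s : seq I) (F : I -> R2 -> R) f : good f -> (forall i, good (F i)) ->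
  I4 K (fun y => \sum_(i <- s) F i y) f = \sum_(i <- s) I4 K (F i) f.
Proof.
move=> hf hF; rewrite (I4C (good_sum _ _ hF) hf) (I4_sumr _ hf hF).
by apply: eq_bigr => i _; rewrite (I4C hf (hF i)).
Qed.

Lemma pot_trans g b x : good g -> pot K (fun y => g (y + b)) x = pot K g (x + b).
Proof.
move=> hg; rewrite /pot -[RHS](I2_trans b); last exact: ig_pot.
by apply: eq_I2 => y; congr (K _ * _); rewrite opprD addrACA subrr addr0.
Qed.
Lemma I4_trans f g b : good f -> good g ->
  I4 K (fun x => f (x + b)) (fun x => g (x + b)) = I4 K f g.
Proof.
move=> hf hg; rewrite !I4E -[RHS](I2_trans b); last exact: pot_lint.
by apply: eq_I2 => x; rewrite pot_trans.
Qed.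
End one.

Lemma I4_kerD K L f g : ker K -> ker L -> good f -> good g ->
  I4 (fun x => K x + L x) f g = I4 K f g + I4 L f g.
Proof.
move=> kK kL hf hg; rewrite !I4E -I2D; [|exact: pot_lint|exact: pot_lint].
apply: eq_I2 => x; rewrite -mulrDr /pot -I2D; [|exact: ig_pot|exact: ig_pot].
by congr (_ * _); apply: eq_I2 => y; rewrite mulrDl.
Qed.
Lemma I4_kerZ c K f g : ker K -> good f -> good g -> I4 (fun x => c * K x) f g = c * I4 K f g.
Proof.
move=> kK hf hg; rewrite !I4E -I2Z; last exact: pot_lint.
apply: eq_I2 => x; rewrite mulrCA; congr (_ * _); rewrite /pot -I2Z; last exact: ig_pot.
by apply: eq_I2 => y; rewrite mulrA.
Qed.
Lemma pot_cst c g x : good g -> pot (fun=> c) g x = c * I2 g.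
Proof. by move=> hg; rewrite /pot I2Z//; exact: good_ig. Qed.
Lemma I4_cst c f g : good f -> good g -> I4 (fun=> c) f g = c * I2 f * I2 g.
Proof.
move=> hf hg; rewrite !I4E; under eq_I2 do rewrite pot_cst// mulrC.
by rewrite I2Z; [ring|exact: good_ig].
Qed.

Lemma measurable_pt (a : R2) : measurable [set a].
Proof.
have -> : [set a] = [set a.1] `*` [set a.2].
  by apply/seteqP; split => [x ->//|[u v] /= [-> ->]]; case: a.
exact: measurableX.
Qed.
Lemma leb2_pt (a : R2) : (@leb2 R) [set a] = 0%E.
Proof.
have -> : [set a] = [set a.1] `*` [set a.2].
  by apply/seteqP; split => [x ->//|[u v] /= [-> ->]]; case: a.
by rewrite [LHS]product_measure1E//= lebesgue_measure_set1 mul0e.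
Qed.
Lemma I2_pt a h : measurable_fun setT h ->
  ig (fun x => \1_[set a] x * h x) /\ I2 (fun x => \1_[set a] x * h x) = 0.
Proof.
move=> mh.
have e x : \1_[set a] x * h x = h a * \1_[set a] x.
  have [->|/indF->] := pselect ([set a] x); last by rewrite mul0r mulr0.
  exact: mulrC.
have i : ig (fun x => h a * \1_[set a] x).
  by apply/igZ/ig_ind; [exact: measurable_pt|rewrite leb2_pt].
split; first by apply: eq_ig i => x; rewrite e.
rewrite (eq_I2 e) I2Z; last by apply/ig_ind; [exact: measurable_pt|rewrite leb2_pt].
by rewrite I2_ind ?leb2_pt ?mulr0//; exact: measurable_pt.
Qed.

(** Points are null, so kernel bounds may ignore the singularity. The larger function is raised by
    [|f - g|] on the exceptional points, which does not change its integral and makes the inequality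
    hold everywhere. *)
Lemma I2_le_off (s : seq R2) f g : ig f -> ig g ->
  (forall x, x \notin s -> f x <= g x) -> I2 f <= I2 g.
Proof.
move=> hf hg h.
have mfg : measurable_fun setT (fun x => `|f x - g x|) by exact: ig_meas (ig_abs (igB hf hg)).
have i a : ig (fun x => \1_[set a] x * `|f x - g x|) by case: (I2_pt a mfg).
have is_ : ig (fun x => \sum_(a <- s) \1_[set a] x * `|f x - g x|) by apply: ig_sum.
have -> : I2 g = I2 (fun x => g x + \sum_(a <- s) \1_[set a] x * `|f x - g x|).
  rewrite I2D// I2_sum// big1 ?addr0// => a _.
  by case: (I2_pt a mfg).
apply: I2_le => // [|x]; first exact: igD.
have [xs|/h xs] := boolP (x \in s); last first.
  by apply: (le_trans xs); rewrite lerDl sumr_ge0// => a _; rewrite mulr_ge0 ?ind_ge0.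
rewrite (big_rem x)//= indT// mul1r.
have : 0 <= \sum_(y <- rem x s) \1_[set y] x * `|f x - g x|.
  by rewrite sumr_ge0// => a _; rewrite mulr_ge0 ?ind_ge0.
by have := ler_norm (f x - g x); lra.
Qed.

Lemma I2_eq_off (s : seq R2) f g : ig f -> ig g ->
  (forall x, x \notin s -> f x = g x) -> I2 f = I2 g.
Proof.
move=> hf hg h; apply/eqP; rewrite eq_le; apply/andP; split;
by apply: (@I2_le_off s) => // x /h->.
Qed.

Lemma pot_le K L g x : ker K -> ker L -> good g -> (forall y, 0 <= g y) ->
  (forall y, g y != 0 -> x != y -> K (x - y) <= L (x - y)) -> pot K g x <= pot L g x.
Proof.
move=> kK kL hg g0 h; apply: (@I2_le_off [:: x]); [exact: ig_pot|exact: ig_pot|].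
move=> y; rewrite inE eq_sym => yx; have [->|gy] := eqVneq (g y) 0; first by rewrite !mulr0.
by rewrite ler_wpM2r// h.
Qed.

Lemma I4_le K L f g : ker K -> ker L -> good f -> good g ->
  (forall x, 0 <= f x) -> (forall x, 0 <= g x) ->
  (forall x y, f x != 0 -> g y != 0 -> x != y -> K (x - y) <= L (x - y)) ->
  I4 K f g <= I4 L f g.
Proof.
move=> kK kL hf hg f0 g0 h; rewrite !I4E; apply: I2_le; [exact: pot_lint|exact: pot_lint|move=> x].
have [->|fx] := eqVneq (f x) 0; first by rewrite !mul0r.
by rewrite ler_wpM2l//; apply: pot_le => // y gy xy; exact: h.
Qed.

Lemma I2_zero f h : good f -> (forall x, 0 <= f x) -> I2 f = 0 ->
  ig (fun x => f x * h x) -> I2 (fun x => f x * h x) = 0.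
Proof.
move=> hf f0 mf ifh.
have : (\int[@leb2 R]_x `|(EFin \o f) x| = 0)%E.
  transitivity (\int[@leb2 R]_x (f x)%:E)%E; last by rewrite (I2E (good_ig hf)) mf.
  by apply: eq_integral => x _ /=; rewrite ger0_norm.
move/(ae_eq_integral_abs (@leb2 R) measurableT (f := EFin \o f)).
have mf' : measurable_fun setT (EFin \o f) by apply/measurable_EFinP; exact: good_meas.
move=> /(_ mf') ae; apply: EFin_inj; rewrite -I2E//.
have -> : (0%:E = \int[@leb2 R]_x (cst 0%E x) :> \bar R)%E by rewrite integral0.
apply: ae_eq_integral => //; first by apply/measurable_EFinP; exact: ig_meas.
by move: ae; apply: filterS => x /(_ I) /= [->] _; rewrite mul0r.
Qed.
End Kernels.

(** * States and their energies *)
Section States.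
Context {R : realType}.
Local Notation R2 := (R * R)%type.
Implicit Types (u v x y z b : R2) (f g h K L V : R2 -> R).

(* [Ach n f E]: a state of [n] points with one-particle density [f], built from
   single particles, independent products and mixtures; [E K] is the expected
   value of the sum of [K] over all pairs of particles. *)
Inductive Ach : nat -> (R2 -> R) -> ((R2 -> R) -> R) -> Prop :=
| Ach0 f : good f -> (forall x, 0 <= f x) -> I2 f = 0 -> Ach 0 f (fun=> 0)
| Ach1 f : good f -> (forall x, 0 <= f x) -> I2 f = 1 -> Ach 1 f (fun=> 0)
| AchM n1 n2 f1 f2 E1 E2 : Ach n1 f1 E1 -> Ach n2 f2 E2 ->
    Ach (n1 + n2) (fun x => f1 x + f2 x) (fun K => E1 K + E2 K + I4 K f1 f2)
| AchX p n f1 f2 E1 E2 : 0 < p < 1 -> Ach n f1 E1 -> Ach n f2 E2 ->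
    Ach n (fun x => p * f1 x + (1 - p) * f2 x) (fun K => p * E1 K + (1 - p) * E2 K)
| AchW n f E E' : Ach n f E -> (forall K, ker K -> E K = E' K) -> Ach n f E'.

Lemma Ach_good n f E : Ach n f E -> good f.
Proof.
elim=> // [n1 n2 f1 f2 E1 E2 _ h1 _ h2|p m f1 f2 E1 E2 _ _ h1 _ h2]; first exact: goodD.
by apply: goodD; exact: goodZ.
Qed.
Lemma Ach_ge0 n f E : Ach n f E -> forall x, 0 <= f x.
Proof.
elim=> // [n1 n2 f1 f2 E1 E2 _ h1 _ h2 x|p m f1 f2 E1 E2 /andP[p0 p1] _ h1 _ h2 x].
  exact: addr_ge0.
by rewrite addr_ge0// mulr_ge0// ?subr_ge0 ltW.
Qed.
Lemma Ach_mass n f E : Ach n f E -> I2 f = n%:R.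
Proof.
elim=> // [n1 n2 f1 f2 E1 E2 a1 h1 a2 h2|p m f1 f2 E1 E2 _ a1 h1 a2 h2].
  by rewrite I2D ?h1 ?h2 ?natrD//; apply/good_ig/Ach_good; [exact: a1|exact: a2].
have g1 := good_ig (Ach_good a1); have g2 := good_ig (Ach_good a2).
rewrite I2D; [|exact: igZ|exact: igZ].
by rewrite !I2Z// h1 h2; ring.
Qed.

Definition prs (n : nat) : R := n%:R * (n%:R - 1) / 2.
Lemma prsD m n : prs (m + n) = prs m + prs n + m%:R * n%:R.
Proof. by rewrite /prs natrD; field. Qed.

(** The pairs of a state of [n] points have total weight [prs n], so a shift of the kernel by [c]
    costs [c] per pair. The kernels are compared only on differences of points of the support, which
    lets the kernel of a large torus be exchanged for [nlg] plus a constant. *)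
Lemma Ach_le n f E K L c : Ach n f E -> ker K -> ker L ->
  (forall x y, f x != 0 -> f y != 0 -> x != y -> K (x - y) <= L (x - y) + c) ->
  E K <= E L + c * prs n.
Proof.
move=> a kK kL; elim: a => {n f E}.
- by move=> f _ _ _ _; rewrite /prs mul0r mul0r mulr0 addr0.
- by move=> f _ _ _ _; rewrite /prs subrr mulr0 mul0r mulr0 addr0.
- move=> n1 n2 f1 f2 E1 E2 a1 h1 a2 h2 h.
  have g1 := Ach_good a1; have g2 := Ach_good a2.
  have p1 := Ach_ge0 a1; have p2 := Ach_ge0 a2.
  have n10 x : f1 x != 0 -> f1 x + f2 x != 0.
    by move=> e; rewrite paddr_eq0// (negbTE e).
  have n20 x : f2 x != 0 -> f1 x + f2 x != 0.
    by move=> e; rewrite paddr_eq0// (negbTE e) andbF.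
  have := h1 (fun x y e1 e2 => h x y (n10 _ e1) (n10 _ e2)).
  have := h2 (fun x y e1 e2 => h x y (n20 _ e1) (n20 _ e2)).
  have : I4 K f1 f2 <= I4 (fun x => L x + c) f1 f2.
    apply: I4_le => //; first by apply: kerD => //; exact: ker_cst.
    by move=> x y e1 e2; apply: h; [exact: n10|exact: n20].
  rewrite (I4_kerD kL (ker_cst c) g1 g2) (I4_cst c g1 g2) (Ach_mass a1) (Ach_mass a2) prsD.
  move: (I4 K f1 f2) (I4 L f1 f2) (E1 K) (E2 K) (E1 L) (E2 L) => i1 i2 e1 e2 e3 e4.
  by move: (prs n1) (prs n2) => q1 q2; lra.
- move=> p n f1 f2 E1 E2 /andP[p0 p1] a1 h1 a2 h2 h.
  have q1 := Ach_ge0 a1; have q2 := Ach_ge0 a2.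
  have p1' : 0 < 1 - p by rewrite subr_gt0.
  have nz (x : R2) (w1 : 0 <= p * f1 x) (w2 : 0 <= (1 - p) * f2 x) :
    (f1 x != 0) || (f2 x != 0) -> p * f1 x + (1 - p) * f2 x != 0.
    move=> e; rewrite paddr_eq0// !mulf_eq0 (gt_eqF p0) (gt_eqF p1') /=.
    by rewrite negb_and.
  have w1 x : 0 <= p * f1 x by rewrite mulr_ge0// ltW.
  have w2 x : 0 <= (1 - p) * f2 x by rewrite mulr_ge0// ltW.
  have e1 : E1 K <= E1 L + c * prs n.
    by apply: h1 => x y e1 e2; apply: h; apply: nz => //; rewrite ?e1 ?e2.
  have e2 : E2 K <= E2 L + c * prs n.
    by apply: h2 => x y e1' e2; apply: h; apply: nz => //; rewrite ?e1' ?e2 orbT.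
  have := ler_wpM2l (ltW p0) e1; have := ler_wpM2l (ltW p1') e2; nra.
- move=> n f E E' a h EE hK; rewrite -!EE//; exact: h.
Qed.

Lemma Ach_trans n f E b : Ach n f E -> Ach n (fun x => f (x + b)) E.
Proof.
elim => {n f E}.
- move=> f gf f0 mf; apply: Ach0 => //; first exact: good_trans.
  by rewrite I2_trans//; exact: good_ig.
- move=> f gf f0 mf; apply: Ach1 => //; first exact: good_trans.
  by rewrite I2_trans//; exact: good_ig.
- move=> n1 n2 f1 f2 E1 E2 a1 h1 a2 h2.
  apply: AchW (AchM h1 h2) _ => K kK.
  by rewrite (I4_trans kK b (Ach_good a1) (Ach_good a2)).
- by move=> p n f1 f2 E1 E2 p01 a1 h1 a2 h2; exact: AchX.
- by move=> n f E E' a h EE; apply: AchW h EE.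
Qed.

Fixpoint pEs K (s : seq R2) : R :=
  if s is x :: s' then \sum_(y <- s') K (x - y) + pEs K s' else 0.
Lemma pEs_cat K s t : pEs K (s ++ t) = pEs K s + pEs K t + \sum_(x <- s) \sum_(y <- t) K (x - y).
Proof.
elim: s => [|x s ih] /=; first by rewrite big_nil addr0 add0r.
by rewrite ih big_cat big_cons /=; ring.
Qed.

(* Points realizing at most the expected energy, chosen one factor at a time:
   [V] collects the interaction with the particles chosen already and the
   mean interaction with those still to be chosen. *)
Lemma derandomize n f E K : Ach n f E -> ker K ->
  forall V (F : seq R2) eps, lint V -> 0 < eps ->
  exists s : seq R2, [/\ size s = n, uniq s, {in s, forall x, f x != 0 /\ x \notin F} &
    pEs K s + \sum_(x <- s) V x <= E K + I2 (fun x => f x * V x) + eps].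
Proof.
move=> a kK; elim: a => {n f E}.
- move=> f gf f0 mf V F eps lV e0; exists [::]; split => //=.
  by rewrite big_nil !add0r (I2_zero gf f0 mf (lV _ gf)) add0r ltW.
- move=> f gf f0 mf V F eps lV e0.
  suff [x [fx xF Vx]] : exists x, [/\ f x != 0, x \notin F & V x <= I2 (fun x => f x * V x) + eps].
    exists [:: x]; split => //=; first by move=> y; rewrite inE => /eqP->.
    by rewrite big_nil big_seq1 !add0r.
  apply: contrapT => h.
  (* Otherwise [V] would exceed its mean by [eps] wherever the density lives, apart from the finite
     null set [F]; integrating against [f] contradicts [eps > 0]. *)
  have : I2 (fun x => (I2 (fun x => f x * V x) + eps) * f x) <= I2 (fun x => f x * V x).
    apply: (@I2_le_off _ F); [exact/igZ/good_ig|exact: lV|move=> x xF].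
    have [->|fx] := eqVneq (f x) 0; first by rewrite mul0r mulr0.
    rewrite mulrC ler_wpM2l// ltW// ltNge; apply/negP => Vx; apply: h.
    by exists x.
  by rewrite I2Z ?mf; [lra|exact: good_ig].
- move=> n1 n2 f1 f2 E1 E2 a1 h1 a2 h2 V F eps lV e0.
  have g1 := Ach_good a1; have g2 := Ach_good a2.
  have e2 : 0 < eps / 2 by rewrite divr_gt0.
  have lp := pot_lint kK g2.
  have [s [ss us hs Es]] := h1 _ F _ (lintD lV lp) e2.
  have lq : lint (fun y => \sum_(x <- s) K (x - y)) by apply: lint_sum => x; exact: lint_ker.
  have [t [st ut ht Et]] := h2 _ (s ++ F) _ (lintD lV lq) e2.
  have p1 := Ach_ge0 a1; have p2 := Ach_ge0 a2.
  exists (s ++ t); split.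
  + by rewrite size_cat ss st.
  + rewrite cat_uniq us ut andbT /=; apply/hasPn => x /ht[_].
    by rewrite mem_cat negb_or => /andP[].
  + move=> x; rewrite mem_cat => /orP[/hs[fx ->]|/ht[fx]].
      by split => //; rewrite paddr_eq0// (negbTE fx).
    rewrite mem_cat negb_or => /andP[_ ->].
    by split => //; rewrite paddr_eq0// (negbTE fx) andbF.
  + rewrite pEs_cat big_cat /=.
    have i1 := lV _ g1; have i2 := lV _ g2.
    rewrite (eq_I2 (g := fun x => f1 x * V x + f2 x * V x)); last by move=> x; rewrite mulrDl.
    rewrite (I2D i1 i2).
    move: Es; rewrite big_split /= (eq_I2 (g := fun x => f1 x * V x + f1 x * pot K f2 x)); last by move=> x; rewrite mulrDr.
    rewrite (I2D i1 (lp _ g1)) -I4E.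
    move: Et; rewrite big_split /= (eq_I2 (g := fun x => f2 x * V x + f2 x * (\sum_(z <- s) K (z - x)))); last by move=> x; rewrite mulrDr.
    rewrite (I2D i2 (lq _ g2)).
    have -> : I2 (fun x => f2 x * (\sum_(z <- s) K (z - x))) = \sum_(z <- s) pot K f2 z.
      rewrite /pot -I2_sum; last by move=> z; exact: ig_pot.
      by apply: eq_I2 => x; rewrite mulr_sumr; apply: eq_bigr => z _; rewrite mulrC.
    by rewrite exchange_big /=; lra.
- move=> p n f1 f2 E1 E2 /andP[p0 p1] a1 h1 a2 h2 V F eps lV e0.
  have g1 := Ach_good a1; have g2 := Ach_good a2.
  have q1 := Ach_ge0 a1; have q2 := Ach_ge0 a2.
  have p1' : 0 < 1 - p by rewrite subr_gt0.
  have i1 := lV _ g1; have i2 := lV _ g2.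
  rewrite (eq_I2 (g := fun x => p * (f1 x * V x) + (1 - p) * (f2 x * V x))); last by move=> x; ring.
  rewrite I2D; [|exact: igZ|exact: igZ]; rewrite !I2Z//.
  have [s [ss us hs Es]] := h1 _ F _ lV e0.
  have [t [st ut ht Et]] := h2 _ F _ lV e0.
  have [c|c] := lerP (E1 K + I2 (fun x => f1 x * V x)) (E2 K + I2 (fun x => f2 x * V x)).
  + exists s; split => //; last by nra.
    move=> x /hs[fx ->]; split => //.
    by rewrite paddr_eq0 ?mulr_ge0 ?(ltW p0) ?(ltW p1')// !mulf_eq0 (gt_eqF p0) (negbTE fx).
  + exists t; split => //; last by nra.
    move=> x /ht[fx ->]; split => //.
    by rewrite paddr_eq0 ?mulr_ge0 ?(ltW p0) ?(ltW p1')// !mulf_eq0 (gt_eqF p1') (negbTE fx) andbF.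
- by move=> n f E E' a h EE V F eps lV e0; rewrite -EE//; exact: h.
Qed.

End States.

(** * States in a neutralizing background *)

Section Background.
Context {R : realType}.
Local Notation R2 := (R * R)%type.
Implicit Types (x y z : R2) (f g b K : R2 -> R).

(** The density [f] is kept apart from the background [b]: a jellium tile has the background of a
    square but a density that deviates from it, and only mixtures restore equality. *)
Definition JA K n f b (j : R) :=
  exists E, Ach n f E /\ E K - I4 K f b + 2^-1 * I4 K b b <= j.

Section JA.
Variable K : R2 -> R.
Hypothesis kK : ker K.

Lemma JA_le n f b i j : JA K n f b i -> i <= j -> JA K n f b j.
Proof. by move=> [E [a h]] ij; exists E; split => //; exact: le_trans ij. Qed.
Lemma JA_ext n f b f' b' j : JA K n f b j -> f =1 f' -> b =1 b' -> JA K n f' b' j.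
Proof. by move=> h /funext<- /funext<-. Qed.

(** All cross terms collect into the interaction of the two net charges [f - b]. It is zero as soon
    as one system has density equal to its background, which is why such squares can be put side by
    side for free. *)
Lemma JAM n1 n2 f1 f2 b1 b2 j1 j2 : good b1 -> good b2 ->
  JA K n1 f1 b1 j1 -> JA K n2 f2 b2 j2 ->
  JA K (n1 + n2) (fun x => f1 x + f2 x) (fun x => b1 x + b2 x)
    (j1 + j2 + I4 K (fun x => f1 x - b1 x) (fun x => f2 x - b2 x)).
Proof.
move=> gb1 gb2 [E1 [a1 h1]] [E2 [a2 h2]]; have g1 := Ach_good a1; have g2 := Ach_good a2.
exists (fun K => E1 K + E2 K + I4 K f1 f2); split; first exact: AchM.
rewrite (I4Dr kK (goodD g1 g2) gb1 gb2) !(I4Dl kK _ g1 g2)//.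
rewrite (I4Dr kK (goodD gb1 gb2) gb1 gb2) !(I4Dl kK _ gb1 gb2)//.
rewrite (I4Br kK (goodB g1 gb1) g2 gb2) !(I4Bl kK _ g1 gb1)//.
rewrite (I4C kK gb2 gb1) (I4C kK g2 gb1).
clear - h1 h2; lra.
Qed.

Lemma JAX p n f1 f2 b j1 j2 : 0 < p < 1 -> good b ->
  JA K n f1 b j1 -> JA K n f2 b j2 ->
  JA K n (fun x => p * f1 x + (1 - p) * f2 x) b (p * j1 + (1 - p) * j2).
Proof.
move=> p01 gb [E1 [a1 h1]] [E2 [a2 h2]]; have g1 := Ach_good a1; have g2 := Ach_good a2.
exists (fun K => p * E1 K + (1 - p) * E2 K); split; first exact: AchX.
rewrite (I4Dl kK gb (goodZ p g1) (goodZ (1 - p) g2)) !(I4Zl kK)//.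
have /andP[p0 p1] := p01.
have := ler_wpM2l (ltW p0) h1; have p1' : 0 <= 1 - p by rewrite subr_ge0 ltW.
by have := ler_wpM2l p1' h2; lra.
Qed.

Lemma JA_trans n f b j c : good b -> JA K n f b j ->
  JA K n (fun x => f (x + c)) (fun x => b (x + c)) j.
Proof.
move=> gb [E [a h]]; exists E; split; first exact: Ach_trans.
by rewrite !(I4_trans kK)//; exact: Ach_good a.
Qed.

Lemma JA_mix n b (I : eqType) (s : seq I) (F : I -> R2 -> R) (j : I -> R) : good b -> (0 < size s)%N ->
  (forall i, i \in s -> JA K n (F i) b (j i)) ->
  JA K n (fun x => (size s)%:R^-1 * \sum_(i <- s) F i x) b ((size s)%:R^-1 * \sum_(i <- s) j i).
Proof.
move=> gb; elim: s => // i s ih _ h.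
have [/size0nil s0|s0] := posnP (size s).
  have := h i (mem_head _ _); rewrite s0 /= invr1 => hi.
  rewrite big_seq1 mul1r; apply: JA_ext hi _ _ => // x.
  by rewrite big_seq1 mul1r.
have k0 : 0 < (size s)%:R :> R by rewrite ltr0n.
have k1 : 0 < (size s).+1%:R :> R by rewrite ltr0n.
have p01 : 0 < ((size s).+1%:R^-1 : R) < 1.
  by rewrite invr_gt0 k1 invf_lt1// -natr1; lra.
have := JAX p01 gb (h i (mem_head _ _)) (ih s0 (fun k ks => h k (mem_behead (s := i :: s) ks))).
have e (a c : R) : (size s).+1%:R^-1 * a + (1 - (size s).+1%:R^-1) * ((size s)%:R^-1 * c) =
    (size s).+1%:R^-1 * (a + c).
  by rewrite -natr1; field; rewrite natr1 !gt_eqF.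
rewrite big_cons /= -e => hi; apply: JA_ext hi _ _ => // x.
by rewrite big_cons -e.
Qed.

Lemma JA_0 : JA K 0 (fun=> 0) (fun=> 0) 0.
Proof.
exists (fun=> 0); split; first by apply: Ach0; [exact: good0| |exact: I20].
by rewrite I4E (eq_I2 (g := fun=> 0)) ?I20; [lra|move=> x; rewrite mul0r].
Qed.

Lemma JA_fold (I : eqType) (s : seq I) (n : I -> nat) (f b : I -> R2 -> R) (j : I -> R) (c : R) :
  uniq s -> 0 <= c -> (forall i, good (b i)) -> (forall i, good (f i)) ->
  (forall i, i \in s -> JA K (n i) (f i) (b i) (j i)) ->
  (forall i k, i \in s -> k \in s -> i != k ->
    I4 K (fun x => f i x - b i x) (fun x => f k x - b k x) <= c) ->
  JA K (\sum_(i <- s) n i) (fun x => \sum_(i <- s) f i x) (fun x => \sum_(i <- s) b i x)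
    (\sum_(i <- s) j i + c * (size s)%:R ^+ 2).
Proof.
move=> us c0 gb gf; elim: s us => [_ _ _|i s ih /= /andP[is_ us] h hc].
  rewrite !big_nil mulr0n expr0n /= mulr0 addr0.
  by apply: JA_ext JA_0 _ _ => x; rewrite big_nil.
have ss k : k \in s -> k \in i :: s by move=> ks; rewrite inE ks orbT.
have := JAM (gb i) (good_sum s xpredT gb) (h i (mem_head _ _))
  (ih us (fun k ks => h k (ss _ ks)) (fun k l ks ls => hc k l (ss _ ks) (ss _ ls))).
rewrite big_cons => hj; have := JA_ext (f' := fun x => \sum_(i <- i :: s) f i x) (b' := fun x => \sum_(i <- i :: s) b i x) hj.
move=> /(_ _ _) hj2; apply: JA_le (hj2 _ _) _; [by move=> x; rewrite big_cons|by move=> x; rewrite big_cons|].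
have -> : I4 K (fun x => f i x - b i x) (fun x => \sum_(k <- s) f k x - \sum_(k <- s) b k x) =
   \sum_(k <- s) I4 K (fun x => f i x - b i x) (fun x => f k x - b k x).
  rewrite -(I4_sumr kK _ (goodB (gf i) (gb i)) (fun k => goodB (gf k) (gb k))).
  by congr I4; apply/funext => x; rewrite sumrB.
have : \sum_(k <- s) I4 K (fun x => f i x - b i x) (fun x => f k x - b k x) <= \sum_(k <- s) c.
  rewrite big_seq [leRHS]big_seq; apply: ler_sum => k ks; apply: hc; rewrite ?mem_head ?ss//.
  by apply: contraNneq is_ => ->.
rewrite big_cons big_const_seq count_predT iter_addr_0 -(mulr_natr c) -natr1.
move: (\sum_(k <- s) _) => q; have : 0 <= (size s)%:R :> R by [].
move: (size s)%:R (\sum_(k <- s) j k) => k t k0; nra.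
Qed.

Lemma Ach_iid g k : good g -> (forall x, 0 <= g x) -> I2 g = 1 ->
  Ach k (fun x => k%:R * g x) (fun K => prs k * I4 K g g).
Proof.
move=> gg g0 m1; elim: k => [|k ih].
  have -> : (fun x => 0%:R * g x) = (fun=> 0) by apply/funext => x; rewrite mul0r.
  apply: AchW (Ach0 good0 _ I20) _ => // L kL.
  by rewrite /prs !mul0r.
have := AchM ih (Ach1 gg g0 m1); rewrite addn1.
have -> : (fun x => k%:R * g x + g x) = (fun x => k.+1%:R * g x).
  by apply/funext => x; rewrite -natr1 mulrDl mul1r.
move=> a; apply: AchW a _ => L kL.
by rewrite (I4Zl kL _ gg gg) -addn1 prsD /prs; ring.
Qed.

(** For independent particles of law [f / r] the pair energy is the full [I4 K f f / 2] less the
    self-interaction [I4 K f f / (2 r)]; since [K >= - c] on the support and [f] has mass [r],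
    dropping the latter costs at most [r c / 2]. *)
Lemma JA_iid r f b c : good f -> good b -> (forall x, 0 <= f x) -> I2 f = r%:R ->
  (forall x y, f x != 0 -> f y != 0 -> x != y -> - c <= K (x - y)) ->
  JA K r f b (r%:R / 2 * c + 2^-1 * I4 K (fun x => f x - b x) (fun x => f x - b x)).
Proof.
move=> gf gb f0 mf h.
rewrite (I4Br kK (goodB gf gb) gf gb) (I4Bl kK gf gf gb) (I4Bl kK gb gf gb) (I4C kK gb gf).
case: r mf => [|r] mf.
  (* A density of mass zero is null but may be nonzero on boundary lines, hence the form of
     [Ach0]. *)
  exists (fun=> 0); split; first exact: Ach0.
  have z : I4 K f f = 0 by rewrite I4E; apply: I2_zero => //; exact: pot_lint.
  by rewrite z; lra.
have r0 : 0 < r.+1%:R :> R by rewrite ltr0n.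
pose g x := r.+1%:R^-1 * f x.
have gg : good g by exact: goodZ.
have g0 x : 0 <= g x by rewrite mulr_ge0// invr_ge0 ltW.
have m1 : I2 g = 1 by rewrite I2Z ?mf ?mulVf ?gt_eqF//; exact: good_ig.
have := Ach_iid r.+1 gg g0 m1.
have -> : (fun x => r.+1%:R * g x) = f.
  by apply/funext => x; rewrite mulrA divff ?gt_eqF// mul1r.
move=> a; exists (fun K => prs r.+1 * I4 K g g); split => //.
rewrite (I4Zl kK _ gf gg) (I4Zr kK _ gf gf).
have : I4 (fun=> - c) f f <= I4 K f f by apply: I4_le => //; exact: ker_cst.
rewrite I4_cst// mf => hc.
have -> : prs r.+1 * (r.+1%:R^-1 * (r.+1%:R^-1 * I4 K f f)) = 2^-1 * I4 K f f - (2 * r.+1%:R)^-1 * I4 K f f.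
  by rewrite /prs; field; rewrite gt_eqF.
have : - ((2 * r.+1%:R)^-1 * I4 K f f) <= r.+1%:R / 2 * c.
  rewrite -mulrN mulrC ler_pdivrMr ?mulr_gt0// .
  by move: hc; nra.
by move: ((2 * r.+1%:R)^-1 * I4 K f f) (r.+1%:R / 2 * c) => q t; lra.
Qed.
End JA.
End Background.

(** * Square meshes and the filling of a density by cells *)

Section Cells.
Context {R : realType}.
Local Notation R2 := (R * R)%type.
Implicit Types (x y z : R2) (f g b K : R2 -> R) (m : R) (i : int * int).

Lemma sum_seq_const (I : Type) (s : seq I) (c : R) : \sum_(i <- s) c = (size s)%:R * c.
Proof. by rewrite big_const_seq count_predT iter_addr_0 mulr_natl. Qed.

Definition sc (c : R) x : R2 := (c * x.1, c * x.2).
Definition fl x : int * int := (Num.floor x.1, Num.floor x.2).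
Definition zr i : R2 := (i.1%:~R, i.2%:~R).
(** The indicator of the half-open square [hsq m i]. With [floor], the cells partition the plane
    exactly and a sum over distinct indices is again an indicator ([cell_sum]). *)
Definition cellf m i x : R := (fl (sc m^-1 x) == i)%:R.
Definition hsq m i : set R2 :=
  `[i.1%:~R * m, (i.1 + 1)%:~R * m[%classic `*` `[i.2%:~R * m, (i.2 + 1)%:~R * m[%classic.

Lemma sc_cm c x : sc c x = cm (c, 0) x.
Proof. by rewrite /cm /sc /=; congr pair; ring. Qed.
Lemma nrm_sc c x : nrm (sc c x) = `|c| * nrm x.
Proof. by rewrite sc_cm nrm_cm /nrm /nsq /= expr0n /= addr0 sqrtr_sqr. Qed.
Lemma scB c x y : sc c (x - y) = sc c x - sc c y.
Proof. by rewrite !sc_cm cmBr. Qed.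
Lemma scN c x : sc c (- x) = - sc c x.
Proof. by rewrite !sc_cm cmNr. Qed.
Lemma scA c d x : sc c (sc d x) = sc (c * d) x.
Proof. by rewrite /sc /= !mulrA. Qed.
Lemma sc1 x : sc 1 x = x. Proof. by case: x => a c; rewrite /sc /= !mul1r. Qed.
Lemma measurable_sc c : measurable_fun setT (sc c).
Proof. by apply: measurable_fun_pair => /=; apply: measurable_funM. Qed.
Lemma zrD i k : zr (i + k) = zr i + zr k.
Proof. by rewrite /zr /= !intrD. Qed.
Lemma zrN i : zr (- i) = - zr i.
Proof. by rewrite /zr /= !mulrNz. Qed.
Lemma zrB i k : zr (i - k) = zr i - zr k.
Proof. by rewrite zrD zrN. Qed.
Lemma zr0 : zr 0 = 0. Proof. by []. Qed.
Lemma fl_zr x i : fl (x + zr i) = fl x + i.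
Proof. by rewrite /fl /= !floorDrz ?intr_int// !intrKfloor; case: i. Qed.

Lemma fl_eq x i : (fl x == i) = (i.1%:~R <= x.1 < (i.1 + 1)%:~R) && (i.2%:~R <= x.2 < (i.2 + 1)%:~R).
Proof. by case: i => a c; rewrite /fl xpair_eqE !floor_eq. Qed.

Lemma cellE m i x : 0 < m -> cellf m i x = \1_(hsq m i) x.
Proof.
move=> m0; rewrite /cellf fl_eq indicE; congr (_%:R); congr nat_of_bool.
rewrite /sc /= ![m^-1 * _]mulrC !ler_pdivlMr// !ltr_pdivrMr//.
apply/idP/idP => [/andP[h1 h2]|]; first by rewrite inE; split; rewrite /= in_itv /=.
by rewrite inE => -[] /=; rewrite !in_itv /= => -> ->.
Qed.
Lemma measurable_hsq m i : measurable (hsq m i).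
Proof. exact: measurableX. Qed.
Lemma hsq_bx m i : exists r, hsq m i `<=` bx r.
Proof.
exists ((`|i.1%:~R| + `|i.2%:~R| + 1) * `|m|) => x [] /=; rewrite !in_itv /= !intrD => /andP[a1 a2] /andP[b1 b2].
have h1 : `|i.1%:~R * m| <= `|i.1%:~R| * `|m| by rewrite normrM.
have h2 : `|i.2%:~R * m| <= `|i.2%:~R| * `|m| by rewrite normrM.
have h3 : 0 <= `|i.1%:~R : R| * `|m| by rewrite mulr_ge0.
have h4 : 0 <= `|i.2%:~R : R| * `|m| by rewrite mulr_ge0.
move: h1 h2; rewrite !ler_norml => /andP[p1 p2] /andP[q1 q2]; have := ler_norm m.
rewrite /bx /= !ler_norml !mulrDl mul1r => hm; rewrite mulrDl mul1r in a2; rewrite mulrDl mul1r in b2.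
by split; apply/andP; split; lra.
Qed.
Lemma good_cell m i : 0 < m -> good (cellf m i).
Proof.
move=> m0; rewrite (_ : cellf m i = \1_(hsq m i)); last by apply/funext => x; exact: cellE.
by have [r hr] := hsq_bx m i; apply: good_ind hr; exact: measurable_hsq.
Qed.
Lemma cell_ge0 m i x : 0 <= cellf m i x. Proof. exact: ler0n. Qed.
Lemma I2_cell m i : 0 < m -> I2 (cellf m i) = m ^+ 2.
Proof.
move=> m0; rewrite (_ : cellf m i = \1_(hsq m i)); last by apply/funext => x; exact: cellE.
rewrite I2_ind; last exact: measurable_hsq.
rewrite [(@leb2 R) _]product_measure1E//= !lebesgue_measure_itv /= !lte_fin !ltr_pM2r// !ltr_int !ltrDl /=.
by rewrite !intrD; ring.
Qed.
Lemma cell_sum m (s : seq (int * int)) x : uniq s ->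
  \sum_(i <- s) cellf m i x = (fl (sc m^-1 x) \in s)%:R.
Proof.
move=> us; rewrite /cellf; have [h|h] := boolP (_ \in s).
  rewrite (bigD1_seq (fl (sc m^-1 x)))//= eqxx big1 ?addr0// => k kx.
  by rewrite eq_sym (negbTE kx).
rewrite big_seq big1// => k ks; case: eqP => // e; by rewrite e ks in h.
Qed.
Lemma cell_trans m i x : 0 < m -> cellf m i x = cellf m 0 (x - sc m (zr i)).
Proof.
move=> m0; rewrite /cellf scB scA mulVf ?gt_eqF// sc1 -zrN fl_zr.
by rewrite subr_eq0.
Qed.
Lemma cell_near m i x y : 0 < m -> cellf m i x != 0 -> cellf m i y != 0 ->
  `|x.1 - y.1| <= m /\ `|x.2 - y.2| <= m.
Proof.
move=> m0; rewrite !cellE// => hx hy.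
have [hx1 hx2] : hsq m i x by apply: contrapT => /(@indF R) e; rewrite e eqxx in hx.
have [hy1 hy2] : hsq m i y by apply: contrapT => /(@indF R) e; rewrite e eqxx in hy.
move: hx1 hx2 hy1 hy2; rewrite /= !in_itv /= !intrD !mulrDl !mul1r.
move=> /andP[a1 a2] /andP[b1 b2] /andP[c1 c2] /andP[d1 d2].
by rewrite !ler_norml; split; apply/andP; split; lra.
Qed.

Section fill.
Variable K : R2 -> R.
Hypothesis kK : ker K.

Lemma JA_cell n m i j : 0 < m -> JA K n (cellf m 0) (cellf m 0) j ->
  JA K n (cellf m i) (cellf m i) j.
Proof.
move=> m0 h; have := JA_trans kK (- sc m (zr i)) (good_cell 0 m0) h.
by move=> h'; apply: JA_ext h' _ _ => x; rewrite -cell_trans.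
Qed.

Lemma I4_00l f g : (forall x, f x = 0) -> I4 K f g = 0.
Proof. by move=> f0; rewrite I4E (eq_I2 (g := fun=> 0)) ?I20// => x; rewrite f0 mul0r. Qed.

(* Cells of the mesh [m] inside the density [A], completed by independent particles. *)
Lemma JA_fill N n m (s : seq (int * int)) A j c : 0 < m -> good A -> uniq s -> 0 <= c ->
  (forall x, (fl (sc m^-1 x) \in s)%:R <= A x) -> I2 A = N%:R -> m ^+ 2 = n%:R ->
  (n * size s <= N)%N ->
  (forall x y, A x != 0 -> A y != 0 -> x != y -> - c <= K (x - y)) ->
  JA K n (cellf m 0) (cellf m 0) j ->
  JA K N A A ((size s)%:R * j + (N - n * size s)%:R / 2 * c).
Proof.
move=> m0 gA us c0 sA mA mn nN hK h.
have gc i := good_cell i m0.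
have hs : JA K (\sum_(i <- s) n) (fun x => \sum_(i <- s) cellf m i x) (fun x => \sum_(i <- s) cellf m i x)
   (\sum_(i <- s) j + 0 * (size s)%:R ^+ 2).
  apply: (JA_fold kK (n := fun=> n) (j := fun=> j)) => // [i _|i k _ _ _]; first exact: JA_cell.
  by rewrite I4_00l// => x; rewrite subrr.
pose B x := A x - \sum_(i <- s) cellf m i x.
have gS : good (fun x => \sum_(i <- s) cellf m i x) by exact: good_sum.
have gB : good B by exact: goodB.
have B0 x : 0 <= B x by rewrite /B cell_sum// subr_ge0.
have mB : I2 B = (N - n * size s)%:R.
  rewrite /B I2B ?mA; [|exact: good_ig|exact: good_ig].
  rewrite I2_sum; last by move=> i; exact: good_ig.
  under eq_bigr do rewrite I2_cell// mn.
  by rewrite sum_seq_const natrB// natrM mulrC.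
have BA x : B x != 0 -> A x != 0.
  apply: contraNneq => A0; rewrite /B A0 cell_sum//; have := sA x; rewrite A0.
  by case: (_ \in _); rewrite ?subr0// ler10.
have hB := JA_iid kK gB gB B0 mB (fun x y bx by_ => hK x y (BA _ bx) (BA _ by_)).
have := JAM kK gS gB hs hB.
rewrite sum_seq_const mul0r addr0 [I4 _ _ _ in X in JA _ _ _ _ X]I4_00l; last by move=> x; rewrite subrr.
have -> : (\sum_(i <- s) n + (N - n * size s) = N)%N.
  by rewrite big_const_seq count_predT iter_addn_0 [LHS]subnKC.
rewrite [I4 _ _ _]I4_00l ?mulr0 ?addr0; last by move=> x; rewrite subrr.
move=> hj; apply: JA_ext hj _ _ => x; rewrite /B; ring.
Qed.
End fill.

End Cells.

Section Energy.
Context {R : realType}.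
Local Notation R2 := (R * R)%type.
Definition nlg (x : R2) : R := - lg x.
Lemma ker_nlg : ker nlg.
Proof.
have := kerZ (-1) (@ker_lg R); rewrite (_ : (fun x => -1 * lg x) = nlg)//.
by apply/funext => x; rewrite mulN1r.
Qed.
Definition exS (m : nat) (j : R) := (0 < m)%N /\ JA nlg (m ^ 2) (cellf m%:R 0) (cellf m%:R 0) j.
Definition eset : set R := [set r | exists m j, exS m j /\ r = j / (m ^ 2)%:R].
(* The common value of the three limits. *)
Definition e0 : R := inf eset.

Lemma nlg_ge (x : R2) (D : R) : 1 <= D -> nrm x <= D -> - ln D <= nlg x.
Proof.
move=> D1 xD; rewrite /nlg lerN2 /lg.
have [->|x0] := eqVneq x 0; first by rewrite nrm0 ln0// ln_ge0.
by rewrite ler_ln ?posrE ?nrm_gt0// (lt_le_trans ltr01).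
Qed.

Lemma exS1 : exists j, exS 1 j.
Proof.
have gc := good_cell 0 (@ltr01 R).
have m1 : I2 (cellf (1 : R) 0) = 1%:R by rewrite I2_cell// expr1n.
have h := JA_iid ker_nlg gc gc (@cell_ge0 _ 1 0) m1 (c := ln 2).
exists (1%:R / 2 * ln 2 + 2^-1 * I4 nlg (fun x => cellf 1 0 x - cellf 1 0 x) (fun x => cellf 1 0 x - cellf 1 0 x)).
split => //; apply: h => x y hx hy _.
have [h1 h2] := cell_near ltr01 hx hy.
apply: nlg_ge; first by rewrite ler1n.
by apply: (le_trans (nrm_le _)); rewrite /=; lra.
Qed.

Lemma eset_neq0 : eset !=set0.
Proof. by have [j h] := exS1; exists (j / (1 ^ 2)%:R), 1%N, j. Qed.

Section bounded.
Variable B : R.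
Hypothesis hB : forall m j, exS m j -> - B * (m ^ 2)%:R <= j.
(** [inf] behaves as an infimum only on a set bounded below; the bound [B] is supplied later by the
    stability estimate [e0_bounded]. *)
Lemma e0_le m j : exS m j -> e0 * (m ^ 2)%:R <= j.
Proof.
move=> h; have m0 : 0 < (m ^ 2)%:R :> R by rewrite ltr0n expn_gt0; case: h => ->.
rewrite -ler_pdivlMr//; apply: ge_inf; last by exists m, j.
exists (- B) => r [k [i [hk ->]]]; rewrite ler_pdivlMr; first exact: hB.
by rewrite ltr0n expn_gt0; case: hk => ->.
Qed.
Lemma e0_near d : 0 < d -> exists m j, exS m j /\ j <= (e0 + d) * (m ^ 2)%:R.
Proof.
move=> d0; have hi : has_inf eset.
  split; first exact: eset_neq0.
  exists (- B) => r [k [i [hk ->]]]; rewrite ler_pdivlMr; first exact: hB.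
  by rewrite ltr0n expn_gt0; case: hk => ->.
have [r [m [j [hm ->]]] lt] := inf_adherent d0 hi.
exists m, j; split => //; rewrite -ler_pdivrMr ?(ltW lt)//.
by rewrite ltr0n expn_gt0; case: hm => ->.
Qed.
End bounded.
End Energy.

(** * States as probability measures *)
Section DensityLaw.
Context {R : realType}.
Local Notation R2 := (R * R)%type.
Import HBNNSimple.

Lemma density_law (f : R2 -> R) : good f -> (forall x, 0 <= f x) -> I2 f = 1 ->
  exists P : probability R2 R, forall A, measurable A ->
    P A = (\int[@leb2 R]_(x in A) (f x)%:E)%E.
Proof.
move=> gf f0 m1.
pose d (A : set R2) := (\int[@leb2 R]_(x in A) (f x)%:E)%E.
have h0 : d set0 = 0%E by rewrite /d integral_set0.
have h1 A : (0 <= d A)%E by rewrite /d integral_ge0//= => x _; rewrite lee_fin.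
have h2 : semi_sigma_additive d.
  move=> F mF tF mUF; rewrite /d integral_bigcup//=; last first.
    by apply: (integrableS _ _ (subsetT _)) => //; exact: good_ig.
  by apply: is_cvg_ereal_nneg_natsum_cond => n _ _; exact: h1.
pose dm : {measure set R2 -> \bar R} := HB.pack d (isMeasure.Build _ _ _ d h0 h1 h2).
have hT : dm setT = 1%E by rewrite /dm /= /d (I2E (good_ig gf)) m1.
pose PP : probability R2 R := HB.pack d (isMeasure.Build _ _ _ d h0 h1 h2)
  (Measure_isProbability.Build _ _ _ dm hT).
by exists PP.
Qed.

(** Indicators, then simple functions, then monotone limits. [P] is any measure with density [f], so
    the lemma also applies to the sum of the marginals of a law on tuples. *)
Lemma density_int (f : R2 -> R) (P : {measure set R2 -> \bar R}) : good f -> (forall x, 0 <= f x) ->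
  (forall A, measurable A -> P A = (\int[@leb2 R]_(x in A) (f x)%:E)%E) ->
  forall h : R2 -> \bar R, measurable_fun setT h -> (forall x, (0 <= h x)%E) ->
  (\int[P]_x h x = \int[@leb2 R]_x ((f x)%:E * h x))%E.
Proof.
move=> gf f0 PE h mh h0; have mf := good_meas gf.
have mfE : measurable_fun setT (fun x => (f x)%:E) by apply/measurable_EFinP.
have ind E : measurable E -> (\int[P]_x (\1_E x)%:E = \int[@leb2 R]_x ((f x)%:E * (\1_E x)%:E))%E.
  move=> mE; rewrite integral_indic// setIT PE// integral_mkcond.
  apply: eq_integral => x _; rewrite patchE indicE.
  by case: (x \in E); rewrite ?mule1// mule0.
have nn (g : {nnsfun R2 >-> R}) : (\int[P]_x (g x)%:E = \int[@leb2 R]_x ((f x)%:E * (g x)%:E))%E.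
  under [LHS]eq_integral do rewrite fimfunE -fsumEFin//.
  rewrite [LHS]ge0_integral_fsum//; last 2 first.
    - by move=> r; apply/measurable_EFinP; exact: measurableT_comp.
    - by move=> n x _; rewrite EFinM nnfun_muleindic_ge0.
  under [RHS]eq_integral.
    move=> x xD; rewrite fimfunE -fsumEFin// ge0_mule_fsumr; last first.
      by move=> r; rewrite EFinM nnfun_muleindic_ge0.
    over.
  rewrite [RHS]ge0_integral_fsum//; last 2 first.
    - move=> r; have mi : measurable_fun (setT : set R2) (fun x => (r * \1_(g @^-1` [set r]) x)%:E).
        by apply/measurable_EFinP; exact: measurableT_comp.
      exact: (emeasurable_funM mfE mi).
    - move=> n x _; apply: mule_ge0; first by rewrite lee_fin.
      by rewrite EFinM nnfun_muleindic_ge0.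
  apply: eq_fsbigr => r _.
  have [r0|r0] := ltP r 0.
    have -> : g @^-1` [set r] = set0 by apply: preimage_nnfun0.
    under eq_integral do rewrite indic0 mulr0.
    under [RHS]eq_integral do rewrite indic0 mulr0 mule0.
    by rewrite !integral0.
  have mg : measurable (g @^-1` [set r]) by rewrite -[X in measurable X]setTI; exact: measurable_funP.
  under eq_integral do rewrite EFinM.
  rewrite ge0_integralZl//; [|by apply/measurable_EFinP; exact: measurable_indic].
  rewrite ind// -ge0_integralZl//.
  - by apply: eq_integral => x _; rewrite EFinM muleCA.
  - have mi : measurable_fun (setT : set R2) (fun x => (\1_(g @^-1` [set r]) x : R)%:E).
      by apply/measurable_EFinP; exact: measurable_indic.
    exact: (emeasurable_funM mfE mi).
  - by move=> x _; rewrite mule_ge0// lee_fin// indicE.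
pose h_ := nnsfun_approx measurableT mh.
have hnd (x : R2) a b : (a <= b)%N -> h_ a x <= h_ b x.
  by move=> ab; exact/lefP/nd_nnsfun_approx.
transitivity (limn (fun n => \int[P]_x (h_ n x)%:E))%E.
  rewrite -monotone_convergence//=.
  - by apply: eq_integral => x _; apply/esym/cvg_lim => //=; apply: cvg_nnsfun_approx.
  - by move=> n; apply/measurable_EFinP; exact: measurable_funP.
  - by move=> n x _; rewrite lee_fin.
  - by move=> x _ a b ab; rewrite lee_fin//; exact/lefP/nd_nnsfun_approx.
transitivity (limn (fun n => \int[@leb2 R]_x ((f x)%:E * (h_ n x)%:E)))%E.
  by congr (limn _); apply/funext => n; rewrite nn.
rewrite -monotone_convergence//=.
- apply: eq_integral => x _; rewrite limeMl//.
  + by congr (_ * _)%E; apply/cvg_lim => //=; apply: cvg_nnsfun_approx.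
  + by apply/ereal_nondecreasing_is_cvgn => a b ab; rewrite lee_fin; exact: hnd.
- move=> n; have mi : measurable_fun (setT : set R2) (fun x => (h_ n x)%:E).
    by apply/measurable_EFinP; exact: measurable_funP.
  exact: (emeasurable_funM mfE mi).
- by move=> n x _; rewrite mule_ge0// lee_fin.
- move=> x _ a b ab; apply: lee_wpmul2l; first by rewrite lee_fin.
  by rewrite lee_fin; exact: hnd.
Qed.
End DensityLaw.

Section Realization.
Context {R : realType}.
Local Notation R2 := (R * R)%type.
Local Notation T n := (n.-tuple R2).
Implicit Types (f g : R2 -> R) (h : R2 -> \bar R).

(** The integrated form of [has_density_indicator], for a general density; in this form products and
    mixtures of laws can be computed by Tonelli. *)
Definition has_density n f (P : probability (T n) R) := forall h,
  measurable_fun setT h -> (forall x, (0 <= h x)%E) ->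
  (\sum_(j < n) \int[P]_x h (tnth x j) = \int[@leb2 R]_z ((f z)%:E * h z))%E.

(* The truncation only makes Tonelli applicable: [c] is taken so large that it is not felt
   on the support of the density. *)
Definition kc (c : R) (z : R2) : \bar R :=
  if z == 0 then +oo%E else (Num.max 0 (nlg z + c))%:E.

Lemma kc_ge0 c z : (0 <= kc c z)%E.
Proof. by rewrite /kc; case: ifP => // _; rewrite lee_fin le_max lexx. Qed.

Lemma measurable_kc c : measurable_fun setT (kc c).
Proof.
have -> : kc c = (fun z => (Num.max 0 (nlg z + c))%:E + +oo * (\1_[set (0 : R2)] z)%:E)%E.
  apply/funext => z; rewrite /kc; case: eqVneq => [->|z0].
    by rewrite indT// mule1 addeC.
  by rewrite indF ?mule0 ?adde0// => /eqP; rewrite (negbTE z0).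
apply: emeasurable_funD.
  apply/measurable_EFinP; apply: measurable_maxr => //; apply: measurable_funD => //.
  by case: (@ker_nlg R).
apply: emeasurable_funM => //; apply/measurable_EFinP.
by apply: measurable_ind; exact: measurable_pt.
Qed.

Definition inter c n (x : T n) : \bar R :=
  (\sum_(j < n) \sum_(k < n | (j < k)%N) kc c (tnth x j - tnth x k)%R)%E.
Definition cross c m n (x : T m) (y : T n) : \bar R :=
  (\sum_(j < m) \sum_(k < n) kc c (tnth x j - tnth y k)%R)%E.

Lemma inter_ge0 c n (x : T n) : (0 <= inter c x)%E.
Proof. by apply: sume_ge0 => j _; apply: sume_ge0 => k _; exact: kc_ge0. Qed.
Lemma cross_ge0 c m n (x : T m) (y : T n) : (0 <= cross c x y)%E.
Proof. by apply: sume_ge0 => j _; apply: sume_ge0 => k _; exact: kc_ge0. Qed.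

Lemma inter_cat c m n (x : T m) (y : T n) :
  (inter c [tuple of x ++ y] = inter c x + inter c y + cross c x y)%E.
Proof.
rewrite /inter big_split_ord /=.
have -> : (\sum_(i < m) \sum_(k < m + n | (i < k)%N) kc c (tnth [tuple of x ++ y] (lshift n i) - tnth [tuple of x ++ y] k)%R =
   inter c x + cross c x y)%E.
  rewrite /inter /cross -big_split /=; apply: eq_bigr => i _.
  rewrite big_split_ord /=; congr (_ + _)%E.
    by apply: eq_bigr => k _; rewrite !tnth_lshift.
  apply: eq_big => [k|k _]; first by rewrite ltn_addr.
  by rewrite tnth_lshift tnth_rshift.
have -> : (\sum_(i < n) \sum_(k < m + n | (m + i < k)%N) kc c (tnth [tuple of x ++ y] (rshift m i) - tnth [tuple of x ++ y] k)%R =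
   inter c y)%E.
  rewrite /inter; apply: eq_bigr => i _.
  rewrite big_split_ord /= big_pred0 ?add0e; last first.
    by move=> k; apply/negbTE; rewrite -leqNgt (leq_trans (ltnW (ltn_ord k)))// leq_addr.
  apply: eq_big => [k|k _]; first by rewrite ltn_add2l.
  by rewrite !tnth_rshift.
by rewrite addeAC.
Qed.

Lemma measurable_cat m n : measurable_fun setT (fun p : T m * T n => [tuple of p.1 ++ p.2]).
Proof.
apply/measurable_fun_tnthP => i.
case: (split_ordP i) => k ->.
  have -> : (@tnth _ _ ^~ (lshift n k) \o (fun p : T m * T n => [tuple of p.1 ++ p.2])) =
     (fun p => tnth p.1 k) by apply/funext => p /=; rewrite tnth_lshift.
  exact: (measurableT_comp (@measurable_tnth _ _ _ k) measurable_fst).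
have -> : (@tnth _ _ ^~ (rshift m k) \o (fun p : T m * T n => [tuple of p.1 ++ p.2])) =
   (fun p => tnth p.2 k) by apply/funext => p /=; rewrite tnth_rshift.
exact: (measurableT_comp (@measurable_tnth _ _ _ k) measurable_snd).
Qed.

Lemma measurable_subR2 d (X : measurableType d) (u v : X -> R2) :
  measurable_fun setT u -> measurable_fun setT v -> measurable_fun setT (fun p => u p - v p).
Proof.
move=> mu mv; apply: measurable_fun_pair => /=; apply: measurable_funB;
  (try by apply: (measurableT_comp measurable_fst)); by apply: (measurableT_comp measurable_snd).
Qed.

Lemma measurable_inter c n : measurable_fun setT (@inter c n).
Proof.
have mk (j k : 'I_n) : measurable_fun setT (fun x : T n => kc c (tnth x j - tnth x k)%R).
  apply: (measurableT_comp (measurable_kc c)); apply: measurable_subR2; exact: measurable_tnth.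
rewrite (_ : @inter c n = fun x => \sum_(j < n) \sum_(k < n) if (j < k)%N then kc c (tnth x j - tnth x k)%R else 0%E)%E.
  apply: emeasurable_sum => j; apply: emeasurable_sum => k.
  by case: (j < k)%N; [exact: mk|exact: measurable_cst].
by apply/funext => x; apply: eq_bigr => j _; rewrite big_mkcond.
Qed.
Lemma measurable_cross c m n : measurable_fun setT (fun p : T m * T n => cross c p.1 p.2).
Proof.
apply: emeasurable_sum => j; apply: emeasurable_sum => k.
apply: (measurableT_comp (measurable_kc c)); apply: measurable_subR2.
  exact: (measurableT_comp (@measurable_tnth _ _ _ j) measurable_fst).
exact: (measurableT_comp (@measurable_tnth _ _ _ k) measurable_snd).
Qed.

Lemma push_prob d1 d2 (X : measurableType d1) (Y : measurableType d2) (Q : probability X R) (g : X -> Y) :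
  measurable_fun setT g -> exists P : probability Y R, forall h : Y -> \bar R,
    measurable_fun setT h -> (forall y, (0 <= h y)%E) -> (\int[P]_y h y = \int[Q]_x h (g x))%E.
Proof.
move=> mg.
pose mp : {measure set Y -> \bar R} := pushforward Q g.
pose m : {measure set Y -> \bar R} := mp mg.
have mT : m setT = 1%E by rewrite /m /mp /= /pushforward preimage_setT probability_setT.
pose P : probability Y R := HB.pack (Measure.sort m) (Measure_isProbability.Build _ _ _ m mT).
exists P => h mh h0.
transitivity (\int[pushforward Q g]_y h y)%E => //.
by rewrite ge0_integral_pushforward// preimage_setT.
Qed.

Lemma mix_prob d (X : measurableType d) (P1 P2 : probability X R) (p : R) : 0 < p < 1 ->
  exists P : probability X R, forall h : X -> \bar R,
    measurable_fun setT h -> (forall y, (0 <= h y)%E) ->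
    (\int[P]_y h y = p%:E * \int[P1]_x h x + (1 - p)%:E * \int[P2]_x h x)%E.
Proof.
move=> /andP[p0 p1]; have q0 : 0 <= 1 - p by rewrite subr_ge0 ltW.
pose m : {measure set X -> \bar R} :=
  measure_add (mscale (NngNum (ltW p0)) P1) (mscale (NngNum q0) P2).
have mE A : m A = (p%:E * P1 A + (1 - p)%:E * P2 A)%E by rewrite /m [LHS]measure_addE.
have mT : m setT = 1%E.
  by rewrite mE !probability_setT !mule1 -EFinD addrC subrK.
pose P : probability X R := HB.pack (Measure.sort m) (Measure_isProbability.Build _ _ _ m mT).
exists P => h mh h0.
transitivity (\int[m]_y h y)%E => //.
by rewrite /m ge0_integral_measure_add// !ge0_integral_mscale.
Qed.

Lemma prod_fst d1 d2 (X : measurableType d1) (Y : measurableType d2) (P1 : probability X R)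
  (P2 : probability Y R) (h : X -> \bar R) : measurable_fun setT h -> (forall x, (0 <= h x)%E) ->
  (\int[P1 \x P2]_p h p.1 = \int[P1]_x h x)%E.
Proof.
move=> mh h0; rewrite (fubini_tonelli1 (fun p => h p.1))//; last exact: (measurableT_comp mh measurable_fst).
apply: eq_integral => x _; rewrite /fubini_F /=.
have /= -> := integral_cst P2 measurableT (h x).
by rewrite [X in (_ * X)%E](_ : _ = 1%E) ?mule1//; exact: probability_setT.
Qed.
Lemma prod_snd d1 d2 (X : measurableType d1) (Y : measurableType d2) (P1 : probability X R)
  (P2 : probability Y R) (h : Y -> \bar R) : measurable_fun setT h -> (forall x, (0 <= h x)%E) ->
  (\int[P1 \x P2]_p h p.2 = \int[P2]_x h x)%E.
Proof.
move=> mh h0; rewrite (fubini_tonelli1 (fun p => h p.2))//; last exact: (measurableT_comp mh measurable_snd).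
rewrite /fubini_F /=.
have /= -> := integral_cst P1 measurableT (\int[P2]_x h x)%E.
by rewrite [X in (_ * X)%E](_ : _ = 1%E) ?mule1//; exact: probability_setT.
Qed.

Lemma kc_pot c f w : good f -> (forall x, 0 <= f x) ->
  (forall z, f z != 0 -> w != z -> - c <= nlg (w - z)) ->
  (\int[@leb2 R]_z ((f z)%:E * kc c (w - z)%R) = (pot nlg f w + c * I2 f)%:E)%E.
Proof.
move=> gf f0 h; have kN := @ker_nlg R.
have i1 := ig_pot kN w gf; have i2 := igZ c (good_ig gf).
rewrite /pot -(I2Z c (good_ig gf)) -(I2D i1 i2) -(I2E (igD i1 i2)).
have mw : measurable_fun setT (fun z : R2 => w - z).
  by apply: measurable_subR2; [exact: measurable_cst|exact: measurable_id].
apply: ae_eq_integral => //.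
- have mf : measurable_fun setT (fun x => (f x)%:E) by apply/measurable_EFinP; exact: good_meas.
  exact: (emeasurable_funM mf (measurableT_comp (measurable_kc c) mw)).
- by apply/measurable_EFinP; exact: ig_meas (igD i1 i2).
- exists [set w]; split; [exact: measurable_pt|exact: leb2_pt|].
  move=> z /= hz; apply: contrapT => /eqP zw; apply: hz => _.
  rewrite /kc subr_eq0 eq_sym (negbTE zw) -EFinM.
  have [->|fz] := eqVneq (f z) 0; first by rewrite mul0r !mulr0 addr0.
  rewrite -mulrDl mulrC max_r//.
  by have := h z fz; rewrite eq_sym => /(_ zw); lra.
Qed.

(** Induction on the state: a product becomes the product law on concatenated tuples, a mixture the
    convex combination of the laws. The kernel is raised by [c] and cut off at 0; on the support the
    cut-off is inactive, so the expectation is the energy plus [c] per pair. *)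
Lemma realize n f E c : Ach n f E ->
  (forall x y, f x != 0 -> f y != 0 -> x != y -> - c <= nlg (x - y)) ->
  exists P : probability (T n) R, has_density f P /\
    (\int[P]_x inter c x <= (E nlg + c * prs n)%:E)%E.
Proof.
elim => {n f E}.
- move=> f gf f0 mf _; exists (\d_([tuple] : T 0)); split.
    move=> h mh h0; rewrite big_ord0.
    have : (\int[@leb2 R]_x `|(EFin \o f) x| = 0)%E.
      transitivity (\int[@leb2 R]_x (f x)%:E)%E; last by rewrite (I2E (good_ig gf)) mf.
      by apply: eq_integral => x _ /=; rewrite ger0_norm.
    have mfE : measurable_fun setT (EFin \o f) by apply/measurable_EFinP; exact: good_meas.
    move/(ae_eq_integral_abs (@leb2 R) measurableT (f := EFin \o f)) => /(_ mfE) ae.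
    have -> : (0%E = \int[@leb2 R]_x (cst 0%E x) :> \bar R)%E by rewrite integral0.
    apply/esym/ae_eq_integral => //; first by apply: emeasurable_funM.
    by move: ae; apply: filterS => x /(_ I) /= [->] _; rewrite mul0e.
  under eq_integral do rewrite /inter big_ord0.
  by rewrite integral0 /prs !mul0r mulr0 addr0.
- move=> f gf f0 mf _; have [Q hQ] := density_law gf f0 mf.
  have mg : measurable_fun setT (fun z : R2 => [tuple z] : T 1).
    by apply/measurable_fun_tnthP => i; rewrite (_ : _ \o _ = id)//; apply/funext => z; rewrite (ord1 i).
  have [P hP] := push_prob Q mg; exists P; split.
    move=> h mh h0; rewrite big_ord1.
    rewrite (hP (fun x => h (tnth x ord0))); last 2 first.
      by apply: (measurableT_comp mh); exact: measurable_tnth.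
      by move=> y; exact: h0.
    by rewrite -(density_int gf f0 hQ mh h0).
  under eq_integral.
    move=> x _; rewrite /inter big_ord1 big1; last by move=> k; rewrite (ord1 k).
    over.
  by rewrite integral0 /prs subrr mulr0 mul0r mulr0 addr0.
- move=> n1 n2 f1 f2 E1 E2 a1 h1 a2 h2 h.
  have g1 := Ach_good a1; have g2 := Ach_good a2.
  have p1 := Ach_ge0 a1; have p2 := Ach_ge0 a2.
  have n10 x : f1 x != 0 -> f1 x + f2 x != 0.
    by move=> e; rewrite paddr_eq0// (negbTE e).
  have n20 x : f2 x != 0 -> f1 x + f2 x != 0.
    by move=> e; rewrite paddr_eq0// (negbTE e) andbF.
  have [P1 [d1 i1]] := h1 (fun x y e1 e2 => h x y (n10 _ e1) (n10 _ e2)).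
  have [P2 [d2 i2]] := h2 (fun x y e1 e2 => h x y (n20 _ e1) (n20 _ e2)).
  have [P hP] := push_prob (P1 \x P2)%E (@measurable_cat n1 n2).
  exists P; split.
    move=> g mg g0; rewrite big_split_ord /=.
    have mt k (i : 'I_k) : measurable_fun setT (fun x : T k => g (tnth x i)).
      by apply: (measurableT_comp mg); exact: measurable_tnth.
    have e1 (i : 'I_n1) : (\int[P]_x g (tnth x (lshift n2 i)) = \int[P1]_x g (tnth x i))%E.
      rewrite (hP (fun x => g (tnth x (lshift n2 i)))) => [||x]; [|exact: mt|exact: g0].
      under eq_integral do rewrite tnth_lshift.
      by apply: (prod_fst P1 P2 (mt _ i)) => x; exact: g0.
    have e2 (i : 'I_n2) : (\int[P]_x g (tnth x (rshift n1 i)) = \int[P2]_x g (tnth x i))%E.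
      rewrite (hP (fun x => g (tnth x (rshift n1 i)))) => [||x]; [|exact: mt|exact: g0].
      under eq_integral do rewrite tnth_rshift.
      by apply: (prod_snd P1 P2 (mt _ i)) => x; exact: g0.
    under eq_bigr do rewrite e1.
    under [X in (_ + X)%E]eq_bigr do rewrite e2.
    rewrite (d1 g mg g0) (d2 g mg g0) -ge0_integralD//.
    - apply: eq_integral => z _; rewrite EFinD ge0_muleDl// ?lee_fin//.
    - by move=> x _; rewrite mule_ge0// lee_fin.
    - by apply: (emeasurable_funM _ mg); apply/measurable_EFinP; exact: good_meas.
    - by move=> x _; rewrite mule_ge0// lee_fin.
    - by apply: (emeasurable_funM _ mg); apply/measurable_EFinP; exact: good_meas.
  rewrite (hP _ (@measurable_inter c _) (@inter_ge0 c _)).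
  under eq_integral do rewrite inter_cat.
  have m1 : measurable_fun setT (fun p : T n1 * T n2 => inter c p.1).
    exact: (measurableT_comp (@measurable_inter c _) measurable_fst).
  have m2 : measurable_fun setT (fun p : T n1 * T n2 => inter c p.2).
    exact: (measurableT_comp (@measurable_inter c _) measurable_snd).
  rewrite ge0_integralD//; last 4 first.
  - by move=> p _; rewrite adde_ge0// inter_ge0.
  - exact: emeasurable_funD.
  - by move=> p _; exact: cross_ge0.
  - exact: measurable_cross.
  rewrite ge0_integralD//; last 2 first.
  - by move=> p _; exact: inter_ge0.
  - by move=> p _; exact: inter_ge0.
  rewrite (prod_fst P1 P2 (@measurable_inter c _) (@inter_ge0 c _)).
  rewrite (prod_snd P1 P2 (@measurable_inter c _) (@inter_ge0 c _)).
  (* Integrating out one factor and then the other uses nothing but the two one-particle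
     densities. *)
  have -> : (\int[P1 \x P2]_p cross c p.1 p.2 = (I4 nlg f1 f2 + c * n1%:R * n2%:R)%:E)%E.
    rewrite (fubini_tonelli1 (fun p => cross c p.1 p.2)) => [||p]; [|exact: measurable_cross|exact: cross_ge0].
    pose G w := (\int[@leb2 R]_z ((f2 z)%:E * kc c (w - z)%R))%E.
    have mG : measurable_fun setT G.
      apply: (@measurable_fun_fubini_tonelli_F _ _ _ _ _ (@leb2 R) (fun p : R2 * R2 => ((f2 p.2)%:E * kc c (p.1 - p.2)%R)%E)).
        apply: emeasurable_funM.
          by apply/measurable_EFinP; exact: (measurableT_comp (good_meas g2) measurable_snd).
        apply: (measurableT_comp (measurable_kc c)).
        by apply: measurable_subR2; [exact: measurable_fst|exact: measurable_snd].
      by move=> p; rewrite mule_ge0 ?lee_fin// kc_ge0.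
    have G0 w : (0 <= G w)%E by apply: integral_ge0 => z _; rewrite mule_ge0 ?lee_fin// kc_ge0.
    have GE w : G w = (\int[@leb2 R]_z ((f2 z)%:E * kc c (w - z)%R))%E by [].
    clearbody G.
    transitivity (\int[P1]_x \sum_(j < n1) G (tnth x j))%E.
      apply: eq_integral => x _; rewrite /fubini_F /= /cross.
      have mk (j : 'I_n1) (k : 'I_n2) : measurable_fun setT (fun y : T n2 => kc c (tnth x j - tnth y k)%R).
        apply: (measurableT_comp (measurable_kc c)).
        by apply: measurable_subR2; [exact: measurable_cst|exact: measurable_tnth].
      rewrite ge0_integral_sum//; last 2 first.
      - by move=> j; apply: emeasurable_sum => k; exact: mk.
      - by move=> j y _; apply: sume_ge0 => k _; exact: kc_ge0.
      apply: eq_bigr => j _; rewrite ge0_integral_sum//; last by move=> k y _; exact: kc_ge0.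
      rewrite GE (d2 (fun z => kc c (tnth x j - z)%R))//.
      - apply: (measurableT_comp (measurable_kc c)).
        by apply: measurable_subR2; [exact: measurable_cst|exact: measurable_id].
      - by move=> z; exact: kc_ge0.
    have mGt (j : 'I_n1) : measurable_fun setT (fun x : T n1 => G (tnth x j)).
      by apply: (measurableT_comp mG); exact: measurable_tnth.
    rewrite (ge0_integral_sum P1 measurableT mGt (fun j x _ => G0 _)).
    rewrite (d1 G mG G0).
    have ii : ig (fun w => f1 w * pot nlg f2 w + c * n2%:R * f1 w).
      by apply: igD; [exact: (pot_lint (@ker_nlg R) g2)|apply: igZ; exact: good_ig].
    transitivity (\int[@leb2 R]_w (f1 w * pot nlg f2 w + c * n2%:R * f1 w)%:E)%E.
      apply: eq_integral => w _; have [f1w|f1w] := eqVneq (f1 w) 0.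
        by rewrite f1w mul0e mul0r mulr0 addr0.
      rewrite GE (kc_pot (c := c) g2 p2) ?(Ach_mass a2) -?EFinM; last first.
        by move=> z f2z; apply: h; [exact: n10|exact: n20].
      by congr EFin; ring.
    rewrite (I2E ii) I2D; [|exact: (pot_lint (@ker_nlg R) g2)|apply: igZ; exact: good_ig].
    by rewrite -I4E I2Z ?(Ach_mass a1)//; [congr EFin; ring|exact: good_ig].
  rewrite prsD; apply: (le_trans (leeD (leeD i1 i2) (lexx _))).
  by rewrite -!EFinD lee_fin; lra.
- move=> p n f1 f2 E1 E2 p01 a1 h1 a2 h2 h.
  have /andP[p0 p1] := p01.
  have q1 := Ach_ge0 a1; have q2 := Ach_ge0 a2.
  have g1 := Ach_good a1; have g2 := Ach_good a2.
  have p1' : 0 < 1 - p by rewrite subr_gt0.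
  have w1 x : 0 <= p * f1 x by rewrite mulr_ge0// ltW.
  have w2 x : 0 <= (1 - p) * f2 x by rewrite mulr_ge0// ltW.
  have nz x : (f1 x != 0) || (f2 x != 0) -> p * f1 x + (1 - p) * f2 x != 0.
    move=> e; rewrite paddr_eq0// !mulf_eq0 (gt_eqF p0) (gt_eqF p1') /=.
    by rewrite negb_and.
  have [P1 [d1 i1]] : exists P : probability (T n) R, has_density f1 P /\
    (\int[P]_x inter c x <= (E1 nlg + c * prs n)%:E)%E.
    by apply: h1 => x y e1 e2; apply: h; apply: nz => //; rewrite ?e1 ?e2.
  have [P2 [d2 i2]] : exists P : probability (T n) R, has_density f2 P /\
    (\int[P]_x inter c x <= (E2 nlg + c * prs n)%:E)%E.
    by apply: h2 => x y e1 e2; apply: h; apply: nz => //; rewrite ?e1 ?e2 orbT.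
  have [P hP] := mix_prob P1 P2 p01; exists P; split; last first.
    rewrite (hP _ (@measurable_inter c _) (@inter_ge0 c _)).
    apply: (@le_trans _ _ (p%:E * (E1 nlg + c * prs n)%:E + (1 - p)%:E * (E2 nlg + c * prs n)%:E)%E).
      by apply: leeD; apply: lee_wpmul2l => //; rewrite lee_fin ltW.
    by rewrite -!EFinM -EFinD lee_fin; lra.
  move=> g mg g0.
  have mt (i : 'I_n) : measurable_fun setT (fun x : T n => g (tnth x i)).
    by apply: (measurableT_comp mg); exact: measurable_tnth.
  under eq_bigr => j _ do rewrite (hP _ (mt j) (fun x => g0 _)).
  rewrite big_split /= -!ge0_sume_distrr; last 2 first.
  - by move=> j _; apply: integral_ge0 => x _; exact: g0.
  - by move=> j _; apply: integral_ge0 => x _; exact: g0.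
  have mE k : good k -> measurable_fun (setT : set R2) (fun z => ((k z)%:E * g z)%E).
    by move=> gk; apply: (emeasurable_funM _ mg); apply/measurable_EFinP; exact: good_meas.
  rewrite (d1 g mg g0) (d2 g mg g0) -!ge0_integralZl//; last 6 first.
  - exact: mE.
  - by move=> x _; rewrite mule_ge0// lee_fin.
  - by rewrite lee_fin ltW.
  - exact: mE.
  - by move=> x _; rewrite mule_ge0// lee_fin.
  - by rewrite lee_fin ltW.
  have n0 k q x : 0 <= k x -> 0 <= q -> (0 <= q%:E * ((k x)%:E * g x))%E.
    by move=> k0 qq; apply: mule_ge0; [rewrite lee_fin|apply: mule_ge0; rewrite ?lee_fin].
  rewrite -ge0_integralD//; last 4 first.
  - by move=> x _; apply: n0 => //; exact: ltW.
  - by apply: emeasurable_funM; [exact: measurable_cst|exact: mE].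
  - by move=> x _; apply: n0 => //; exact: ltW.
  - by apply: emeasurable_funM; [exact: measurable_cst|exact: mE].
  apply: eq_integral => z _; rewrite !muleA -!EFinM -ge0_muleDl -?EFinD//; exact: w1 || exact: w2.
- move=> n f E E' a h EE hK.
  have [P [dP iP]] := h hK; exists P; split => //.
  by rewrite -EE//; exact: ker_nlg.
Qed.
End Realization.

(** * The uniform electron gas: comparison with jellium and upper bound *)

Section UEG.
Context {R : realType}.
Local Notation R2 := (R * R)%type.
Local Notation T n := (n.-tuple R2).
Implicit Types (f g : R2 -> R) (h : R2 -> \bar R).

Lemma sqE (a : R) : sq a = bx (a / 2).
Proof. by rewrite bxE. Qed.
Definition bsq N : R2 -> R := \1_(bx (Num.sqrt N%:R / 2)).
Lemma good_bsq N : good (bsq N). Proof. exact: good_bx. Qed.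
Lemma sqr_sqrtN N : (Num.sqrt N%:R : R) ^+ 2 = N%:R.
Proof. by rewrite sqr_sqrtr// ler0n. Qed.
Lemma I2_bsq N : I2 (bsq N) = N%:R.
Proof.
rewrite /bsq I2_ind; last exact: measurable_bx.
rewrite leb2_bx ?divr_ge0 ?sqrtr_ge0//= mulrC divfK ?pnatr_eq0//.
exact: sqr_sqrtN.
Qed.

Lemma EJelE N (x : 'I_N -> R2) : EJel (sq (Num.sqrt N%:R)) x =
  \sum_(j < N) \sum_(k < N | (j < k)%N) nlg (x j - x k)
  + \sum_(j < N) pot lg (bsq N) (x j) - 2^-1 * I4 lg (bsq N) (bsq N).
Proof.
have pE z : Rint2 (sq (Num.sqrt N%:R)) (fun y => ln (dist2 z y)) = pot lg (bsq N) z.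
  by rewrite Rint2_I2 sqE; apply: eq_I2 => y; rewrite mulrC.
rewrite /EJel; congr (_ + _ - _ * _).
- rewrite -sumrN; apply: eq_bigr => j _; rewrite -sumrN; exact: eq_bigr.
- by apply: eq_bigr => j _; rewrite pE.
- rewrite Rint2_I2 I4E sqE; apply: eq_I2 => y; congr (_ * _).
  by rewrite -sqE; exact: pE.
Qed.

Lemma EIndE N (P : probability (T N) R) : EInd (sq (Num.sqrt N%:R)) P =
  (\int[P]_x interaction x + (2^-1 * I4 lg (bsq N) (bsq N))%:E)%E.
Proof.
rewrite /EInd; congr (_ + _%:E)%E; congr (_ * _).
rewrite Rint2_I2 I4E sqE; apply: eq_I2 => y; congr (_ * _).
by rewrite -sqE Rint2_I2 sqE; apply: eq_I2 => z; rewrite mulrC.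
Qed.

Lemma mlogE (x y : R2) : mlog x y = if x - y == 0 then +oo%E else (nlg (x - y))%:E.
Proof. by rewrite /mlog subr_eq0. Qed.

Lemma measurable_interaction N : measurable_fun setT (@interaction R N).
Proof.
rewrite /interaction; apply: emeasurable_sum => j.
under eq_fun do rewrite big_mkcond; apply: emeasurable_sum => k.
case: (j < k)%N; last exact: measurable_cst.
have e : (fun x : T N => mlog (tnth x j) (tnth x k)) =
   ((fun z : R2 => if z == 0 then +oo%E else (nlg z)%:E) \o (fun x : T N => tnth x j - tnth x k)).
  by apply/funext => x; rewrite mlogE.
rewrite e; apply: measurableT_comp; last first.
  by apply: measurable_subR2; exact: measurable_tnth.
have -> : (fun z : R2 => if z == 0 then +oo%E else (nlg z)%:E) =
    (fun z => (nlg z)%:E + +oo * (\1_[set (0 : R2)] z)%:E)%E.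
  apply/funext => z; case: eqVneq => [->|z0].
    by rewrite indT// mule1 addeC.
  by rewrite indF ?mule0 ?adde0// => /eqP; rewrite (negbTE z0).
apply: emeasurable_funD.
  by apply/measurable_EFinP; case: (@ker_nlg R).
apply: emeasurable_funM => //; apply/measurable_EFinP.
by apply: measurable_ind; exact: measurable_pt.
Qed.

Lemma sum_pairs_cst n (c : R) : \sum_(j < n) \sum_(k < n | (j < k)%N) c = c * prs n.
Proof.
elim: n => [|n IH]; first by rewrite big_ord0 /prs mul0r mul0r mulr0.
rewrite big_ord_recr /= [X in _ + X]big_pred0 ?addr0; last first.
  by move=> k; apply/negbTE; rewrite -leqNgt -ltnS.
under eq_bigr => j _ do rewrite big_mkcond big_ord_recr /= ltn_ord -big_mkcond /=.
rewrite big_split /= IH sumr_const card_ord -addn1 prsD.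
by rewrite /prs -[c *+ n]mulr_natl; field.
Qed.

Lemma interaction_le n (c : R) (x : T n) : (interaction x <= inter c x - (c * prs n)%:E)%E.
Proof.
rewrite leeBrDr// -sum_pairs_cst -sumEFin /interaction /inter -big_split /=.
apply: lee_sum => j _; rewrite -sumEFin -big_split /=; apply: lee_sum => k _.
rewrite mlogE /kc; case: ifP => _ //.
by rewrite -EFinD lee_fin le_max lexx orbT.
Qed.

Lemma le_int_up d (X : measurableType d) (mu : {measure set X -> \bar R}) (f g : X -> \bar R) :
  measurable_fun setT f -> mu.-integrable setT g -> (forall x, f x <= g x)%E ->
  (\int[mu]_x f x <= \int[mu]_x g x)%E.
Proof.
move=> mf ig h; have mg := measurable_int _ ig.
rewrite integralE [leRHS]integralE; apply: leeB.
  apply: ge0_le_integral => //; [exact: measurable_funepos|exact: measurable_funepos|].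
  by move=> x _; apply: (@funepos_le _ _ setT) => [y _|]; [exact: h|rewrite inE].
apply: ge0_le_integral => //; [exact: measurable_funeneg|exact: measurable_funeneg|].
by move=> x _; apply: (@funeneg_le _ _ setT) => [y _|]; [exact: h|rewrite inE].
Qed.

Lemma le_int_dn d (X : measurableType d) (mu : {measure set X -> \bar R}) (f g : X -> \bar R) :
  measurable_fun setT f -> mu.-integrable setT g -> (forall x, g x <= f x)%E ->
  (\int[mu]_x g x <= \int[mu]_x f x)%E.
Proof.
move=> mf ig h; have mg := measurable_int _ ig.
rewrite integralE [leRHS]integralE; apply: leeB.
  apply: ge0_le_integral => //; [exact: measurable_funepos|exact: measurable_funepos|].
  by move=> x _; apply: (@funepos_le _ _ setT) => [y _|]; [exact: h|rewrite inE].
apply: ge0_le_integral => //; [exact: measurable_funeneg|exact: measurable_funeneg|].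
by move=> x _; apply: (@funeneg_le _ _ setT) => [y _|]; [exact: h|rewrite inE].
Qed.

Lemma has_density_ind N (P : probability (T N) R) : has_density (bsq N) P ->
  has_density_indicator (sq (Num.sqrt N%:R)) P.
Proof.
move=> h B mB.
transitivity (\sum_(j < N) \int[P]_x (\1_B (tnth x j))%:E)%E.
  apply: eq_bigr => j _.
  have mp : measurable [set x : T N | tnth x j \in B].
    have -> : [set x : T N | tnth x j \in B] = (fun x => tnth x j) @^-1` B.
      by apply/seteqP; split=> x /=; rewrite inE.
    by rewrite -[X in measurable X]setTI; exact: measurable_tnth.
  by rewrite -(setIT [set x | _]) -integral_indic//; apply: eq_integral => x _; rewrite !indicE mem_setE.
rewrite (h (fun y => (\1_B y)%:E)); last 2 first.
- by apply/measurable_EFinP; exact: measurable_ind.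
- by move=> y; rewrite lee_fin ind_ge0.
rewrite sqE -(setIT (B `&` _)) -integral_indic//; last first.
  by apply: measurableI => //; exact: measurable_bx.
by apply: eq_integral => x _; rewrite -EFinM indicI/= mulrC.
Qed.

(** The sum of the [N] marginals is itself a measure, Lebesgue measure restricted to the square,
    against which [density_int] integrates. [inord] indexes the marginals by natural numbers, as
    [msum] expects. *)
Lemma ind_has_density N (P : probability (T N) R) : (0 < N)%N ->
  has_density_indicator (sq (Num.sqrt N%:R)) P -> has_density (bsq N) P.
Proof.
case: N P => // n P _ h g mg g0; set A := sq _ in h.
have mA : measurable A by rewrite /A sqE; exact: measurable_bx.
have mt (j : 'I_n.+1) : measurable_fun setT (fun x : T n.+1 => tnth x j) by exact: measurable_tnth.
pose m0_ (k : nat) : {measure set R2 -> \bar R} := pushforward P (fun x : T n.+1 => tnth x (inord k)).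
pose m_ := m0_ (fun k => mt (inord k)).
have mE (l : R2 -> \bar R) : measurable_fun setT l -> (forall x, 0 <= l x)%E ->
    (\sum_(j < n.+1) \int[P]_x l (tnth x j) = \int[msum m_ n.+1]_x l x)%E.
  move=> ml l0; rewrite ge0_integral_measure_sum//; apply: eq_bigr => j _.
  by rewrite /m_ /m0_ ge0_integral_pushforward//= preimage_setT inord_val.
have mB B : measurable B -> msum m_ n.+1 B = leb2 (B `&` A).
  move=> mB; rewrite -h// /msum; apply: eq_bigr => j _.
  by rewrite /m_ /m0_ /pushforward /= inord_val; congr (P _); apply/seteqP; split=> x /=; rewrite inE.
rewrite mE//.
apply: (density_int (P := msum m_ n.+1) (good_bsq _) (fun x => ind_ge0 _ _)) => // B mB'.
apply: (eq_trans (mB _ mB')); rewrite /A sqE setIC -integral_indic//; exact: measurable_bx.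
Qed.

Lemma lint_meas (V : R2 -> R) : lint V -> measurable_fun setT V.
Proof.
move=> lV; apply: (@measurable_fun_cvg _ _ _ setT (fun n x => \1_(bx n%:R) x * V x)).
  by move=> n; apply: ig_meas; apply: lV; exact: good_bx.
move=> x _; apply: cvg_near_cst; near=> n; rewrite indT ?mul1r//.
have h : nrm x <= n%:R.
  have := ltW (archi_boundP (nrm_ge0 x)); move/le_trans; apply; rewrite ler_nat.
  near: n; exact: nbhs_infty_ge.
exact: bx_nrm h.
Unshelve. all: by end_near.
Qed.

Lemma prob_cst d (X : measurableType d) (P : probability X R) (c : R) : (\int[P]__ c%:E = c%:E)%E.
Proof. 
rewrite integral_cst//; transitivity (c%:E * 1)%E; last by rewrite mule1.
by congr (_ * _)%E; exact: probability_setT.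
Qed.

(** Average the pointwise jellium bound over [P]. As the density of [P] is the background, the
    particle-background term has mean [I4 lg b b], which turns the coefficient [- 1/2] of the
    background energy into [+ 1/2]. Where points coincide the interaction is [+oo] and the bound is
    trivial. *)
Lemma EIndE_ge N (P : probability (T N) R) (r : R) : (0 < N)%N ->
  has_density_indicator (sq (Num.sqrt N%:R)) P ->
  (forall x : 'I_N -> R2, distinct x -> r <= EJel (sq (Num.sqrt N%:R)) x) ->
  (r%:E <= EInd (sq (Num.sqrt N%:R)) P)%E.
Proof.
move=> N0 /(ind_has_density N0) hP hr; rewrite EIndE.
set A := bsq N; set I := I4 lg A A; pose U := pot lg A.
have lU : lint U := pot_lint ker_lg (good_bsq N).
have mU := lint_meas lU.
have mt (j : 'I_N) : measurable_fun setT (fun x : T N => tnth x j) by exact: measurable_tnth.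
have mUj j : measurable_fun setT (fun x : T N => (U (tnth x j))%:E).
  by apply/measurable_EFinP; exact: (measurableT_comp mU).
have fin : (\int[@leb2 R]_z ((A z)%:E * `|U z|%:E) < +oo)%E.
  have := ig_lty (lU _ (good_bsq N)); congr (_ < _)%E; apply: eq_integral => z _.
  by rewrite normrM [X in X * _]ger0_norm ?ind_ge0 ?EFinM.
have iU j : P.-integrable setT (fun x : T N => (U (tnth x j))%:E).
  apply/integrableP; split; first exact: mUj.
  apply: le_lt_trans fin.
  have m1 : measurable_fun setT (fun z : R2 => `|U z|%:E).
    by apply/measurable_EFinP; exact: (measurableT_comp _ mU).
  rewrite -(hP _ m1) => [|x]; last by rewrite lee_fin.
  rewrite (bigD1 j)//= leeDl// sume_ge0// => k _.
  by apply: integral_ge0 => x _; rewrite lee_fin.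
pose g (x : T N) : R := r - \sum_(j < N) U (tnth x j) + 2^-1 * I.
have iS : P.-integrable setT (fun x : T N => \sum_(j < N) (U (tnth x j))%:E)%E.
  by apply: integrable_sum => // j; exact: iU.
have iS' : P.-integrable setT (fun x : T N => ((\sum_(j < N) U (tnth x j))%:E)).
  by apply: eq_integrable iS => // x _; rewrite sumEFin.
have ic (c : R) : P.-integrable setT (fun=> c%:E : \bar R).
  exact: finite_measure_integrable_cst.
have SE : (\int[P]_x (\sum_(j < N) U (tnth x j))%:E = I%:E)%E.
  under eq_integral => x _ do rewrite -sumEFin.
  rewrite integral_sum//.
  (* [has_density] speaks of nonnegative functions, so the potential is split into its positive and
     negative parts. *)
  have pos (V : R2 -> R) : measurable_fun setT V -> (forall z, 0 <= V z) ->
     ig (fun z => A z * V z) ->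
     (\sum_(j < N) \int[P]_x (V (tnth x j))%:E = (I2 (fun z => A z * V z))%:E)%E.
    move=> mV V0 iV; rewrite (hP (fun z => (V z)%:E)); last 2 first.
    - exact/measurable_EFinP.
    - by move=> z; rewrite lee_fin.
    by rewrite -I2E//; apply: eq_integral => z _; rewrite EFinM.
  have mp : measurable_fun setT (fun z => Num.max (U z) 0) by exact: measurable_maxr.
  have mn : measurable_fun setT (fun z => Num.max (- U z) 0).
    by apply: measurable_maxr => //; exact: measurableT_comp.
  have gA : good A := good_bsq N.
  have iA := lU _ gA.
  have ip : ig (fun z => A z * Num.max (U z) 0).
    apply: ig_le (ig_abs iA).
      by apply: measurable_funM => //; exact: good_meas.
    move=> z; rewrite !normrM ler_wpM2l//; case: (leP (U z) 0) => h.
      by rewrite normr0.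
    by [].
  have in_ : ig (fun z => A z * Num.max (- U z) 0).
    apply: ig_le (ig_abs iA).
      by apply: measurable_funM => //; exact: good_meas.
    move=> z; rewrite !normrM ler_wpM2l//; case: (leP (- U z) 0) => h.
      by rewrite normr0.
    by rewrite normrN.
  have e1 := pos _ mp (fun z => ltac:(by rewrite le_max lexx orbT)) ip.
  have e2 := pos _ mn (fun z => ltac:(by rewrite le_max lexx orbT)) in_.
  have -> : I%:E = ((I2 (fun z => A z * Num.max (U z) 0))%:E - (I2 (fun z => A z * Num.max (- U z) 0))%:E)%E.
    rewrite -EFinB -I2B// /I I4E; congr EFin; apply: eq_I2 => z.
    by rewrite -mulrBr; congr (_ * _); rewrite -/(U z) /Num.max; case: ltP => h1; case: ltP => h2; lra.
  rewrite -e1 -e2 -fin_num_sumeN => [|j _]; last first.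
    have := integrable_neg_fin_num measurableT (iU j); congr (_ \is a fin_num).
    by apply: eq_integral => x _; rewrite funeneg.unlock EFin_max.
  rewrite -big_split/=; apply: eq_bigr => j _; rewrite integralE; congr (_ - _)%E.
    by apply: eq_integral => x _; rewrite funepos.unlock EFin_max.
  by apply: eq_integral => x _; rewrite funeneg.unlock EFin_max.
have igg : P.-integrable setT (fun x => (g x)%:E).
  have := integrableD measurableT (integrableB measurableT (ic r) iS') (ic (2^-1 * I)).
  by apply: eq_integrable => // x _; rewrite /g EFinD EFinB.
have gE : (\int[P]_x (g x)%:E = (r - 2^-1 * I)%:E)%E.
  under eq_integral => x _ do rewrite /g EFinD EFinB.
  rewrite integralD//; last exact: integrableB.
  rewrite integralB// SE !prob_cst -EFinB -EFinD.
  by congr EFin; field.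
have : (\int[P]_x (g x)%:E <= \int[P]_x interaction x)%E.
  apply: le_int_dn igg _; first exact: measurable_interaction.
  move=> x; have [dx|ndx] := pselect (distinct (tnth x)).
    have -> : interaction x = (\sum_(j < N) \sum_(k < N | (j < k)%N) nlg (tnth x j - tnth x k))%:E.
      rewrite -sumEFin; apply: eq_bigr => j _; rewrite -sumEFin; apply: eq_bigr => k jk.
      rewrite mlogE ifN// subr_eq0; apply/eqP/dx.
      by apply: contraTneq jk => ->; rewrite ltnn.
    by rewrite lee_fin; have := hr _ dx; rewrite EJelE /g -/A -/I -/U; lra.
  have -> : interaction x = +oo%E; last by rewrite leey.
  apply: contra_notP ndx => h j k jk xjk; apply: h.
  wlog jlk : j k jk xjk / (j < k)%N.
    have : (j < k)%N || (k < j)%N by rewrite -neq_ltn.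
    move=> /orP[jk'|kj] w; first exact: (w j k).
    by apply: (w k j) => //; rewrite eq_sym.
  have ny (i l : 'I_N) : mlog (tnth x i) (tnth x l) != -oo%E by rewrite /mlog; case: ifP.
  apply/eqP; rewrite /interaction esum_eqy => [|i _]; last first.
    by rewrite esum_eqNy; apply/negP => /existsP[l /andP[_]]; apply/negP; exact: ny.
  apply/existsP; exists j; rewrite /= esum_eqy => [|l _]; last exact: ny.
  by apply/existsP; exists k; apply/andP; split => //; rewrite /mlog xjk eqxx.
by rewrite gE => h; rewrite -leeBlDr//; apply: le_trans h.
Qed.

Lemma minJel_UEG N : (0 < N)%N -> (minJel R N <= minUEG R N)%E.
Proof.
move=> N0; apply/ereal_infP => _ [P hP <-].
case E : (minJel R N) => [r| |]; last by rewrite leNye.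
  apply: EIndE_ge => // x dx; rewrite -lee_fin -E.
  by apply: ereal_inf_lbound; exists x.
rewrite leye_eq; apply/eqP/eqyP => r _; apply: EIndE_ge => // x dx.
exfalso; have : (minJel R N <= (EJel (sq (Num.sqrt N%:R)) x)%:E)%E.
  by apply: ereal_inf_lbound; exists x.
by rewrite E.
Qed.

(** Perimeter errors are of order [a ln a] for a square of side [a]; this makes them smaller than
    [d a^2]. The proof uses [ln y <= 2 sqrt y] and completes a square. *)
Lemma ln_le_lin (C d : R) : 0 <= C -> 0 < d ->
  exists2 a0 : R, 1 <= a0 & forall a, a0 <= a -> C + C * ln (2 * a + 1) <= d * a.
Proof.
move=> C0 d0; exists (1 + (2 * C + d + 64 * C ^+ 2 / d) / d) => [|a ha].
  by rewrite lerDl divr_ge0 ?(ltW d0)// !addr_ge0 ?mulr_ge0 ?invr_ge0 ?exprn_ge0 ?(ltW d0).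
have P0 : 0 <= (2 * C + d + 64 * C ^+ 2 / d) / d.
  by rewrite divr_ge0 ?(ltW d0)// !addr_ge0 ?mulr_ge0 ?invr_ge0 ?exprn_ge0 ?(ltW d0).
have a1 : 1 <= a by apply: le_trans ha; rewrite lerDl.
have y0 : 0 < 2 * a + 1 by lra.
set y := 2 * a + 1 in y0 *; set t := Num.sqrt y.
have t0 : 0 < t by rewrite sqrtr_gt0.
have tt : y = t ^+ 2 by rewrite sqr_sqrtr// ltW.
have lt : ln y <= 2 * t.
  have -> : ln y = 2 * ln t by rewrite tt lnXn// mulr_natl.
  by have := @le_ln1Dx R (t - 1); rewrite subrKC; lra.
have h1 : C * ln y <= 2 * C * t by rewrite -[2 * C]mulrC -mulrA mulrC [_ * C]mulrC ler_wpM2l// mulrC.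
have h2 : 2 * C * t <= d / 8 * y + 8 * (C ^+ 2 / d).
  have : 0 <= d / 8 * (t - 8 * C / d) ^+ 2 by rewrite mulr_ge0 ?sqr_ge0// divr_ge0// ltW.
  have -> : d / 8 * (t - 8 * C / d) ^+ 2 = d / 8 * y - 2 * C * t + 8 * (C ^+ 2 / d).
    by rewrite tt; field; rewrite gt_eqF.
  lra.
have h3 : 2 * C + d + 64 * C ^+ 2 / d <= d * (a - 1).
  by rewrite [d * _]mulrC -ler_pdivrMr// lerBrDl.
have h4 : 0 <= C ^+ 2 / d by rewrite divr_ge0 ?sqr_ge0// ltW.
have : 64 * C ^+ 2 / d = 64 * (C ^+ 2 / d) by rewrite mulrA.
have : d / 8 * y = d / 4 * a + d / 8 by rewrite /y; field.
clear -h1 h2 h3 h4 a1 d0 C0; set u := C ^+ 2 / d; set w := d / 8 * y; set v := C * ln y.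
have da : d <= d * a by rewrite ler_peMr// ltW.
move=> e1 e2; move: h1 h2 h3 h4; rewrite -/u -/w -/v; lra.
Qed.

Definition gidx (k : nat) : seq (int * int) :=
  [seq (i%:Z - k%:Z, j%:Z - k%:Z) | i <- iota 0 (2 * k), j <- iota 0 (2 * k)].
Lemma uniq_gidx k : uniq (gidx k).
Proof.
rewrite allpairs_uniq ?iota_uniq// => -[a b] [c d] _ _ /= [e1 e2].
by move: e1 e2 => /addIr [->] /addIr [->].
Qed.
Lemma size_gidx k : size (gidx k) = (2 * k * (2 * k))%N.
Proof. by rewrite size_allpairs !size_iota. Qed.
Lemma mem_gidx k i : (i \in gidx k) =
  [&& - k%:Z <= i.1, i.1 < k%:Z, - k%:Z <= i.2 & i.2 < k%:Z].
Proof.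
apply/allpairsP/idP => [[[a b] /= [/[!mem_iota] ha hb ->]]|] /=; first by lia.
case: i => a b /= h; exists (absz (a + k%:Z), absz (b + k%:Z)); rewrite !mem_iota /=.
by split; [lia|lia|congr pair; lia].
Qed.

Lemma grid_count (m N : nat) : (0 < m)%N -> exists k : nat,
  [/\ (m ^ 2 * (2 * k * (2 * k)) <= N)%N, k%:R * m%:R <= Num.sqrt N%:R / 2 :> R &
   (N - m ^ 2 * (2 * k * (2 * k)))%:R <= 4 * m%:R * Num.sqrt N%:R :> R].
Proof.
move=> m0; set a : R := Num.sqrt N%:R.
have a0 : 0 <= a by rewrite sqrtr_ge0.
have m0' : 0 < m%:R :> R by rewrite ltr0n.
pose k := Num.trunc (a / (2 * m%:R)); exists k.
have q0 : 0 <= a / (2 * m%:R) by rewrite divr_ge0// mulr_ge0.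
have /andP[k1 k2] := truncn_itv q0.
rewrite -/k ler_pdivlMr ?mulr_gt0// in k1; rewrite -/k ltr_pdivrMr ?mulr_gt0// in k2.
have a2 : a ^+ 2 = N%:R by exact: sqr_sqrtN.
have e : (m ^ 2 * (2 * k * (2 * k)))%:R = (k%:R * (2 * m%:R)) ^+ 2 :> R.
  by rewrite !natrM; ring.
have kn : 0 <= k%:R :> R by [].
rewrite -natr1 in k2.
clearbody k; clear q0; move: (k%:R) (m%:R) kn m0' k1 k2 e => x y x0 y0 k1 k2 e.
have xy : 0 <= x * y by rewrite mulr_ge0// ltW.
have le : (m ^ 2 * (2 * k * (2 * k)) <= N)%N.
  by rewrite -(ler_nat R) e -a2 lerXn2r// nnegrE; lra.
split => //; first by lra.
rewrite natrB// e -a2; nra.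
Qed.

Lemma bsq_cells m k N : 0 < m -> k%:R * m <= Num.sqrt N%:R / 2 :> R ->
  forall x : R2, (fl (sc m^-1 x) \in gidx k)%:R <= bsq N x.
Proof.
move=> m0 h x; rewrite mem_gidx; have [/and4P[]|_] := boolP [&& _, _, _ & _]; last exact: ind_ge0.
have p (t : R) (i : int) : - k%:Z <= Num.floor t -> Num.floor t < k%:Z -> - (k%:R) <= t < k%:R.
  move=> h1 h2; apply/andP; split.
    by apply: le_trans (ge_floor t); rewrite -(ler_int R) in h1; rewrite intrN in h1.
  by apply: (lt_le_trans (lt_succ_floor t)); rewrite -[k%:R]/(k%:Z%:~R) ler_int lezD1.
move=> /p /[apply] /(_ 0) /andP[a1 a2] /p /[apply] /(_ 0) /andP[b1 b2].
rewrite /bsq indT//; rewrite /= mulrC ler_pdivlMr// in a1; rewrite /= mulrC ltr_pdivrMr// in a2.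
rewrite /= mulrC ler_pdivlMr// in b1; rewrite /= mulrC ltr_pdivrMr// in b2.
by split; rewrite ler_norml; apply/andP; split; lra.
Qed.

Lemma bsq_diam N (x y : R2) : bsq N x != 0 -> bsq N y != 0 -> nrm (x - y) <= 2 * Num.sqrt N%:R + 1.
Proof.
have p z : bsq N z != 0 -> bx (Num.sqrt N%:R / 2) z.
  by move=> h; apply: contrapT => hz; move: h; rewrite /bsq indF ?eqxx.
move=> /p h1 /p h2; apply: le_trans (nrmB _ _) _.
by have := nrm_bx h1; have := nrm_bx h2; lra.
Qed.

Lemma fill_bsq (K : R2 -> R) m j N c : ker K -> (0 < m)%N ->
  JA K (m ^ 2) (cellf m%:R 0) (cellf m%:R 0) j -> 0 <= c ->
  (forall x y, bsq N x != 0 -> bsq N y != 0 -> x != y -> - c <= K (x - y)) ->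
  JA K N (bsq N) (bsq N) (j / (m ^ 2)%:R * N%:R + (`|j| / (m ^ 2)%:R + c) * (4 * m%:R * Num.sqrt N%:R)).
Proof.
move=> kK m0 hj c0 hc; have [k [k1 k2 k3]] := grid_count N m0.
have m0' : 0 < m%:R :> R by rewrite ltr0n.
apply: (JA_le (JA_fill (s := gidx k) (n := (m ^ 2)%N) kK m0' (good_bsq N) (uniq_gidx k) c0 _ (I2_bsq N) _ _ hc hj)).
- exact: bsq_cells.
- by rewrite natrX.
- by rewrite size_gidx.
set n := (m ^ 2)%N in k1 k3 *; rewrite size_gidx; set s := (2 * k * (2 * k))%N in k1 k3 *.
have n0 : 0 < n%:R :> R by rewrite ltr0n expn_gt0 m0.
set r : R := (N - n * s)%:R in k3 *.
have r0 : 0 <= r by [].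
have e : s%:R = (N%:R - r) / n%:R :> R by rewrite /r natrB// opprB addrC subrK natrM mulrC mulKf// gt_eqF.
rewrite e.
have -> : (N%:R - r) / n%:R * j + r / 2 * c = j / n%:R * N%:R + (- (j / n%:R) + c / 2) * r by field; rewrite gt_eqF.
rewrite lerD2l; apply: (@le_trans _ _ ((`|j| / n%:R + c) * r)).
  apply: ler_wpM2r => //; apply: lerD; last lra.
  by rewrite -mulNr; apply: ler_wpM2r; [rewrite invr_ge0 ltW|have := ler_norm (- j); rewrite normrN].
by apply: ler_wpM2l => //; rewrite addr_ge0// divr_ge0// ltW.
Qed.

(** The frame around the block of squares holds at most [4 m sqrt N] independent particles. Each
    costs at most the logarithm of the diameter, an error of order [sqrt N ln N]. *)
Lemma ueg_upper m j d : exS m j -> 0 < d -> exists N0 : nat, forall N, (N0 <= N)%N -> (0 < N)%N ->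
  (minUEG R N <= ((j / (m ^ 2)%:R + d) * N%:R)%:E)%E.
Proof.
move=> [m0 hj] d0; set J := j / (m ^ 2)%:R; set J' := `|j| / (m ^ 2)%:R.
have J0 : 0 <= J' by rewrite divr_ge0.
pose C : R := (J' + 1) * (4 * m%:R).
have C0 : 0 <= C by rewrite mulr_ge0 ?addr_ge0.
have [a0 a1 ha] := ln_le_lin C0 d0.
exists (Num.trunc (a0 ^+ 2)).+1 => N hN N0.
set a : R := Num.sqrt N%:R.
have aa : a ^+ 2 = N%:R by exact: sqr_sqrtN.
have a0a : a0 <= a.
  rewrite -(@ler_pXn2r _ 2) ?nnegrE ?sqrtr_ge0//; last by lra.
  rewrite aa ltW//; apply: (lt_le_trans (truncnS_gt _)); by rewrite ler_nat.
have D1 : 1 <= 2 * a + 1 by lra.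
have c0 : 0 <= ln (2 * a + 1) by exact: ln_ge0.
have hc x y : bsq N x != 0 -> bsq N y != 0 -> x != y -> - ln (2 * a + 1) <= nlg (x - y).
  by move=> h1 h2 _; apply: nlg_ge => //; exact: bsq_diam.
have [E [aE hE]] := fill_bsq (@ker_nlg R) m0 hj c0 hc.
have [P [dP iP]] := realize aE hc.
have gA := good_bsq N.
have I4n : I4 nlg (bsq N) (bsq N) = - I4 lg (bsq N) (bsq N).
  rewrite -mulN1r -I4_kerZ//; last exact: ker_lg.
  by rewrite !I4E; apply: eq_I2 => x; congr (_ * _); apply: eq_I2 => y; rewrite mulN1r.
apply: (@le_trans _ _ (EInd (sq (Num.sqrt N%:R)) P)).
  by apply: ereal_inf_lbound; exists P => //=; exact: has_density_ind.
rewrite EIndE; set c := ln _ in c0 hc hE iP *.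
have ii : P.-integrable setT (inter c (n := N)).
  apply/integrableP; split; first exact: measurable_inter.
  under eq_integral => x _ do rewrite gee0_abs ?inter_ge0//.
  by apply: le_lt_trans iP _; rewrite ltry.
have ic : P.-integrable setT (fun=> (c * prs N)%:E : \bar R) by exact: finite_measure_integrable_cst.
apply: (@le_trans _ _ ((E nlg + c * prs N)%:E - (c * prs N)%:E + (2^-1 * I4 lg (bsq N) (bsq N))%:E)%E).
  apply: leeD => //; apply: le_trans (le_int_up (measurable_interaction (N := N)) (integrableB measurableT ii ic) (fun x => interaction_le c x)) _.
  rewrite integralB// prob_cst.
  by apply: leeB.
rewrite -EFinB -EFinD lee_fin -/J.
have e : E nlg + 2^-1 * I4 lg (bsq N) (bsq N) <= J * N%:R + (J' + c) * (4 * m%:R * a).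
  by apply: le_trans hE; rewrite I4n; lra.
have := ha _ a0a; rewrite -/c => hh.
have : (J' + c) * (4 * m%:R * a) <= d * a * a.
  apply: le_trans (ler_wpM2r (sqrtr_ge0 _) hh).
  rewrite -/a !mulrA ler_wpM2r ?sqrtr_ge0// /C.
  have -> : (J' + c) * 4 * m%:R = (J' + c) * (4 * m%:R) by rewrite mulrA.
  have -> : (J' + 1) * (4 * m%:R) + (J' + 1) * (4 * m%:R) * c = (J' + 1) * (1 + c) * (4 * m%:R) by ring.
  apply: ler_wpM2r; first by rewrite mulr_ge0.
  nra.
have -> : d * a * a = d * N%:R by rewrite -aa; ring.
rewrite mulrDl; lra.
Qed.
End UEG.

(** * Stability *)
Section LogSeries.
Context {R : realType}.

(** The term [k = 0] is [x^0 / 0 = 0], so this is the Taylor sum of [- ln (1 - x)] starting at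
    [k = 1]. *)
Lemma is_derive_psum n (x : R) :
  is_derive x (1 : R) (fun t : R => \sum_(k < n.+1) t ^+ k / k%:R) (\sum_(k < n) x ^+ k).
Proof.
elim: n => [|n IH].
  rewrite big_ord0; have -> : (fun t : R => \sum_(k < 1) t ^+ k / k%:R) = cst 0.
    by apply/funext => t; rewrite big_ord1 invr0 mulr0.
  exact: is_derive_cst.
rewrite big_ord_recr /=.
have -> : (fun t : R => \sum_(k < n.+2) t ^+ k / k%:R) =
    (fun t : R => \sum_(k < n.+1) t ^+ k / k%:R) + (fun t : R => n.+1%:R^-1 *: (t ^+ n.+1)).
  by apply/funext => t; rewrite big_ord_recr /= mulrC.
apply: is_deriveD.
have h : is_derive x (1 : R) (fun t : R => t ^+ n.+1) (n.+1%:R * x ^+ n).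
  have := @is_deriveX R R id n.+1 x 1 1 (is_derive_id _ _).
  have -> : (id ^+ n.+1 : R -> R) = (fun t : R => t ^+ n.+1).
    by apply/funext => t; rewrite fctE.
  by rewrite /GRing.scale /= mulr1.
have := is_deriveZ (n.+1%:R^-1) h.
by rewrite /GRing.scale /= mulrA mulVf ?mul1r ?pnatr_eq0.
Qed.

(** The remainder has derivative [c^n / (1 - c)]; the mean value theorem on [[0, q]] gives the
    bound. *)
Lemma ln_series_bound n (q : R) : 0 <= q < 1 ->
  `|- ln (1 - q) - \sum_(k < n.+1) q ^+ k / k%:R| <= q / (1 - q) * q ^+ n.
Proof.
move=> /andP[q0 q1].
pose f t : R := - ln (1 - t) - \sum_(k < n.+1) t ^+ k / k%:R.
pose df t : R := (1 - t)^-1 - \sum_(k < n) t ^+ k.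
have d (t : R) : t < 1 -> is_derive t (1 : R) f (df t).
  move=> t1; apply: is_deriveB; last exact: is_derive_psum.
  have h : is_derive t (1 : R) (fun t : R => 1 - t) (- 1).
    have := is_deriveB (is_derive_cst (1 : R) t 1) (is_derive_id t (1 : R)).
    by rewrite sub0r.
  have h2 : is_derive (1 - t) (1 : R) (@ln R) (1 - t)^-1 by apply: is_derive1_ln; rewrite subr_gt0.
  have := is_deriveN (@is_derive1_comp R (@ln R) (fun t : R => 1 - t) t _ _ h2 h).
  by rewrite /GRing.scale /= mulrN1 opprK.
have [c /[!in_itv]/= /andP[c0 cq] e] : exists2 c, c \in `[0, q] & f q - f 0 = df c * (q - 0).
  apply: MVT_segment => //.
    move=> t; rewrite in_itv /= => /andP[_ tq]; apply: d; exact: lt_trans q1.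
  apply: derivable_within_continuous => t; rewrite in_itv /= => /andP[_ tq].
  by have [] := d t (le_lt_trans tq q1).
have f0 : f 0 = 0.
  rewrite /f subr0 ln1 oppr0 sub0r big_ord_recl /= invr0 mulr0 add0r big1 ?oppr0// => i _.
  by rewrite exprS mul0r mul0r.
rewrite f0 !subr0 in e; rewrite -/(f q) e.
have c1 : c < 1 by exact: le_lt_trans cq q1.
have -> : df c = c ^+ n / (1 - c).
  have : (1 - c) * \sum_(k < n) c ^+ k = 1 - c ^+ n by rewrite -[RHS]opprB subrX1 -mulNr opprB.
  rewrite /df => h; have c1' : 1 - c != 0 by rewrite subr_eq0 gt_eqF.
  apply: (mulfI c1'); rewrite mulrBr h mulfV// mulrCA mulfV// mulr1; ring.
rewrite ger0_norm; last by rewrite mulr_ge0 ?divr_ge0 ?exprn_ge0// subr_ge0 ltW.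
rewrite [leRHS](_ : _ = q ^+ n / (1 - q) * q); last by ring.
apply: ler_wpM2r => //; apply: ler_pM.
- exact: exprn_ge0.
- by rewrite invr_ge0 subr_ge0 ltW.
- exact: lerXn2r.
- by rewrite lef_pV2 ?posrE ?subr_gt0// lerB.
Qed.

Lemma cvg_ln_series (q : R) : 0 <= q < 1 ->
  (fun n => \sum_(k < n.+1) q ^+ k / k%:R) @ \oo --> - ln (1 - q).
Proof.
move=> hq; have /andP[q0 q1] := hq.
have z : (fun n => q / (1 - q) * q ^+ n) @ \oo --> (0 : R).
  rewrite -[X in _ --> X](mulr0 (q / (1 - q))); apply: cvgM; first exact: cvg_cst.
  by apply: cvg_expr; rewrite ger0_norm.
apply/subr_cvg0; apply: norm_cvg0.
apply: (squeeze_cvgr _ (cvg_cst 0) z); near=> n.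
by rewrite normr_ge0 /= distrC ln_series_bound.
Unshelve. all: by end_near.
Qed.

(** As [h] tends to 0 this exhibits [- ln v] as the limit of [- ln (1 - exp (- h v)) + ln h], that
    is, of a positive series of exponentials in [v] plus a constant: the source of conditional
    positive definiteness. *)
Lemma one_sub_exp (h v : R) : 0 < h -> 0 < v ->
  - ln v <= - ln (1 - expR (- (h * v))) + ln h <= - ln v + h * v.
Proof.
move=> h0 v0; set s := h * v; have s0 : 0 < s by rewrite mulr_gt0.
have e1 : expR (- s) < 1 by rewrite expR_lt1 oppr_lt0.
have u : 1 - expR (- s) <= s by have := expR_ge1Dx (- s); lra.
have l : s / (1 + s) <= 1 - expR (- s).
  have h1 : expR (- s) <= (1 + s)^-1.
    by rewrite expRN lef_pV2 ?posrE ?expR_gt0 ?addr_gt0// expR_ge1Dx.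
  have : s / (1 + s) = 1 - (1 + s)^-1 by field; rewrite gt_eqF// addr_gt0.
  lra.
have p : 0 < 1 - expR (- s) by rewrite subr_gt0.
have lns : ln s = ln h + ln v by rewrite lnM.
apply/andP; split.
  have : ln (1 - expR (- s)) <= ln s by rewrite ler_ln ?posrE.
  by rewrite lns; lra.
have : ln (s / (1 + s)) <= ln (1 - expR (- s)).
  by rewrite ler_ln ?posrE// divr_gt0// addr_gt0.
rewrite ln_div ?posrE ?addr_gt0//; have := @le_ln1Dx R s; lra.
Qed.
End LogSeries.

(** * Conditionally positive definite regularization of the logarithm *)

Section Stability.
Context {R : realType}.
Local Notation R2 := (R * R)%type.
Implicit Types (x y z : R2) (b f : R2 -> R) (k : R2 -> R2 -> R).

Lemma cvg_sumr (I : Type) (s : seq I) (F : nat -> I -> R) (G : I -> R) :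
  (forall i, F n i @[n --> \oo] --> G i) -> (\sum_(i <- s) F n i) @[n --> \oo] --> \sum_(i <- s) G i.
Proof.
move=> h; elim: s => [|i s IH].
  by under eq_fun do rewrite big_nil; rewrite big_nil; exact: cvg_cst.
by under eq_fun do rewrite big_cons; rewrite big_cons; apply: cvgD.
Qed.

Section form.
Variable s : seq (R * R2).
Definition qf k : R := \sum_(a <- s) \sum_(c <- s) a.1 * c.1 * k a.2 c.2.
Lemma qfD k l : qf (fun x y => k x y + l x y) = qf k + qf l.
Proof.
rewrite /qf -big_split /=; apply: eq_bigr => a _; rewrite -big_split /=.
by apply: eq_bigr => c _; rewrite mulrDr.
Qed.
Lemma qfZ t k : qf (fun x y => t * k x y) = t * qf k.
Proof.
rewrite /qf mulr_sumr; apply: eq_bigr => a _; rewrite mulr_sumr.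
by apply: eq_bigr => c _; ring.
Qed.
Lemma qf_sum n (F : 'I_n -> R2 -> R2 -> R) : qf (fun x y => \sum_(i < n) F i x y) = \sum_(i < n) qf (F i).
Proof.
rewrite /qf [RHS]exchange_big /=; apply: eq_bigr => a _; rewrite [RHS]exchange_big /=.
by apply: eq_bigr => c _; rewrite mulr_sumr.
Qed.
Lemma eq_qf k l : (forall x y, k x y = l x y) -> qf k = qf l.
Proof. by move=> h; apply: eq_bigr => a _; apply: eq_bigr => c _; rewrite h. Qed.
Lemma qf_sq f : qf (fun x y => f x * f y) = (\sum_(a <- s) a.1 * f a.2) ^+ 2.
Proof.
rewrite expr2 mulr_suml; apply: eq_bigr => a _; rewrite mulr_sumr.
by apply: eq_bigr => c _; ring.
Qed.
Lemma qf_lim (K : nat -> R2 -> R2 -> R) k : (forall x y, K n x y @[n --> \oo] --> k x y) ->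
  (forall n, 0 <= qf (K n)) -> 0 <= qf k.
Proof.
move=> h p; have c : qf (K n) @[n --> \oo] --> qf k.
  by apply: cvg_sumr => a; apply: cvg_sumr => c; apply: cvgM; [exact: cvg_cst|exact: h].
by rewrite -(cvg_lim _ c)//; apply: limr_ge; [apply/cvg_ex; exists (qf k)|exact: nearW].
Qed.

Definition gauss (t : R) z : R := expR (- (t * nsq z)).
(** Up to the factors [g x * g y] the Gaussian is [exp (2 t x.y)], whose power series is a sum, with
    nonnegative coefficients, of products [p x * p y] of monomials; each contributes a square. *)
Lemma qf_gauss t : 0 <= t -> 0 <= qf (fun x y => gauss t (x - y)).
Proof.
move=> t0; pose g x : R := expR (- (t * nsq x)).
pose ip x y : R := 2 * t * (x.1 * y.1 + x.2 * y.2).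
apply: (@qf_lim (fun n x y => g x * g y * \sum_(i < n) ip x y ^+ i / i`!%:R)).
  move=> x y; have -> : gauss t (x - y) = g x * g y * expR (ip x y).
    by rewrite /gauss /g -!expRD; congr expR; rewrite /nsq /ip /=; ring.
  apply: cvgM; first exact: cvg_cst.
  have := @is_cvg_series_exp_coeff R (ip x y).
  have -> : (fun n => \sum_(i < n) ip x y ^+ i / i`!%:R) = series (exp_coeff (ip x y)).
    by apply/funext => n; rewrite /series /= big_mkord.
  by [].
move=> n.
rewrite (@eq_qf _ (fun x y => \sum_(i < n) (2 * t) ^+ i / i`!%:R *
   \sum_(j < i.+1) 'C(i, j)%:R * ((g x * (x.1 ^+ (i - j) * x.2 ^+ j)) * (g y * (y.1 ^+ (i - j) * y.2 ^+ j))))); last first.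
  move=> x y; rewrite mulr_sumr; apply: eq_bigr => i _.
  rewrite /ip exprMn exprDn !mulr_sumr mulr_suml mulr_sumr; apply: eq_bigr => j _.
  by rewrite !exprMn -mulr_natl; ring.
rewrite qf_sum; apply: sumr_ge0 => i _; rewrite qfZ mulr_ge0//.
  by rewrite divr_ge0// exprn_ge0// mulr_ge0.
rewrite qf_sum; apply: sumr_ge0 => j _; rewrite qfZ mulr_ge0// qf_sq; exact: sqr_ge0.
Qed.

Hypothesis neutral : \sum_(a <- s) a.1 = 0.
Lemma qf_cst c : qf (fun _ _ => c) = 0.
Proof.
rewrite /qf big1// => a _; rewrite -mulr_suml -mulr_sumr neutral mulr0 mul0r//.
Qed.

(* Conditionally positive definite, with the same behaviour as [- ln] at infinity. *)
Definition wk (u : R) : R := - ln (1 + u) + ln (2 + u) / 2.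
(** Each logarithm is replaced by its series of exponentials. The constant [ln h / 2] drops by
    neutrality, and the [k]-th term is a Gaussian with weight [(exp (- h k) - exp (- 2 h k) / 2) / k
    >= 0]. *)
Lemma qf_wk : 0 <= qf (fun x y => wk (nsq (x - y))).
Proof.
have p1 z : 0 < 1 + nsq z :> R by have := nsq_ge0 z; lra.
have p2 z : 0 < 2 + nsq z :> R by have := nsq_ge0 z; lra.
pose l (h v : R) : R := - ln (1 - expR (- (h * v))).
apply: (@qf_lim (fun n x y => (l n.+1%:R^-1 (1 + nsq (x - y)) + ln n.+1%:R^-1)
   - 2^-1 * (l n.+1%:R^-1 (2 + nsq (x - y)) + ln n.+1%:R^-1))).
  move=> x y; rewrite (_ : wk _ = - ln (1 + nsq (x - y)) - 2^-1 * - ln (2 + nsq (x - y))); last by rewrite /wk; ring.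
  have c v : 0 < v -> (l n.+1%:R^-1 v + ln n.+1%:R^-1) @[n --> \oo] --> - ln v.
    move=> v0.
    have z : (- ln v + n.+1%:R^-1 * v) @[n --> \oo] --> - ln v.
      rewrite -[X in _ --> X]addr0; apply: cvgD; first exact: cvg_cst.
      rewrite -[X in _ --> X](mul0r v); apply: cvgM; last exact: cvg_cst.
      exact: cvg_harmonic.
    apply: (squeeze_cvgr _ (cvg_cst (- ln v)) z); near=> n.
    exact: one_sub_exp.
  by apply: cvgB; [exact: c|apply: cvgM; [exact: cvg_cst|exact: c]].
move=> n; set h := n.+1%:R^-1; have h0 : 0 < h by rewrite invr_gt0.
rewrite (@eq_qf _ (fun x y => (l h (1 + nsq (x - y)) - 2^-1 * l h (2 + nsq (x - y))) + ln h / 2)); last first.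
  by move=> x y; field.
rewrite qfD qf_cst addr0.
apply: (@qf_lim (fun n x y => \sum_(k < n.+1) (expR (- (h * k%:R)) - 2^-1 * expR (- (2 * (h * k%:R)))) / k%:R * gauss (h * k%:R) (x - y))).
  move=> x y.
  have c v : 0 < v -> (\sum_(k < n.+1) expR (- (h * v)) ^+ k / k%:R) @[n --> \oo] --> l h v.
    by move=> v0; apply: cvg_ln_series; rewrite expR_ge0 expR_lt1 oppr_lt0 mulr_gt0.
  have -> : (fun n => \sum_(k < n.+1) (expR (- (h * k%:R)) - 2^-1 * expR (- (2 * (h * k%:R)))) / k%:R * gauss (h * k%:R) (x - y)) =
    (fun n => \sum_(k < n.+1) expR (- (h * (1 + nsq (x - y)))) ^+ k / k%:R -
       2^-1 * \sum_(k < n.+1) expR (- (h * (2 + nsq (x - y)))) ^+ k / k%:R).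
    apply/funext => m; rewrite mulr_sumr -sumrB; apply: eq_bigr => k _.
    rewrite -!expRM_natl /gauss.
    have -> : expR (k%:R * - (h * (1 + nsq (x - y)))) = expR (- (h * k%:R)) * expR (- (h * k%:R * nsq (x - y))).
      by rewrite -expRD; congr expR; ring.
    have -> : expR (k%:R * - (h * (2 + nsq (x - y)))) = expR (- (2 * (h * k%:R))) * expR (- (h * k%:R * nsq (x - y))).
      by rewrite -expRD; congr expR; ring.
    ring.
  by apply: cvgB; [exact: c|apply: cvgM; [exact: cvg_cst|exact: c]].
move=> m; rewrite qf_sum; apply: sumr_ge0 => k _; rewrite qfZ mulr_ge0//; last first.
  by apply: qf_gauss; rewrite mulr_ge0// ltW.
rewrite divr_ge0// subr_ge0.
have : expR (- (2 * (h * k%:R))) <= expR (- (h * k%:R)).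
  have : 0 <= h * k%:R by rewrite mulr_ge0// ltW.
  by rewrite ler_expR; lra.
have := expR_gt0 (- (2 * (h * k%:R))); lra.
Unshelve. all: by end_near.
Qed.
End form.

(** An integrable majorant in product form, whose integral reduces to that of [1 / (1 + t^2)]. It
    dominates [|z|^-4] up to a factor 3 for [|z| >= 1] and controls all tails of that order. *)
Definition pg z : R := ((1 + z.1 ^+ 2) * (1 + z.2 ^+ 2))^-1.
Lemma pg_ge0 z : 0 <= pg z.
Proof. by rewrite invr_ge0 mulr_ge0// addr_ge0// sqr_ge0. Qed.

Lemma measurable_oneDsqrV : measurable_fun (setT : set R) (fun t : R => (1 + t ^+ 2)^-1).
Proof. by apply: continuous_measurable_fun; exact: continuous_oneDsqrV. Qed.

Lemma int_oneDsqrV : (\int[@lebesgue_measure R]_t ((1 + t ^+ 2)^-1)%:E < +oo)%E.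
Proof.
pose g (t : R) : \bar R := (\1_(`[0, +oo[%classic : set R) t * (1 + t ^+ 2)^-1)%:E.
have mg : measurable_fun setT g.
  apply/measurable_EFinP; apply: measurable_funM; last exact: measurable_oneDsqrV.
  by apply: measurable_indic; exact: measurable_itv.
have p t : 0 <= (1 + t ^+ 2)^-1 :> R by rewrite invr_ge0 addr_ge0 ?sqr_ge0.
have g0 t : (0 <= g t)%E by rewrite lee_fin mulr_ge0// indicE.
have ge : (\int[@lebesgue_measure R]_t g t = (pi / 2)%:E)%E.
  rewrite -integral0y_oneDsqr [RHS]integral_mkcond; apply: eq_integral => t _.
  by rewrite patchE /g indicE; case: (_ \in _); rewrite ?mul1r ?mul0r.
have := @ge0_leb_affine R (-1) 0 g; rewrite oppr_eq0 oner_eq0 normrN1 invr1 mul1e => /(_ isT mg g0) h.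
apply: (@le_lt_trans _ _ (\int[@lebesgue_measure R]_t (g t + g (-1 * t + 0)%R))%E).
  apply: ge0_le_integral => //.
  - by move=> t _; rewrite lee_fin.
  - by apply/measurable_EFinP; exact: measurable_oneDsqrV.
  - apply: emeasurable_funD => //; apply: (measurableT_comp mg); exact: measurable_affine.
  move=> t _; rewrite /g -EFinD lee_fin mulN1r addr0 sqrrN -mulrDl ler_peMl//.
  rewrite !indicE !mem_setE !in_itv /= !andbT oppr_ge0.
  by case: (leP 0 t) => [h0|/ltW ->]; rewrite ?lerDl ?lerDr.
rewrite ge0_integralD//; last first.
  by apply: (measurableT_comp mg); exact: measurable_affine.
by rewrite h ge -EFinD ltry.
Qed.

Lemma measurable_pg : measurable_fun (setT : set R2) pg.
Proof.
have -> : pg = fun z => (1 + z.1 ^+ 2)^-1 * (1 + z.2 ^+ 2)^-1 by apply/funext => z; rewrite /pg invfM.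
apply: measurable_funM.
  exact: (measurableT_comp measurable_oneDsqrV measurable_fst).
exact: (measurableT_comp measurable_oneDsqrV measurable_snd).
Qed.

Lemma ig_pg : ig pg.
Proof.
apply: ig_of; first exact: measurable_pg.
under eq_integral => z _ do rewrite ger0_norm ?pg_ge0//.
rewrite tonelli1; last 2 first.
- by apply/measurable_EFinP; exact: measurable_pg.
- by move=> z; rewrite lee_fin pg_ge0.
have p (t : R) : 0 <= (1 + t ^+ 2)^-1 :> R by rewrite invr_ge0 addr_ge0 ?sqr_ge0.
set J := (\int[@lebesgue_measure R]_t ((1 + t ^+ 2)^-1)%:E)%E.
have J0 : (0 <= J)%E by apply: integral_ge0 => y _; rewrite lee_fin.
have -> : (\int[@lebesgue_measure R]_x \int[@lebesgue_measure R]_y (pg (x, y))%:E =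
    \int[@lebesgue_measure R]_x (((1 + x ^+ 2)^-1)%:E * J))%E.
  apply: eq_integral => x _; rewrite -ge0_integralZl ?lee_fin//; last 2 first.
  - by apply/measurable_EFinP; exact: measurable_oneDsqrV.
  - by move=> y _; rewrite lee_fin.
  by apply: eq_integral => y _; rewrite /pg invfM EFinM.
rewrite ge0_integralZr//; last 2 first.
- by apply/measurable_EFinP; exact: measurable_oneDsqrV.
- by move=> y _; rewrite lee_fin.
rewrite -/J; have : (J < +oo)%E by exact: int_oneDsqrV.
by case: J J0 => [r| |]//= _ _; rewrite -EFinM ltry.
Qed.

Lemma pg_nsq z : 1 <= nsq z -> (nsq z ^+ 2)^-1 <= 3 * pg z.
Proof.
move=> u1; have h : (1 + z.1 ^+ 2) * (1 + z.2 ^+ 2) <= 3 * nsq z ^+ 2.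
  have -> : (1 + z.1 ^+ 2) * (1 + z.2 ^+ 2) = 1 + nsq z + z.1 ^+ 2 * z.2 ^+ 2 by rewrite /nsq; ring.
  have : z.1 ^+ 2 * z.2 ^+ 2 <= nsq z ^+ 2.
    by rewrite /nsq; have := sqr_ge0 z.1; have := sqr_ge0 z.2; nra.
  nra.
have p : 0 < (1 + z.1 ^+ 2) * (1 + z.2 ^+ 2) by rewrite mulr_gt0// ltr_pwDl// sqr_ge0.
have p2 : 0 < nsq z ^+ 2 by rewrite exprn_gt0//; lra.
by rewrite /pg ler_pdivlMr// mulrC ler_pdivrMr.
Qed.

Definition wz z : R := wk (nsq z).
Definition zz z : R := nlg z - wz z.

Lemma measurable_wz : measurable_fun (setT : set R2) wz.
Proof.
have m a : measurable_fun (setT : set R2) (fun z => ln (a + nsq z)).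
  apply: (measurableT_comp (@measurable_ln R)).
  by apply: measurable_funD => //; exact: measurable_nsq.
apply: measurable_funD; last exact: measurable_funM.
by apply: measurableT_comp => //; exact: (m 1).
Qed.

Lemma ker_wz : ker wz.
Proof.
split; first exact: measurable_wz.
  by move=> z; rewrite /wz -!nrmE nrmN.
apply: lint_bx measurable_wz _ => r.
apply: (@ig_le _ _ (fun x => (2 * (2 * r) ^+ 2 + 1) * \1_(bx r) x)).
- apply: measurable_funM; last exact: measurable_wz.
  by apply: measurable_ind; exact: measurable_bx.
- move=> z; rewrite normrM ger0_norm ?ind_ge0// mulrC.
  have [hz|hz] := pselect (bx r z); last by rewrite indF// !mulr0.
  rewrite indT// !mulr1; have u0 := nsq_ge0 z.
  have ur : nsq z <= (2 * r) ^+ 2.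
    by rewrite -nrmE lerXn2r ?nnegrE ?nrm_ge0 ?nrm_bx//; have := nrm_bx hz; have := nrm_ge0 z; lra.
  have a1 : ln (1 + nsq z) <= nsq z by apply: le_ln1Dx; lra.
  have a2 : ln (2 + nsq z) <= 1 + nsq z.
    by have := @le_ln1Dx R (1 + nsq z); rewrite (_ : 1 + (1 + nsq z) = 2 + nsq z); [apply; lra|ring].
  have b1 : 0 <= ln (1 + nsq z) by apply: ln_ge0; lra.
  have b2 : 0 <= ln (2 + nsq z) by apply: ln_ge0; lra.
  rewrite /wz /wk ler_norml; apply/andP; split; lra.
- by apply: igZ; exact: ig_bx.
Qed.

Lemma ker_zz : ker zz.
Proof.
have := kerD (@ker_nlg R) (kerZ (-1) ker_wz).
by congr ker; apply/funext => z; rewrite mulN1r.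
Qed.

Lemma lg_nsq z : z != 0 -> 2 * lg z = ln (nsq z).
Proof. by move=> z0; rewrite -nrmE lnXn ?nrm_gt0// mulr_natl. Qed.

(** With [u = |z|^2], [2 zz z = ln ((1 + u)^2 / (u (2 + u)))], and numerator and denominator differ
    by 1. The two logarithms in [wk] are combined for this purpose: the remainder is nonnegative and
    integrable at infinity. *)
Lemma zz_bound z : z != 0 -> 0 <= zz z <= 1 / (2 * nsq z ^+ 2).
Proof.
move=> z0; have := lg_nsq z0; rewrite /zz /wz /nlg /wk; set u := nsq z.
have u0 : 0 < u by rewrite lt_neqAle nsq_ge0 eq_sym nsq_eq0 z0.
have w0 : 0 < u * (2 + u) by rewrite mulr_gt0//; lra.
have e1 : ln (u * (2 + u)) = ln u + ln (2 + u) by rewrite lnM ?posrE//; lra.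
have p : 0 < 1 + u by lra.
have e2 : ln ((1 + u) ^+ 2) = 2 * ln (1 + u) by rewrite lnXn// mulr_natl.
have h1 : ln (u * (2 + u)) <= ln ((1 + u) ^+ 2) by rewrite ler_ln ?posrE ?exprn_gt0//; nra.
have h2 : ln ((1 + u) ^+ 2) - ln (u * (2 + u)) <= 1 / u ^+ 2.
  rewrite -ln_div ?posrE ?exprn_gt0//.
  have -> : (1 + u) ^+ 2 / (u * (2 + u)) = 1 + 1 / (u * (2 + u)).
    by field; rewrite gt_eqF ?gt_eqF//; lra.
  have q : 0 < 1 / (u * (2 + u)) by rewrite divr_gt0.
  have := @le_ln1Dx R (1 / (u * (2 + u))); move=> /(_ ltac:(lra)) h; apply: le_trans h _.
  rewrite !div1r lef_pV2 ?posrE ?exprn_gt0//; nra.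
move=> e; have -> : 1 / (2 * u ^+ 2) = (1 / u ^+ 2) / 2.
  by field; rewrite gt_eqF.
apply/andP; split; lra.
Qed.

Lemma ig_zz : ig zz.
Proof.
have [mz _ _] := ker_zz.
apply: (@ig_le _ _ (fun x => (4 * \1_(bx 1) x + \1_(bx 1) x * rinv x) + 2 * pg x)) => //; last first.
  apply: igD; last by apply: igZ; exact: ig_pg.
  by apply: igD; [apply: igZ; exact: ig_bx|exact: rinv_lint].
move=> z; have [hz|hz] := leP 1 (nsq z).
  have z0 : z != 0 by rewrite -nsq_eq0 gt_eqF//; lra.
  have /andP[a0 a1] := zz_bound z0; rewrite ger0_norm//; apply: (le_trans a1).
  have := pg_nsq hz; have -> : 1 / (2 * nsq z ^+ 2) = (nsq z ^+ 2)^-1 / 2 by field; rewrite gt_eqF//; lra.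
  have := rinv_ge0 z; have := ind_ge0 (bx 1) z; have := pg_ge0 z.
  move=> b1 b2 b3 b4; have : 0 <= \1_(bx 1) z * rinv z by rewrite mulr_ge0.
  lra.
have u0 := nsq_ge0 z.
have zb : bx 1 z.
  by apply: bx_nrm; rewrite -[1](expr1n _ 2) -(@ler_pXn2r _ 2) ?nnegrE ?nrm_ge0// nrmE expr1n; lra.
have n1 : nrm z <= 2 by have := nrm_bx zb; lra.
have a1 : ln (1 + nsq z) <= nsq z by apply: le_ln1Dx; lra.
have a2 : ln (2 + nsq z) <= 1 + nsq z.
  by have := @le_ln1Dx R (1 + nsq z); rewrite (_ : 1 + (1 + nsq z) = 2 + nsq z); [apply; lra|ring].
have b1 : 0 <= ln (1 + nsq z) by apply: ln_ge0; lra.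
have b2 : 0 <= ln (2 + nsq z) by apply: ln_ge0; lra.
have lw : `|wz z| <= 1 by rewrite /wz /wk ler_norml; apply/andP; split; lra.
have := lg_abs z; have := pg_ge0 z; have := ler_normB (nlg z) (wz z).
rewrite indT// mulr1 mul1r /zz {2}/nlg normrN; lra.
Qed.

Lemma pot_zz b x : good b -> (forall y, 0 <= b y <= 1) -> pot zz b x <= I2 zz.
Proof.
move=> gb b01; have e : (fun y => zz (- (y + (- x)))) =1 (fun y => zz (x - y)).
  by move=> y; rewrite opprB.
have it : ig (fun y => zz (x - y)) := eq_ig e (ig_trans (- x) (ig_opp ig_zz)).
have -> : I2 zz = I2 (fun y => zz (x - y)).
  by rewrite -(eq_I2 e) (I2_trans (- x) (ig_opp ig_zz)) I2_opp//; exact: ig_zz.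
apply: (@I2_le_off _ [:: x]) => //; first exact: (ig_pot ker_zz).
move=> y; rewrite inE => yx; have /zz_bound/andP[p _] : x - y != 0 by rewrite subr_eq0 eq_sym.
by have /andP[_ h] := b01 y; rewrite ler_piMr.
Qed.

Lemma pEs_double K (s : seq R2) : (forall z, K (- z) = K z) ->
  \sum_(x <- s) \sum_(y <- s) K (x - y) = 2 * pEs K s + (size s)%:R * K 0.
Proof.
move=> sK; elim: s => [|x s IH]; first by rewrite big_nil /= mulr0 mul0r addr0.
rewrite big_cons big_cons subrr /=.
have -> : \sum_(j <- s) \sum_(y <- x :: s) K (j - y) = \sum_(j <- s) K (j - x) + \sum_(j <- s) \sum_(y <- s) K (j - y).
  by rewrite -big_split; apply: eq_bigr => i _; rewrite big_cons.
rewrite IH; have -> : \sum_(i <- s) K (i - x) = \sum_(i <- s) K (x - i).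
  by apply: eq_bigr => i _; rewrite -sK opprB.
by rewrite -natr1; ring.
Qed.

Lemma pEs_le K L (s : seq R2) : uniq s -> (forall z, z != 0 -> K z <= L z) -> pEs K s <= pEs L s.
Proof.
move=> us h; elim: s us => [|x s IH] //= /andP[xs us]; apply: lerD; last exact: IH.
rewrite [leLHS]big_seq [leRHS]big_seq; apply: ler_sum => y ys; apply: h.
by rewrite subr_eq0; apply: contraNneq xs => ->.
Qed.

Lemma ln2_le1 : ln 2 <= 1 :> R.
Proof. by have := @le_ln1Dx R 1; rewrite -(natrD _ 1 1); apply; lra. Qed.

(* The background is replaced by [M] light charges chosen by [derandomize]. *)
Lemma wz_stable (s : seq R2) b : good b -> (forall y, 0 <= b y) -> I2 b = (size s)%:R ->
  - (3 * (size s)%:R) <= pEs wz s - \sum_(x <- s) pot wz b x + 2^-1 * I4 wz b b.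
Proof.
move=> gb b0 bm; have kW := ker_wz; have [mW sW lW] := kW.
have [n0|n0] := eqVneq (size s) 0%N.
  rewrite n0 in bm *; move/size0nil : n0 => -> /=; rewrite big_nil mulr0 oppr0 !add0r.
  rewrite I4E I2_zero ?mulr0//; exact: (pot_lint kW).
have w0 : wz 0 = ln 2 / 2 by rewrite /wz /wk /nsq /= expr0n /= !addr0 ln1 oppr0 add0r.
have l2 : 0 <= ln 2 :> R by apply: ln_ge0; lra.
have w0b : 0 <= wz 0 <= 1 by rewrite w0; have := ln2_le1; lra.
set n : R := (size s)%:R in bm *; have n1 : 1 <= n by rewrite ler1n lt0n.
(* So large that the self-energies of the light charges, [w^2 M wz 0 <= n^2 / M], and the correction
   [I4 wz b b / M] due to missing diagonal pairs are both at most 1 in size. *)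
pose M := (Num.trunc (n ^+ 2 + `|I4 wz b b|)).+1.
have hM : n ^+ 2 + `|I4 wz b b| <= M%:R by exact/ltW/truncnS_gt.
have M0 : 0 < M%:R :> R by rewrite ltr0n.
pose w := n / M%:R; pose g y := n^-1 * b y.
have gg : good g by exact: goodZ.
have g1 : I2 g = 1 by rewrite I2Z ?bm ?mulVf//; [rewrite gt_eqF//; lra|exact: good_ig].
have ge0 y : 0 <= g y by rewrite mulr_ge0// invr_ge0; lra.
pose V y := \sum_(x <- s) (- w * wz (x - y)).
have lV : lint V.
  by apply: lint_sum => x; apply: lintZ; exact: (lint_ker kW).
have [t [st ut _ ht]] := derandomize (Ach_iid M gg ge0 g1) (kerZ (w ^+ 2) kW) [::] lV (ltr01 : 0 < 1 :> R).
have I4g : I4 wz g g = n^-1 ^+ 2 * I4 wz b b.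
  by rewrite /g (I4Zl kW)// (I4Zr kW)//; ring.
have n00 : n != 0 by rewrite gt_eqF//; lra.
have M00 : M%:R != 0 :> R by rewrite gt_eqF.
have EV : I2 (fun x => M%:R * g x * V x) = - \sum_(x <- s) pot wz b x.
  rewrite /V.
  have -> : I2 (fun x => M%:R * g x * \sum_(z <- s) (- w * wz (z - x))) =
     I2 (fun x => \sum_(z <- s) (- 1 * (wz (z - x) * b x))).
    apply: eq_I2 => x; rewrite mulr_sumr; apply: eq_bigr => z _.
    by rewrite /g /w; field; rewrite n00 M00.
  rewrite I2_sum => [|z]; last by apply: igZ; exact: (ig_pot kW).
  rewrite -sumrN; apply: eq_bigr => z _; rewrite I2Z; last exact: (ig_pot kW).
  by rewrite mulN1r.
have EE : prs M * I4 (fun x => w ^+ 2 * wz x) g g = (1 - M%:R^-1) / 2 * I4 wz b b.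
  by rewrite I4_kerZ// I4g /prs /w; field; rewrite n00 M00.
rewrite EV EE in ht.
(* Unit charges at the particles and charges [- w] at the points replacing the background; neutral
   because [w M = n], so [qf_wk] applies. *)
pose q := [seq (1, x) | x <- s] ++ [seq (- w, y) | y <- t].
have nq : \sum_(a <- q) a.1 = 0.
  rewrite big_cat !big_map /= !sum_seq_const st -/n /w.
  by field; rewrite M00.
have Q : 0 <= 2 * pEs wz s + n * wz 0 - 2 * w * (\sum_(x <- s) \sum_(y <- t) wz (x - y))
    + w ^+ 2 * (2 * pEs wz t + M%:R * wz 0).
  have := qf_wk nq; congr (_ <= _).
  rewrite /n -(pEs_double s sW) -st -(pEs_double t sW).
  rewrite /qf big_cat !big_map /=.
  under eq_bigr => x _ do rewrite big_cat !big_map /=.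
  under [X in _ + X]eq_bigr => x _ do rewrite big_cat !big_map /=.
  rewrite !big_split /=.
  have -> : \sum_(i <- t) \sum_(j <- s) - w * 1 * wk (nsq (i - j)) = - w * \sum_(x <- s) \sum_(y <- t) wz (x - y).
    rewrite exchange_big /= mulr_sumr; apply: eq_bigr => x _; rewrite mulr_sumr; apply: eq_bigr => y _.
    by rewrite mulr1 -/(wz (y - x)) -sW opprB.
  have -> : \sum_(i <- s) \sum_(j <- t) 1 * - w * wk (nsq (i - j)) = - w * \sum_(x <- s) \sum_(y <- t) wz (x - y).
    rewrite mulr_sumr; apply: eq_bigr => x _; rewrite mulr_sumr; apply: eq_bigr => y _.
    by rewrite mul1r.
  have -> : \sum_(i <- t) \sum_(j <- t) - w * - w * wk (nsq (i - j)) = w ^+ 2 * \sum_(x <- t) \sum_(y <- t) wz (x - y).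
    rewrite mulr_sumr; apply: eq_bigr => x _; rewrite mulr_sumr; apply: eq_bigr => y _.
    by rewrite mulrNN expr2.
  have -> : \sum_(i <- s) \sum_(j <- s) 1 * 1 * wk (nsq (i - j)) = \sum_(x <- s) \sum_(y <- s) wz (x - y).
    by apply: eq_bigr => x _; apply: eq_bigr => y _; rewrite !mul1r.
  by ring.
have pk : pEs (fun x => w ^+ 2 * wz x) t = w ^+ 2 * pEs wz t.
  by elim: (t) => [|x u IH] /=; rewrite ?mulr0// IH -mulr_sumr mulrDr.
have sV : \sum_(y <- t) V y = - w * \sum_(x <- s) \sum_(y <- t) wz (x - y).
  rewrite exchange_big /= mulr_sumr; apply: eq_bigr => x _; rewrite mulr_sumr//.
rewrite pk sV in ht.
have e1 : w ^+ 2 * M%:R <= 1.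
  have -> : w ^+ 2 * M%:R = n ^+ 2 / M%:R by rewrite /w; field.
  by rewrite ler_pdivrMr// mul1r; apply: le_trans hM; rewrite lerDl.
have e2 : - 1 <= M%:R^-1 * I4 wz b b.
  rewrite mulrC lerNl -mulNr ler_pdivrMr// mul1r.
  by have := ler_norm (- I4 wz b b); rewrite normrN; have := sqr_ge0 n; lra.
have e3 : w ^+ 2 * M%:R * wz 0 <= 1 by rewrite mulr_ile1 ?mulr_ge0 ?sqr_ge0//; case/andP: w0b.
have e4 : n * wz 0 <= n by case/andP: w0b => ? ?; rewrite ler_piMr//; lra.
have q1 : w ^+ 2 * (2 * pEs wz t + M%:R * wz 0) = 2 * (w ^+ 2 * pEs wz t) + w ^+ 2 * M%:R * wz 0 by ring.
have q2 : (1 - M%:R^-1) / 2 * I4 wz b b = 2^-1 * I4 wz b b - 2^-1 * (M%:R^-1 * I4 wz b b) by ring.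
rewrite q1 in Q; rewrite q2 in ht.
move: Q ht e2 e3 e4 n1; move: (w ^+ 2 * M%:R * wz 0) (M%:R^-1 * I4 wz b b) (w ^+ 2 * pEs wz t) (n * wz 0) => a1 a2 a3 a4.
set c := \sum_(x <- s) \sum_(y <- t) _; have -> : 2 * w * c = 2 * (w * c) by ring.
rewrite mulNr; clearbody n; clear; move: (w * c) (\sum_(x <- s) _) (I4 wz b b) (pEs wz s) => a5 a6 a7 a8; lra.
Qed.

(** Write [nlg = wz + zz] with [zz >= 0]. The short-range part may be dropped between particles and
    in the background energy; between a particle and the background it costs at most [I2 zz],
    because [b <= 1]. *)
Lemma stable (s : seq R2) b : uniq s -> good b -> (forall y, 0 <= b y <= 1) -> I2 b = (size s)%:R ->
  - ((3 + I2 zz) * (size s)%:R) <= pEs nlg s - \sum_(x <- s) pot nlg b x + 2^-1 * I4 nlg b b.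
Proof.
move=> us gb b01 bm; have b0 y : 0 <= b y by case/andP: (b01 y).
have := wz_stable gb b0 bm.
have nE z : nlg z = wz z + zz z by rewrite /zz subrKC.
have h1 : pEs wz s <= pEs nlg s.
  by apply: pEs_le => // z z0; rewrite nE lerDl; case/andP: (zz_bound z0).
have h2 : \sum_(x <- s) pot nlg b x <= \sum_(x <- s) pot wz b x + (size s)%:R * I2 zz.
  rewrite -sum_seq_const -big_split /=; apply: ler_sum => x _.
  have -> : pot nlg b x = pot wz b x + pot zz b x.
    rewrite /pot -I2D; [|exact: (ig_pot ker_wz)|exact: (ig_pot ker_zz)].
    by apply: eq_I2 => y; rewrite nE mulrDl.
  by rewrite lerD2l; exact: pot_zz.
have h3 : I4 wz b b <= I4 nlg b b.
  apply: I4_le => //; [exact: ker_wz|exact: ker_nlg|].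
  by move=> x y _ _ xy; rewrite nE lerDl; have /zz_bound/andP[] : x - y != 0 by rewrite subr_eq0.
have : (3 + I2 zz) * (size s)%:R = 3 * (size s)%:R + (size s)%:R * I2 zz by ring.
lra.
Qed.

(** [derandomize] replaces the state by a configuration whose energy is larger by at most 1, and
    [stable] bounds that configuration; [4 = 3 + 1] absorbs the error since [m^2 >= 1]. *)
Lemma e0_bounded m j : exS (R := R) m j -> - (4 + I2 zz) * (m ^ 2)%:R <= j.
Proof.
move=> [m0 [E [aE hE]]]; set f := cellf m%:R 0 in aE hE.
have m0' : 0 < m%:R :> R by rewrite ltr0n.
have gf : good f by exact: good_cell.
have lV : lint (fun x => - pot nlg f x).
  have := lintZ (-1) (pot_lint (@ker_nlg R) gf); congr lint; apply/funext => x; exact: mulN1r.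
have [s [ss us _ hs]] := derandomize aE (@ker_nlg R) [::] lV (ltr01 : 0 < 1 :> R).
have f01 y : 0 <= f y <= 1 by rewrite /f /cellf; case: eqP => _ /=; rewrite ?lexx ?ler01.
have fm : I2 f = (size s)%:R by rewrite ss (Ach_mass aE).
have := stable us gf f01 fm; rewrite sumrN in hs.
have e : I2 (fun x => f x * - pot nlg f x) = - I4 nlg f f.
  rewrite I4E -I2N; last exact: (pot_lint (@ker_nlg R) gf).
  by apply: eq_I2 => x; rewrite mulrN.
rewrite e in hs; rewrite ss.
have : 1 <= (m ^ 2)%:R :> R by rewrite ler1n expn_gt0 m0.
have : - (4 + I2 zz) * (m ^ 2)%:R = - ((3 + I2 zz) * (m ^ 2)%:R) - (m ^ 2)%:R by ring.
move: ((m ^ 2)%:R) ((3 + _) * _) => u v; lra.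
Qed.
End Stability.

(** * Floating tiles *)
Section Layers.
Implicit Types (a l K : nat) (z c : int).

Definition lay a K z : nat := \sum_(k < K) (a%:Z * k%:Z <= z)%R.
Lemma lay_mono a K z z' : (z <= z')%R -> (lay a K z <= lay a K z')%N.
Proof.
move=> h; apply: leq_sum => k _; case: (_ <= z)%R / boolP => // h1.
by rewrite (le_trans h1 h).
Qed.
Lemma lay_step a K z : (lay a K (z + a%:Z) <= (lay a K z).+1)%N.
Proof.
rewrite /lay; case: K => [|K]; first by rewrite !big_ord0.
rewrite big_ord_recl [X in (_ <= X.+1)%N]big_ord_recr /= -[X in (_ <= X)%N]add1n.
apply: leq_add; first by case: (_ <= _)%R.
apply: (@leq_trans (\sum_(i < K) (a%:Z * i%:Z <= z)%R)%N); last exact: leq_addr.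
apply: leq_sum => i _; rewrite (_ : (a%:Z * (lift ord0 i)%:Z <= z + a%:Z)%R = (a%:Z * i%:Z <= z)%R)//.
by rewrite /= /bump /= add1n; lia.
Qed.
Lemma lay_steps a K z l : (lay a K (z + (l * a)%:Z) <= lay a K z + l)%N.
Proof.
elim: l => [|l IH]; first by rewrite mul0n addr0 addn0.
have -> : (z + (l.+1 * a)%:Z = (z + (l * a)%:Z) + a%:Z)%R by rewrite mulSn; lia.
by apply: (leq_trans (lay_step _ _ _)); rewrite addnS.
Qed.
(** The number of shifts [t < l a] and positions [k < K] with [z = t + a k] ([cov_sum]). It is [l]
    in the bulk and falls off only near the two ends. *)
Definition cov a l K z : nat := \sum_(k < K) (0 <= z - a%:Z * k%:Z < (l * a)%:Z)%R.
Lemma covE a l K z : (cov a l K z + lay a K (z - (l * a)%:Z) = lay a K z)%N.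
Proof.
rewrite /cov /lay -big_split /=; apply: eq_bigr => k _.
by case: (_ && _) / boolP; case: (_ <= z - _)%R / boolP; case: (_ <= z)%R / boolP; lia.
Qed.
Lemma cov_le a l K z : (cov a l K z <= l)%N.
Proof.
have := covE a l K z; have := lay_steps a K (z - (l * a)%:Z) l.
by rewrite subrK; lia.
Qed.
(** [cov] is the difference of two values of the monotone step function [lay], each of which grows
    by at most 1 over a distance less than [a]. *)
Lemma cov_near a l K z c : (0 <= c < a%:Z)%R ->
  (cov a l K z <= (cov a l K (z - c)).+1)%N /\ (cov a l K (z - c) <= (cov a l K z).+1)%N.
Proof.
move=> hc; have e1 := covE a l K z; have e2 := covE a l K (z - c).
have m1 : (lay a K (z - c) <= lay a K z)%N by apply: lay_mono; lia.
have m2 : (lay a K z <= (lay a K (z - c)).+1)%N.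
  by apply: (leq_trans _ (lay_step a K (z - c))); apply: lay_mono; lia.
have m3 : (lay a K (z - c - (l * a)%:Z) <= lay a K (z - (l * a)%:Z))%N by apply: lay_mono; lia.
have m4 : (lay a K (z - (l * a)%:Z) <= (lay a K (z - c - (l * a)%:Z)).+1)%N.
  by apply: (leq_trans _ (lay_step a K (z - c - (l * a)%:Z))); apply: lay_mono; lia.
lia.
Qed.
Lemma cov_sum a l K z : (0 < a)%N ->
  cov a l K z = (\sum_(t < l * a) \sum_(k < K) (z == t%:Z + a%:Z * k%:Z)%R)%N.
Proof.
move=> a0; rewrite exchange_big /=; apply: eq_bigr => k _.
case: (boolP (_ && _)) => [/andP[h1 h2]|h]; last first.
  rewrite big1// => t _; have := ltn_ord t; case: eqP => //; lia.
have ht : (absz (z - a%:Z * k%:Z)%R < l * a)%N by lia.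
rewrite (bigD1 (Ordinal ht))//= big1 ?addn0 => [|t /eqP tn].
  by case: eqP => //; lia.
by case: eqP => // e; exfalso; apply: tn; apply: val_inj => /=; lia.
Qed.
Lemma same_tile a (z t p q : int) : (0 < a)%N -> (0 <= z - (t + a%:Z * p) < a%:Z)%R ->
  (0 <= z - (t + a%:Z * q) < a%:Z)%R -> p = q.
Proof.
move=> a0 h1 h2; have e (u v : int) : (u + 1 <= v -> a%:Z * u + a%:Z <= a%:Z * v)%R.
  by move=> uv; rewrite -{2}[a%:Z]mulr1 -mulrDr ler_wpM2l.
case: (ltgtP p q) => // [pq|pq]; exfalso.
  by have := e p q; lia.
by have := e q p; lia.
Qed.
Lemma tile_in a l K (z t k : int) : (0 <= z - (t + a%:Z * k) < a%:Z)%R -> (0 <= k < K%:Z)%R ->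
  (0 <= t < (l * a)%:Z)%R -> (0 <= z < ((K + l) * a)%:Z)%R.
Proof.
move=> h1 h2 h3; have k0 : (0 <= a%:Z * k)%R by rewrite mulr_ge0//; lia.
have e : (a%:Z * k + a%:Z <= a%:Z * K%:Z)%R by rewrite -{2}[a%:Z]mulr1 -mulrDr ler_wpM2l//; lia.
by rewrite mulnDl PoszD !PoszM in h3 *; lia.
Qed.
End Layers.

Section Zidx.
Context {R : realType}.
Definition zidx (n : nat) : seq (int * int) := [seq (i%:Z, j%:Z) | i <- iota 0 n, j <- iota 0 n].
Lemma uniq_zidx n : uniq (zidx n).
Proof. by rewrite allpairs_uniq ?iota_uniq// => -[x y] [z t] _ _ /= [-> ->]. Qed.
Lemma size_zidx n : size (zidx n) = (n * n)%N.
Proof. by rewrite size_allpairs !size_iota. Qed.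
Lemma mem_zidx n i : (i \in zidx n) = (0 <= i.1 < n%:Z) && (0 <= i.2 < n%:Z).
Proof.
apply/allpairsP/idP => [[[x y] /= [/[!mem_iota] hx hy ->]]|] /=; first by lia.
case: i => x y /= h; exists (absz x, absz y); rewrite !mem_iota /=.
by split; [lia|lia|congr pair; lia].
Qed.
Lemma sum_zidx n (F : int * int -> R) :
  \sum_(i <- zidx n) F i = \sum_(i < n) \sum_(j < n) F (i%:Z, j%:Z).
Proof.
have e : iota 0 n = index_iota 0 n by rewrite /index_iota subn0.
rewrite big_allpairs_dep /= e big_mkord; apply: eq_bigr => i _.
by rewrite big_mkord.
Qed.
End Zidx.

Section Floating.
Context {R : realType}.
Local Notation R2 := (R * R)%type.
Variables (a l K : nat) (w : int * int -> R).
Hypothesis a0 : (0 < a)%N.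
Hypothesis hw : forall i, w i != 0 -> (0 <= i.1 < a%:Z) && (0 <= i.2 < a%:Z).
Definition am (k : int * int) : int * int := (a%:Z * k.1, a%:Z * k.2).
Definition ctr (i : int * int) : R := (cov a l K i.1)%:R * (cov a l K i.2)%:R.

Lemma float_sum i : \sum_(t <- zidx (l * a)) \sum_(k <- zidx K) w (i - t - am k) =
  \sum_(c <- zidx a) w c * ctr (i - c).
Proof.
transitivity (\sum_(t <- zidx (l * a)) \sum_(k <- zidx K) \sum_(c <- zidx a)
    w c * (i - c == t + am k)%:R).
  apply: eq_bigr => t _; apply: eq_bigr => k _.
  have [hz|hz] := boolP (i - t - am k \in zidx a).
    rewrite (bigD1_seq _ hz (uniq_zidx a)) /= opprB addrA [X in X == _](_ : _ = t + am k); last first.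
      by rewrite opprB [in LHS]addrC; apply/eqP; rewrite -subr_eq0; apply/eqP; ring.
    rewrite eqxx mulr1 big1 ?addr0// => c cn; case: eqP => [e|]; last by rewrite mulr0.
    by case/eqP: cn; rewrite -addrA -opprD -e opprB subrKC.
  rewrite big1_seq => [|c /andP[_ hc]].
    by apply/eqP; apply: contraNT hz => /hw; rewrite mem_zidx.
  case: eqP => [e|]; last by rewrite mulr0.
  by move: hz; rewrite -addrA -opprD -e opprB subrKC hc.
under eq_bigr => t _ do rewrite exchange_big /=.
rewrite exchange_big /=; apply: eq_bigr => c _.
under eq_bigr => t _ do rewrite -mulr_sumr.
rewrite -mulr_sumr; congr (_ * _).
rewrite sum_zidx /ctr !cov_sum//.
under eq_bigr => t1 _.
  under eq_bigr => t2 _.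
    rewrite sum_zidx.
    under eq_bigr => k1 _.
      under eq_bigr => k2 _.
        rewrite (_ : (i - c == (t1%:Z, t2%:Z) + am (k1%:Z, k2%:Z))%:R =
          ((i - c).1 == t1%:Z + a%:Z * k1%:Z)%:R * ((i - c).2 == t2%:Z + a%:Z * k2%:Z)%:R :> R); last first.
          by rewrite -pair_eqE /pair_eq /= -natrM mulnb.
        over.
      rewrite -mulr_sumr; over.
    rewrite -mulr_suml; over.
  rewrite -mulr_sumr; over.
rewrite -mulr_suml; congr (_ * _); rewrite natr_sum; apply: eq_bigr => t _; rewrite natr_sum//.
Qed.

Hypothesis w0 : \sum_(c <- zidx a) w c = 0.
(** By [float_sum] the sum over shifts is a convolution of [w] with the counting function [ctr]. As
    [w] has total charge zero, only the variation of [ctr] across one tile matters: it is at most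
    [2 l], while [ctr] itself is of order [l^2]. *)
Lemma float_bound i : `|\sum_(t <- zidx (l * a)) \sum_(k <- zidx K) w (i - t - am k)|
  <= 2 * l%:R * \sum_(c <- zidx a) `|w c|.
Proof.
rewrite float_sum.
have -> : \sum_(c <- zidx a) w c * ctr (i - c) = \sum_(c <- zidx a) w c * (ctr (i - c) - ctr i).
  by under [RHS]eq_bigr => c _ do rewrite mulrBr; rewrite sumrB -mulr_suml w0 mul0r subr0.
apply: le_trans (ler_norm_sum _ _ _) _; rewrite mulr_sumr big_seq [leRHS]big_seq.
apply: ler_sum => c; rewrite mem_zidx => /andP[h1 h2].
rewrite normrM mulrC; apply: ler_wpM2r => //.
have [p1 p2] := cov_near l K i.1 h1; have [q1 q2] := cov_near l K i.2 h2.
have b1 := cov_le a l K i.1; have b2 := cov_le a l K (i.2 - c.2).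
rewrite /ctr /=.
have -> : 2 * l%:R = 1 * l%:R + l%:R * 1 :> R by ring.
move: p1 p2 q1 q2 b1 b2.
rewrite -!(ler_nat R) -!natr1.
move: ((cov a l K i.1)%:R : R) (ler0n R (cov a l K i.1)) => x x0.
move: ((cov a l K (i.1 - c.1))%:R : R) => x'.
move: ((cov a l K i.2)%:R : R) => y.
move: ((cov a l K (i.2 - c.2))%:R : R) (ler0n R (cov a l K (i.2 - c.2))) => y' y'0.
move=> *; have -> : x' * y' - x * y = (x' - x) * y' + x * (y' - y) by ring.
apply: le_trans (ler_normD _ _) _; rewrite !normrM (ger0_norm x0) (ger0_norm y'0).
apply: lerD; apply: ler_pM => //; rewrite ler_norml; apply/andP; split; lra.
Qed.
End Floating.

Section Grid.
Context {R : realType}.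
Local Notation R2 := (R * R)%type.
Variable h : R.
Hypothesis h0 : 0 < h.
Implicit Types (W : int * int -> R) (z : seq (int * int)) (i k t : int * int).
(** Functions constant on the cells of mesh [h]. For them a finite mixture over shifts by multiples
    of [h] does the work of a continuous average over translations. *)
Definition gf W (x : R2) : R := W (fl (sc h^-1 x)).
Lemma gf_shift W i x : gf W (x - sc h (zr i)) = gf (fun k => W (k - i)) x.
Proof. by rewrite /gf scB scA mulVf ?gt_eqF// sc1 -zrN fl_zr. Qed.
Lemma gf_sum W z : uniq z -> (forall i, W i != 0 -> i \in z) ->
  gf W = fun x => \sum_(i <- z) W i * cellf h i x.
Proof.
move=> uz hz; apply/funext => x; rewrite /gf /cellf; set k := fl _.
have [kz|kz] := boolP (k \in z).
  rewrite (bigD1_seq _ kz uz) /= eqxx mulr1 big1 ?addr0// => i ik.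
  by rewrite eq_sym (negbTE ik) mulr0.
rewrite big1_seq => [|i /andP[_ iz]]; last first.
  by case: eqP => [e|]; rewrite ?mulr0//; rewrite e iz in kz.
by apply/eqP; apply: contraNT kz; exact: hz.
Qed.
Lemma good_gf W z : uniq z -> (forall i, W i != 0 -> i \in z) -> good (gf W).
Proof.
move=> uz hz; rewrite (gf_sum uz hz); apply: good_sum => i; apply: goodZ; exact: good_cell.
Qed.
Lemma I2_gf W z : uniq z -> (forall i, W i != 0 -> i \in z) ->
  I2 (gf W) = h ^+ 2 * \sum_(i <- z) W i.
Proof.
move=> uz hz; rewrite (gf_sum uz hz) I2_sum => [|i]; last by apply: igZ; apply: good_ig; exact: good_cell.
rewrite mulr_sumr; apply: eq_bigr => i _.
rewrite I2Z; last by apply: good_ig; exact: good_cell.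
by rewrite I2_cell// mulrC.
Qed.
Lemma cell_zidx n : (0 < n)%N -> cellf (n%:R * h) 0 = gf (fun i => (i \in zidx n)%:R).
Proof.
move=> n0; apply/funext => x; have n0' : 0 < n%:R :> R by rewrite ltr0n.
have p (u : R) : (0%:~R <= (n%:R * h)^-1 * u < (0 + 1)%:~R) = (0 <= Num.floor (h^-1 * u) < n%:Z).
  rewrite floor_ge_int floor_lt_int add0r invfM -mulrA.
  by rewrite ler_pdivlMl// ltr_pdivrMl// mulr0 mulr1.
by rewrite /gf /cellf fl_eq mem_zidx /= !p.
Qed.
End Grid.

(** * From a tile to a competitor of exact density *)

Section Core.
Context {R : realType}.
Local Notation R2 := (R * R)%type.
Variables (s a l K : nat) (w : int * int -> R) (j eta C1 : R).
Hypothesis s0 : (0 < s)%N.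
Hypothesis a0 : (0 < a)%N.
Hypothesis l0 : (0 < l)%N.
Hypothesis K0 : (0 < K)%N.
Hypothesis hw : forall i, w i != 0 -> i \in zidx a.
Local Notation h := (s%:R / a%:R : R).
Local Notation v := (gf h w).
Local Notation b := (cellf (s%:R : R) 0).
Hypothesis vb : forall x, - b x <= v x.
Hypothesis v0 : I2 v = 0.
Hypothesis hJ : JA nlg (s ^ 2) (fun x => b x + v x) b j.
Hypothesis eta0 : 0 <= eta.
Hypothesis hout : forall x, b x = 0 -> `|pot nlg v x| <= eta.
Hypothesis hin : I2 (fun x => b x * `|pot nlg v x|) <= C1.

Let s0' : 0 < s%:R :> R. Proof. by rewrite ltr0n. Qed.
Let a0' : 0 < a%:R :> R. Proof. by rewrite ltr0n. Qed.
Let l0' : 0 < l%:R :> R. Proof. by rewrite ltr0n. Qed.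
Let h0 : 0 < h. Proof. exact: divr_gt0. Qed.
Let bE : b = gf h (fun i => (i \in zidx a)%:R).
Proof. by rewrite -(cell_zidx h a0) mulrC divfK// gt_eqF. Qed.
Let gb : good b. Proof. exact: good_cell. Qed.
Let gv : good v. Proof. exact: (good_gf h0 (uniq_zidx a) hw). Qed.
Let knl := @ker_nlg R.
Let w0 : \sum_(c <- zidx a) w c = 0.
Proof.
have := v0; rewrite (I2_gf h0 (uniq_zidx a) hw) => /eqP; rewrite mulf_eq0 expf_eq0 /= gt_eqF//=.
by move/eqP.
Qed.
Let v_abs : I2 (fun x => `|v x|) <= 2 * s%:R ^+ 2.
Proof.
have -> : 2 * s%:R ^+ 2 = I2 (fun x => v x + 2 * b x) :> R.
  rewrite I2D ?I2Z ?v0 ?I2_cell// ?add0r//; try exact: good_ig.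
  by apply: igZ; exact: good_ig.
apply: I2_le.
- by apply: ig_abs; exact: good_ig.
- by apply: igD; [exact: good_ig|apply: igZ; exact: good_ig].
by move=> x; have := vb x; have := cell_ge0 s%:R 0 x; rewrite ler_norml => *; apply/andP; split; lra.
Qed.
Let w_abs : \sum_(c <- zidx a) `|w c| <= 2 * a%:R ^+ 2.
Proof.
have hw' i : `|w i| != 0 -> i \in zidx a by rewrite normr_eq0; exact: hw.
have := v_abs; have := I2_gf h0 (uniq_zidx a) hw'; rewrite /gf => ->.
have -> : 2 * s%:R ^+ 2 = h ^+ 2 * (2 * a%:R ^+ 2) :> R by field; rewrite gt_eqF.
by rewrite ler_pM2l// exprn_gt0.
Qed.

Let sh i : R2 := sc h (zr i).
Let bi i x : R := b (x - sh i).
Let vi i x : R := v (x - sh i).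
Let gbi i : good (bi i). Proof. exact: good_trans. Qed.
Let gvi i : good (vi i). Proof. exact: good_trans. Qed.
Let biE i x : bi i x = (fl (sc h^-1 x) - i \in zidx a)%:R.
Proof. by rewrite /bi bE gf_shift. Qed.
Let viE i x : vi i x = w (fl (sc h^-1 x) - i).
Proof. by rewrite /vi gf_shift. Qed.
Let potvi i x : pot nlg (vi i) x = pot nlg v (x - sh i).
Proof. exact: (pot_trans knl). Qed.
Let vi_out i x : bi i x = 0 -> vi i x = 0.
Proof.
rewrite biE viE => /eqP; rewrite pnatr_eq0 eqb0 => hx; apply/eqP; apply: contraNT hx; exact: hw.
Qed.

Lemma I4_tiles i k : (forall x, bi i x != 0 -> bi k x = 0) ->
  I4 nlg (vi i) (vi k) <= 2 * s%:R ^+ 2 * eta.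
Proof.
move=> hd; rewrite I4E; apply: (@le_trans _ _ (I2 (fun x => eta * `|vi i x|))).
  apply: I2_le.
  - exact: (pot_lint knl).
  - by apply: igZ; apply: ig_abs; exact: good_ig.
  move=> x; have [e|e] := eqVneq (bi i x) 0.
    by rewrite vi_out// normr0 mul0r mulr0.
  apply: le_trans (ler_norm _) _; rewrite normrM mulrC; apply: ler_wpM2r => //.
  by rewrite potvi; apply: hout; exact: hd.
rewrite I2Z; last by apply: ig_abs; exact: good_ig.
rewrite mulrC ler_wpM2r//; have := v_abs; congr (_ <= _).
have := I2_trans (- sh i) (ig_abs (good_ig gv)); exact.
Qed.

Let D := (K + l)%N.
Let S := (D * s)%N.
Let bb : R2 -> R := cellf (S%:R : R) 0.
Let S0 : 0 < S%:R :> R. Proof. by rewrite ltr0n muln_gt0 addn_gt0 K0 s0. Qed.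
Let bbE : bb = gf h (fun i => (i \in zidx (D * a))%:R).
Proof.
rewrite -(cell_zidx h); last by rewrite muln_gt0 addn_gt0 K0 a0.
by congr cellf; rewrite /S !natrM; field; rewrite gt_eqF.
Qed.
Let gbb : good bb. Proof. exact: good_cell. Qed.
Let tile_uniq (t k k' : int * int) z : z - (t + am a k) \in zidx a -> z - (t + am a k') \in zidx a -> k = k'.
Proof.
case: z t k k' => z1 z2 [t1 t2] [k1 k2] [m1 m2]; rewrite !mem_zidx /am /=.
move=> /andP[h1 h2] /andP[h3 h4].
by congr pair; [apply: (same_tile a0 h1 h3)|apply: (same_tile a0 h2 h4)].
Qed.

(** What the array of tiles shifted by [t] leaves of the large square. All shifts keep the array
    inside that square, so the remainder is nonnegative and can be filled by independent
    particles. *)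
Let collar t x : R := bb x - \sum_(k <- zidx K) bi (t + am a k) x.
Let collar_ge0 t x : t \in zidx (l * a) -> 0 <= collar t x.
Proof.
move=> ht; rewrite /collar subr_ge0.
have [/hasP[k kK kz]|/hasPn hn] := boolP (has (fun k => fl (sc h^-1 x) - (t + am a k) \in zidx a) (zidx K)).
  rewrite (bigD1_seq _ kK (uniq_zidx K)) /= big1 ?addr0 => [|m mk].
    rewrite biE kz bbE /gf; move: kz kK ht; case: (fl _) => z1 z2; case: k => k1 k2; case: (t) => t1 t2.
    rewrite !mem_zidx /am /= => /andP[h1 h2] /andP[h3 h4] /andP[h5 h6].
    by rewrite (tile_in h1 h3 h5) (tile_in h2 h4 h6).
  rewrite biE; case: (boolP (_ \in zidx a)) => // mz.
  by case/eqP: mk; apply: (tile_uniq mz kz).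
rewrite big1_seq// => k /andP[_ kK]; rewrite biE.
by rewrite (negbTE (hn _ kK)).
Qed.
Let good_collar t : good (collar t).
Proof. by apply: goodB => //; apply: good_sum => k. Qed.
Let r := (S ^ 2 - (K * K) * s ^ 2)%N.
Let rle : ((K * K) * s ^ 2 <= S ^ 2)%N.
Proof. by rewrite /S expnMn leq_mul2r; apply/orP; right; rewrite -mulnn leq_mul ?leq_addr. Qed.
Let I2_bi i : I2 (bi i) = s%:R ^+ 2.
Proof. by rewrite (I2_trans _ (good_ig gb)) I2_cell. Qed.
Let I2_collar t : I2 (collar t) = r%:R.
Proof.
rewrite I2B; [|exact: good_ig|apply: good_ig; exact: good_sum].
rewrite I2_sum => [|k]; last exact: good_ig.
under eq_bigr => k _ do rewrite I2_bi.
by rewrite I2_cell// sum_seq_const size_zidx /r natrB// !natrM; ring.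
Qed.

Let c : R := ln (2 * S%:R + 1).
Let hc x y : bb x != 0 -> bb y != 0 -> x != y -> - c <= nlg (x - y).
Proof.
move=> hx hy _; apply: nlg_ge; first by have := ltW S0; lra.
have [h1 h2] := cell_near S0 hx hy.
by apply: le_trans (nrm_le _) _; rewrite /=; lra.
Qed.

Let J1 : R := r%:R / 2 * c + ((K * K)%:R * j + 2 * s%:R ^+ 2 * eta * (K * K)%:R ^+ 2).
Let state t : t \in zidx (l * a) ->
  JA nlg (S ^ 2) (fun x => bb x + \sum_(k <- zidx K) vi (t + am a k) x) bb J1.
Proof.
move=> ht.
have h1 : JA nlg (\sum_(k <- zidx K) s ^ 2)%N
   (fun x => \sum_(k <- zidx K) (bi (t + am a k) x + vi (t + am a k) x))
   (fun x => \sum_(k <- zidx K) bi (t + am a k) x)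
   (\sum_(k <- zidx K) j + 2 * s%:R ^+ 2 * eta * (size (zidx K))%:R ^+ 2).
  apply: (JA_fold knl) => //.
  - exact: uniq_zidx.
  - by rewrite mulr_ge0// mulr_ge0// sqr_ge0.
  - by move=> k; apply: goodD.
  - by move=> k _; exact: (JA_trans knl (- sh (t + am a k)) gb hJ).
  move=> k m _ _ km.
  have e (i : int * int) : (fun x => bi i x + vi i x - bi i x) = vi i by apply/funext => x; rewrite addrAC subrr add0r.
  rewrite !e; apply: I4_tiles => x; rewrite !biE pnatr_eq0 eqb0 negbK => kz.
  case: (boolP (_ \in zidx a)) => // mz; case/eqP: km; exact: tile_uniq kz mz.
have h2 : JA nlg r (collar t) (collar t) (r%:R / 2 * c + 2^-1 * I4 nlg (fun x => collar t x - collar t x) (fun x => collar t x - collar t x)).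
  apply: (JA_iid knl) => //.
  - by move=> x; exact: collar_ge0.
  move=> x y hx hy; apply: hc.
    apply: contraNneq hx => e; have := collar_ge0 x ht; rewrite /collar e => h.
    have : 0 <= \sum_(k <- zidx K) bi (t + am a k) x by apply: sumr_ge0 => k _; exact: cell_ge0.
    by move=> h'; apply/eqP; lra.
  apply: contraNneq hy => e; have := collar_ge0 y ht; rewrite /collar e => h.
  have : 0 <= \sum_(k <- zidx K) bi (t + am a k) y by apply: sumr_ge0 => k _; exact: cell_ge0.
  by move=> h'; apply/eqP; lra.
have gs : good (fun x => \sum_(k <- zidx K) bi (t + am a k) x) by exact: good_sum.
have := JAM knl (good_collar t) gs h2 h1.
have -> : (r + \sum_(k <- zidx K) s ^ 2 = S ^ 2)%N.
  by rewrite big_const_seq count_predT iter_addn_0 size_zidx /r [(s ^ 2 * _)%N]mulnC subnK.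
rewrite !I4_00l => [|x|x]; [|by rewrite subrr..].
rewrite mulr0 !addr0 sum_seq_const size_zidx => h3.
apply: JA_ext h3 _ _ => x.
  by rewrite /collar big_split /= addrA subrK.
by rewrite /collar subrK.
Qed.

Let T := zidx (l * a).
Let v' x : R := (size T)%:R^-1 * \sum_(t <- T) \sum_(k <- zidx K) vi (t + am a k) x.
Let gv' : good v'.
Proof. by apply: goodZ; apply: good_sum => t; exact: good_sum. Qed.
Let T0 : (0 < size T)%N. Proof. by rewrite size_zidx !muln_gt0 l0 a0. Qed.
Let mixed : JA nlg (S ^ 2) (fun x => bb x + v' x) bb J1.
Proof.
have := JA_mix knl (j := fun=> J1) gbb T0 state.
rewrite sum_seq_const mulKf; last by rewrite pnatr_eq0 -lt0n.
move=> h; apply: JA_ext h _ _ => // x; rewrite big_split /= sum_seq_const mulrDr mulKf//.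
by rewrite pnatr_eq0 -lt0n.
Qed.
(** [float_bound] divided by the number [(l a)^2] of shifts, with [w_abs]: floating flattens the
    deviation to order [1 / l]. *)
Let v'_le x : `|v' x| <= 4 / l%:R * bb x.
Proof.
have [e|e] := eqVneq (bb x) 0.
  rewrite e mulr0 /v' big1_seq ?mulr0 ?normr0// => t /andP[_ ht].
  rewrite big1_seq// => k /andP[_ hk]; apply: vi_out.
  have := collar_ge0 x ht; rewrite /collar e sub0r oppr_ge0 => h; apply/eqP; rewrite eq_le cell_ge0 andbT.
  apply: le_trans h; rewrite (bigD1_seq _ hk (uniq_zidx K)) /= lerDl; apply: sumr_ge0 => m _; exact: cell_ge0.
have -> : bb x = 1 by move: e; rewrite /bb /cellf; rewrite pnatr_eq0 eqb0 negbK => ->.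
rewrite mulr1 /v' normrM ger0_norm; last by rewrite invr_ge0.
rewrite mulrC ler_pdivrMr ?ltr0n// size_zidx.
have -> : 4 / l%:R * (l * a * (l * a))%:R = 2 * l%:R * (2 * a%:R ^+ 2) :> R.
  by rewrite !natrM; field; rewrite gt_eqF.
apply: le_trans (ler_wpM2l _ w_abs); last by rewrite mulr_ge0.
have hw2 i : w i != 0 -> (0 <= i.1 < a%:Z) && (0 <= i.2 < a%:Z) by move/hw; rewrite mem_zidx.
have := float_bound l K a0 hw2 w0 (fl (sc h^-1 x)); congr (`|_| <= _).
by apply: eq_bigr => t _; apply: eq_bigr => k _; rewrite viE opprD addrA.
Qed.
Let I2_v' : I2 v' = 0.
Proof.
rewrite I2Z; last by apply: good_ig; apply: good_sum => t; exact: good_sum.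
rewrite I2_sum => [|t]; last by apply: good_ig; exact: good_sum.
rewrite big1 ?mulr0// => t _; rewrite I2_sum => [|k]; last exact: good_ig.
by rewrite big1// => k _; rewrite (I2_trans _ (good_ig gv)).
Qed.
Let X : R := (K * K)%:R * (4 / l%:R * (C1 + eta * S%:R ^+ 2)).
(** The averaged deviation is at most [4 / l], and the potential of a single tile has integral at
    most [C1] over the tile and size at most [eta] elsewhere in the large square. *)
Let I4_v' : I4 nlg v' v' <= X.
Proof.
have gp : lint (pot nlg v) := pot_lint knl gv.
have one i : I4 nlg v' (vi i) <= 4 / l%:R * (C1 + eta * S%:R ^+ 2).
  rewrite I4E; apply: (@le_trans _ _ (I2 (fun x => 4 / l%:R * (bi i x * `|pot nlg (vi i) x| + eta * bb x)))).
    have i1 : ig (fun x => bi i x * `|pot nlg (vi i) x|).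
      have := ig_abs (pot_lint knl (gvi i) (gbi i)); apply: eq_ig => x.
      by rewrite normrM ger0_norm//; exact: cell_ge0.
    apply: I2_le.
    - exact: (pot_lint knl).
    - by apply: igZ; apply: igD => //; apply: igZ; exact: good_ig.
    move=> x; apply: le_trans (ler_norm _) _; rewrite normrM.
    apply: le_trans (ler_wpM2r _ (v'_le x)) _ => //.
    rewrite -[leLHS]mulrA; apply: ler_wpM2l; first by rewrite divr_ge0.
    have [e|e] := eqVneq (bi i x) 0.
      by rewrite e mul0r add0r mulrC; apply: ler_wpM2r => //; rewrite potvi; exact: hout.
    have -> : bi i x = 1 by move: e; rewrite biE; case: (_ \in _); rewrite ?eqxx.
    rewrite mul1r; apply: (@le_trans _ _ (1 * `|pot nlg (vi i) x|)).
      by apply: ler_wpM2r => //; rewrite /bb /cellf; case: eqP.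
    by rewrite mul1r lerDl mulr_ge0.
  have i1 : ig (fun x => bi i x * `|pot nlg (vi i) x|).
    have := ig_abs (pot_lint knl (gvi i) (gbi i)); apply: eq_ig => x.
    by rewrite normrM ger0_norm//; exact: cell_ge0.
  rewrite I2Z; last by apply: igD => //; apply: igZ; exact: good_ig.
  apply: ler_wpM2l; first by rewrite divr_ge0.
  rewrite I2D//; last by apply: igZ; exact: good_ig.
  apply: lerD; last by rewrite I2Z ?I2_cell//; exact: good_ig.
  have i2 : ig (fun x => b x * `|pot nlg v x|).
    have := ig_abs (gp _ gb); apply: eq_ig => x.
    by rewrite normrM ger0_norm//; exact: cell_ge0.
  have := hin; rewrite -(I2_trans (- sh i) i2); congr (_ <= _).
  by apply: eq_I2 => x; rewrite potvi.
rewrite {2}/v' (I4Zr knl)//; last by apply: good_sum => t; exact: good_sum.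
rewrite (I4_sumr knl)// => [|t]; last exact: good_sum.
rewrite mulrC ler_pdivrMr ?ltr0n// mulrC -sum_seq_const; apply: ler_sum => t _.
rewrite (I4_sumr knl)// /X -(size_zidx K) -sum_seq_const; apply: ler_sum => k _; exact: one.
Qed.

(** Independent particles of density [bb - (1 - p) / p * v'], taken with weight [p], cancel the
    deviation [v'] of the floating array, taken with weight [1 - p]. The second hypothesis keeps
    that density nonnegative. *)
Lemma core_step (p : R) : 0 < p < 1 -> (1 - p) / p * (4 / l%:R) <= 1 ->
  exS S (p * ((S ^ 2)%:R / 2 * c + 2^-1 * (((1 - p) / p) ^+ 2 * X)) + (1 - p) * J1).
Proof.
move=> p01 hp; have /andP[p0 p1] := p01; split; first by rewrite -(ltr0n R).
set la := (1 - p) / p in hp *; have la0 : 0 <= la by rewrite divr_ge0 ?subr_ge0 ?ltW.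
pose g x := bb x - la * v' x.
have gg : good g by apply: goodB => //; exact: goodZ.
have hla x : `|la * v' x| <= bb x.
  rewrite normrM (ger0_norm la0); apply: le_trans (ler_wpM2l la0 (v'_le x)) _.
  by rewrite mulrA ler_piMl.
have g0 x : 0 <= g x.
  by rewrite subr_ge0; apply: le_trans (hla x); exact: ler_norm.
have hg : JA nlg (S ^ 2) g bb ((S ^ 2)%:R / 2 * c + 2^-1 * I4 nlg (fun x => g x - bb x) (fun x => g x - bb x)).
  apply: (JA_iid knl) => //.
    rewrite I2B; [|exact: good_ig|by apply: igZ; exact: good_ig].
    by rewrite I2Z ?I2_v' ?mulr0 ?subr0 ?I2_cell ?natrX//; exact: good_ig.
  have nz x : g x != 0 -> bb x != 0.
    apply: contraNneq => e; have := hla x; rewrite e normr_le0 => /eqP e2.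
    by rewrite /g e e2 subrr.
  by move=> x y /nz hx /nz hy; exact: hc.
have e : (fun x => g x - bb x) = (fun x => - la * v' x) by apply/funext => x; rewrite /g; ring.
rewrite e (I4Zl knl) in hg => //; last exact: goodZ.
rewrite (I4Zr knl) in hg => //; rewrite mulrA mulrNN -expr2 in hg.
have := JAX knl p01 gbb hg mixed; move/JA_ext => /(_ bb bb) h.
apply: JA_le (h _ _) _ => [x|//|].
  by rewrite /g /la; field; rewrite gt_eqF.
rewrite lerD2r; apply: ler_wpM2l; first exact: ltW.
by rewrite lerD2l; apply: ler_wpM2l => //; apply: ler_wpM2l; rewrite ?sqr_ge0.
Qed.
End Core.

Section CoreLimit.
Context {R : realType}.
Local Notation R2 := (R * R)%type.

(** The bookkeeping of [core] per tile: [x = 1/k] is the weight of the independent particles, [s2]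
    the area of a tile, [u] the ratio of the area of the large square to that of its tiles, [c] the
    logarithm of its size, [ee] the interaction of the tiles. *)
Lemma core_num (e j C1 x u s2 c ee d L lam : R) : 0 < x -> x <= 1 / 4 -> 1 <= u -> u <= 1 + x ->
  1 <= s2 -> 0 <= C1 -> 0 <= c -> 0 <= lam -> 0 <= L -> c <= lam + 4 * L -> 0 <= ee -> ee <= x ->
  e * (u * s2) <= x * (u * s2 / 2 * c + 2 * (1 - x) ^+ 2 * (C1 + x / 2)) +
    (1 - x) * ((u - 1) * s2 / 2 * c + (j + ee)) ->
  let A := 2 * s2 * (lam + 4) + 2 * C1 + 3 + `|j| + `|e| * s2 in
  x * (A + A * L) <= d -> e * s2 <= j + d.
Proof.
move=> x0 x4 u1 u2 s1 C10 c0 lam0 L0 cb ee0 eex h A xA.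
have x0' := ltW x0; have s0 : 0 <= s2 by lra.
have e0b : - (x * (`|e| * s2)) <= e * (u * s2) - e * s2.
  have -> : e * (u * s2) - e * s2 = - (((u - 1) * s2) * - e) by ring.
  rewrite lerN2; apply: (@le_trans _ _ ((u - 1) * s2 * `|e|)).
    by apply: ler_wpM2l; [rewrite mulr_ge0//; lra|rewrite -normrN ler_norm].
  have -> : x * (`|e| * s2) = (x * s2) * `|e| by ring.
  by apply: ler_wpM2r => //; apply: ler_wpM2r => //; lra.
have sc0 : 0 <= s2 * c by rewrite mulr_ge0.
have b1 : u * s2 / 2 * c <= s2 * c.
  have -> : u * s2 / 2 * c = u / 2 * (s2 * c) by field.
  by rewrite ler_piMl//; lra.
have b2 : 2 * (1 - x) ^+ 2 * (C1 + x / 2) <= 2 * (C1 + 1).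
  have y1 : (1 - x) ^+ 2 <= 1 by rewrite exprn_ile1//; lra.
  by move: y1 (sqr_ge0 (1 - x)) C10 x0 x4; clear; move: ((1 - x) ^+ 2) => y; nra.
have b3 : (1 - x) * ((u - 1) * s2 / 2 * c) <= x * (s2 * c).
  have -> : (1 - x) * ((u - 1) * s2 / 2 * c) = ((1 - x) * (u - 1) / 2) * (s2 * c) by field.
  apply: ler_wpM2r => //; have : 0 <= x * (u - 1) by rewrite mulr_ge0//; lra.
  lra.
have b4 : (1 - x) * j <= j + x * `|j|.
  have : x * - j <= x * `|j| by apply: ler_wpM2l; rewrite // -normrN ler_norm.
  lra.
have b5 : (1 - x) * ee <= x by apply: le_trans eex; rewrite ler_piMl//; lra.
have b6 : x * (u * s2 / 2 * c + 2 * (1 - x) ^+ 2 * (C1 + x / 2)) <= x * (s2 * c + 2 * (C1 + 1)).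
  by apply: ler_wpM2l; lra.
have b7 : (1 - x) * ((u - 1) * s2 / 2 * c + (j + ee)) =
    (1 - x) * ((u - 1) * s2 / 2 * c) + (1 - x) * j + (1 - x) * ee by ring.
have sc : s2 * c <= s2 * (lam + 4 * L) by apply: ler_wpM2l; lra.
have fin : x * (2 * (s2 * c) + 2 * C1 + 3 + `|j|) + x * (`|e| * s2) <= x * (A + A * L).
  rewrite -mulrDr; apply: ler_wpM2l => //.
  have n1 := normr_ge0 j; have n2 : 0 <= `|e| * s2 by rewrite mulr_ge0.
  have n3 : 0 <= s2 * lam by rewrite mulr_ge0.
  have : 8 * s2 * L <= A * L by apply: ler_wpM2r => //; rewrite /A; lra.
  by move: (A * L) => AL; rewrite /A; lra.
rewrite b7 in h; lra.
Qed.

Lemma core_ln (k g : R) : 4 <= k -> 1 <= g -> 0 <= ln (2 * k + 1) /\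
  ln (2 * ((k ^+ 4 + k ^+ 2) * g) + 1) <= ln (5 * g) + 4 * ln (2 * k + 1).
Proof.
move=> k4 g1; have q2 : 0 < 2 * k + 1 by lra.
split; first by apply: ln_ge0; lra.
have q1 : 0 < 5 * g by lra.
have -> : ln (5 * g) + 4 * ln (2 * k + 1) = ln ((5 * g) * (2 * k + 1) ^+ 4).
  by rewrite [RHS]lnM ?posrE ?exprn_gt0// lnXn// [4 * _]mulr_natl.
have kk : k ^+ 2 <= k ^+ 4 by rewrite ler_eXn2l//; lra.
have k1 : 1 <= k ^+ 4 by rewrite exprn_ege1//; lra.
have k2 : k ^+ 4 <= (2 * k + 1) ^+ 4 by rewrite lerXn2r ?nnegrE//; lra.
have k0 : 0 <= k ^+ 2 := sqr_ge0 k.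
rewrite ler_ln ?posrE; [|by rewrite ltr_wpDl// !mulr_ge0 ?addr_ge0//; lra|by rewrite mulr_gt0 ?exprn_gt0].
by move: k1 k2 kk g1; move: (k ^+ 4) (k ^+ 2) ((2 * k + 1) ^+ 4) => y z t; clear; nra.
Qed.

(* Tiles whose density deviates from a square by a charge invisible from outside
   can replace the square: float a large array of them, fill the frame with
   independent particles and flatten the small averaged deviation by a mixture. *)
Lemma core (s : nat) (j C1 : R) : (0 < s)%N -> 0 <= C1 ->
  (forall eta : R, 0 < eta -> exists (a : nat) (w : int * int -> R),
    [/\ (0 < a)%N, (forall i, w i != 0 -> i \in zidx a),
      (forall x, - cellf s%:R 0 x <= gf (s%:R / a%:R) w x), I2 (gf (s%:R / a%:R) w) = 0 &
      [/\ JA nlg (s ^ 2) (fun x => cellf s%:R 0 x + gf (s%:R / a%:R) w x) (cellf s%:R 0) j,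
       (forall x, cellf s%:R 0 x = 0 -> `|pot nlg (gf (s%:R / a%:R) w) x| <= eta) &
       I2 (fun x => cellf s%:R 0 x * `|pot nlg (gf (s%:R / a%:R) w) x|) <= C1]]) ->
  e0 * (s ^ 2)%:R <= j.
Proof.
move=> s0 C10 H; apply/ler_addgt0Pr => d d0.
have s1 : 1 <= s%:R :> R by rewrite ler1n.
set sg : R := s%:R in s1 *; pose s2 := sg ^+ 2; have s21 : 1 <= s2 by rewrite exprn_ege1.
have ln0 : 0 <= ln (5 * sg) by apply: ln_ge0; lra.
pose A := 2 * s2 * (ln (5 * sg) + 4) + 2 * C1 + 3 + `|j| + `|e0 : R| * s2.
have t1 : 0 <= 2 * s2 * (ln (5 * sg) + 4) by rewrite !mulr_ge0//; lra.
have t2 : 0 <= `|e0 : R| * s2 by rewrite mulr_ge0//; lra.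
have A0 : 0 <= A by rewrite /A; have := normr_ge0 j; lra.
have [a0 a1 ha] := ln_le_lin A0 d0.
pose k := ((Num.trunc a0).+4)%N; pose kp : R := k%:R.
have k4 : 4 <= kp by rewrite ler_nat.
have ka : a0 <= kp by apply: (le_trans (ltW (truncnS_gt _))); rewrite ler_nat ltnS -addn3 leq_addr.
have k0 : (0 < k)%N by [].
have kp0 : 0 < kp by lra.
have [L0 lnb] := core_ln k4 s1.
(* The collar takes a fraction of order [l / K = k^-2] of the area; the deviation [4 / l] is
   compensated with weight [p = 1/k], which requires [4 (k - 1) <= k^2]. Since [ln S] is of order
   [ln k], what is lost is of order [ln k / k]. *)
pose l := (k ^ 2)%N; pose K := (k ^ 4)%N; pose S := ((K + l) * s)%N.
have Kr : K%:R = kp ^+ 4 :> R by rewrite /K natrX.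
have lr : l%:R = kp ^+ 2 :> R by rewrite /l natrX.
have Sr : S%:R = (kp ^+ 4 + kp ^+ 2) * sg :> R by rewrite /S natrM natrD Kr lr.
have l0 : (0 < l)%N by rewrite expn_gt0 k0.
have K0 : (0 < K)%N by rewrite expn_gt0 k0.
clearbody kp K l.
pose x := kp^-1; have x0 : 0 < x by rewrite invr_gt0.
have x4 : x <= 1 / 4 by rewrite div1r lef_pV2 ?posrE.
pose u := (1 + x ^+ 2) ^+ 2.
pose K2 : R := kp ^+ 8; have K20 : 0 < K2 by rewrite exprn_gt0.
have kx : kp = x^-1 by rewrite invrK.
have S2 : S%:R ^+ 2 = K2 * (u * s2) :> R.
  by rewrite Sr /K2 /u /s2 kx; field; rewrite gt_eqF.
have u1 : 1 <= u by rewrite /u exprn_ege1// lerDl sqr_ge0.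
have u2 : u <= 1 + x.
  have y1 : x ^+ 2 <= x / 4 by rewrite expr2; apply: ler_wpM2l; lra.
  by rewrite /u; move: (x ^+ 2) (sqr_ge0 x) y1 x4 x0; clear => y *; nra.
clearbody u; have K2E : K2 = kp ^+ 4 * kp ^+ 4 by rewrite -exprD.
clearbody K2 x; have u0 : 0 < u := lt_le_trans ltr01 u1.
have s1' : 0 < sg := lt_le_trans ltr01 s1.
have s20 : 0 < s2 := lt_le_trans ltr01 s21.
have S20 : 0 < S%:R ^+ 2 :> R by rewrite S2; exact: (mulr_gt0 K20 (mulr_gt0 u0 s20)).
(* Chosen after the size [S] of the array, small enough for all pairs of tiles together. The tile
   may depend on [eta], but its energy [j] and inner bound [C1] may not. *)
pose eta : R := x / (2 * S%:R ^+ 2).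
have eta0 : 0 < eta by rewrite divr_gt0// mulr_gt0.
have [a [w [aa hw vb v0 [hJ hout hin]]]] := H _ eta0.
have p01 : 0 < x < 1 by rewrite x0; lra.
have px : (1 - x) / x = kp - 1 by rewrite mulrBl mul1r mulfV ?gt_eqF// kx.
have hp : (1 - x) / x * (4 / l%:R) <= 1.
  by rewrite px lr mulrA ler_pdivrMr ?exprn_gt0//; nra.
have h := e0_le (@e0_bounded R) (core_step s0 aa l0 K0 hw vb v0 hJ (ltW eta0) hout hin p01 hp).
rewrite -/S in h; set c := ln _ in h.
have c0 : 0 <= c by apply: ln_ge0; rewrite lerDr mulr_ge0.
have cb : c <= ln (5 * sg) + 4 * ln (2 * kp + 1) by rewrite /c Sr.
have etaS : eta * S%:R ^+ 2 = x / 2 by rewrite /eta S2; field; rewrite ?(gt_eqF K20) ?(gt_eqF u0) ?(gt_eqF s20) ?(gt_eqF s1').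
have etaK : 2 * s2 * eta * K2 <= x.
  have -> : 2 * s2 * eta * K2 = x / u.
    by rewrite /eta S2; field; rewrite ?(gt_eqF K20) ?(gt_eqF u0) ?(gt_eqF s20) ?(gt_eqF s1').
  by rewrite ler_pdivrMr// ler_peMr// ltW.
have rE : (S ^ 2 - K * K * s ^ 2)%:R = K2 * ((u - 1) * s2) :> R.
  rewrite natrB; last by rewrite /S expnMn leq_mul2r; apply/orP; right; rewrite -mulnn leq_mul ?leq_addr.
  by rewrite natrX S2 natrM natrM natrX Kr -/sg K2E /s2; ring.
rewrite rE etaS natrX S2 natrM !Kr lr px -/sg in h.
pose J' := x * (u * s2 / 2 * c + 2 * (1 - x) ^+ 2 * (C1 + x / 2)) +
  (1 - x) * ((u - 1) * s2 / 2 * c + (j + 2 * s2 * eta * K2)).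
have {h} h : e0 * (u * s2) <= J'.
  rewrite -(ler_pM2r K20) -mulrA [_ * K2]mulrC; apply: le_trans h _.
  rewrite le_eqVlt; apply/orP; left; apply/eqP.
  by rewrite /J' K2E /s2 kx; field; rewrite gt_eqF.
have xA : x * (A + A * ln (2 * kp + 1)) <= d.
  by rewrite -ler_pdivlMl// [_^-1 * _]mulrC -kx; exact: ha.
have ee0 : 0 <= 2 * s2 * eta * K2.
  apply: mulr_ge0; last exact: ltW.
  by apply: mulr_ge0; last exact: ltW; apply: mulr_ge0; last exact: ltW.
rewrite natrX -/sg -/s2.
exact: (core_num x0 x4 u1 u2 s21 C10 c0 ln0 L0 cb ee0 etaK h xA).
Qed.
End CoreLimit.

(** * Confinement *)
Section Balayage.
Context {R : realType}.
Local Notation R2 := (R * R)%type.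
Implicit Types (u v x y z A B c : R2) (s t : seq R2).

Lemma unit_sqrt u : nsq u = 1 -> exists v, cm v v = u.
Proof.
move=> h; have h' : u.1 ^+ 2 + u.2 ^+ 2 = 1 by [].
have [e|e] := eqVneq (1 + u.1) 0.
  have e1 : u.1 = -1 by lra.
  have e2 : u.2 = 0 by apply/eqP; rewrite -sqrf_eq0; apply/eqP; move: h'; rewrite e1; lra.
  by exists (0, 1); rewrite /cm /= [RHS]surjective_pairing e1 e2; congr pair; ring.
have p : 0 < 1 + u.1.
  rewrite lt_neqAle eq_sym e /=; have : u.1 ^+ 2 <= 1 by rewrite -h' lerDl sqr_ge0.
  nra.
set t := Num.sqrt (2 * (1 + u.1)).
have t0 : 0 < t by rewrite sqrtr_gt0 mulr_gt0.
have tt : t ^+ 2 = 2 * (1 + u.1) by rewrite sqr_sqrtr// mulr_ge0// ltW.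
exists ((1 + u.1) / t, u.2 / t); rewrite /cm /= [RHS]surjective_pairing; congr pair.
  apply: (@mulIf _ (t ^+ 2)); first by rewrite expf_neq0// gt_eqF.
  have -> : ((1 + u.1) / t * ((1 + u.1) / t) - u.2 / t * (u.2 / t)) * t ^+ 2 = (1 + u.1) ^+ 2 - u.2 ^+ 2.
    by field; rewrite gt_eqF.
  by rewrite tt (_ : u.2 ^+ 2 = 1 - u.1 ^+ 2); [ring|rewrite -h'; ring].
apply: (@mulIf _ (t ^+ 2)); first by rewrite expf_neq0// gt_eqF.
have -> : ((1 + u.1) / t * (u.2 / t) + u.2 / t * ((1 + u.1) / t)) * t ^+ 2 = 2 * (1 + u.1) * u.2.
  by field; rewrite gt_eqF.
by rewrite tt mulrC.
Qed.

(** The complex power [z^(2^p)]. *)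
Definition sqn p z : R2 := iter p (fun z => cm z z) z.
Lemma nrm_sqn p z : nrm (sqn p z) = nrm z ^+ (2 ^ p).
Proof.
elim: p => [|p IH] /=; first by rewrite expn0 expr1.
by rewrite -/(sqn p z) nrm_cm IH -exprD addnn -mul2n expnS.
Qed.
Lemma sqnS p z : sqn p.+1 z = sqn p (cm z z).
Proof. by rewrite /sqn iterSr. Qed.
Lemma sqn1 p : sqn p (1, 0) = (1, 0).
Proof. by elim: p => //= p IH; rewrite -/(sqn p _) IH cm1. Qed.

Lemma unit_nrm u : nsq u = 1 -> nrm u = 1.
Proof. by rewrite /nrm => ->; rewrite sqrtr1. Qed.

Lemma sq_diff v A B : cm A A - cm (cm v v) (cm B B) = cm (A - cm v B) (A - cm (- v) B).
Proof.
case: v A B => [a b] [c d] [e g].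
by rewrite /cm /=; congr pair => /=; ring.
Qed.

(** The roots of unity of order [2^p], obtained by taking square roots repeatedly; the identity is
    the logarithm of the modulus of [A^n - B^n = prod (A - u B)] with [n = 2^p]. *)
Lemma roots p : exists s, [/\ size s = (2 ^ p)%N, (forall u, u \in s -> nsq u = 1) &
  forall A B, (forall u, u \in s -> A - cm u B != 0) ->
    sqn p A - sqn p B != 0 /\ \sum_(u <- s) lg (A - cm u B) = lg (sqn p A - sqn p B)].
Proof.
elim: p => [|p [s [ss su sP]]].
  exists [:: (1, 0)]; split => // [u|A B h].
    by rewrite inE => /eqP ->; rewrite /nsq /= expr1n expr0n addr0.
  have := h (1, 0); rewrite inE eqxx cm1 => /(_ isT) h1.
  by rewrite big_seq1 cm1.
have : forall u, exists v, u \in s -> cm v v = u.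
  move=> u; have [us|us] := boolP (u \in s); last by exists 0.
  by have [v hv] := unit_sqrt (su _ us); exists v.
move/choice => [f hf].
have fu u : u \in s -> nsq (f u) = 1.
  move=> us; have := su _ us; rewrite -{1}(hf _ us) nsq_cm => h.
  by have := nsq_ge0 (f u) => h0; apply/eqP; rewrite eq_le; apply/andP; split; nra.
exists ([seq f u | u <- s] ++ [seq - f u | u <- s]); split.
- by rewrite size_cat !size_map ss expnS mul2n addnn.
- move=> u; rewrite mem_cat => /orP[|] /mapP[v vs ->]; first exact: fu.
  by rewrite -nrmE nrmN nrmE fu.
move=> A B h.
have k u : u \in s -> cm A A - cm u (cm B B) = cm (A - cm (f u) B) (A - cm (- f u) B).
  by move=> us; rewrite -{1}(hf _ us) sq_diff.
have h1 u : u \in s -> A - cm (f u) B != 0 by move=> us; apply: h; rewrite mem_cat map_f.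
have h2 u : u \in s -> A - cm (- f u) B != 0.
  by move=> us; apply: h; rewrite mem_cat (map_f (fun u => - f u)) ?orbT.
have [|n0 e] := sP (cm A A) (cm B B).
  by move=> u us; rewrite k// cm_eq0 negb_or h1 ?h2.
rewrite !sqnS; split => //; rewrite -e big_cat /= !big_map -big_split /= big_seq [RHS]big_seq.
by apply: eq_bigr => u us; rewrite k// lg_cm ?h1 ?h2.
Qed.

Lemma pow_small (q : R) : 0 <= q < 1 -> exists p0 : nat, forall p, (p0 <= p)%N -> q ^+ (2 ^ p) <= 1 / 2.
Proof.
move=> /andP[q0 q1].
have : (fun n => q ^+ n) @ \oo --> (0 : R) by apply: cvg_expr; rewrite ger0_norm.
move/cvgrPdist_lt => /(_ (1 / 2)) [|n0 _ hn]; first lra.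
exists n0 => p hp; have := hn (2 ^ p)%N; rewrite /= sub0r normrN ger0_norm ?exprn_ge0// => h; apply/ltW/h.
by apply: leq_trans hp _; apply/ltnW; exact: ltn_expl.
Qed.

Lemma pow_small_all s (g : R2 -> R) : (forall y, y \in s -> 0 <= g y < 1) ->
  exists p0 : nat, forall p, (p0 <= p)%N -> forall y, y \in s -> g y ^+ (2 ^ p) <= 1 / 2.
Proof.
elim: s => [|y s IH] h; first by exists 0%N.
have [|p1 h1] := IH; first by move=> z zs; apply: h; rewrite inE zs orbT.
have [|p2 h2] := @pow_small (g y); first by apply: h; rewrite inE eqxx.
exists (maxn p1 p2) => p; rewrite geq_max => /andP[hp1 hp2] z; rewrite inE => /orP[/eqP ->|].
  exact: h2.
exact: h1.
Qed.

Definition conj z : R2 := (z.1, - z.2).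
Lemma nsq_conj z : nsq (conj z) = nsq z. Proof. by rewrite /nsq /= sqrrN. Qed.
Lemma nrm_conj z : nrm (conj z) = nrm z. Proof. by rewrite /nrm nsq_conj. Qed.
Lemma cm_conj z : cm z (conj z) = (nsq z, 0).
Proof. by rewrite /cm /nsq /=; congr pair; ring. Qed.
Lemma nrm_pair1 : nrm (1, 0) = 1 :> R.
Proof. by rewrite unit_nrm// /nsq /= expr1n expr0n addr0. Qed.

Lemma cm_inv z : z != 0 -> cm z (sc (nsq z)^-1 (conj z)) = (1, 0).
Proof.
move=> z0; have d0 : nsq z != 0 by rewrite nsq_eq0.
rewrite /cm /conj /sc /=; congr pair; last ring.
by transitivity (nsq z / nsq z); [rewrite [X in _ = X / _]/nsq; ring|rewrite mulfV].
Qed.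

Lemma nsq_moebius c u : nsq u = 1 -> nsq ((1, 0) + cm (conj c) u) = nsq (u + c).
Proof.
rewrite /cm /conj /nsq /= => h.
have -> : (1 + (c.1 * u.1 - - c.2 * u.2)) ^+ 2 + (0 + (c.1 * u.2 + - c.2 * u.1)) ^+ 2 =
    1 + 2 * (c.1 * u.1 + c.2 * u.2) + (c.1 ^+ 2 + c.2 ^+ 2) * (u.1 ^+ 2 + u.2 ^+ 2) by ring.
have -> : (u.1 + c.1) ^+ 2 + (u.2 + c.2) ^+ 2 =
    (u.1 ^+ 2 + u.2 ^+ 2) + 2 * (c.1 * u.1 + c.2 * u.2) + (c.1 ^+ 2 + c.2 ^+ 2) by ring.
by rewrite h mulr1.
Qed.

Let lin1 (a b d : R) : a <= b -> a - b <= d -> b - a <= d -> a <= 1 / 2 * b -> a / 2 <= d.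
Proof. lra. Qed.
Let lin2 (a b d : R) : a - b <= d -> b - a <= d -> b <= 1 / 2 * a -> a / 2 <= d.
Proof. lra. Qed.
Let lin3 (a b d : R) : b <= a -> d <= b + a -> d <= a * 2.
Proof. lra. Qed.
Let lin4 (a b d e f : R) : - e <= f -> f <= e -> 2 * e <= d -> a - e <= b -> a - d <= b - f.
Proof. lra. Qed.
Let lin5 (a b d e f : R) : - e <= f -> f <= e -> 2 * e <= d -> b <= a + e -> b - f <= a + d.
Proof. lra. Qed.

(* Harmonic measure of the unit circle seen from an exterior point: the images of
   roots of unity under a Moebius transformation. *)
Lemma balayage xi s (eps : R) : 1 < nrm xi -> (forall y, y \in s -> nrm y != 1 /\ y != xi) -> 0 < eps ->
  exists t, [/\ (0 < size t)%N, (forall z, z \in t -> nrm z = 1),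
    (forall y, y \in s -> (size t)%:R * (lg (xi - y) - lg xi - eps) <= \sum_(z <- t) lg (z - y)) &
    (forall y, nrm y < 1 -> \sum_(z <- t) lg (z - y) <= (size t)%:R * (lg (xi - y) - lg xi + eps))].
Proof.
move=> x1 hs eps0.
have x0 : xi != 0 by rewrite -nrm_gt0; lra.
have nx0 : nsq xi != 0 by rewrite nsq_eq0.
pose c := sc (nsq xi)^-1 xi; pose cb := conj c.
have nc : nrm c = (nrm xi)^-1.
  by rewrite nrm_sc ger0_norm ?invr_ge0 ?nsq_ge0// -nrmE; field; rewrite gt_eqF//; lra.
have c01 : 0 <= nrm c < 1 by rewrite nc invr_ge0 nrm_ge0 invf_lt1//; lra.
have cbx : cm xi cb = (1, 0).
  rewrite /cb /c /cm /conj /sc /=; congr pair; last ring.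
  by transitivity (nsq xi / nsq xi); [rewrite /nsq; field|rewrite mulfV].
pose Ay y := (1, 0) - cm cb y; pose By y := y - c.
have AyE y : cm xi (Ay y) = xi - y by rewrite /Ay cmBr cmA cbx cm1 cmC cm1.
have Ay0 y : y != xi -> Ay y != 0.
  by move=> yx; apply: contraNneq yx => e; rewrite eq_sym -subr_eq0 -AyE e cm0.
have lgA y : y != xi -> lg (Ay y) = lg (xi - y) - lg xi.
  by move=> yx; rewrite -AyE lg_cm// ?Ay0// addrC addKr.
have AB y : nrm (Ay y) ^+ 2 - nrm (By y) ^+ 2 = (1 - nrm c ^+ 2) * (1 - nrm y ^+ 2).
  by rewrite !nrmE /Ay /By /cb /cm /conj /nsq /=; ring.
have c1 : 0 < 1 - nrm c ^+ 2.
  by rewrite subr_gt0 expr_lt1//; case/andP: c01.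
have ABlt y : nrm y < 1 -> nrm (By y) < nrm (Ay y).
  move=> y1; rewrite -(@ltr_pXn2r _ 2) ?nnegrE ?nrm_ge0// -subr_gt0 AB mulr_gt0//.
  by rewrite subr_gt0 expr_lt1 ?nrm_ge0.
have ABgt y : 1 < nrm y -> nrm (Ay y) < nrm (By y).
  move=> y1; rewrite -(@ltr_pXn2r _ 2) ?nnegrE ?nrm_ge0// -subr_lt0 AB pmulr_rlt0//.
  by rewrite subr_lt0 expr_gt1 ?nrm_ge0.
pose g y := Num.min (nrm (Ay y)) (nrm (By y)) / Num.max (nrm (Ay y)) (nrm (By y)).
have hg y : y \in s -> 0 <= g y < 1.
  move=> ys; have [y1 yx] := hs _ ys.
  have a0 : 0 < nrm (Ay y) by rewrite nrm_gt0 Ay0.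
  have b0 := nrm_ge0 (By y).
  have m0 : 0 < Num.max (nrm (Ay y)) (nrm (By y)) by rewrite lt_max a0.
  rewrite /g divr_ge0 ?ltr_pdivrMr ?mul1r//=; last 2 first.
  - by rewrite le_min b0 ltW.
  - exact: ltW.
  have : (nrm (By y) < nrm (Ay y)) || (nrm (Ay y) < nrm (By y)).
    by case: (ltgtP (nrm y) 1) y1 => // [/ABlt ->//|/ABgt ->]; rewrite ?orbT.
  by rewrite /Num.min /Num.max; case: ltgtP.
have [p1 hp1] := pow_small_all hg.
have [p2 hp2] := pow_small c01.
have l2 : 0 <= ln 2 :> R by apply: ln_ge0; lra.
(* The products below are known up to a factor 2 twice, so [2 ln 2] must not exceed [n eps]. *)
pose p3 := (Num.trunc (2 * ln 2 / eps)).+1.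
pose p := maxn p1 (maxn p2 p3).
have p1p : (p1 <= p)%N by rewrite leq_max leqnn.
have p2p : (p2 <= p)%N by rewrite !leq_max leqnn orbT.
have p3p : (p3 <= p)%N by rewrite !leq_max leqnn !orbT.
have [w [ws wu wP]] := roots p.
set n := (2 ^ p)%N in ws.
have n0 : (0 < n)%N by rewrite expn_gt0.
have neps : 2 * ln 2 <= n%:R * eps.
  rewrite -ler_pdivrMr//; apply: (le_trans (ltW (truncnS_gt _))).
  by rewrite ler_nat; apply: leq_trans p3p _; apply/ltnW; exact: ltn_expl.
pose den u := (1, 0) + cm cb u; pose num u := u + c.
have dn u : u \in w -> nsq (den u) = nsq (num u).
  by move=> uw; rewrite /den /num /cb nsq_moebius// wu.
have den0 u : u \in w -> den u != 0.
  move=> uw; rewrite -nrm_gt0; have := nrm_lb (1, 0) (- cm cb u).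
  rewrite opprK nrmN nrm_cm (unit_nrm (wu _ uw)) mulr1 nrm_conj nrm_pair1 -/(den u).
  by case/andP: c01; lra.
(* The image [(u + c) / (1 + conj c u)] of the root [u] under a Moebius map preserving the unit
   circle. *)
pose z u := cm (sc (nsq (den u))^-1 (conj (den u))) (num u).
have zE u : u \in w -> cm (den u) (z u) = num u.
  by move=> uw; rewrite /z cmA cm_inv ?den0// cm1.
have z1 u : u \in w -> nrm (z u) = 1.
  move=> uw; have d0 : nrm (den u) != 0 by rewrite nrm_eq0 den0.
  by apply: (mulfI d0); rewrite -nrm_cm zE// mulr1 /nrm dn.
have zy u y : u \in w -> cm (den u) (z u - y) = - (By y - cm u (Ay y)).
  move=> uw; rewrite cmBr zE// /den /num /By /Ay.
  by case: (u) (y) (c) (cb) => [a b] [d e] [f k] [m l]; rewrite /cm /=; congr pair => /=; ring.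
have dsum : - ln 2 <= \sum_(u <- w) lg (den u) <= ln 2.
  have [|q0 e] := wP (1, 0) (- cb).
    by move=> u uw; have := den0 _ uw; rewrite /den cmNr opprK (cmC cb).
  have -> : \sum_(u <- w) lg (den u) = lg (sqn p (1, 0) - sqn p (- cb)).
    by rewrite -e; apply: eq_bigr => u _; rewrite /den cmNr opprK (cmC cb).
  rewrite sqn1 in q0 *.
  have b1 : nrm (sqn p (- cb)) <= 1 / 2 by rewrite nrm_sqn nrmN nrm_conj; exact: hp2.
  have b2 := nrm_lb (1, 0) (sqn p (- cb)); have b3 := nrmB (1, 0) (sqn p (- cb)).
  rewrite nrm_pair1 in b2 b3.
  rewrite /lg; apply/andP; split; last by rewrite ler_ln ?posrE ?nrm_gt0//; lra.
  by rewrite -lnV ?posrE// ler_ln ?posrE ?nrm_gt0 ?invr_gt0//; lra.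
(* By [zy] the product of the factors [z u - y] is [By^n - Ay^n] divided by the product of the
   denominators, whose modulus lies between 1/2 and 2. For large [n] one of the two powers
   dominates. *)
have zsum y : (forall u, u \in w -> z u != y) -> sqn p (By y) - sqn p (Ay y) != 0 /\
   \sum_(u <- w) lg (z u - y) = lg (sqn p (By y) - sqn p (Ay y)) - \sum_(u <- w) lg (den u).
  move=> hy; have h0 u : u \in w -> By y - cm u (Ay y) != 0.
    move=> uw; rewrite -oppr_eq0 -zy// cm_eq0 negb_or den0//=.
    by rewrite subr_eq0 hy.
  have [q0 e] := wP _ _ h0; split => //; rewrite -e -sumrB big_seq [RHS]big_seq.
  apply: eq_bigr => u uw; rewrite -[lg (By y - _)]lgN -zy// lg_cm ?den0 ?subr_eq0 ?hy//; ring.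
have zny y : nrm y != 1 -> forall u, u \in w -> z u != y.
  by move=> y1 u uw; apply: contraNneq y1 => <-; rewrite z1.
exists [seq z u | u <- w]; rewrite size_map ws; split => //.
- by move=> _ /mapP[u uw ->]; exact: z1.
- move=> y ys; have [y1 yx] := hs _ ys; rewrite big_map.
  have [q0 ->] := zsum y (zny _ y1).
  have a0 : 0 < nrm (Ay y) by rewrite nrm_gt0 Ay0.
  have b0 := nrm_ge0 (By y).
  have m0 : 0 < Num.max (nrm (Ay y)) (nrm (By y)) by rewrite lt_max a0.
  have : ln (nrm (Ay y) ^+ n / 2) <= lg (sqn p (By y) - sqn p (Ay y)).
    rewrite /lg ler_ln ?posrE ?nrm_gt0 ?divr_gt0 ?exprn_gt0//.
    have := hp1 _ p1p _ ys; rewrite /g expr_div_n ler_pdivrMr ?exprn_gt0//.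
    have := nrm_lb (sqn p (By y)) (sqn p (Ay y)); have := nrm_lb (sqn p (Ay y)) (sqn p (By y)).
    rewrite (nrmBC (sqn p (Ay y))) !nrm_sqn -/n.
    have [h|h] := leP (nrm (Ay y)) (nrm (By y)).
      have : nrm (Ay y) ^+ n <= nrm (By y) ^+ n by rewrite lerXn2r ?nnegrE ?nrm_ge0.
      exact: lin1.
    exact: lin2.
  rewrite ln_div ?posrE ?exprn_gt0// lnXn// -[_ *+ n]mulr_natl -/(lg (Ay y)) lgA//.
  case/andP: dsum => d1 d2; rewrite [n%:R * (_ - eps)]mulrBr; exact: (lin4 d1 d2 neps).
move=> y y1; rewrite big_map.
have yx : y != xi by apply: contraTneq y1 => ->; rewrite -leNgt ltW.
have [|q0 ->] := zsum y; first by apply: zny; rewrite lt_eqF.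
have a0 : 0 < nrm (Ay y) by rewrite nrm_gt0 Ay0.
have : lg (sqn p (By y) - sqn p (Ay y)) <= ln (nrm (Ay y) ^+ n * 2).
  rewrite /lg ler_ln ?posrE ?nrm_gt0 ?mulr_gt0 ?exprn_gt0//.
  have := nrmB (sqn p (By y)) (sqn p (Ay y)); rewrite !nrm_sqn -/n.
  have : nrm (By y) ^+ n <= nrm (Ay y) ^+ n by rewrite lerXn2r ?nnegrE ?nrm_ge0// ltW// ABlt.
  exact: lin3.
rewrite lnM ?posrE ?exprn_gt0// lnXn// -[_ *+ n]mulr_natl -/(lg (Ay y)) lgA//.
case/andP: dsum => d1 d2; rewrite [n%:R * (_ + eps)]mulrDr; exact: (lin5 d1 d2 neps).
Qed.

Lemma pEs_perm (K : R2 -> R) s t : (forall z, K (- z) = K z) -> perm_eq s t -> pEs K s = pEs K t.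
Proof.
move=> sK h; have := pEs_double s sK; have := pEs_double t sK.
rewrite (perm_size h) (perm_big _ h) /= => e1 e2.
have : \sum_(i <- t) \sum_(y <- s) K (i - y) = \sum_(i <- t) \sum_(y <- t) K (i - y).
  by apply: eq_bigr => i _; exact: perm_big.
by rewrite e1 e2; lra.
Qed.

Lemma pEs_ord (K : R2 -> R) N (x : 'I_N -> R2) :
  pEs K [seq x j | j <- enum 'I_N] = \sum_(j < N) \sum_(k < N | (j < k)%N) K (x j - x k).
Proof.
elim: N x => [|N IH] x; first by rewrite big_ord0 enum_ord0.
rewrite enum_ordSl /= big_ord_recl -map_comp IH; congr (_ + _).
  by rewrite big_map [RHS]big_mkcond big_ord_recl /= add0r big_enum.
by apply: eq_bigr => i _; rewrite [RHS]big_mkcond big_ord_recl /= add0r -big_mkcond.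
Qed.

Definition eJ (b : R2 -> R) s : R :=
  pEs nlg s + \sum_(x <- s) pot lg b x - 2^-1 * I4 lg b b.
Lemma EJel_list N (x : 'I_N -> R2) :
  EJel (sq (Num.sqrt N%:R)) x = eJ (bsq N) [seq x j | j <- enum 'I_N].
Proof. by rewrite EJelE /eJ pEs_ord big_map big_enum. Qed.
Lemma eJ_perm b s t : perm_eq s t -> eJ b s = eJ b t.
Proof.
move=> h; rewrite /eJ (perm_big _ h) (pEs_perm _ h)// => z.
by rewrite /nlg lgN.
Qed.

Lemma exists_le_avg (I : eqType) (r : seq I) (F : I -> R) (c : R) : (0 < size r)%N ->
  \sum_(i <- r) F i <= (size r)%:R * c -> exists2 i, i \in r & F i <= c.
Proof.
move=> r0; rewrite -sum_seq_const => h; apply: contrapT => hn.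
suff : \sum_(i <- r) c < \sum_(i <- r) F i by rewrite ltNge h.
have lt i : i \in r -> c < F i by move=> ir; rewrite ltNge; apply/negP => le; apply: hn; exists i.
case: r r0 lt {h hn} => // i r _ lt; rewrite !big_cons; apply: ltr_leD; first by rewrite lt// inE eqxx.
rewrite big_seq [leRHS]big_seq; apply: ler_sum => k kr; rewrite ltW// lt// inE kr orbT//.
Qed.

Lemma lg_sc (rho : R) z : 0 < rho -> z != 0 -> lg (sc rho z) = ln rho + lg z.
Proof. by move=> r0 z0; rewrite /lg nrm_sc gtr0_norm// lnM ?posrE ?nrm_gt0. Qed.

(** Swept onto the circle of radius [rho], the charge at [x] has its logarithmic potential lowered
    by [L = ln (|x| / rho)] inside the disc and by at most [L] elsewhere, up to [e]. The energy thus
    changes by at most [(size t - I2 b) L] plus errors, and the first term is not positive. Some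
    point of the circle does at least as well as the average. *)
Lemma move_in b x t (rho eps : R) : good b -> (forall y, 0 <= b y) -> 0 < rho ->
  (forall y, b y != 0 -> nrm y < rho) -> (size t)%:R <= I2 b -> x \notin t -> rho < nrm x ->
  (forall y, y \in t -> nrm y != rho) -> 0 < eps ->
  exists z, [/\ nrm z = rho, z \notin t & eJ b (z :: t) <= eJ b (x :: t) + eps].
Proof.
move=> gb b0 r0 br bt xt xr tr eps0.
pose m : R := (size t)%:R + I2 b + 1.
have m0 : 0 < m by rewrite ltr_wpDl// addr_ge0// I2_ge0.
pose e := eps / m; have e0 : 0 < e by rewrite divr_gt0.
pose sv := sc rho^-1.
have rn : rho != 0 by rewrite gt_eqF.
have svK y : sc rho (sv y) = y by rewrite /sv scA mulfV// sc1.
have nsv y : nrm (sv y) = nrm y / rho by rewrite /sv nrm_sc ger0_norm ?invr_ge0 ?ltW// mulrC.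
have lgsv y z : z != sv y -> lg (sc rho z - y) = ln rho + lg (z - sv y).
  by move=> h; rewrite -{1}(svK y) -scB lg_sc// subr_eq0.
have inj y z : (sv y == sv z) = (y == z).
  by apply/eqP/eqP => [h|-> //]; rewrite -(svK y) h svK.
have [zs [z0 z1 zl zu]] : exists zs, [/\ (0 < size zs)%N, (forall z, z \in zs -> nrm z = 1),
    (forall y, y \in map sv t -> (size zs)%:R * (lg (sv x - y) - lg (sv x) - e) <= \sum_(z <- zs) lg (z - y)) &
    (forall y, nrm y < 1 -> \sum_(z <- zs) lg (z - y) <= (size zs)%:R * (lg (sv x - y) - lg (sv x) + e))].
  apply: balayage => //; first by rewrite nsv ltr_pdivlMr// mul1r.
  move=> _ /mapP[y yt ->]; split; last by rewrite inj; apply: contraNneq xt => <-.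
  by rewrite nsv; apply: contra_neq (tr _ yt) => h; rewrite -[LHS](divfK rn) h mul1r.
set n : R := (size zs)%:R in zl zu.
have n0 : 0 < n by rewrite ltr0n.
pose U z := \sum_(y <- t) nlg (z - y) + pot lg b z.
have eJU z : eJ b (z :: t) = U z + (pEs nlg t + \sum_(x <- t) pot lg b x - 2^-1 * I4 lg b b).
  by rewrite /eJ /U /= big_cons; ring.
pose L := lg (sv x).
have L0 : 0 < L by rewrite /L /lg nsv ln_gt0// ltr_pdivlMr// mul1r.
have x0 : sv x != 0 by rewrite -nrm_gt0 nsv divr_gt0// (lt_trans r0).
have h1 y : y \in t -> n * (lg (x - y) - L - e) <= \sum_(z <- zs) lg (sc rho z - y).
  move=> yt; have := zl (sv y) (map_f _ yt).
  have xy : sv x != sv y by rewrite inj; apply: contraNneq xt => ->.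
  have -> : lg (x - y) = ln rho + lg (sv x - sv y) by rewrite -lgsv// svK.
  have -> : \sum_(z <- zs) lg (sc rho z - y) = \sum_(z <- zs) (ln rho + lg (z - sv y)).
    rewrite big_seq [RHS]big_seq; apply: eq_bigr => z zz; apply: lgsv.
    apply: contraNneq (tr _ yt) => h; have := z1 _ zz; rewrite h nsv => h'.
    by rewrite -[nrm y](divfK rn) h' mul1r.
  by rewrite big_split sum_seq_const -/n -/L /= !mulrBr mulrDr; lra.
have h2 : \sum_(z <- zs) pot lg b (sc rho z) <= n * (pot lg b x - I2 b * (L - e)).
  have i1 z : ig (fun y => b y * lg (z - y)) by exact: (ig_potC (@ker_lg R)).
  have pE z : pot lg b z = I2 (fun y => b y * lg (z - y)) by apply: eq_I2 => y; rewrite mulrC.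
  have -> : n * (pot lg b x - I2 b * (L - e)) = I2 (fun y => n * (b y * lg (x - y) - (L - e) * b y)).
    have gi := good_ig gb.
    rewrite I2Z; last by apply: igB => //; exact: igZ.
    by rewrite I2B ?I2Z//; [rewrite pE; ring|exact: igZ].
  under eq_bigr => z _ do rewrite pE.
  rewrite -I2_sum//; apply: I2_le.
  - exact: ig_sum.
  - by apply: igZ; apply: igB => //; apply: igZ; exact: good_ig.
  move=> y; have [e1|by0] := eqVneq (b y) 0.
    by rewrite e1 !mul0r mulr0 subr0 mulr0 big1// => z _; rewrite mul0r.
  have yr := br _ by0.
  have hy : nrm (sv y) < 1 by rewrite nsv ltr_pdivrMr// mul1r.
  have := zu _ hy.
  have xy : sv x != sv y by rewrite inj; apply: contraTneq yr => <-; rewrite -leNgt ltW.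
  have -> : b y * lg (x - y) - (L - e) * b y = b y * (ln rho + lg (sv x - sv y) - L + e).
    by rewrite -lgsv// svK; ring.
  rewrite -mulr_sumr mulrCA => h; apply: ler_wpM2l => //.
  have -> : \sum_(z <- zs) lg (sc rho z - y) = \sum_(z <- zs) (ln rho + lg (z - sv y)).
    rewrite big_seq [RHS]big_seq; apply: eq_bigr => z zz; apply: lgsv.
    by apply: contraTneq hy => <-; rewrite z1// ltxx.
  by rewrite big_split sum_seq_const -/n /= -addrA -addrA mulrDr lerD2l addrA.
have hU : \sum_(z <- zs) U (sc rho z) <= n * (U x + eps).
  rewrite /U big_split /= exchange_big /=.
  have : \sum_(y <- t) \sum_(z <- zs) nlg (sc rho z - y) <= \sum_(y <- t) (n * (nlg (x - y) + (L + e))).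
    rewrite big_seq [leRHS]big_seq; apply: ler_sum => y yt; have := h1 _ yt.
    have -> : \sum_(z <- zs) nlg (sc rho z - y) = - \sum_(z <- zs) lg (sc rho z - y) by rewrite sumrN.
    have -> : n * (nlg (x - y) + (L + e)) = - (n * (lg (x - y) - L - e)) by rewrite /nlg; ring.
    by rewrite lerN2.
  rewrite -mulr_sumr big_split /= sum_seq_const => h3.
  apply: le_trans (lerD h3 h2) _; rewrite -mulrDr ler_pM2l//.
  have : (size t)%:R * (L + e) - I2 b * (L - e) <= eps.
    have -> : (size t)%:R * (L + e) - I2 b * (L - e) = e * ((size t)%:R + I2 b) - (I2 b - (size t)%:R) * L by ring.
    have q1 : 0 <= (I2 b - (size t)%:R) * L by rewrite mulr_ge0 ?subr_ge0// ltW.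
    have q2 : e * ((size t)%:R + I2 b) <= eps.
      rewrite /e mulrAC ler_pdivrMr// ler_wpM2l ?(ltW eps0)// /m lerDl//.
    lra.
  lra.
have [z zz hz] := exists_le_avg z0 hU; exists (sc rho z); split.
- by rewrite nrm_sc z1// mulr1 gtr0_norm.
- apply/negP => zt; have := tr _ zt; rewrite nrm_sc z1// mulr1 gtr0_norm//; by rewrite eqxx.
- by rewrite !eJU; lra.
Qed.

Lemma avoid (l : seq R) (a b : R) : a < b -> exists a' b', [/\ a <= a', a' < b', b' <= b &
  forall c : R, c \in l -> ~ (a' < c < b')].
Proof.
elim: l a b => [|c l IH] a b ab; first by exists a, b; split.
have [a' [b' [h1 h2 h3 h4]]] := IH a b ab; set m := (a' + b') / 2.
have [cm|mc] := leP c m.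
  exists m, b'; split => //; rewrite /m; try lra.
  move=> d; rewrite inE => /orP[/eqP ->|dl]; first by rewrite /m in cm; move=> /andP[? _]; lra.
  by move=> /andP[k1 k2]; apply: (h4 _ dl); rewrite k2 andbT; rewrite /m in k1; lra.
exists a', m; split => //; rewrite /m; try lra.
move=> d; rewrite inE => /orP[/eqP ->|dl]; first by move=> /andP[_ k]; rewrite /m in mc k; lra.
by move=> /andP[k1 k2]; apply: (h4 _ dl); rewrite k1 /=; rewrite /m in k2; lra.
Qed.

Lemma bsq_nrm N y : bsq N y != 0 -> nrm y <= Num.sqrt N%:R.
Proof.
move=> h; have hb : bx (Num.sqrt N%:R / 2) y.
  by apply: contrapT => hz; move: h; rewrite /bsq indF ?eqxx.
by have := nrm_bx hb; lra.
Qed.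

(** One distant particle at a time is moved to a circle of radius between [sqrt N] and [2 sqrt N].
    The radius avoids the moduli of the other particles, as [balayage] demands and as keeps the
    points distinct. *)
Lemma confine N s (eps : R) : (0 < N)%N -> size s = N -> uniq s -> 0 < eps ->
  exists s', [/\ size s' = N, uniq s', (forall x, x \in s' -> nrm x <= 2 * Num.sqrt N%:R) &
    eJ (bsq N) s' <= eJ (bsq N) s + eps].
Proof.
move=> N0 sN us eps0; set a : R := Num.sqrt N%:R.
have a0 : 0 < a by rewrite sqrtr_gt0 ltr0n.
pose far x := 2 * a < nrm x.
suff H m (e : R) : 0 < e -> forall s, size s = N -> uniq s -> count far s = m ->
    exists s', [/\ size s' = N, uniq s', (forall x, x \in s' -> nrm x <= 2 * a) &
    eJ (bsq N) s' <= eJ (bsq N) s + m%:R * e].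
  have := H (count far s) (eps / (count far s).+1%:R) _ s sN us erefl.
  rewrite divr_gt0// => /(_ isT) [s' [h1 h2 h3 h4]]; exists s'; split => //.
  apply: le_trans h4 _; rewrite lerD2l mulrCA ler_piMr ?(ltW eps0)//.
  by rewrite ler_pdivrMr// mul1r ler_nat.
move=> e_gt0; elim: m => [|m IH] {}s {}sN {}us cs.
  exists s; split => //; last by rewrite mul0r addr0.
  move=> x xs; rewrite leNgt; apply/negP => fx.
  have : has far s by apply/hasP; exists x.
  by rewrite has_count cs.
have /hasP[x xs fx] : has far s by rewrite has_count cs.
have ps := perm_to_rem xs; set t := rem x s in ps.
have a2 : a < 2 * a by lra.
have [r1 [r2 [q1 q2 q3 q4]]] := avoid [seq nrm y | y <- t] a2.
pose rho := (r1 + r2) / 2.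
have ur : uniq (x :: t) by rewrite -(perm_uniq ps).
have /= /andP[xt ut] := ur.
have st : (size t).+1 = N by rewrite -sN (perm_size ps).
have rr : r1 < rho < r2 by apply/andP; rewrite /rho; split; lra.
have /andP[rr1 rr2] := rr.
have [z [zr zt hz]] : exists z, [/\ nrm z = rho, z \notin t & eJ (bsq N) (z :: t) <= eJ (bsq N) (x :: t) + e].
  apply: move_in => //.
  - exact: good_bsq.
  - lra.
  - by move=> y /bsq_nrm; rewrite -/a; lra.
  - by rewrite I2_bsq ler_nat -st.
  - by rewrite /far in fx; lra.
  by move=> y yt; apply/eqP => e1; apply: (q4 (nrm y)); rewrite ?map_f// e1.
have [|||s' [h1 h2 h3 h4]] := IH (z :: t).
- by rewrite /= st.
- by rewrite /= zt.
- move: cs; have /permP -> /= := ps; rewrite fx.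
  have -> : far z = false by rewrite /far zr; apply/negbTE; rewrite -leNgt; lra.
  by case.
exists s'; split => //; rewrite (eJ_perm _ ps).
by apply: le_trans h4 _; rewrite -natr1 mulrDl mul1r; lra.
Qed.
End Balayage.

(** * The lower bound for jellium *)
Section Projection.
Context {R : realType}.
Local Notation R2 := (R * R)%type.
Implicit Types (x y z : R2) (f g F G : R2 -> R) (i : int * int) (Z : seq (int * int)).

Lemma I2_reflect f x : ig f -> ig (fun y => f (x - y)) /\ I2 (fun y => f (x - y)) = I2 f.
Proof.
move=> hf; have e : (fun y => f (- (y + (- x)))) =1 (fun y => f (x - y)) by move=> y; rewrite opprB.
split; first exact: eq_ig e (ig_trans (- x) (ig_opp hf)).
by rewrite -(eq_I2 e) (I2_trans (- x) (ig_opp hf)) I2_opp.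
Qed.

Definition kap : R := I2 (fun z : R2 => \1_(bx 1) z * rinv z).
Lemma kap_ge0 : 0 <= kap.
Proof. by apply: I2_ge0 => z; rewrite mulr_ge0 ?ind_ge0 ?rinv_ge0. Qed.

Lemma rinv_far z : ~ bx 1 z -> rinv z <= 1.
Proof.
move=> h; rewrite /rinv; have [n1|/ltW n1] := leP 1 (nrm z).
  by rewrite invf_le1// (lt_le_trans ltr01).
by case: h; exact: bx_nrm.
Qed.

Lemma pot_rinv f x : good f -> (forall y, 0 <= f y <= 1) -> pot rinv f x <= kap + I2 f.
Proof.
move=> gf f01; have [i1 e1] := I2_reflect x (rinv_lint 1).
rewrite /kap -e1 -I2D//; last exact: good_ig.
apply: I2_le; [exact: (ig_pot (@ker_rinv R))|by apply: igD => //; exact: good_ig|].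
move=> y; have /andP[f0 f1] := f01 y; have r0 := rinv_ge0 (x - y).
have [hb|hb] := pselect (bx 1 (x - y)).
  by rewrite indT// mul1r; apply: (@le_trans _ _ (rinv (x - y))); rewrite ?ler_piMr ?lerDl.
by rewrite indF// mul0r add0r ler_piMl// rinv_far.
Qed.

Lemma pot_lip F G x x' : good F -> good G -> (forall y, `|F y| <= G y) ->
  `|pot lg F x - pot lg F x'| <= nrm (x - x') * (pot rinv G x + pot rinv G x').
Proof.
move=> gF gG FG; have kl := @ker_lg R; have kr := @ker_rinv R.
rewrite /pot -I2B; [|exact: (ig_pot kl)..].
rewrite -I2D; [|exact: (ig_pot kr)..].
have i1 : ig (fun y => lg (x - y) * F y - lg (x' - y) * F y) by apply: igB; exact: (ig_pot kl).
have i2 : ig (fun y => rinv (x - y) * G y + rinv (x' - y) * G y) by apply: igD; exact: (ig_pot kr).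
rewrite -I2Z//; apply: le_trans (I2_abs i1) _.
apply: (@I2_le_off _ [:: x; x']); [exact: ig_abs|exact: igZ|].
move=> y; rewrite !inE negb_or => /andP[yx yx'].
rewrite -mulrBl -mulrDl normrM mulrA.
apply: ler_pM => //; have -> : x - x' = (x - y) - (x' - y) by rewrite opprB addrA subrK.
by apply: lg_lip_abs; rewrite subr_eq0 eq_sym.
Qed.

Section grid.
Variable h : R.
Hypothesis h0 : 0 < h.
Local Notation cl := (cellf h).

Lemma cell_nrm i x y : cl i x != 0 -> cl i y != 0 -> nrm (x - y) <= 2 * h.
Proof.
move=> hx hy; have [h1 h2] := cell_near h0 hx hy.
by apply: le_trans (nrm_le _) _; rewrite /=; lra.
Qed.
Lemma cell_is1 i x : cl i x != 0 -> cl i x = 1.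
Proof. by rewrite /cellf pnatr_eq0 eqb0 negbK => ->. Qed.
Let gc i : good (cl i). Proof. exact: good_cell. Qed.
Let kl := @ker_lg R.
Let kr := @ker_rinv R.
Let hh : h ^+ 2 != 0. Proof. by rewrite expf_neq0// gt_eqF. Qed.

Lemma cell_mean i x y : cl i y != 0 -> x != y ->
  `|lg (x - y) - (h ^+ 2)^-1 * pot lg (cl i) x| <=
  2 * h * (rinv (x - y) + (h ^+ 2)^-1 * pot rinv (cl i) x).
Proof.
move=> ciy xy.
have hi : 0 < (h ^+ 2)^-1 by rewrite invr_gt0 exprn_gt0.
have gi := good_ig (gc i).
have e0 (k : R) : k = (h ^+ 2)^-1 * I2 (fun z => k * cl i z).
  by rewrite I2Z// I2_cell//; field; rewrite gt_eqF.
rewrite (e0 (lg (x - y))) -mulrBr normrM (gtr0_norm hi) {1}(e0 (rinv (x - y))) -mulrDr mulrCA.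
apply: ler_wpM2l; first exact: ltW.
rewrite /pot -I2B; [|exact: igZ|exact: (ig_pot kl)].
rewrite -I2D; [|exact: igZ|exact: (ig_pot kr)].
have i1 : ig (fun z => lg (x - y) * cl i z - lg (x - z) * cl i z) by apply: igB; [exact: igZ|exact: (ig_pot kl)].
have i2 : ig (fun z => rinv (x - y) * cl i z + rinv (x - z) * cl i z) by apply: igD; [exact: igZ|exact: (ig_pot kr)].
rewrite -I2Z//; apply: le_trans (I2_abs i1) _.
apply: (@I2_le_off _ [:: x]); [exact: ig_abs|exact: igZ|].
move=> z; rewrite inE => zx; have [c0|c0] := eqVneq (cl i z) 0.
  by rewrite c0 !mulr0 subrr normr0 addr0 mulr0.
rewrite (cell_is1 c0) !mulr1.
apply: le_trans (lg_lip_abs _ _) _; rewrite ?subr_eq0// 1?eq_sym//.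
apply: ler_wpM2r; first by rewrite addr_ge0 ?rinv_ge0.
have -> : x - y - (x - z) = z - y by rewrite opprB addrC addrA subrK.
exact: cell_nrm c0 ciy.
Qed.

Lemma proj_cell i f x : good f -> (forall y, `|f y| <= 1) ->
  `|pot lg (fun y => f y * cl i y) x - (h ^+ 2)^-1 * I2 (fun y => f y * cl i y) * pot lg (cl i) x|
  <= 4 * h * pot rinv (cl i) x.
Proof.
move=> gf f1; have mf := good_meas gf.
have gfc : good (fun y => f y * cl i y) := goodMb (gc i) mf f1.
set M := (h ^+ 2)^-1 * pot lg (cl i) x; set Q := (h ^+ 2)^-1 * pot rinv (cl i) x.
have -> : (h ^+ 2)^-1 * I2 (fun y => f y * cl i y) * pot lg (cl i) x = I2 (fun y => M * (f y * cl i y)).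
  by rewrite I2Z; [rewrite /M; ring|exact: good_ig].
have i1 : ig (fun y => lg (x - y) * (f y * cl i y)) := ig_pot kl x gfc.
have i2 : ig (fun y => M * (f y * cl i y)) by apply: igZ; exact: good_ig.
have i3 : ig (fun y => rinv (x - y) * cl i y) := ig_pot kr x (gc i).
have -> : 4 * h * pot rinv (cl i) x = 2 * h * I2 (fun y => rinv (x - y) * cl i y + Q * cl i y).
  rewrite I2D//; last by apply: igZ; exact: good_ig.
  rewrite I2Z; last exact: good_ig.
  by rewrite I2_cell// -/(pot rinv (cl i) x) /Q; field; rewrite gt_eqF.
rewrite /pot -I2B// -I2Z; last by apply: igD => //; apply: igZ; exact: good_ig.
have i4 : ig (fun y => lg (x - y) * (f y * cl i y) - M * (f y * cl i y)) by exact: igB.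
apply: le_trans (I2_abs i4) _; apply: (@I2_le_off _ [:: x]).
- exact: ig_abs.
- by apply: igZ; apply: igD => //; apply: igZ; exact: good_ig.
move=> y; rewrite inE => yx; have [c0|c0] := eqVneq (cl i y) 0.
  by rewrite c0 !mulr0 subrr normr0 addr0 mulr0.
rewrite (cell_is1 c0) !mulr1 -mulrBl normrM.
apply: (@le_trans _ _ (`|lg (x - y) - M|)); first by rewrite ler_piMr.
by apply: cell_mean => //; rewrite eq_sym.
Qed.

(** The average of [f] over each cell of the mesh. It keeps the mass, the bounds between 0 and 1
    and, up to order [h], the potential, while making the background constant on cells. *)
Definition Pj Z f x : R := \sum_(i <- Z) (h ^+ 2)^-1 * I2 (fun y => f y * cl i y) * cl i x.
Lemma good_Pj Z f : good (Pj Z f).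
Proof. by apply: good_sum => i; exact: goodZ. Qed.

Section proj.
Variables (Z : seq (int * int)) (f : R2 -> R).
Hypotheses (uZ : uniq Z) (gf : good f) (f01 : forall y, 0 <= f y <= 1).
Hypothesis fZ : forall x, f x != 0 -> fl (sc h^-1 x) \in Z.
Let f1 y : `|f y| <= 1. Proof. by rewrite ger0_norm; case/andP: (f01 y). Qed.
Let gfc i : good (fun y => f y * cl i y).
Proof. exact: goodMb (gc i) (good_meas gf) f1. Qed.
Lemma split_cells : f = fun x => \sum_(i <- Z) f x * cl i x.
Proof.
apply/funext => x; rewrite -mulr_sumr cell_sum//.
have [->|fx] := eqVneq (f x) 0; first by rewrite mul0r.
by rewrite fZ// mulr1.
Qed.
Lemma I2_Pj : I2 (Pj Z f) = I2 f.
Proof.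
rewrite {2}split_cells /Pj !I2_sum => [|i|i]; [|exact: good_ig|by apply: igZ; exact: good_ig].
apply: eq_bigr => i _; rewrite I2Z; last exact: good_ig.
by rewrite I2_cell//; field; rewrite gt_eqF.
Qed.
Lemma Pj01 x : 0 <= Pj Z f x <= (fl (sc h^-1 x) \in Z)%:R.
Proof.
have hi : 0 < (h ^+ 2)^-1 by rewrite invr_gt0 exprn_gt0.
have p i : 0 <= I2 (fun y => f y * cl i y).
  by apply: I2_ge0 => y; rewrite mulr_ge0//; case/andP: (f01 y).
apply/andP; split.
  by apply: sumr_ge0 => i _; rewrite !mulr_ge0// ?ltW//; exact: cell_ge0.
rewrite -cell_sum//; apply: ler_sum => i _; rewrite ler_piMl ?cell_ge0//.
rewrite mulrC ler_pdivrMr ?exprn_gt0// mul1r -[leRHS](I2_cell i h0); apply: I2_le.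
- exact: good_ig.
- exact: good_ig.
- by move=> y; rewrite ler_piMl ?cell_ge0//; case/andP: (f01 y).
Qed.
Lemma Pj_supp x : Pj Z f x != 0 -> exists2 y, f y != 0 & nrm (x - y) <= 2 * h.
Proof.
move=> hx; apply: contrapT => hn; case/eqP: hx; rewrite /Pj big1// => i _.
have [->|cx] := eqVneq (cl i x) 0; first by rewrite mulr0.
rewrite (@eq_I2 _ _ (fun=> 0)) ?I20 ?mulr0 ?mul0r// => y.
have [->|cy] := eqVneq (cl i y) 0; first by rewrite mulr0.
have [->|fy] := eqVneq (f y) 0; first by rewrite mul0r.
by case: hn; exists y => //; exact: cell_nrm cx cy.
Qed.
Lemma pot_Pj x : `|pot lg f x - pot lg (Pj Z f) x| <= 4 * h * (kap + (size Z)%:R * h ^+ 2).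
Proof.
rewrite {1}split_cells /Pj !(pot_sum kl)//; last by move=> i; exact: goodZ.
rewrite -sumrB; apply: le_trans (ler_norm_sum _ _ _) _.
apply: (@le_trans _ _ (\sum_(i <- Z) 4 * h * pot rinv (cl i) x)).
  by apply: ler_sum => i _; rewrite (potZ kl)//; exact: proj_cell.
rewrite -mulr_sumr -(pot_sum kr)//; apply: ler_wpM2l; first by rewrite mulr_ge0// ltW.
have -> : (size Z)%:R * h ^+ 2 = I2 (fun y => \sum_(i <- Z) cl i y).
  rewrite I2_sum => [|i]; last exact: good_ig.
  by rewrite -sum_seq_const; apply: eq_bigr => i _; rewrite I2_cell.
apply: pot_rinv; first exact: good_sum.
by move=> y; rewrite cell_sum//; case: (_ \in _); rewrite ?lexx ?ler01.
Qed.
End proj.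

(** A unit charge spread over the mesh cell that contains [y]: the smearing adapted to densities
    constant on cells. *)
Definition blob y x : R := (h ^+ 2)^-1 * cl (fl (sc h^-1 y)) x.
Lemma good_blob y : good (blob y). Proof. exact: goodZ. Qed.
Lemma blob_ge0 y x : 0 <= blob y x.
Proof. by rewrite mulr_ge0 ?invr_ge0 ?sqr_ge0 ?cell_ge0. Qed.
Lemma I2_blob y : I2 (blob y) = 1.
Proof. by rewrite I2Z ?I2_cell ?mulVf//; exact: good_ig. Qed.
Lemma blob_near y x : blob y x != 0 -> nrm (x - y) <= 2 * h.
Proof.
rewrite mulf_eq0 negb_or => /andP[_ hx]; apply: cell_nrm hx _.
by rewrite /cellf eqxx oner_eq0.
Qed.
Lemma blob_mean V y c e : lint V -> (forall x, nrm (x - y) <= 2 * h -> V x <= c + e) ->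
  I2 (fun x => blob y x * V x) <= c + e.
Proof.
move=> lV hV; have g := good_blob y.
have -> : c + e = I2 (fun x => (c + e) * blob y x) by rewrite I2Z ?I2_blob ?mulr1//; exact: good_ig.
apply: I2_le; [exact: lV|by apply: igZ; exact: good_ig|].
move=> x; have [->|bx0] := eqVneq (blob y x) 0; first by rewrite mul0r mulr0.
by rewrite mulrC; apply: ler_wpM2r; [exact: blob_ge0|apply: hV; exact: blob_near].
Qed.

Lemma blob_pair x y (d : R) : d <= nrm (x - y) -> 8 * h <= d -> 0 < d ->
  I4 nlg (blob x) (blob y) <= nlg (x - y) + 12 * h / d.
Proof.
move=> dxy hd d0.
have -> : nlg (x - y) + 12 * h / d = I4 (fun=> nlg (x - y) + 12 * h / d) (blob x) (blob y).
  rewrite I4_cst ?I2_blob ?mulr1//; exact: good_blob.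
apply: I4_le => //; [exact: ker_nlg|exact: ker_cst|exact: good_blob|exact: good_blob|exact: blob_ge0|exact: blob_ge0|].
move=> x' y' /blob_near hx /blob_near hy _.
have e : x' - y' - (x - y) = (x' - x) - (y' - y) by rewrite [LHS]surjective_pairing [RHS]surjective_pairing /=; congr pair; ring.
have n1 : nrm (x' - y' - (x - y)) <= 4 * h by rewrite e; apply: le_trans (nrmB _ _) _; lra.
have n2 : d / 2 <= nrm (x' - y').
  by have := nrm_lb (x - y) (x' - y'); rewrite nrmBC in n1; lra.
have p1 : x' - y' != 0 by rewrite -nrm_gt0; lra.
have p2 : x - y != 0 by rewrite -nrm_gt0; lra.
have := lg_lip_abs p2 p1; rewrite nrmBC => hl.
have r1 : rinv (x - y) <= d^-1 by rewrite lef_pV2 ?posrE// nrm_gt0.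
have r2 : rinv (x' - y') <= 2 / d.
  have -> : 2 / d = (d / 2)^-1 by rewrite invf_div.
  by rewrite lef_pV2 ?posrE ?nrm_gt0//; lra.
have : nrm (x' - y' - (x - y)) * (rinv (x - y) + rinv (x' - y')) <= 4 * h * (3 / d).
  apply: ler_pM => //; first exact: nrm_ge0.
    by rewrite addr_ge0 ?rinv_ge0.
  have -> : 3 / d = d^-1 + 2 / d by field; rewrite gt_eqF.
  exact: lerD.
have -> : 4 * h * (3 / d) = 12 * h / d by field; rewrite gt_eqF.
have := ler_norm (lg (x - y) - lg (x' - y')); rewrite /nlg; lra.
Qed.

Lemma blobs_state (s : seq R2) (d : R) : 8 * h <= d -> 0 < d ->
  (forall x y, x \in s -> y \in s -> x != y -> d <= nrm (x - y)) -> uniq s ->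
  exists E, Ach (size s) (fun z => \sum_(y <- s) blob y z) E /\
    E nlg <= pEs nlg s + 12 * h / d * (size s)%:R ^+ 2.
Proof.
move=> hd d0; elim: s => [|x s IH] hs us.
  exists (fun=> 0); split.
    have -> : (fun z => \sum_(y <- [::]) blob y z) = fun=> 0 by apply/funext => z; rewrite big_nil.
    by apply: Ach0; [exact: good0|by []|rewrite I20].
  by rewrite /= expr0n /= mulr0 addr0.
have /= /andP[xs us'] := us.
have [|E [aE hE]] := IH _ us'.
  by move=> y z ys zs; apply: hs; rewrite inE ?ys ?zs orbT.
have := AchM (Ach1 (good_blob x) (blob_ge0 x) (I2_blob x)) aE => a1.
eexists; split.
  have -> : (fun z => \sum_(y <- x :: s) blob y z) = (fun z => blob x z + \sum_(y <- s) blob y z).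
    by apply/funext => z; rewrite big_cons.
  exact: a1.
rewrite /= add0r (I4_sumr (@ker_nlg R)); [|exact: good_blob|exact: good_blob].
have : \sum_(y <- s) I4 nlg (blob x) (blob y) <= \sum_(y <- s) (nlg (x - y) + 12 * h / d).
  rewrite big_seq [leRHS]big_seq; apply: ler_sum => y ys; apply: blob_pair => //.
  by apply: hs; rewrite ?inE ?eqxx ?ys ?orbT//; apply: contraNneq xs => ->.
rewrite big_split /= sum_seq_const -[(size s).+1%:R]natr1.
set c := 12 * h / d in hE *; have c0 : 0 <= c by rewrite divr_ge0 ?(ltW d0)// mulr_ge0// ltW.
have : 0 <= (size s)%:R * c + c by rewrite addr_ge0// mulr_ge0.
have -> : c * ((size s)%:R + 1) ^+ 2 = c * (size s)%:R ^+ 2 + (size s)%:R * c + ((size s)%:R * c + c) by ring.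
lra.
Qed.
End grid.

Lemma min_dist (s : seq R2) : exists2 d : R, 0 < d & forall x y, x \in s -> y \in s -> x != y -> d <= nrm (x - y).
Proof.
elim: s => [|a s [d d0 hd]]; first by exists 1.
have [e e0 he] : exists2 e : R, 0 < e & forall y, y \in s -> y != a -> e <= nrm (a - y).
  elim: (s) => [|c t [e e0 he]]; first by exists 1.
  have [ca|ca] := eqVneq c a.
    by exists e => // y; rewrite inE => /orP[/eqP ->|/he//]; rewrite ca eqxx.
  exists (Num.min e (nrm (a - c))); first by rewrite lt_min e0 nrm_gt0 subr_eq0 eq_sym.
  move=> y; rewrite inE ge_min => /orP[/eqP ->|yt ya]; first by rewrite lexx orbT.
  by rewrite he.
exists (Num.min d e); first by rewrite lt_min d0.
move=> x y; rewrite !inE ge_min => /orP[/eqP ->|xs] /orP[/eqP ->|ys].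
- by rewrite eqxx.
- by move=> ay; rewrite he ?orbT// eq_sym.
- by move=> xa; rewrite nrmBC he ?orbT.
by move=> xy; rewrite hd.
Qed.
End Projection.

(** * Rotations and averages over roots of unity *)

Section Rotation.
Context {R : realType}.
Local Notation R2 := (R * R)%type.
Implicit Types (x y z u : R2) (f g : R2 -> R).

Lemma I4_nlg f g : good f -> good g -> I4 nlg f g = - I4 lg f g.
Proof.
move=> gf gg; have -> : nlg = (fun x : R2 => -1 * lg x) by apply/funext => x; rewrite mulN1r.
by rewrite I4_kerZ ?mulN1r//; exact: ker_lg.
Qed.
Lemma pot_nlg f x : good f -> pot nlg f x = - pot lg f x.
Proof.
move=> gf; rewrite /pot -I2N; last exact: (ig_pot (@ker_lg R)).
by apply: eq_I2 => y; rewrite mulNr.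
Qed.

Definition cbox (t : R) x : R := [&& - t <= x.1, x.1 < t, - t <= x.2 & x.2 < t]%:R.
Lemma gidx_cbox (h : R) n x : 0 < h -> (fl (sc h^-1 x) \in gidx n)%:R = cbox (n%:R * h) x :> R.
Proof.
move=> h0; rewrite mem_gidx /cbox /=; congr (nat_of_bool _)%:R.
have p (v : R) : (- n%:Z <= Num.floor (h^-1 * v)) = (- (n%:R * h) <= v).
  by rewrite floor_ge_int intrN ler_pdivlMl// mulrN mulrC.
have q (v : R) : (Num.floor (h^-1 * v) < n%:Z) = (v < n%:R * h).
  by rewrite floor_lt_int ltr_pdivrMl// mulrC.
by rewrite !p !q.
Qed.

Lemma zidx_shift n (i : int * int) : (i - (n%:Z, n%:Z) \in gidx n) = (i \in zidx (2 * n)).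
Proof. by rewrite mem_gidx mem_zidx; case: i => x y /=; lia. Qed.

Lemma good_01 f r : measurable_fun setT f -> (forall x, 0 <= f x <= 1) ->
  (forall x, f x != 0 -> nrm x <= r) -> good f.
Proof.
move=> mf f01 hf; split => //; exists (`|r| + 1) => x.
have [->|fx] := eqVneq (f x) 0.
  by rewrite normr0 mulr_ge0 ?ind_ge0// addr_ge0.
have hb : bx (`|r| + 1) x.
  by apply: bx_nrm; apply: le_trans (hf _ fx) _; apply: le_trans (ler_norm r) _; rewrite lerDl.
rewrite indT// mulr1; have /andP[f0 f1] := f01 x; rewrite ger0_norm//.
by apply: (le_trans f1); rewrite lerDr.
Qed.

Section unit.
Variable u : R2.
Hypothesis u1 : nsq u = 1.
Lemma nrm_u x : nrm (cm u x) = nrm x. Proof. by rewrite nrm_cm unit_nrm// mul1r. Qed.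
Lemma cm_uK x : cm (conj u) (cm u x) = x.
Proof. by rewrite cmA (cmC (conj u)) cm_conj u1 cm1. Qed.
Lemma nrm_cu x : nrm (cm (conj u) x) = nrm x.
Proof. by rewrite nrm_cm nrm_conj unit_nrm// mul1r. Qed.
Lemma lg_u x y : lg (cm u x - cm u y) = lg (x - y).
Proof. by rewrite -cmBr /lg nrm_u. Qed.
Definition rot f x := f (cm (conj u) x).
Lemma I2_u f : ig f -> I2 (fun x => f (cm u x)) = I2 f.
Proof. by move=> hf; rewrite I2_cm ?u1 ?oner_eq0// invr1 mul1r. Qed.
Lemma measurable_rot f : measurable_fun setT f -> measurable_fun setT (rot f).
Proof. by move=> mf; apply: (measurableT_comp mf); exact: measurable_cm. Qed.
Lemma pot_rot f x : good (rot f) -> pot lg (rot f) (cm u x) = pot lg f x.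
Proof.
move=> gf; rewrite /pot -(I2_u (ig_pot (@ker_lg R) _ gf)); apply: eq_I2 => y.
by rewrite lg_u /rot cm_uK.
Qed.
Lemma I4_rot f : good (rot f) -> I4 lg (rot f) (rot f) = I4 lg f f.
Proof.
move=> gf; rewrite !I4E -(I2_u (pot_lint (@ker_lg R) gf gf)); apply: eq_I2 => y.
by rewrite pot_rot// /rot cm_uK.
Qed.
Lemma I2_rot f : good (rot f) -> I2 (rot f) = I2 f.
Proof. by move=> gf; rewrite -(I2_u (good_ig gf)); apply: eq_I2 => y; rewrite /rot cm_uK. Qed.
Lemma pot_rot_far f z : good (rot f) -> pot lg (rot f) z = I2 (fun y => lg (z - cm u y) * f y).
Proof.
move=> gf; rewrite /pot -(I2_u (ig_pot (@ker_lg R) _ gf)); apply: eq_I2 => y.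
by rewrite /rot cm_uK.
Qed.
Lemma pEs_rot (s : seq R2) : pEs nlg [seq cm u y | y <- s] = pEs nlg s.
Proof.
elim: s => //= x s ->; congr (_ + _); rewrite big_map; apply: eq_bigr => y _.
by rewrite /nlg lg_u.
Qed.
End unit.

(** The product over the roots is [z^n - y^n], whose modulus is within a factor 2 of [|z|^n] when
    [|y| <= |z| / 2]. The error [ln 2] is for the sum over all [2^p] rotations, so the average is
    radial up to [ln 2 / 2^p]. *)
Lemma avg_far p w : size w = (2 ^ p)%N -> (forall u, u \in w -> nsq u = 1) ->
  (forall A B, (forall u, u \in w -> A - cm u B != 0) ->
    sqn p A - sqn p B != 0 /\ \sum_(u <- w) lg (A - cm u B) = lg (sqn p A - sqn p B)) ->
  forall z y, z != 0 -> 2 * nrm y <= nrm z ->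
  `|\sum_(u <- w) lg (z - cm u y) - (size w)%:R * lg z| <= ln 2.
Proof.
move=> sw w1 wP z y z0 yz; have nz : 0 < nrm z by rewrite nrm_gt0.
have ny := nrm_ge0 y.
have [|q0 ->] := wP z y.
  by move=> u uw; rewrite -nrm_gt0; have := nrm_lb z (cm u y); rewrite nrm_u ?w1//; lra.
rewrite sw; set n := (2 ^ p)%N.
have n0 : (0 < n)%N by rewrite expn_gt0.
have e : nrm (sqn p y) <= nrm (sqn p z) / 2.
  rewrite !nrm_sqn -/n; have : (2 * nrm y) ^+ n <= nrm z ^+ n by rewrite lerXn2r ?nnegrE ?mulr_ge0 ?nrm_ge0.
  have : 2 * nrm y ^+ n <= (2 * nrm y) ^+ n.
    rewrite exprMn; apply: ler_wpM2r; first exact: exprn_ge0.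
    by rewrite -{1}[2]expr1; apply: ler_weXn2l => //; lra.
  lra.
have zn : 0 < nrm (sqn p z) by rewrite nrm_sqn exprn_gt0.
have lgz : n%:R * lg z = ln (nrm (sqn p z)) by rewrite nrm_sqn lnXn// mulr_natl.
rewrite lgz.
have b1 := nrm_lb (sqn p z) (sqn p y); have b2 := nrmB (sqn p z) (sqn p y).
have p0 : 0 < nrm (sqn p z - sqn p y) by rewrite nrm_gt0.
rewrite -[lg _]/(ln _) -ln_div ?posrE// ler_norml -lnV ?posrE// !ler_ln ?posrE ?invr_gt0 ?divr_gt0//.
rewrite ler_pdivlMr// ler_pdivrMr//; apply/andP; split; lra.
Qed.
End Rotation.

(* A confined configuration, smeared and rotated by [2 ^ p]-th roots of unity, sits in the
   middle of a box filled with nearly optimal squares; the average over the rotations is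
   almost radial, hence its potential and that of the charge it replaces nearly agree outside. *)
Section Tile.
Context {R : realType}.
Local Notation R2 := (R * R)%type.
Variables (N m k : nat) (s : seq R2) (jm dl : R).
Hypothesis N0 : (0 < N)%N.
Hypothesis sN : size s = N.
Hypothesis us : uniq s.
Let rN : R := Num.sqrt N%:R.
Hypothesis hs : forall x, x \in s -> nrm x <= 2 * rN.
Hypothesis hm : exS m jm.
Hypothesis dl0 : 0 <= dl.
Hypothesis hjm : jm <= (e0 + dl) * (m ^ 2)%:R.
Variable t : R.
Hypothesis tE : t = k%:R * m%:R.
(** Outside the box [|z| >= 4 sqrt N], twice the radius of the confined configuration: the condition
    of [avg_far]. *)
Hypothesis ht : 4 * rN <= t.
Let b : R2 -> R := bsq N.
Let Sn := (2 * (k * m))%N.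
Let Cr : R := kap + Sn%:R ^+ 2.
Let c : R := ln (2 * Sn%:R + 1).
(** [(rN + 8 m)^2 - N], the area of an enlarged rotated background minus its own: a bound for what
    the squares of side [m] leave uncovered. *)
Let rho : R := 16 * m%:R * rN + 64 * m%:R ^+ 2.
Let J2 : R := (e0 + dl) * (Sn%:R ^+ 2 - N%:R) + (`|e0 + dl| + c / 2) * rho.
Variables (d : R) (p : nat) (w : seq R2) (a2 : nat).
Hypothesis d0 : 0 < d.
Hypothesis hd : forall x y, x \in s -> y \in s -> x != y -> d <= nrm (x - y).
Hypothesis sw : size w = (2 ^ p)%N.
Hypothesis w1 : forall u, u \in w -> nsq u = 1.
Hypothesis wP : forall A B, (forall u, u \in w -> A - cm u B != 0) ->
    sqn p A - sqn p B != 0 /\ \sum_(u <- w) lg (A - cm u B) = lg (sqn p A - sqn p B).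
Hypothesis a20 : (0 < a2)%N.
Variable h : R.
Hypothesis hE : h = Sn%:R / (2 * a2)%:R.
Hypothesis hd8 : 8 * h <= d.
Hypothesis h12 : h <= 1 / 2.

Let m0 : (0 < m)%N. Proof. by case: hm. Qed.
Let m0' : 0 < m%:R :> R. Proof. by rewrite ltr0n. Qed.
Let rN1 : 1 <= rN. Proof. by rewrite /rN -[X in X <= _]sqrtr1 ler_sqrt// ler1n. Qed.
Let t0 : 0 < t. Proof. by have := rN1; have := ht; lra. Qed.
Let a20' : 0 < a2%:R :> R. Proof. by rewrite ltr0n. Qed.
Let SnE : Sn%:R = 2 * t :> R. Proof. by rewrite tE /Sn !natrM. Qed.
Let Sn0 : 0 < Sn%:R :> R. Proof. by rewrite SnE mulr_gt0. Qed.
Let h0 : 0 < h. Proof. by rewrite hE divr_gt0// ltr0n muln_gt0 a20. Qed.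
Let ah : a2%:R * h = t. Proof. by rewrite hE SnE natrM; field; rewrite gt_eqF. Qed.
Let hm1 : h <= m%:R. Proof. apply: (le_trans h12); apply: (@le_trans _ _ 1); [lra|by rewrite ler1n]. Qed.
Let B := cbox t.
Let BE x : B x = (fl (sc h^-1 x) \in gidx a2)%:R. Proof. by rewrite gidx_cbox// ah. Qed.
Let BmE x : B x = (fl (sc m%:R^-1 x) \in gidx k)%:R. Proof. by rewrite gidx_cbox// -tE. Qed.
Let Bsum x : B x = \sum_(i <- gidx a2) cellf h i x.
Proof. by rewrite cell_sum ?uniq_gidx// BE. Qed.
Let gB : good B.
Proof.
have -> : B = fun x => \sum_(i <- gidx a2) cellf h i x by apply/funext => x; exact: Bsum.
by apply: good_sum => i; exact: good_cell.
Qed.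
Let hsz : (size (gidx a2))%:R * h ^+ 2 = Sn%:R ^+ 2.
Proof. by rewrite hE size_gidx !natrM; field; rewrite gt_eqF. Qed.
Let I2_B : I2 B = Sn%:R ^+ 2.
Proof.
have -> : B = fun x => \sum_(i <- gidx a2) cellf h i x by apply/funext => x; exact: Bsum.
rewrite I2_sum => [|i]; last by apply: good_ig; exact: good_cell.
by rewrite -hsz -sum_seq_const; apply: eq_bigr => i _; rewrite I2_cell.
Qed.
Let B01 x : 0 <= B x <= 1. Proof. by rewrite /B /cbox; case: [&& _, _, _ & _]; rewrite ?lexx ?ler01. Qed.
Let B_far z : B z = 0 -> t <= nrm z.
Proof.
rewrite /B /cbox; case: (boolP [&& _, _, _ & _]) => [_ /eqP|hz _]; first by rewrite oner_eq0.
rewrite leNgt; apply: contraNN hz => zt; have := nrm_ge1 z; have := nrm_ge2 z.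
rewrite !ler_norml => /andP[h1 h2] /andP[h3 h4].
by apply/and4P; split; lra.
Qed.
Let B_in z : nrm z < t -> B z = 1.
Proof.
move=> zt; rewrite /B /cbox; have := nrm_ge1 z; have := nrm_ge2 z.
rewrite !ler_norml => /andP[h1 h2] /andP[h3 h4].
by have -> : [&& - t <= z.1, z.1 < t, - t <= z.2 & z.2 < t] by apply/and4P; split; lra.
Qed.
Let B_diam x y : B x != 0 -> B y != 0 -> nrm (x - y) <= 2 * Sn%:R.
Proof.
rewrite /B /cbox; case: (boolP [&& _, _, _ & _]) => [/and4P[x1 x2 x3 x4] _|_]; last by rewrite eqxx.
case: (boolP [&& _, _, _ & _]) => [/and4P[y1 y2 y3 y4] _|_]; last by rewrite eqxx.
apply: le_trans (nrm_le _) _; rewrite SnE /=.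
have : `|x.1 - y.1| <= 2 * t by rewrite ler_norml; apply/andP; split; lra.
have : `|x.2 - y.2| <= 2 * t by rewrite ler_norml; apply/andP; split; lra.
lra.
Qed.

Section oneroot.
Variable u : R2.
Hypothesis uw : u \in w.
Let u1 := w1 uw.
Let bu := rot u b.
Let bu01 x : 0 <= bu x <= 1. Proof. by rewrite ind_ge0 ind_le1. Qed.
Let bu_nrm x : bu x != 0 -> nrm x <= rN.
Proof. by move/bsq_nrm; rewrite nrm_cu. Qed.
Lemma good_bu : good bu.
Proof.
apply: (good_01 (r := rN)) => //.
by apply: measurable_rot; apply: good_meas; exact: good_bsq.
Qed.
Let gbu := good_bu.
Let buZ x : bu x != 0 -> fl (sc h^-1 x) \in gidx a2.
Proof.
move/bu_nrm => hx; have : B x = 1.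
  by apply: B_in; have := rN1; have := ht; lra.
move: hx => _.
by rewrite BE; case: (_ \in _) => // /eqP; rewrite eq_sym oner_eq0.
Qed.
Let g := Pj h (gidx a2) bu.
Let gg : good g. Proof. exact: good_Pj. Qed.
Let I2_bu : I2 bu = N%:R. Proof. by rewrite /bu I2_rot// I2_bsq. Qed.
Let I2_g : I2 g = N%:R. Proof. by rewrite /g (I2_Pj h0 (uniq_gidx a2) gbu bu01 buZ). Qed.
Let g_ge0 x : 0 <= g x.
Proof. by have /andP[] := Pj01 h0 (uniq_gidx a2) gbu bu01 x. Qed.
Let g_leB x : g x <= B x.
Proof. by rewrite BE; have /andP[] := Pj01 h0 (uniq_gidx a2) gbu bu01 x. Qed.
Lemma pot_g x : `|pot lg bu x - pot lg g x| <= 4 * h * Cr.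
Proof. by have := pot_Pj h0 (uniq_gidx a2) gbu bu01 buZ x; rewrite hsz. Qed.

Definition vu x : R := \sum_(y <- s) blob h (cm u y) x - g x.

Let NS : N%:R <= Sn%:R ^+ 2 :> R.
Proof. 
rewrite -sqr_sqrtN -/rN lerXn2r ?nnegrE ?sqrtr_ge0 ?(ltW Sn0)// SnE.
by have := rN1; have := ht; lra.
Qed.

(** Smearing the pairs costs [12 h N^2 / d]. In the background terms, smearing the particles and
    projecting the background cost [8 h Cr N], and half the change of the background energy under
    projection costs [4 h Cr N]. *)
Lemma core_state : JA nlg N (fun x => \sum_(y <- s) blob h (cm u y) x) g
  (eJ b s + (12 * h / d * N%:R ^+ 2 + 12 * h * Cr * N%:R)).
Proof.
have knl := @ker_nlg R; have kl := @ker_lg R.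
have [||E [aE hEE]] := @blobs_state R h h0 [seq cm u y | y <- s] d hd8 d0.
- move=> _ _ /mapP[x xs ->] /mapP[y ys ->] xy; rewrite -cmBr nrm_u//; apply: hd => //.
  by apply: contraNneq xy => ->.
- by rewrite map_inj_uniq// => x y e; rewrite -(cm_uK u1 x) e cm_uK.
exists E; split.
  have := aE; rewrite size_map sN; congr (Ach _ _ _).
  by apply/funext => x; rewrite big_map.
have gs : good (fun x => \sum_(y <- s) blob h (cm u y) x) by apply: good_sum => y; exact: good_blob.
rewrite !I4_nlg// opprK.
have Cr0 : 0 <= Cr by rewrite addr_ge0 ?kap_ge0 ?sqr_ge0.
have e1 : I4 lg (fun x => \sum_(y <- s) blob h (cm u y) x) g <= \sum_(y <- s) (pot lg b y + 8 * h * Cr).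
  rewrite (I4_suml kl)// => [|y]; last exact: good_blob.
  apply: ler_sum => y _; rewrite I4E; apply: blob_mean => //; first exact: (pot_lint kl).
  move=> x hx; rewrite -(pot_rot u1 y gbu).
  have := pot_g x; rewrite distrC => p1; have := le_trans (ler_norm _) p1.
  have p2 := pot_lip x (cm u y) gbu gbu (fun y => ltac:(by rewrite ger0_norm//; case/andP: (bu01 y))).
  have := le_trans (ler_norm _) p2.
  have q z : pot rinv bu z <= Cr.
    by apply: le_trans (pot_rinv _ gbu bu01) _; rewrite lerD2l I2_bu.
  have q0 z : 0 <= pot rinv bu z.
    by apply: I2_ge0 => x'; rewrite mulr_ge0 ?rinv_ge0//; case/andP: (bu01 x').
  have : nrm (x - cm u y) * (pot rinv bu x + pot rinv bu (cm u y)) <= 2 * h * (Cr + Cr).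
    by apply: ler_pM => //; [exact: nrm_ge0|exact: addr_ge0|exact: lerD].
  rewrite -/bu; lra.
have e2 : I4 lg bu bu - I4 lg g g <= 8 * h * Cr * N%:R.
  have -> : I4 lg bu bu - I4 lg g g = I2 (fun x => (bu x + g x) * (pot lg bu x - pot lg g x)).
    transitivity (I4 lg bu bu + I4 lg g bu - (I4 lg bu g + I4 lg g g)).
      by rewrite (I4C kl gbu gg); ring.
    rewrite -!(I4Dl kl)// !I4E -I2B; [|apply: (pot_lint kl) => //; exact: goodD..].
    by apply: eq_I2 => x; rewrite mulrBr.
  have -> : 8 * h * Cr * N%:R = I2 (fun x => 4 * h * Cr * (bu x + g x)).
    rewrite I2Z ?I2D ?I2_bu ?I2_g//; try exact: good_ig; first by ring.
    by apply: igD; exact: good_ig.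
  apply: I2_le.
  - have := lintD (pot_lint kl gbu) (lintZ (-1) (pot_lint kl gg)) (goodD gbu gg).
    by apply: eq_ig => x; rewrite mulN1r.
  - by apply: igZ; apply: igD; exact: good_ig.
  move=> x; rewrite mulrC; apply: ler_wpM2r; first by rewrite addr_ge0//; case/andP: (bu01 x).
  by apply: le_trans (ler_norm _) _; exact: pot_g.
rewrite (I4_rot u1 gbu) in e2.
rewrite size_map sN (pEs_rot u1) in hEE.
rewrite big_split /= sum_seq_const sN in e1.
rewrite /eJ -/b.
have -> : 12 * h * Cr * N%:R = 8 * h * Cr * N%:R + 4 * h * Cr * N%:R by ring.
have r1 : N%:R * (8 * h * Cr) = 8 * h * Cr * N%:R by ring.
rewrite r1 in e1.
have r2 : 8 * h * Cr * N%:R = 2 * (4 * h * Cr * N%:R) by ring.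
rewrite {1}r2 in e2.
lra.
Qed.

Let A x := B x - g x.
Let gA : good A. Proof. exact: goodB. Qed.
Let gd := [seq i <- gidx k | `[< forall x, cellf m%:R i x != 0 -> g x = 0 >]].
Let ugd : uniq gd. Proof. by rewrite filter_uniq// uniq_gidx. Qed.
Let gd_leA x : ((fl (sc m%:R^-1 x) \in gd)%:R : R) <= A x.
Proof.
have [|_] := boolP (_ \in gd); last by rewrite subr_ge0.
rewrite mem_filter => /andP[/asboolP hx ik]; rewrite /A hx ?subr0; last by rewrite /cellf eqxx oner_eq0.
by rewrite BmE ik.
Qed.
Let N' := (Sn ^ 2 - N)%N.
Let NS' : (N <= Sn ^ 2)%N. Proof. by rewrite -(ler_nat R) natrX. Qed.
Let I2_A : I2 A = N'%:R.
Proof. by rewrite I2B ?I2_B ?I2_g ?natrB ?natrX//; exact: good_ig. Qed.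
Let I2_gd : I2 (fun x => ((fl (sc m%:R^-1 x) \in gd)%:R : R)) = (m ^ 2 * size gd)%:R.
Proof.
transitivity (I2 (fun x => \sum_(i <- gd) cellf (m%:R : R) i x)).
  by apply: eq_I2 => x; rewrite cell_sum.
rewrite I2_sum => [|i]; last by apply: good_ig; exact: good_cell.
by rewrite natrM mulrC -sum_seq_const natrX; apply: eq_bigr => i _; rewrite I2_cell.
Qed.
Let good_gd : good (fun x => (fl (sc m%:R^-1 x) \in gd)%:R : R).
Proof.
have -> : (fun x => (fl (sc m%:R^-1 x) \in gd)%:R : R) = (fun x => \sum_(i <- gd) cellf m%:R i x).
  by apply/funext => x; rewrite cell_sum.
by apply: good_sum => i; exact: good_cell.
Qed.
Let gd_le : (m ^ 2 * size gd <= N')%N.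
Proof.
rewrite -(ler_nat R) -I2_gd -I2_A; apply: I2_le => //; exact: good_ig.
Qed.
Lemma leftover : (N' - m ^ 2 * size gd)%:R <= rho.
Proof.
pose big x : R := rot u \1_(bx (rN / 2 + 4 * m%:R)) x.
have gbig : good big.
  apply: (good_01 (r := 2 * (rN / 2 + 4 * m%:R))).
  - by apply: measurable_rot; apply: measurable_ind; exact: measurable_bx.
  - by move=> x; rewrite ind_ge0 ind_le1.
  move=> x hx; rewrite -(nrm_cu u1); apply: nrm_bx; apply: contrapT => hn.
  by move: hx; rewrite /big /rot indF ?eqxx.
have I2big : I2 big = (rN + 8 * m%:R) ^+ 2.
  rewrite /big I2_rot// I2_ind; last exact: measurable_bx.
  rewrite leb2_bx /=; first by congr (_ ^+ _); field.
  by rewrite addr_ge0 ?mulr_ge0 ?divr_ge0 ?sqrtr_ge0.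
have : I2 (fun x => B x - ((fl (sc m%:R^-1 x) \in gd)%:R : R)) <= I2 big.
  apply: I2_le; [by apply: igB; exact: good_ig|exact: good_ig|].
  move=> x; have big0 : 0 <= big x by exact: ind_ge0.
  rewrite BmE; have [ik|_] := boolP (_ \in gidx k); last by rewrite sub0r; apply: le_trans big0; rewrite oppr_le0.
  have [_|] := boolP (_ \in gd); first by rewrite subrr.
  rewrite mem_filter ik andbT => /asboolPn hn; rewrite subr0.
  have [x' cx' gx'] : exists2 x', cellf m%:R (fl (sc m%:R^-1 x)) x' != 0 & g x' != 0.
    apply: contrapT => h'; apply: hn => x' cx'; apply/eqP/negPn/negP => gx'; apply: h'.
    by exists x'.
  have [y by0 yx'] := Pj_supp h0 gx'.
  have n1 : nrm (x - x') <= 2 * m%:R.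
    by apply: (cell_nrm m0' _ cx'); rewrite /cellf eqxx oner_eq0.
  have n2 : nrm (x - y) <= 4 * m%:R.
    have -> : x - y = (x - x') + (x' - y) by rewrite addrA subrK.
    by apply: le_trans (nrmD _ _) _; have := hm1; lra.
  rewrite /big /rot indT//.
  have hy : bx (rN / 2) (cm (conj u) y).
    by apply: contrapT => hz; move: by0; rewrite /bu /rot /b /bsq indF ?eqxx.
  have n3 : nrm (cm (conj u) x - cm (conj u) y) <= 4 * m%:R by rewrite -cmBr nrm_cu.
  have := nrm_ge1 (cm (conj u) x - cm (conj u) y); have := nrm_ge2 (cm (conj u) x - cm (conj u) y).
  case: hy => /=; rewrite /bx /= !ler_norml => /andP[y1 y2] /andP[y3 y4] /andP[z1 z2] /andP[z3 z4].
  by split; apply/andP; split; lra.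
rewrite I2B ?I2_B ?I2_gd ?I2big; try exact: good_ig.
rewrite natrB// natrB// natrX.
have := sqr_sqrtN N; rewrite -/rN /rho => e.
have -> : (rN + 8 * m%:R) ^+ 2 = rN ^+ 2 + (16 * m%:R * rN + 64 * m%:R ^+ 2) by ring.
rewrite e; move: ((m ^ 2 * size gd)%:R : R) (Sn%:R ^+ 2 : R) (N%:R : R) (16 * _ * _ + _) => q1 q2 q3 q4; lra.
Qed.

Lemma fluid_state : JA nlg N' A A J2.
Proof.
have c0 : 0 <= c by apply: ln_ge0; have := Sn0; lra.
have [_ jm'] := hm.
apply: JA_le (JA_fill (@ker_nlg R) m0' gA ugd c0 gd_leA I2_A _ gd_le _ jm') _.
- by rewrite natrX.
- move=> x y hx hy _; apply: nlg_ge; first by have := Sn0; lra.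
  have pA z : A z != 0 -> B z != 0.
    apply: contraNneq => e; have := g_leB z; have := g_ge0 z; rewrite /A e sub0r oppr_eq0 => q1 q2.
    by apply/eqP; lra.
  by have := B_diam (pA _ hx) (pA _ hy); lra.
have lo := leftover; set r := (N' - m ^ 2 * size gd)%N in lo *.
have r0 : 0 <= r%:R :> R by [].
have e : (m ^ 2)%:R * (size gd)%:R = N'%:R - r%:R :> R by rewrite /r (natrB _ gd_le) opprB addrC subrK natrM.
have : (size gd)%:R * jm <= (e0 + dl) * (N'%:R - r%:R).
  have -> : (e0 + dl) * (N'%:R - r%:R) = (size gd)%:R * ((e0 + dl) * (m ^ 2)%:R) by rewrite -e; ring.
  by apply: ler_wpM2l.
rewrite /J2 (_ : N'%:R = Sn%:R ^+ 2 - N%:R); last by rewrite natrB// natrX.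
set X := Sn%:R ^+ 2 - N%:R; rewrite mulrBr.
have : - ((e0 + dl) * r%:R) <= `|e0 + dl| * r%:R.
  by rewrite -mulNr; apply: ler_wpM2r => //; rewrite -normrN ler_norm.
have : (`|e0 + dl| + c / 2) * r%:R <= (`|e0 + dl| + c / 2) * rho.
  by apply: ler_wpM2l => //; rewrite addr_ge0// divr_ge0.
rewrite mulrDl; move: ((e0 + dl) * _) ((e0 + dl) * _) (`|_| * r%:R) => q1 q2 q3.
have -> : r%:R / 2 * c = c / 2 * r%:R by ring.
lra.
Qed.

Lemma root_state : JA nlg (Sn ^ 2) (fun x => B x + vu x) B
  (J2 + (eJ b s + (12 * h / d * N%:R ^+ 2 + 12 * h * Cr * N%:R))).
Proof.
have := JAM (@ker_nlg R) gA gg fluid_state core_state.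
rewrite I4_00l => [|x]; last by rewrite subrr.
rewrite addr0 subnK// => q; apply: JA_ext q _ _ => x; rewrite /A.
  by rewrite /vu; ring.
by rewrite subrK.
Qed.

Lemma I2_vu : I2 vu = 0.
Proof.
rewrite I2B; [|apply: good_ig; apply: good_sum => y; exact: good_blob|exact: good_ig].
rewrite I2_sum => [|y]; last by apply: good_ig; exact: good_blob.
under eq_bigr => y _ do rewrite I2_blob//.
by rewrite sum_seq_const sN mulr1 I2_g subrr.
Qed.
Lemma vu_ge x : - B x <= vu x.
Proof.
rewrite /vu; have := g_leB x; have : 0 <= \sum_(y <- s) blob h (cm u y) x.
  by apply: sumr_ge0 => y _; exact: blob_ge0.
lra.
Qed.
Lemma pot_vu z : B z = 0 ->
  `|pot lg vu z - (\sum_(y <- s) lg (z - cm u y) - I2 (fun y => lg (z - cm u y) * b y))| <= 4 * h * N%:R + 4 * h * Cr.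
Proof.
move=> Bz; have kl := @ker_lg R; have zt := B_far Bz.
have -> : pot lg vu z = \sum_(y <- s) pot lg (blob h (cm u y)) z - pot lg g z.
  rewrite /vu -(pot_sum kl) => [|y]; last exact: good_blob.
  rewrite /pot -I2B; [|apply: (ig_pot kl); apply: good_sum => y; exact: good_blob|exact: (ig_pot kl)].
  by apply: eq_I2 => y; rewrite mulrBr.
rewrite -pot_rot_far//.
have -> : \sum_(y <- s) pot lg (blob h (cm u y)) z - pot lg g z - (\sum_(y <- s) lg (z - cm u y) - pot lg (rot u b) z) =
   \sum_(y <- s) (pot lg (blob h (cm u y)) z - lg (z - cm u y)) + (pot lg bu z - pot lg g z).
  by rewrite sumrB -/bu; ring.
apply: le_trans (ler_normD _ _) _; apply: lerD (pot_g z).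
apply: le_trans (ler_norm_sum _ _ _) _.
have -> : 4 * h * N%:R = \sum_(y <- s) (4 * h) by rewrite sum_seq_const sN mulrC.
rewrite big_seq [leRHS]big_seq; apply: ler_sum => y ys.
have ny : nrm (cm u y) <= 2 * rN by rewrite nrm_u// hs.
have lV : lint (fun x => lg (z - x)) := lint_ker kl z.
have V x : nrm (x - cm u y) <= 2 * h -> `|lg (z - x) - lg (z - cm u y)| <= 4 * h.
  move=> hx.
  have n1 : 1 <= nrm (z - cm u y) by have := nrm_lb z (cm u y); have := rN1; have := ht; lra.
  have n2 : 1 <= nrm (z - x).
    have := nrm_lb z x; have := nrmD (x - cm u y) (cm u y); rewrite subrK; have := rN1; have := ht; have := h12; lra.
  have p1 : z - x != 0 by rewrite -nrm_gt0; lra.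
  have p2 : z - cm u y != 0 by rewrite -nrm_gt0; lra.
  apply: le_trans (lg_lip_abs p1 p2) _.
  have -> : z - x - (z - cm u y) = - (x - cm u y) by rewrite opprB addrC addrA subrK opprB.
  rewrite nrmN; have -> : 4 * h = 2 * h * (1 + 1) by ring.
  apply: ler_pM => //; first exact: nrm_ge0.
    by rewrite addr_ge0 ?rinv_ge0.
  by apply: lerD; rewrite /rinv invf_le1//; lra.
have e : pot lg (blob h (cm u y)) z = I2 (fun x => blob h (cm u y) x * lg (z - x)).
  by apply: eq_I2 => x; rewrite mulrC.
rewrite e ler_norml; apply/andP; split.
  have lV' : lint (fun x => - lg (z - x)).
    by have := lintZ (-1) lV; congr lint; apply/funext => x; rewrite mulN1r.
  have := blob_mean h0 (y := cm u y) (c := - lg (z - cm u y)) (e := 4 * h) lV'.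
  rewrite (_ : I2 (fun x => blob h (cm u y) x * - lg (z - x)) = - I2 (fun x => blob h (cm u y) x * lg (z - x))); last first.
    by rewrite -I2N; [apply: eq_I2 => x; rewrite mulrN|apply: lV; exact: good_blob].
  suff q : forall x, nrm (x - cm u y) <= 2 * h -> - lg (z - x) <= - lg (z - cm u y) + 4 * h by move=> /(_ q); lra.
  by move=> x /V; rewrite ler_norml => /andP[]; lra.
have := blob_mean h0 (y := cm u y) (c := lg (z - cm u y)) (e := 4 * h) lV.
suff q : forall x, nrm (x - cm u y) <= 2 * h -> lg (z - x) <= lg (z - cm u y) + 4 * h by move=> /(_ q); lra.
by move=> x /V; rewrite ler_norml => /andP[]; lra.
Qed.
End oneroot.

Let w0 : (0 < size w)%N. Proof. by rewrite sw expn_gt0. Qed.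
Let wr : (size w)%:R != 0 :> R. Proof. by rewrite pnatr_eq0 -lt0n. Qed.
Let v x : R := (size w)%:R^-1 * \sum_(u <- w) vu u x.
Let gvu u : good (vu u).
Proof.
apply: goodB; first by apply: good_sum => y; exact: good_blob.
exact: good_Pj.
Qed.
Let gv : good v.
Proof. by apply: goodZ; exact: good_sum. Qed.
Let Jt : R := J2 + (eJ b s + (12 * h / d * N%:R ^+ 2 + 12 * h * Cr * N%:R)).
Let tile_state : JA nlg (Sn ^ 2) (fun x => B x + v x) B Jt.
Proof.
have := JA_mix (@ker_nlg R) (j := fun=> Jt) gB w0 root_state.
rewrite sum_seq_const mulKf// => q; apply: JA_ext q _ _ => // x.
by rewrite big_split /= sum_seq_const mulrDr mulKf.
Qed.
Let I2_v : I2 v = 0.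
Proof.
rewrite I2Z; last by apply: good_ig; exact: good_sum.
rewrite I2_sum => [|u]; last exact: good_ig.
by rewrite big1_seq ?mulr0// => u /andP[_ uw]; exact: I2_vu.
Qed.
Let v_ge x : - B x <= v x.
Proof.
have -> : - B x = (size w)%:R^-1 * \sum_(u <- w) - B x by rewrite sum_seq_const mulKf.
apply: ler_wpM2l; first by rewrite invr_ge0.
by rewrite big_seq [leRHS]big_seq; apply: ler_sum => u uw; exact: vu_ge.
Qed.
Let W (i : int * int) : R := (size w)%:R^-1 * \sum_(u <- w)
  (\sum_(y <- s) (h ^+ 2)^-1 * (i == fl (sc h^-1 (cm u y)))%:R -
   \sum_(i' <- gidx a2) (h ^+ 2)^-1 * I2 (fun y => rot u b y * cellf h i' y) * (i == i')%:R).
Let vE : v = gf h W. Proof. by apply/funext => x. Qed.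
Let W_supp i : W i != 0 -> i \in gidx a2.
Proof.
apply: contraNT => hi; apply/eqP; rewrite /W big1_seq ?mulr0// => u /andP[_ uw].
rewrite !big1_seq ?subr0// => [i' /andP[_ hi']|y /andP[_ ys]].
  by case: eqP => [e|_]; rewrite ?mulr0//; rewrite -e (negbTE hi) in hi'.
case: eqP => [e|_]; rewrite ?mulr0//.
have : B (cm u y) = 1.
  apply: B_in; rewrite nrm_u ?w1//; have := hs ys; have := rN1; have := ht; lra.
by rewrite BE -e (negbTE hi) => /eqP; rewrite eq_sym oner_eq0.
Qed.
Let i0 : int * int := (a2%:Z, a2%:Z).
Let w' i := W (i - i0).
Let w'_supp i : w' i != 0 -> i \in zidx (2 * a2).
Proof.
by move/W_supp; rewrite zidx_shift.
Qed.
Let gfw x : gf h w' x = v (x - sc h (zr i0)).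
Proof. by rewrite vE gf_shift. Qed.
Let cellw x : cellf (Sn%:R : R) 0 x = B (x - sc h (zr i0)).
Proof.
have -> : B = gf h (fun i => (i \in gidx a2)%:R) by apply/funext => z; rewrite BE.
have -> : Sn%:R = (2 * a2)%:R * h :> R by rewrite hE mulrC divfK// pnatr_eq0 -lt0n muln_gt0.
rewrite (cell_zidx h) ?muln_gt0// (gf_shift h0).
by transitivity ((fl (sc h^-1 x) \in zidx (2 * a2))%:R : R); rewrite // -zidx_shift.
Qed.

(** After averaging over the rotations, the [N] particles and the background of mass [N] both have
    potential [N lg z] up to [N ln 2 / 2^p]; the other terms are the errors of smearing and
    projection. *)
Lemma pot_v_out z : B z = 0 -> `|pot nlg v z| <= 4 * h * N%:R + 4 * h * Cr + 2 * N%:R * ln 2 / (2 ^ p)%:R.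
Proof.
move=> Bz; have zt := B_far Bz; have kl := @ker_lg R.
have z0 : z != 0 by rewrite -nrm_gt0; have := t0; lra.
have P0 : 0 < (size w)%:R :> R by rewrite ltr0n.
rewrite pot_nlg// normrN /v (potZ kl)//; last exact: good_sum.
rewrite (pot_sum kl)//.
pose X u := \sum_(y <- s) lg (z - cm u y); pose Y u := I2 (fun y => lg (z - cm u y) * b y).
set D := 4 * h * N%:R + 4 * h * Cr.
have e1 : `|\sum_(u <- w) pot lg (vu u) z - \sum_(u <- w) (X u - Y u)| <= (size w)%:R * D.
  rewrite -sumrB -sum_seq_const; apply: le_trans (ler_norm_sum _ _ _) _.
  by rewrite big_seq [leRHS]big_seq; apply: ler_sum => u uw; exact: pot_vu.
pose L := (size w)%:R * (N%:R * lg z).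
have far y : nrm y <= 2 * rN -> `|\sum_(u <- w) lg (z - cm u y) - (size w)%:R * lg z| <= ln 2.
  by move=> hy; apply: (avg_far sw w1 wP) => //; have := ht; lra.
have e2 : `|\sum_(u <- w) X u - L| <= N%:R * ln 2.
  rewrite /X exchange_big /=.
  have -> : L = \sum_(y <- s) ((size w)%:R * lg z) by rewrite sum_seq_const sN /L mulrCA.
  have -> : N%:R * ln 2 = \sum_(y <- s) ln 2 :> R by rewrite sum_seq_const sN.
  rewrite -sumrB; apply: le_trans (ler_norm_sum _ _ _) _.
  by rewrite big_seq [leRHS]big_seq; apply: ler_sum => y ys; apply: far; exact: hs.
have gb : good b by exact: good_bsq.
have iY u : u \in w -> ig (fun y => lg (z - cm u y) * b y).
  move=> uw; have gr := good_bu uw; have u1 := w1 uw.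
  have n1 : nsq u != 0 by rewrite u1 oner_eq0.
  have := ig_cm n1 (ig_pot kl z gr); apply: eq_ig => y.
  by rewrite /rot cm_uK.
have e3 : `|\sum_(u <- w) Y u - L| <= N%:R * ln 2.
  have -> : L = I2 (fun y => (size w)%:R * lg z * b y).
    by rewrite I2Z ?I2_bsq; [rewrite /L; ring|exact: good_ig].
  have -> : \sum_(u <- w) Y u = I2 (fun y => \sum_(u <- w) if u \in w then lg (z - cm u y) * b y else 0).
    rewrite I2_sum => [|u]; last by case: (boolP (u \in w)) => [uw|_]; [exact: iY|exact: ig0].
    by rewrite big_seq [RHS]big_seq; apply: eq_bigr => u uw; rewrite uw.
  have eS y : (\sum_(u <- w) if u \in w then lg (z - cm u y) * b y else 0) = b y * \sum_(u <- w) lg (z - cm u y).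
    by rewrite mulr_sumr big_seq [RHS]big_seq; apply: eq_bigr => u uw; rewrite uw mulrC.
  have iS : ig (fun y => \sum_(u <- w) if u \in w then lg (z - cm u y) * b y else 0).
    by apply: ig_sum => u; case: (boolP (u \in w)) => [uw|_]; [exact: iY|exact: ig0].
  have iL : ig (fun y => (size w)%:R * lg z * b y) by apply: igZ; exact: good_ig.
  rewrite -I2B//; apply: le_trans (I2_abs (igB iS iL)) _.
  have -> : N%:R * ln 2 = I2 (fun y => ln 2 * b y) by rewrite I2Z ?I2_bsq 1?mulrC//; exact: good_ig.
  apply: I2_le; [by apply: ig_abs; exact: igB|by apply: igZ; exact: good_ig|].
  move=> y; rewrite eS; have [by0|by0] := eqVneq (b y) 0.
    by rewrite by0 mul0r !mulr0 subrr normr0.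
  have b0 : 0 <= b y by exact: ind_ge0.
  rewrite mulrC -mulrBl normrM (ger0_norm b0); apply: ler_wpM2r => //.
  by apply: far; have := bsq_nrm by0; rewrite -/rN; have := rN1; lra.
have e4 : `|\sum_(u <- w) (X u - Y u)| <= 2 * N%:R * ln 2.
  have -> : \sum_(u <- w) (X u - Y u) = (\sum_(u <- w) X u - L) - (\sum_(u <- w) Y u - L) by rewrite sumrB; ring.
  by apply: le_trans (ler_normB _ _) _; rewrite -mulrA mulr2n mulrDl mul1r; exact: lerD.
rewrite -sw normrM gtr0_norm ?invr_gt0// mulrC ler_pdivrMr// mulrDl divfK ?gt_eqF//.
have -> : \sum_(u <- w) pot lg (vu u) z = (\sum_(u <- w) pot lg (vu u) z - \sum_(u <- w) (X u - Y u)) + \sum_(u <- w) (X u - Y u).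
  by rewrite subrK.
apply: le_trans (ler_normD _ _) _; apply: lerD => //.
by rewrite [D * _]mulrC.
Qed.

Let C1 : R := (Cr + 2 * Sn%:R * Sn%:R ^+ 2) * (2 * Sn%:R ^+ 2).
(** A crude bound, from [|lg| <= rinv + |x|] and the total charge. What matters is that it depends
    neither on [h] nor on [p]: [core] fixes [C1] before [eta]. *)
Lemma pot_v_in : I2 (fun x => B x * `|pot nlg v x|) <= C1.
Proof.
have kl := @ker_lg R; have kr := @ker_rinv R.
pose K x : R := rinv x + 2 * Sn%:R.
have kK : ker K := kerD kr (ker_cst _).
have gav : good (fun x => `|v x|).
  by have [mv [C hC]] := gv; split; [exact: measurableT_comp|exists C => x; rewrite normr_id].
have vsupp x : B x = 0 -> v x = 0.
  move=> Bx; apply/eqP; apply: contraTT (eqxx (0 : R)) => vx.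
  have : fl (sc h^-1 x) \in gidx a2 by apply: W_supp; move: vx; rewrite vE.
  by move=> hx; move: Bx; rewrite BE hx => /eqP; rewrite oner_eq0.
have h1 x : B x * `|pot nlg v x| <= B x * pot K (fun y => `|v y|) x.
  have [Bx|Bx] := eqVneq (B x) 0; first by rewrite Bx !mul0r.
  apply: ler_wpM2l; first by case/andP: (B01 x).
  rewrite pot_nlg// normrN; apply: le_trans (I2_abs (ig_pot kl x gv)) _.
  apply: I2_le; [by apply: ig_abs; exact: (ig_pot kl)|exact: (ig_pot kK)|].
  move=> y; have [By|By] := eqVneq (B y) 0; first by rewrite (vsupp _ By) normr0 !mulr0 normr0.
  rewrite normrM; apply: ler_wpM2r => //; apply: le_trans (lg_abs _) _.
  by rewrite addrC lerD2l; exact: B_diam.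
have lp : lint (pot K (fun y => `|v y|)) := pot_lint kK gav.
have l1 : ig (fun x => B x * `|pot nlg v x|).
  have := ig_abs (pot_lint (@ker_nlg R) gv gB); apply: eq_ig => x.
  by rewrite normrM ger0_norm//; case/andP: (B01 x).
apply: le_trans (I2_le l1 (lp _ gB) h1) _.
rewrite -I4E (I4C kK gB gav) I4E.
apply: (@le_trans _ _ (I2 (fun x => (Cr + 2 * Sn%:R * Sn%:R ^+ 2) * `|v x|))).
  apply: I2_le; [exact: (pot_lint kK)|by apply: igZ; exact: good_ig|].
  move=> x; rewrite mulrC; apply: ler_wpM2r => //.
  have -> : pot K B x = pot rinv B x + 2 * Sn%:R * Sn%:R ^+ 2.
    rewrite -I2_B -(pot_cst (2 * Sn%:R) x gB) /pot -I2D; [|exact: (ig_pot kr)|exact: (ig_pot (ker_cst _))].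
    by apply: eq_I2 => y; rewrite /K mulrDl.
  rewrite lerD2r; apply: le_trans (pot_rinv x gB B01) _.
  by rewrite I2_B.
rewrite I2Z; last exact: good_ig.
apply: ler_wpM2l.
  by rewrite addr_ge0 ?mulr_ge0 ?sqr_ge0// addr_ge0 ?kap_ge0 ?sqr_ge0.
have -> : 2 * Sn%:R ^+ 2 = I2 (fun x => v x + 2 * B x).
  rewrite I2D; [|exact: good_ig gv|by apply: igZ; exact: good_ig gB].
  by rewrite I2Z ?I2_v ?I2_B ?add0r//; exact: good_ig.
apply: I2_le; [exact: good_ig|by apply: igD; [exact: good_ig|apply: igZ; exact: good_ig]|].
by move=> x; have := v_ge x; have /andP[] := B01 x; rewrite ler_norml => *; apply/andP; split; lra.
Qed.

Lemma tile_core (eta : R) : 4 * h * N%:R + 4 * h * Cr + 2 * N%:R * ln 2 / (2 ^ p)%:R <= eta ->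
  exists (a : nat) (w : int * int -> R),
    [/\ (0 < a)%N, (forall i, w i != 0 -> i \in zidx a),
      (forall x, - cellf Sn%:R 0 x <= gf (Sn%:R / a%:R) w x), I2 (gf (Sn%:R / a%:R) w) = 0 &
      [/\ JA nlg (Sn ^ 2) (fun x => cellf Sn%:R 0 x + gf (Sn%:R / a%:R) w x) (cellf Sn%:R 0) Jt,
       (forall x, cellf Sn%:R 0 x = 0 -> `|pot nlg (gf (Sn%:R / a%:R) w) x| <= eta) &
       I2 (fun x => cellf Sn%:R 0 x * `|pot nlg (gf (Sn%:R / a%:R) w) x|) <= C1]].
Proof.
move=> he; exists (2 * a2)%N, w'; rewrite -hE.
have gE : gf h w' = fun x => v (x + - sc h (zr i0)) by apply/funext => x; exact: gfw.
have cE : cellf (Sn%:R : R) 0 = fun x => B (x + - sc h (zr i0)) by apply/funext => x; exact: cellw.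
have pE x : pot nlg (gf h w') x = pot nlg v (x + - sc h (zr i0)).
  by rewrite gE (pot_trans (@ker_nlg R)).
split; first by rewrite muln_gt0.
- exact: w'_supp.
- by move=> x; rewrite gE cE.
- by rewrite gE (I2_trans _ (good_ig gv)).
split.
- by rewrite gE cE; exact: (JA_trans (@ker_nlg R) _ gB tile_state).
- by move=> x; rewrite cE pE => Bx; apply: le_trans he; exact: pot_v_out.
have i1 : ig (fun x => B x * `|pot nlg v x|).
  have := ig_abs (pot_lint (@ker_nlg R) gv gB); apply: eq_ig => x.
  by rewrite normrM ger0_norm//; case/andP: (B01 x).
have := pot_v_in; rewrite -(I2_trans (- sc h (zr i0)) i1); congr (_ <= _).
by apply: eq_I2 => x; rewrite cE pE.
Qed.
End Tile.

(** * Convergence of the jellium and electron gas energies *)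

Section JelLower.
Context {R : realType}.
Local Notation R2 := (R * R)%type.

(** [core] bounds [e0 S^2] by the energy of the tile, that is about [e0 (S^2 - N)] for the filling
    plus the jellium energy; the terms in [S^2] cancel. The choices come in the order: confinement,
    minimal distance, [eta], number of rotations, mesh. *)
Lemma jel_tile (N m k : nat) (s : seq R2) (jm dl : R) : (0 < N)%N -> size s = N -> uniq s ->
  exS m jm -> 0 <= dl -> jm <= (e0 + dl) * (m ^ 2)%:R -> 4 * Num.sqrt N%:R <= k%:R * m%:R :> R ->
  forall S : R, S = (2 * (k * m))%:R ->
  e0 * N%:R <= eJ (bsq N) s + dl * (S ^+ 2 - N%:R) +
    (`|e0 + dl| + ln (2 * S + 1) / 2) * (16 * m%:R * Num.sqrt N%:R + 64 * m%:R ^+ 2).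
Proof.
move=> N0 sN us hm dl0 hjm ht S SE; apply/ler_addgt0Pr => eps eps0.
have e20 : 0 < eps / 2 by rewrite divr_gt0.
have [s' [sN' us' hs' hE]] := confine N0 sN us e20.
have [d d0 hd] := min_dist s'.
pose Sn := (2 * (k * m))%N; pose Cr : R := kap + S ^+ 2.
pose C1 : R := (Cr + 2 * S * S ^+ 2) * (2 * S ^+ 2).
have Cr0 : 0 <= Cr by rewrite addr_ge0 ?kap_ge0 ?sqr_ge0.
have S0 : 0 < S.
  have : 1 <= Num.sqrt N%:R :> R by rewrite -[X in X <= _]sqrtr1 ler_sqrt// ler1n.
  by rewrite SE natrM natrM; lra.
have p2 : 0 <= S ^+ 2 := sqr_ge0 _.
have C10 : 0 <= C1.
  apply: mulr_ge0; last exact: mulr_ge0.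
  by apply: addr_ge0 => //; apply: mulr_ge0 => //; apply: mulr_ge0 => //; exact: ltW.
have Sn0 : (0 < Sn)%N by rewrite -(ltr0n R) -SE.
pose J := (e0 + dl) * (S ^+ 2 - N%:R) +
   (`|e0 + dl| + ln (2 * S + 1) / 2) * (16 * m%:R * Num.sqrt N%:R + 64 * m%:R ^+ 2) +
   (eJ (bsq N) s' + eps / 2).
have : e0 * (Sn ^ 2)%:R <= J.
  apply: (core (C1 := C1) Sn0 C10) => eta eta0.
  have l2 : 0 <= ln 2 :> R by apply: ln_ge0; lra.
  pose p := (Num.trunc (4 * N%:R * ln 2 / eta)).+1.
  have hp : 2 * N%:R * ln 2 / (2 ^ p)%:R <= eta / 2.
    have P0 : 0 < (2 ^ p)%:R :> R by rewrite ltr0n expn_gt0.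
    rewrite ler_pdivrMr//; have : 4 * N%:R * ln 2 / eta <= (2 ^ p)%:R.
      apply: (le_trans (ltW (truncnS_gt _))); rewrite ler_nat; apply/ltnW; exact: ltn_expl.
    rewrite ler_pdivrMr//; move: ((2 ^ p)%:R : R) (N%:R * ln 2 : R) (mulrA 4 N%:R (ln 2 : R)) (mulrA 2 N%:R (ln 2 : R)) => P y <- <-; clear; lra.
  have [w [sw w1 wP]] := roots (R := R) p.
  pose A1 : R := 12 / d * N%:R ^+ 2 + 12 * Cr * N%:R.
  pose A2 : R := 4 * N%:R + 4 * Cr.
  have A10 : 0 <= A1 by rewrite addr_ge0 ?mulr_ge0 ?sqr_ge0 ?invr_ge0 ?(ltW d0).
  have A20 : 0 <= A2 by rewrite addr_ge0 ?mulr_ge0.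
  (* [h B <= 1] yields at once [8 h <= d], [h <= 1/2], an energy error at most [eps / 2] and an
     outer potential at most [eta / 2], the other half being left to the rotations. *)
  pose B := 8 / d + 2 + 2 * A1 / eps + 2 * A2 / eta.
  have B1 : 0 <= 8 / d by rewrite divr_ge0// ltW.
  have B2 : 0 <= 2 * A1 / eps by rewrite divr_ge0 ?mulr_ge0// ltW.
  have B3 : 0 <= 2 * A2 / eta by rewrite divr_ge0 ?mulr_ge0// ltW.
  have [Ba Bb Bc Bd] : [/\ 8 / d <= B, 2 <= B, 2 * A1 / eps <= B & 2 * A2 / eta <= B].
    by rewrite /B; move: B1 B2 B3; move: (8 / d) (2 * A1 / eps) (2 * A2 / eta) => x y z; clear; split; lra.
  pose a2 := (Num.trunc (S * B)).+1.
  have a20 : (0 < a2)%N by [].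
  have a2r : 0 < a2%:R :> R by rewrite ltr0n.
  pose h : R := S / (2 * a2)%:R; have hhE : h = (2 * (k * m))%:R / (2 * a2)%:R by rewrite -SE.
  have h0 : 0 < h by rewrite divr_gt0// ltr0n muln_gt0.
  have hB : h * B <= 1.
    rewrite /h mulrAC ler_pdivrMr ?mul1r ?ltr0n ?muln_gt0//.
    apply: (le_trans (ltW (truncnS_gt _))); rewrite ler_nat -/a2 leq_pmull//.
  have hb x : x <= B -> 0 <= x -> h * x <= 1 by move=> xB x0; apply: le_trans hB; rewrite ler_pM2l.
  have hd8 : 8 * h <= d.
    have : h * (8 / d) <= 1 by apply: hb.
    by rewrite mulrA ler_pdivrMr// mul1r mulrC.
  have h12 : h <= 1 / 2.
    have : h * 2 <= 1 by apply: hb.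
    by move: (h) => x; clear; lra.
  have hA1 : h * A1 <= eps / 2.
    have : h * (2 * A1 / eps) <= 1 by apply: hb.
    by rewrite mulrA ler_pdivrMr// mul1r; move: (h) (A1) (A2) => x y z; clear; lra.
  have hA2 : h * A2 <= eta / 2.
    have : h * (2 * A2 / eta) <= 1 by apply: hb.
    by rewrite mulrA ler_pdivrMr// mul1r; move: (h) (A1) (A2) => x y z; clear; lra.
  have he : 4 * h * N%:R + 4 * h * (kap + S ^+ 2) + 2 * N%:R * ln 2 / (2 ^ p)%:R <= eta.
    have e : 4 * h * N%:R + 4 * h * (kap + S ^+ 2) = h * A2 by rewrite /A2 /Cr; ring.
    by rewrite e; move: (2 * _ * _ / _) (h * A2) hp hA2 => x y; lra.
  rewrite SE -/Sn in he.
  have [a [v [a0 v1 v2 v3 [v4 v5 v6]]]] :=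
    tile_core N0 sN' us' hs' hm hjm erefl ht d0 hd sw w1 wP a20 hhE hd8 h12 he.
  exists a, v; split => //; split; [|exact: v5|by rewrite /C1 /Cr SE -/Sn].
  apply: JA_le v4 _; rewrite -!SE /J -/Cr lerD2l lerD2l.
  have -> : 12 * h / d * N%:R ^+ 2 + 12 * h * Cr * N%:R = h * A1 by rewrite /A1; ring.
  exact: hA1.
rewrite natrX -SE /J => H.
have e1 : (e0 + dl) * (S ^+ 2 - N%:R) = e0 * S ^+ 2 - e0 * N%:R + dl * (S ^+ 2 - N%:R) by ring.
rewrite e1 in H; move: H hE.
move: (eJ _ s') (eJ _ s) (e0 * S ^+ 2) (e0 * N%:R) (dl * _) ((`|_| + _) * _) => x1 x2 x3 x4 x5 x6.
lra.
Qed.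

Section bounded.
Let bdd := @e0_bounded R.

Lemma jel_lower (d : R) : 0 < d -> exists N0 : nat, forall N, (N0 <= N)%N -> (0 < N)%N ->
  forall s : seq R2, size s = N -> uniq s -> (e0 - d) * N%:R <= eJ (bsq N) s.
Proof.
(* The box has side at most [10 sqrt N], hence area at most [100 N], and [100 dl = d / 2]. *)
move=> d0; pose dl := d / 200; have dl0 : 0 < dl by rewrite divr_gt0.
have [m [jm [hm hjm]]] := e0_near bdd dl0.
have m0 : (0 < m)%N by case: hm.
have m1 : 1 <= m%:R :> R by rewrite ler1n.
(* [80 = 16 + 64], from [m <= sqrt N]. The threshold below is used at [10 sqrt N] with [d / 20],
   which leaves [d / 2]. *)
pose C : R := 80 * m%:R * (`|e0 + dl| + 1).
have C0 : 0 <= C by rewrite !mulr_ge0 ?addr_ge0.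
have [a0 a1 ha] := ln_le_lin C0 (divr_gt0 d0 (ltr0n R 20)).
pose q := a0 + m%:R; have q0 : 0 <= q by rewrite /q; lra.
exists (Num.trunc (q ^+ 2)).+1 => N hN N0 s sN us.
set r : R := Num.sqrt N%:R.
have rr : r ^+ 2 = N%:R by exact: sqr_sqrtN.
have qr : q <= r.
  rewrite -(@ler_pXn2r _ 2) ?nnegrE ?sqrtr_ge0// rr ltW//.
  by apply: (lt_le_trans (truncnS_gt _)); rewrite ler_nat.
pose k := (Num.trunc (4 * r / m%:R)).+1.
have m0' : 0 < m%:R :> R by rewrite ltr0n.
have r0 : 0 < r by rewrite /q in qr; lra.
have k1 : 4 * r <= k%:R * m%:R.
  by rewrite -ler_pdivrMr//; exact/ltW/truncnS_gt.
have k2 : k%:R * m%:R <= 4 * r + m%:R.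
  rewrite -[k%:R]natr1 mulrDl mul1r lerD2r -ler_pdivlMr//.
  have z : 0 <= 4 * r / m%:R by rewrite divr_ge0 ?mulr_ge0// ltW.
  by have /andP[] := truncn_itv z.
have := jel_tile N0 sN us hm (ltW dl0) hjm k1 erefl.
set S : R := (2 * (k * m))%:R.
have SE : S = 2 * (k%:R * m%:R) by rewrite /S !natrM.
have S10 : S <= 10 * r by rewrite SE; rewrite /q in qr; lra.
have S0 : 0 < S by rewrite SE; lra.
have mr : m%:R <= r by rewrite /q in qr; lra.
have b1 : dl * (S ^+ 2 - N%:R) <= d / 2 * N%:R.
  have : S ^+ 2 <= 100 * N%:R.
    by rewrite -rr -[100 * _](_ : (10 * r) ^+ 2 = _); [rewrite lerXn2r ?nnegrE; lra|ring].
  have N0r : 0 <= N%:R :> R by [].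
  move: (S ^+ 2) (N%:R : R) N0r => x y y0 xy.
  have : dl * (x - y) <= dl * (100 * y) by apply: ler_wpM2l; [exact: ltW|lra].
  have -> : dl * (100 * y) = d / 2 * y by rewrite /dl; field.
  by [].
have l0 : 0 <= ln (2 * S + 1) by apply: ln_ge0; lra.
have lS : ln (2 * S + 1) <= ln (2 * (10 * r) + 1) by rewrite ler_ln ?posrE; lra.
have b2 : (`|e0 + dl| + ln (2 * S + 1) / 2) * (16 * m%:R * r + 64 * m%:R ^+ 2) <= d / 2 * N%:R.
  have y0 : 0 <= `|e0 + dl| by [].
  apply: (@le_trans _ _ ((`|e0 + dl| + ln (2 * (10 * r) + 1)) * (80 * m%:R * r))).
    apply: ler_pM; [by rewrite addr_ge0// divr_ge0|by rewrite addr_ge0 ?mulr_ge0 ?sqr_ge0 ?(ltW r0)|lra|].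
    have : m%:R ^+ 2 <= m%:R * r :> R by rewrite expr2 ler_pM2l.
    have -> : 16 * m%:R * r = 16 * (m%:R * r) by ring.
    have -> : 80 * m%:R * r = 80 * (m%:R * r) by ring.
    by move: (m%:R ^+ 2) (m%:R * r) => x y; lra.
  have := ha (10 * r); rewrite (_ : a0 <= 10 * r); last by rewrite /q in qr; lra.
  move=> /(_ isT); set L := ln _ => hL.
  have L0 : 0 <= L by apply: ln_ge0; lra.
  have -> : d / 2 * N%:R = d / 20%:R * (10 * r) * r by rewrite -rr; field.
  rewrite [leLHS]mulrA; apply: ler_wpM2r; first exact: ltW.
  apply: le_trans hL; rewrite /C -[X in _ <= X + _]mulr1 -mulrDr.
  rewrite [leLHS]mulrC -mulrA; apply: ler_wpM2l; first by rewrite mulr_ge0.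
  by move: (`|_|) y0 => y y0; nra.
have -> : (e0 - d) * N%:R = e0 * N%:R - d / 2 * N%:R - d / 2 * N%:R by field.
move: b1 b2; move: (dl * _) (d / 2 * _) ((_ + _) * (_ + _)) (eJ _ _) (e0 * _) => x1 x2 x3 x4 x5; lra.
Qed.

Lemma minJel_lower (d : R) : 0 < d -> exists N0 : nat, forall N, (N0 <= N)%N -> (0 < N)%N ->
  (((e0 - d) * N%:R)%:E <= minJel R N)%E.
Proof.
move=> d0; have [N0 h] := jel_lower d0; exists N0 => N hN hN0.
apply/ereal_infP => _ [x dx <-]; rewrite lee_fin EJel_list; apply: h => //.
  by rewrite size_map size_enum_ord.
rewrite map_inj_uniq ?enum_uniq// => i j e; apply/eqP; apply: contrapT => /negP ij.
exact: (dx i j ij e).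
Qed.

Lemma cvg_of_bounds (u : nat -> \bar R) (e : R) :
  (forall d, 0 < d -> exists N0 : nat, forall N, (N0 <= N)%N -> (0 < N)%N ->
    (((e - d) * N%:R)%:E <= u N)%E /\ (u N <= ((e + d) * N%:R)%:E)%E) ->
  (fun N => (u N * (N%:R^-1)%:E)%E) @ \oo --> e%:E.
Proof.
move=> H.
have B d : 0 < d -> \forall N \near \oo, `|fine (u N * (N%:R^-1)%:E)%E - e| <= d /\ (u N * (N%:R^-1)%:E)%E \is a fin_num.
  move=> d0; have [N0 h] := H _ d0; near=> N.
  have N1 : (0 < N)%N by near: N; exact: nbhs_infty_gt.
  have [|h1 h2] := h N _ N1; first by near: N; exact: nbhs_infty_ge.
  have Nr : 0 < N%:R :> R by rewrite ltr0n.
  case: (u N) h1 h2 => [r| |] //; rewrite !lee_fin -EFinM /= => h1 h2; split => //.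
  rewrite ler_norml; apply/andP; split.
    by rewrite lerBrDr addrC ler_pdivlMr.
  by rewrite lerBlDr addrC ler_pdivrMr.
have c : (fun N => fine (u N * (N%:R^-1)%:E)%E) @ \oo --> e.
  apply/cvgrPdist_le => d d0; have := B d d0; apply: filterS => N [+ _].
  by rewrite distrC.
apply/cvg_EFin => //; have := B 1 ltr01; apply: filterS => N [].
Unshelve. all: by end_near.
Qed.

Lemma ueg_upper_e0 (d : R) : 0 < d -> exists N0 : nat, forall N, (N0 <= N)%N -> (0 < N)%N ->
  (minUEG R N <= ((e0 + d) * N%:R)%:E)%E.
Proof.
move=> d0; have d2 : 0 < d / 2 by rewrite divr_gt0.
have [m [jm [hm hjm]]] := e0_near bdd d2.
have m0 : 0 < (m ^ 2)%:R :> R by rewrite ltr0n expn_gt0; case: hm => ->.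
have [N0 h] := ueg_upper hm d2; exists N0 => N hN hN0.
apply: le_trans (h N hN hN0) _; rewrite lee_fin; apply: ler_wpM2r => //.
have : jm / (m ^ 2)%:R <= e0 + d / 2 by rewrite ler_pdivrMr.
lra.
Qed.

Lemma cvg_jel_ueg : @jel_seq R @ \oo --> (e0 : R)%:E /\ @ueg_seq R @ \oo --> (e0 : R)%:E.
Proof.
split; apply: cvg_of_bounds => d d0.
  have [N1 h1] := minJel_lower d0; have [N2 h2] := ueg_upper_e0 d0.
  exists (maxn N1 N2) => N; rewrite geq_max => /andP[n1 n2] N0; split; first exact: h1.
  exact: le_trans (minJel_UEG N0) (h2 _ n2 N0).
have [N1 h1] := minJel_lower d0; have [N2 h2] := ueg_upper_e0 d0.
exists (maxn N1 N2) => N; rewrite geq_max => /andP[n1 n2] N0; split; last exact: h2.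
exact: le_trans (h1 _ n1 N0) (minJel_UEG N0).
Qed.
End bounded.
End JelLower.

(** * The periodic kernel *)

Section Quadrupole.
Context {R : realType}.
Local Notation R2 := (R * R)%type.
Implicit Types (x y z u : R2) (V : R2 -> R).
Let kl := @ker_lg R.
Let kr := @ker_rinv R.

(** The fourth roots of unity. *)
Definition qr : seq R2 := [:: (1, 0); (-1, 0); (0, 1); (0, -1)].
Lemma sum_qr (F : R2 -> R) : \sum_(u <- qr) F u = F (1, 0) + F (-1, 0) + F (0, 1) + F (0, -1).
Proof. by rewrite !big_cons big_nil addr0 !addrA. Qed.
Lemma qr_ind (P : R2 -> Prop) : P (1, 0) -> P (-1, 0) -> P (0, 1) -> P (0, -1) -> forall u, u \in qr -> P u.
Proof. by move=> p1 p2 p3 p4 u; rewrite !inE => /or4P[] /eqP ->. Qed.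
Lemma qr_nsq u : u \in qr -> nsq u = 1.
Proof. by move: u; apply: qr_ind; rewrite /nsq /= ?sqrrN expr1n expr0n ?addr0 ?add0r. Qed.
Lemma conj_qr u : u \in qr -> conj u \in qr.
Proof. by move: u; apply: qr_ind; rewrite /conj /= !inE ?opprK ?oppr0 eqxx ?orbT. Qed.

(* Quarter turns cancel the multipoles up to order three, so that [fq y x] is
   [ln |1 - y^4 / x^4| / 4], hence integrable at infinity. *)
Definition fq y x : R := 4^-1 * \sum_(u <- qr) lg (x - cm u y) - lg x.

Lemma quartic x y : (forall u, u \in qr -> x - cm u y != 0) ->
  sqn 2 x - sqn 2 y != 0 /\ \sum_(u <- qr) lg (x - cm u y) = lg (sqn 2 x - sqn 2 y).
Proof.
move=> h; have e : sqn 2 x - sqn 2 y =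
  cm (cm (x - cm (1, 0) y) (x - cm (-1, 0) y)) (cm (x - cm (0, 1) y) (x - cm (0, -1) y)).
  by clear h; case: x y => [a b] [c d]; rewrite /sqn /= /cm /=; congr pair => /=; ring.
have h1 : x - cm (1, 0) y != 0 by apply: h; rewrite !inE eqxx ?orbT.
have h2 : x - cm (-1, 0) y != 0 by apply: h; rewrite !inE eqxx ?orbT.
have h3 : x - cm (0, 1) y != 0 by apply: h; rewrite !inE eqxx ?orbT.
have h4 : x - cm (0, -1) y != 0 by apply: h; rewrite !inE eqxx ?orbT.
split; first by rewrite e !cm_eq0 !negb_or h1 h2 h3 h4.
by rewrite e sum_qr !lg_cm ?cm_eq0 ?negb_or ?h1 ?h2 ?h3 ?h4// !addrA.
Qed.

Lemma fq0 x : fq 0 x = 0.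
Proof. by rewrite /fq sum_qr !cm0 !subr0; lra. Qed.

Lemma fq_decay y x : 2 * nrm y <= nrm x -> 1 <= nrm x -> `|fq y x| <= 3 * nrm y ^+ 4 * pg x.
Proof.
move=> hy hx; have ny := nrm_ge0 y.
have x0 : x != 0 by rewrite -nrm_gt0; lra.
have h u : u \in qr -> x - cm u y != 0.
  move=> /qr_nsq u1; rewrite subr_eq0; apply/eqP => e.
  by have : nrm x = nrm y; [rewrite e nrm_u|lra].
have [h0 e] := quartic h.
have nA : nrm (sqn 2 x) = nrm x ^+ 4 by rewrite nrm_sqn.
have nB : nrm (sqn 2 y) = nrm y ^+ 4 by rewrite nrm_sqn.
have A0 : sqn 2 x != 0 by rewrite -nrm_gt0 nA exprn_gt0//; lra.
have eA : lg (sqn 2 x) = 4 * lg x.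
  by rewrite /lg nA lnXn ?nrm_gt0// mulr_natl.
have hf : fq y x = 4^-1 * (lg (sqn 2 x - sqn 2 y) - lg (sqn 2 x)).
  by rewrite /fq e eA; lra.
have := lg_lip_abs h0 A0; rewrite addrAC subrr add0r nrmN.
have B1 : 16 * nrm (sqn 2 y) <= nrm (sqn 2 x).
  rewrite nA nB (_ : 16 = 2 ^+ 4); last by rewrite -natrX.
  by rewrite -exprMn lerXn2r ?nnegrE ?mulr_ge0//; lra.
have A1 : 0 < nrm (sqn 2 x) by rewrite nrm_gt0.
have r1 : rinv (sqn 2 x - sqn 2 y) <= 2 * rinv (sqn 2 x).
  rewrite /rinv -[X in X * _]invrK -invfM lef_pV2 ?posrE ?mulr_gt0 ?invr_gt0 ?nrm_gt0//.
  by have := nrm_lb (sqn 2 x) (sqn 2 y); have := nrm_ge0 (sqn 2 y); lra.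
have r0 := rinv_ge0 (sqn 2 x); have n0 := nrm_ge0 (sqn 2 y).
move=> hl; rewrite hf normrM ger0_norm; last by rewrite invr_ge0.
have q : nrm (sqn 2 y) * rinv (sqn 2 x) <= 3 * nrm y ^+ 4 * pg x.
  have := @pg_nsq R x; rewrite -nrmE -exprM /rinv nA nB => hp.
  rewrite -mulrA mulrCA; apply: ler_wpM2l; first by rewrite exprn_ge0.
  by apply: hp; rewrite -[1](expr1n _ 2) lerXn2r ?nnegrE//; lra.
have : nrm (sqn 2 y) * (rinv (sqn 2 x - sqn 2 y) + rinv (sqn 2 x)) <=
  nrm (sqn 2 y) * (3 * rinv (sqn 2 x)) by apply: ler_wpM2l => //; lra.
move: hl q; rewrite (mulrCA _ 3); clear -n0 r0; have : 0 <= nrm (sqn 2 y) * rinv (sqn 2 x) by exact: mulr_ge0.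
move: (`|_|) (nrm (sqn 2 y) * rinv (sqn 2 x)) (nrm (sqn 2 y) * (_ + _)) (_ * pg x) => a b c d; lra.
Qed.

Lemma lint_fq y : lint (fq y).
Proof.
have h : lint (fun x => 4^-1 * \sum_(u <- qr) lg (x + - cm u y) + (-1) * lg x).
  have [_ _ l] := kl.
  apply: lintD; apply: lintZ => //; apply: (@lint_sum _ _ qr (fun u x => lg (x + - cm u y))) => u.
  exact: (lint_trans (- cm u y) l).
by move=> f gf; apply: eq_ig (h f gf) => x; rewrite /fq mulN1r.
Qed.

Lemma ig_decay V (r C : R) : lint V -> (forall x, r <= nrm x -> `|V x| <= C * pg x) -> ig V.
Proof.
move=> lV hV; apply: (@ig_le _ _ (fun x => `|\1_(bx r) x * V x| + `|C| * pg x)).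
- exact: lint_meas.
- move=> x; have [hr|hr] := leP r (nrm x).
    apply: (le_trans (hV _ hr)); apply: (@le_trans _ _ (`|C| * pg x)); last by rewrite lerDr.
    by apply: ler_wpM2r; [exact: pg_ge0|exact: ler_norm].
  rewrite indT ?mul1r ?lerDl ?mulr_ge0 ?pg_ge0//.
  by apply: bx_nrm; exact: ltW.
- apply: igD; last by apply: igZ; exact: ig_pg.
  by apply: ig_abs; apply: lV; exact: good_bx.
Qed.

Lemma ig_fq y : ig (fq y).
Proof.
apply: (@ig_decay _ (2 * nrm y + 1) (3 * nrm y ^+ 4)); first exact: lint_fq.
by move=> x hx; have n := nrm_ge0 y; apply: fq_decay; lra.
Qed.

Lemma fq_even y x : fq y (- x) = fq y x.
Proof.
have e a b : cm a y = - cm b y -> lg (- x - cm a y) = lg (x - cm b y).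
  by move=> ->; rewrite opprK -lgN opprD opprK.
rewrite /fq lgN !sum_qr; congr (_ * _ - _).
rewrite (e (1, 0) (-1, 0)) ?(e (-1, 0) (1, 0)) ?(e (0, 1) (0, -1)) ?(e (0, -1) (0, 1));
  try by rewrite /cm /=; congr pair; rewrite /=; ring.
by ring.
Qed.

(** By scaling it is [|y|^2 alpha (1, 0)] ([alphaE]). The normalization of [alpha (1, 0)] is read
    off later from the logarithmic singularity of [G1]. *)
Definition alpha y : R := I2 (fq y).
Lemma fq_scale y x : y != 0 -> x != 0 -> x \notin qr -> fq y (cm y x) = fq (1, 0) x.
Proof.
move=> y0 x0 xq; rewrite /fq lg_cm//.
have -> : \sum_(u <- qr) lg (cm y x - cm u y) = \sum_(u <- qr) (lg y + lg (x - cm u (1, 0))).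
  rewrite big_seq [RHS]big_seq; apply: eq_bigr => u uq; rewrite (cmC u) -cmBr (cmC u (1, 0)) cm1.
  by rewrite lg_cm// subr_eq0; apply: contraNneq xq => ->.
by rewrite !sum_qr; lra.
Qed.
Lemma alphaE y : alpha y = nsq y * alpha (1, 0).
Proof.
have [->|y0] := eqVneq y 0.
  rewrite /alpha (@eq_I2 _ (fq 0) (fun _ => 0)) ?I20; last exact: fq0.
  by rewrite /nsq /= expr0n addr0 mul0r.
have n0 : nsq y != 0 by rewrite nsq_eq0.
have := I2_cm n0 (ig_fq y); rewrite -/(alpha y) => e.
rewrite -[LHS](mulVKf n0) -e; congr (_ * _).
apply: (@I2_eq_off _ (0 :: qr)); [by apply: ig_cm => //; exact: ig_fq|exact: ig_fq|].
by move=> x; rewrite in_cons negb_or => /andP[x0 xq]; rewrite fq_scale.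
Qed.

Definition Qf : R2 -> R := \1_(bx 2^-1).
Lemma good_Q : good Qf. Proof. exact: good_bx. Qed.
Lemma Q01 x : 0 <= Qf x <= 1. Proof. by rewrite ind_ge0 ind_le1. Qed.
Lemma I2_Q : I2 Qf = 1.
Proof. by rewrite I2_ind ?leb2_bx//=; [rewrite divff// expr1n|exact: measurable_bx]. Qed.
Lemma Q_nrm x : Qf x != 0 -> nrm x <= 1.
Proof.
have [h|h] := pselect (bx 2^-1 x); last by rewrite /Qf indF// eqxx.
by have := nrm_bx h; rewrite divff.
Qed.
Lemma Q_rot u x : u \in qr -> Qf (cm u x) = Qf x.
Proof.
move=> uq; have h : bx 2^-1 (cm u x) <-> bx 2^-1 x.
  by move: u uq; apply: qr_ind; rewrite /bx /cm /=
    ?(mul0r, mul1r, mulN1r, addr0, add0r, subr0, sub0r, mulNr, opprK, oppr0) ?normrN; tauto.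
by rewrite /Qf !indicE; congr (nat_of_bool _)%:R; apply/idP/idP; rewrite !inE => /h.
Qed.
Lemma rot_Q u : u \in qr -> rot u Qf = Qf.
Proof. by move=> uq; apply/funext => x; rewrite /rot Q_rot// conj_qr. Qed.

Definition PQ : R2 -> R := pot lg Qf.
Lemma PQ_rot u x : u \in qr -> PQ (cm u x) = PQ x.
Proof.
move=> uq; have := @pot_rot _ u (qr_nsq uq) Qf x; rewrite rot_Q// => h; exact: h good_Q.
Qed.
(** The potential, for the kernel [- ln], of a unit point charge at the centre of a unit square of
    opposite charge. *)
Definition phi x : R := PQ x - lg x.
Lemma phi_rot u x : u \in qr -> phi (cm u x) = phi x.
Proof. by move=> uq; rewrite /phi PQ_rot// /lg nrm_u// qr_nsq. Qed.
Lemma phi_even x : phi (- x) = phi x.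
Proof. by rewrite -cmN1 phi_rot// !inE eqxx ?orbT. Qed.

(** The square is invariant under quarter turns, so [lg (x - y)] may be averaged over the turns of
    [y]. Thus [phi] is a superposition of the functions [fq y] and inherits their decay [|x|^-4]. *)
Lemma pot_quad x : ig (fun y => Qf y * fq y x) /\ I2 (fun y => Qf y * fq y x) = phi x.
Proof.
have gQ := good_Q.
pose F u y := lg (x - cm u y) * Qf y.
have iF u : u \in qr -> ig (F u) /\ I2 (F u) = PQ x.
  move=> uq; have u1 := qr_nsq uq.
  have := @pot_rot_far _ u u1 Qf x; rewrite rot_Q// => /(_ gQ) e; split; last by rewrite /F -e.
  have n1 : nsq u != 0 by rewrite u1 oner_neq0.
  by apply: eq_ig (ig_cm n1 (ig_pot kl x gQ)) => y; rewrite /F Q_rot.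
have eF y : Qf y * fq y x = 4^-1 * (F (1, 0) y + F (-1, 0) y + F (0, 1) y + F (0, -1) y) - lg x * Qf y.
  by rewrite /fq sum_qr /F; ring.
have [i1 e1] : ig (F (1, 0)) /\ I2 (F (1, 0)) = PQ x by apply: iF; rewrite !inE eqxx ?orbT.
have [i2 e2] : ig (F (-1, 0)) /\ I2 (F (-1, 0)) = PQ x by apply: iF; rewrite !inE eqxx ?orbT.
have [i3 e3] : ig (F (0, 1)) /\ I2 (F (0, 1)) = PQ x by apply: iF; rewrite !inE eqxx ?orbT.
have [i4 e4] : ig (F (0, -1)) /\ I2 (F (0, -1)) = PQ x by apply: iF; rewrite !inE eqxx ?orbT.
have j2 := igD i1 i2; have j3 := igD j2 i3; have j4 := igD j3 i4.
have iQ : ig (fun y => lg x * Qf y) by apply: igZ; exact: good_ig.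
have iA : ig (fun y => 4^-1 * (F (1, 0) y + F (-1, 0) y + F (0, 1) y + F (0, -1) y)) by exact: igZ.
split; first by apply: (eq_ig (fun y => esym (eF y))); exact: igB.
rewrite (eq_I2 eF) (I2B iA iQ) (I2Z _ j4) (I2D j3 i4) (I2D j2 i3) (I2D i1 i2) e1 e2 e3 e4 I2Z ?I2_Q; last exact: good_ig.
by rewrite /phi; lra.
Qed.

Lemma phi_decay x : 2 <= nrm x -> `|phi x| <= 3 * pg x.
Proof.
move=> hx; have [i <-] := pot_quad x; apply: le_trans (I2_abs i) _.
apply: (@le_trans _ _ (3 * pg x * I2 Qf)); last by rewrite I2_Q mulr1.
rewrite -I2Z; last exact: good_ig good_Q.
apply: I2_le; [exact: ig_abs|by apply: igZ; exact: good_ig good_Q|].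
move=> y; have /andP[q0 q1] := Q01 y; rewrite normrM (ger0_norm q0).
have [->|hq] := eqVneq (Qf y) 0; first by rewrite mulr0 mul0r.
have ny := Q_nrm hq; rewrite mulrC; apply: ler_wpM2r => //.
apply: (le_trans (fq_decay _ _)); [lra|lra|].
apply: ler_wpM2r; first exact: pg_ge0.
by rewrite ler_piMr// exprn_ile1// nrm_ge0.
Qed.

Lemma lint_phi : lint phi.
Proof.
have [_ _ l] := kl.
have lP : lint PQ := pot_lint kl good_Q.
have h : lint (fun x => PQ x + (-1) * lg x) by apply: lintD => //; exact: lintZ.
by move=> f gf; apply: eq_ig (h f gf) => x; rewrite mulN1r.
Qed.
Lemma ig_phi : ig phi.
Proof. exact: ig_decay lint_phi phi_decay. Qed.

Lemma PQ_lip x x' : `|PQ x - PQ x'| <= 2 * (kap + 1) * nrm (x - x').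
Proof.
have gQ := good_Q.
apply: le_trans (@pot_lip _ Qf Qf x x' gQ gQ _) _.
  by move=> y; rewrite ger0_norm//; case/andP: (Q01 y).
rewrite mulrC; apply: ler_wpM2r; first exact: nrm_ge0.
by have := pot_rinv x gQ Q01; have := pot_rinv x' gQ Q01; rewrite I2_Q; lra.
Qed.

(** Truncating the logarithm at the unit circle splits [phi = phr - lgm]: [phr] is Lipschitz and
    keeps the decay, [lgm] is supported in the unit disc and carries the singularity. *)
Definition lgp x : R := ln (Num.max (nrm x) 1).
Definition phr x : R := PQ x - lgp x.
Definition lgm x : R := lg x - lgp x.
Lemma phi_split x : phi x = phr x - lgm x.
Proof. by rewrite /phi /phr /lgm; ring. Qed.
Lemma max1_ge1 x : 1 <= Num.max (nrm x) 1.
Proof. by rewrite le_max lexx orbT. Qed.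
Lemma lgp_far x : 1 <= nrm x -> lgp x = lg x.
Proof. by move=> h; rewrite /lgp max_l. Qed.
Lemma lgm_far x : 1 <= nrm x -> lgm x = 0.
Proof. by move=> h; rewrite /lgm lgp_far// subrr. Qed.
Lemma lgp_near x : nrm x <= 1 -> lgp x = 0.
Proof. by move=> h; rewrite /lgp max_r// ln1. Qed.
Lemma lgm_le0 x : lgm x <= 0.
Proof.
have [h|h] := leP 1 (nrm x); first by rewrite lgm_far.
rewrite /lgm lgp_near ?(ltW h)// subr0 /lg; apply: ln_le0; exact: ltW.
Qed.
Lemma ln_lip1 (a b : R) : 1 <= a -> 1 <= b -> ln a - ln b <= `|a - b|.
Proof.
move=> a1 b1; have a0 : 0 < a by lra.
have b0 : 0 < b by lra.
rewrite -ln_div ?posrE//.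
have := @le_ln1Dx R (a / b - 1); rewrite addrCA subrr addr0 => h; apply: (le_trans (h _)).
  by rewrite -subr_gt0 opprK subrK divr_gt0.
rewrite -[X in _ - X](@divff _ b) ?gt_eqF// -mulrBl.
apply: (@le_trans _ _ (`|a - b| / b)); first by rewrite ler_pM2r ?invr_gt0// ler_norm.
by rewrite ler_piMr// invf_le1.
Qed.
Lemma lgp_lip x x' : `|lgp x - lgp x'| <= nrm (x - x').
Proof.
have h a b : lgp a - lgp b <= nrm (a - b).
  apply: le_trans (ln_lip1 (max1_ge1 a) (max1_ge1 b)) _.
  have h1 := nrm_lb a b; have h2 := nrm_lb b a; rewrite nrmBC in h2; have h3 := nrm_ge0 (a - b).
  by rewrite /Num.max ler_norml; case: ltP => i1; case: ltP => i2; apply/andP; split; lra.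
by rewrite ler_norml h andbT lerNl opprB nrmBC h.
Qed.
Definition Lp : R := 2 * (kap + 1) + 1.
Lemma Lp_gt0 : 0 < Lp. Proof. by rewrite /Lp; have := @kap_ge0 R; lra. Qed.
Lemma phr_lip x x' : `|phr x - phr x'| <= Lp * nrm (x - x').
Proof.
have -> : phr x - phr x' = (PQ x - PQ x') - (lgp x - lgp x') by rewrite /phr; ring.
apply: le_trans (ler_normB _ _) _; rewrite /Lp mulrDl mul1r; apply: lerD; [exact: PQ_lip|exact: lgp_lip].
Qed.
Definition Cp : R := 25 * (`|phr 0| + 2 * Lp + 3).
Lemma phr_bound x : `|phr x| <= Cp * pg x.
Proof.
have p0 := pg_ge0 x; have L0 := Lp_gt0.
have [h|h] := leP 2 (nrm x).
  have -> : phr x = phi x by rewrite phi_split lgm_far ?subr0//; lra.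
  apply: le_trans (phi_decay h) _; apply: ler_wpM2r => //.
  by rewrite /Cp; have := normr_ge0 (phr 0); lra.
have a : `|phr x| <= `|phr 0| + 2 * Lp.
  have := phr_lip x 0; rewrite subr0 => h1.
  rewrite -[phr x](subrK (phr 0)); apply: le_trans (ler_normD _ _) _; rewrite addrC lerD2l.
  by apply: (le_trans h1); rewrite mulrC ler_pM2r// ltW.
(* For [|x| <= 2] each factor [1 + x.i^2] is at most 5. *)
have b : 1 <= 25 * pg x.
  rewrite /pg; have n : nsq x <= 2 ^+ 2 by rewrite -nrmE lerXn2r ?nnegrE ?nrm_ge0// ltW.
  have s1 := sqr_ge0 x.1; have s2 := sqr_ge0 x.2; rewrite /nsq in n.
  have d0 : 0 < (1 + x.1 ^+ 2) * (1 + x.2 ^+ 2) by rewrite mulr_gt0//; lra.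
  rewrite -[X in X <= _](mulfV (lt0r_neq0 d0)) ler_pM2r ?invr_gt0// (_ : 25 = 5 * 5); last by ring.
  by apply: ler_pM; lra.
apply: (le_trans a); rewrite /Cp mulrAC; have := normr_ge0 (phr 0); move: (25 * pg x) b => c b n0.
by rewrite -[X in X <= _]mul1r; apply: ler_pM => //; lra.
Qed.

End Quadrupole.

(** * Lattice sums and unfolding *)

Section LatticeSums.
Context {R : realType}.
Local Notation R2 := (R * R)%type.
Implicit Types (x y z w u : R2) (V f g chi : R2 -> R) (i D : int * int).

Lemma I2_dct (F : nat -> R2 -> R) f g : (forall n, measurable_fun setT (F n)) -> ig g ->
  (forall n x, `|F n x| <= g x) -> (forall x, F n x @[n --> \oo] --> f x) ->
  ig f /\ I2 (F n) @[n --> \oo] --> I2 f.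
Proof.
move=> mF hg Fg Ff.
have mf : measurable_fun setT f by apply: (measurable_fun_cvg mF) => x _; exact: Ff.
have [] := @dominated_convergence _ _ _ (@leb2 R) setT measurableT (fun n x => (F n x)%:E)
  (EFin \o f) (EFin \o g).
- by move=> n; apply/measurable_EFinP; exact: mF.
- exact/measurable_EFinP.
- by apply: aeW => x _; apply: cvg_EFin; [exact: nearW|exact: Ff].
- exact: hg.
- by apply: aeW => x n _ /=; rewrite lee_fin.
move=> i1 _ h; split => //.
have iF n : ig (F n) by exact: ig_le hg.
have e n : (\int[@leb2 R]_x (F n x)%:E)%E = (I2 (F n))%:E by exact: I2E.
have e' : (\int[@leb2 R]_x (EFin \o f) x)%E = (I2 f)%:E by exact: I2E.
rewrite e' in h; move/fine_cvg: h => /=; apply: cvg_trans; apply: near_eq_cvg; apply: nearW => n /=.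
by rewrite e.
Qed.

Lemma measurable_zrfl : measurable_fun setT (fun w : R2 => zr (fl w) : R2).
Proof.
have mf : measurable_fun setT (fun t : R => (Num.floor t)%:~R : R).
  by apply: nondecreasing_measurable => // a b ab; rewrite ler_int le_floor.
by apply: measurable_fun_pair => /=; apply: (measurableT_comp mf).
Qed.

Lemma cell1 i x : cellf 1 i x = (fl x == i)%:R :> R.
Proof. by rewrite /cellf invr1 sc1. Qed.

Lemma pg_shift (r : R) z u : `|u.1| <= r -> `|u.2| <= r ->
  pg z <= (2 * (1 + r ^+ 2)) ^+ 2 * pg (z + u).
Proof.
have h (a t : R) : `|t| <= r -> 1 + (a + t) ^+ 2 <= 2 * (1 + r ^+ 2) * (1 + a ^+ 2).
  move=> ht; have t2 : t ^+ 2 <= r ^+ 2 by rewrite -real_normK ?num_real// lerXn2r ?nnegrE// (le_trans _ ht).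
  have := sqr_ge0 (a - t); have := sqr_ge0 a; have := sqr_ge0 r.
  have : a ^+ 2 * t ^+ 2 <= a ^+ 2 * r ^+ 2 by apply: ler_wpM2l => //; exact: sqr_ge0.
  have := sqr_ge0 (a * t); rewrite exprMn; move: t2.
  rewrite sqrrB sqrrD; move: (a ^+ 2) (r ^+ 2) (t ^+ 2) => A B C; nra.
move=> h1 h2; rewrite /pg /=.
have p (t : R) : 0 < 1 + t ^+ 2 by have := sqr_ge0 t; lra.
rewrite ler_pdivlMr ?mulr_gt0// mulrC ler_pdivrMr ?mulr_gt0//.
rewrite expr2 [X in _ <= X]mulrACA; apply: ler_pM; [exact/ltW/p|exact/ltW/p|exact: h|exact: h].
Qed.

(* The sum of [g] over the lattice translates of [x], written as an integral over the plane. *)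
Definition per g x : R := I2 (fun w => g (x + zr (fl w))).
Definition summ g := forall x, ig (fun w => g (x + zr (fl w))).

Lemma measurable_perF g x : measurable_fun setT g -> measurable_fun setT (fun w => g (x + zr (fl w))).
Proof.
move=> mg; apply: (measurableT_comp mg).
by rewrite (_ : (fun w => _) = (fun w => zr (fl w) + x)); [apply: (measurableT_comp (@measurable_trans _ x)); exact: measurable_zrfl|apply/funext => w; rewrite addrC].
Qed.

Lemma fl_frac (t : R) : `|(Num.floor t)%:~R - t| <= 1.
Proof.
have := floor_le_tmp t; have := floorD1_gt t; rewrite intrD rmorph1 => h1 h2.
by rewrite ler_norml; apply/andP; split; lra.
Qed.
Lemma pg_fl (r : R) x w : nrm x <= r -> pg (x + zr (fl w)) <= (2 * (1 + (r + 1) ^+ 2)) ^+ 2 * pg w.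
Proof.
move=> xr; have -> : pg w = pg ((x + zr (fl w)) + (w - zr (fl w) - x)) by congr pg; rewrite addrC; ring.
have h (a b : R) : `|a| <= r -> `|b - (Num.floor b)%:~R - a| <= r + 1.
  move=> ha; apply: le_trans (ler_normB _ _) _; rewrite addrC; apply: lerD => //.
  by rewrite distrC fl_frac.
apply: pg_shift; apply: h; apply: le_trans xr; [exact: nrm_ge1|exact: nrm_ge2].
Qed.
Lemma summ_pg g C : measurable_fun setT g -> (forall x, `|g x| <= C * pg x) -> summ g.
Proof.
move=> mg hg x; have C0 : 0 <= C.
  have := hg 0; have : 0 < pg (0 : R2) by rewrite /pg /= expr0n addr0 mulr1 invr1.
  by move=> p0 h; rewrite -(@pmulr_lge0 _ (pg 0))//; apply: le_trans h.
apply: (@ig_le _ _ (fun w => C * ((2 * (1 + (nrm x + 1) ^+ 2)) ^+ 2 * pg w))).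
- exact: measurable_perF.
- by move=> w; apply: (le_trans (hg _)); apply: ler_wpM2l => //; exact: pg_fl.
- by apply: igZ; apply: igZ; exact: ig_pg.
Qed.
Lemma summ_fin g x (s : seq (int * int)) : uniq s -> (forall D, D \notin s -> g (x + zr D) = 0) ->
  ig (fun w => g (x + zr (fl w))) /\ per g x = \sum_(D <- s) g (x + zr D).
Proof.
move=> us hs.
have e w : g (x + zr (fl w)) = \sum_(D <- s) g (x + zr D) * cellf 1 D w.
  have [h|h] := boolP (fl w \in s).
    rewrite (bigD1_seq (fl w))//= cell1 eqxx mulr1 big1 ?addr0// => k kx.
    by rewrite cell1 eq_sym (negbTE kx) mulr0.
  rewrite hs// big_seq big1// => k ks; rewrite cell1; case: eqP => [e|]; last by rewrite mulr0.
  by rewrite e ks in h.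
have i D : ig (fun w => g (x + zr D) * cellf 1 D w) by apply: igZ; apply: good_ig; exact: good_cell.
split; first by apply: (eq_ig (fun w => esym (e w))); exact: ig_sum.
rewrite /per (eq_I2 e) I2_sum//; apply: eq_bigr => D _; rewrite I2Z; last by apply: good_ig; exact: good_cell.
by rewrite I2_cell// expr1n mulr1.
Qed.

Lemma per_periodic g x D : summ g -> per g (x + zr D) = per g x.
Proof.
move=> sg; rewrite /per -(I2_trans (zr D) (sg x)); apply: eq_I2 => w.
by rewrite fl_zr zrD addrAC addrA.
Qed.

Definition periodic g := forall x D, g (x + zr D) = g x.
Lemma ig_mulb f g (c : R) : measurable_fun setT f -> (forall x, `|f x| <= c) -> ig g -> ig (fun x => f x * g x).
Proof.
move=> mf fc hg; apply: (@ig_le _ _ (fun x => c * `|g x|)).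
- by apply: measurable_funM => //; exact: ig_meas.
- by move=> x; rewrite normrM ler_wpM2r.
- by apply: igZ; exact: ig_abs.
Qed.
Lemma measurable_cell i : measurable_fun setT (cellf 1 i : R2 -> R).
Proof. by apply: good_meas; exact: good_cell. Qed.
Lemma cell_le1 i x : `|cellf 1 i x : R| <= 1.
Proof. by rewrite cell1; case: (_ == _); rewrite ?normr0 ?normr1. Qed.

Lemma cell_zr D x : cellf 1 0 (x - zr D) = cellf 1 D x :> R.
Proof. by rewrite !cell1 -zrN fl_zr subr_eq0. Qed.

Lemma big_box x (r : R) : exists s : seq (int * int), uniq s /\
  forall y, nrm (y - x) <= r -> fl y \in s.
Proof.
pose n := (Num.trunc (`|x.1| + `|x.2| + r + 1)).+1.
exists (gidx n); split; first exact: uniq_gidx.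
move=> y hy; have a1 := le_trans (nrm_ge1 _) hy; have a2 := le_trans (nrm_ge2 _) hy.
have hn : `|x.1| + `|x.2| + r + 1 <= n%:R by apply/ltW/truncnS_gt.
have h (a b : R) : `|a - b| <= r -> `|b| + r + 1 <= n%:R -> (- n%:Z <= Num.floor a)%R && (Num.floor a < n%:Z)%R.
  rewrite ler_norml => /andP[h1 h2] h3; have := ler_norm b; have := ler_norm (- b); rewrite normrN => h4 h5.
  rewrite floor_ge_int floor_lt_int !intrN -!pmulrn; apply/andP; split; lra.
have n1 := normr_ge0 x.1; have n2 := normr_ge0 x.2.
rewrite mem_gidx /=; have /andP[-> ->] := h _ _ a1 ltac:(lra).
by have /andP[-> ->] := h _ _ a2 ltac:(lra).
Qed.

(* Splitting one shifted cell along the lattice cells reassembles it modulo the lattice. *)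
Lemma cell_shift g b : periodic g -> ig (fun x => cellf 1 0 x * g x) ->
  ig (fun x => cellf 1 0 x * g (x + b)) /\ I2 (fun x => cellf 1 0 x * g (x + b)) = I2 (fun x => cellf 1 0 x * g x).
Proof.
move=> pg hg; have [s [us hs]] := big_box b 4.
have sp w : cellf 1 0 w != 0 :> R -> nrm w <= 2.
  by move=> h; have := @cell_nrm _ 1 ltr01 0 w 0 h; rewrite subr0 mulr1; apply; rewrite cell1 /fl /= floor0 eqxx oner_neq0.
pose F D x := cellf 1 D (x + b) * (cellf 1 0 x * g (x + b)).
have e x : cellf 1 0 x * g (x + b) = \sum_(D <- s) F D x.
  rewrite /F -big_distrl /= cell_sum// invr1 sc1.
  have [->|/sp hx] := eqVneq (cellf 1 0 x : R) 0; first by rewrite mul0r mulr0.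
  by rewrite hs ?mul1r// addrK (le_trans hx)// ler_nat.
pose G D x := cellf 1 D (x + zr D) * (cellf 1 0 (x + zr D - b) * (g x)).
have iG D : ig (G D).
  apply: eq_ig (_ : ig (fun x => cellf 1 0 (x + zr D - b) * (cellf 1 0 x * g x))).
    by move=> x; rewrite /G -[X in _ = X * _](cell_zr D) addrK mulrCA.
  apply: (@ig_mulb _ _ 1) => //; last by move=> x; exact: cell_le1.
  apply: (measurableT_comp (measurable_cell 0)).
  have := @measurable_trans _ (zr D - b : R2); congr measurable_fun; apply/funext => x; by rewrite addrA.
have GF D x : G D (x + (b - zr D)) = F D x.
  have e1 : x + (b - zr D) + zr D = x + b by rewrite addrA subrK.
  by rewrite /G /F e1 addrK addrA -zrN pg.
have iF D : ig (F D) by apply: (eq_ig (GF D)); exact: ig_trans.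
split; first by apply: (eq_ig (fun x => esym (e x))); exact: ig_sum.
rewrite (eq_I2 e) I2_sum//.
under eq_bigr => D _ do rewrite -(eq_I2 (GF D)) I2_trans//.
rewrite -I2_sum//; apply: eq_I2 => x; rewrite /G.
have z0 : fl (0 : R2) = 0 by rewrite /fl /= floor0.
have e2 D : cellf 1 D (x + zr D) * (cellf 1 0 (x + zr D - b) * g x) =
    cellf 1 (- fl (x - b)) (zr D) * (cellf 1 0 x * g x).
  rewrite -(cell_zr D) addrK mulrCA; congr (_ * _); rewrite !cell1 addrAC fl_zr.
  by rewrite -[zr D]add0r fl_zr z0 add0r -(addrC D) addr_eq0.
under eq_bigr => D _ do rewrite e2.
rewrite -big_distrl /=; have [->|/sp hx] := eqVneq (cellf 1 0 x : R) 0; first by rewrite mul0r mulr0.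
have h : - fl (x - b) \in s.
  pose D := - fl (x - b); have eD : fl (zr D : R2) = D by rewrite -[zr D]add0r fl_zr z0 add0r.
  rewrite -/D -eD; apply: hs; have : nrm (x - b + zr D) <= 2 by apply: sp; rewrite cell1 fl_zr /D subrr eqxx oner_neq0.
  have := nrmB (x - b + zr D) x; rewrite (_ : x - b + zr D - x = zr D - b); last by rewrite addrAC [x - b]addrC addrK addrC.
  lra.
rewrite (bigD1_seq _ h us) /= cell1 -[zr (- _)]add0r fl_zr z0 add0r eqxx big1 ?addr0 ?mul1r// => k kx.
by rewrite cell1 -[zr k]add0r fl_zr z0 add0r (negbTE kx).
Qed.

Section unfold.
Variables (g chi : R2 -> R) (c : R).
Hypotheses (hg : ig g) (sg : summ g).
Hypotheses (mchi : measurable_fun setT chi) (chic : forall x, `|chi x| <= c) (pchi : periodic chi).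
Let mg := ig_meas hg.
Let F x w := (cellf 1 0 x * chi x) * g (x + zr (fl w)).
Let F2 x w := cellf 1 0 (w - zr (fl x)) * (chi x * g x).
Let mzf := measurable_zrfl.

Let ccb x : `|cellf 1 0 x * chi x| <= c.
Proof. by rewrite normrM -[c]mul1r; apply: ler_pM => //; exact: cell_le1. Qed.
Let mcc : measurable_fun setT (fun x => cellf 1 0 x * chi x).
Proof. by apply: measurable_funM => //; exact: measurable_cell. Qed.
Let mF : measurable_fun setT (fun p : R2 * R2 => F p.1 p.2).
Proof.
apply: measurable_funM; first exact: (measurableT_comp mcc measurable_fst).
apply: (measurableT_comp mg).
have m1 := measurableT_comp mzf (@measurable_snd _ _ R2 R2).
apply: measurable_fun_pair => /=; apply: measurable_funD.
- exact: measurableT_comp measurable_fst measurable_fst.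
- exact: measurableT_comp measurable_fst m1.
- exact: measurableT_comp measurable_snd measurable_fst.
- exact: measurableT_comp measurable_snd m1.
Qed.
Let mF2 : measurable_fun setT (fun p : R2 * R2 => F2 p.1 p.2).
Proof.
have m2 := measurable_funM mchi mg; apply: measurable_funM; last exact: (measurableT_comp m2 measurable_fst).
apply: (measurableT_comp (measurable_cell 0)).
have m1 := measurableT_comp mzf (@measurable_fst _ _ R2 R2).
apply: measurable_fun_pair => /=; apply: measurable_funB.
- exact: measurableT_comp measurable_fst measurable_snd.
- exact: measurableT_comp measurable_fst m1.
- exact: measurableT_comp measurable_snd measurable_snd.
- exact: measurableT_comp measurable_snd m1.
Qed.
Let igc : ig (fun x => chi x * g x). Proof. exact: ig_mulb hg. Qed.
Let ig1 x : ig (F x). Proof. by apply: igZ; exact: sg. Qed.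
Let ig2 w : ig (F^~ w). Proof. by apply: (@ig_mulb (fun x => cellf 1 0 x * chi x) _ c) => //; exact: ig_trans. Qed.
Let icell D : ig (fun x : R2 => cellf 1 0 (x - zr D) : R) /\ I2 (fun x : R2 => cellf 1 0 (x - zr D) : R) = 1.
Proof.
have h : ig (cellf 1 0 : R2 -> R) by apply: good_ig; exact: good_cell.
by split; [exact: ig_trans|rewrite (I2_trans (- zr D))// I2_cell// expr1n].
Qed.
Let jg1 x : ig (F2 x).
Proof.
by apply: eq_ig (igZ (chi x * g x) (icell (fl x)).1) => w; rewrite /F2 mulrC.
Qed.
Let jg2 w : ig (F2^~ w).
Proof.
have -> : F2^~ w = fun x => cellf 1 (fl w) x * (chi x * g x).
  by apply/funext => x; rewrite /F2 cell_zr !cell1 eq_sym.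
apply: (@ig_mulb _ _ 1) => //; [exact: measurable_cell|by move=> x; exact: cell_le1].
Qed.
Let FF2 x w : F2 (x + zr (fl w)) w = F x w.
Proof.
have e : fl (x + zr (fl w)) = fl x + fl w by exact: fl_zr.
rewrite /F2 /F e cell_zr pchi mulrA !cell1; congr (_%:R * _ * _).
by rewrite eq_sym -subr_eq0 addrK.
Qed.
Let fF2 : (\int[@leb2 R]_x \int[@leb2 R]_w `|F2 x w|%:E < +oo)%E.
Proof.
have e x : (\int[@leb2 R]_w `|F2 x w|%:E)%E = `|chi x * g x|%:E.
  rewrite (I2E (ig_abs (jg1 x))); congr (_%:E).
  rewrite (eq_I2 (_ : _ =1 (fun w => `|chi x * g x| * cellf 1 0 (w - zr (fl x))))).
    by rewrite I2Z; [rewrite (icell (fl x)).2 mulr1|exact: (icell (fl x)).1].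
  by move=> w; rewrite /F2 normrM mulrC [X in _ * X]ger0_norm ?cell_ge0.
by under eq_integral => x _ do rewrite e; exact: ig_lty.
Qed.
Let fF : (\int[@leb2 R]_x \int[@leb2 R]_w `|F x w|%:E < +oo)%E.
Proof.
rewrite (tonelli_abs mF); move: fF2; rewrite (tonelli_abs mF2).
suff e w : (\int[@leb2 R]_x `|F2 x w|%:E = \int[@leb2 R]_x `|F x w|%:E)%E.
  by under eq_integral => x _ do rewrite e.
rewrite (I2E (ig_abs (jg2 w))) (I2E (ig_abs (ig2 w))) -(I2_trans (zr (fl w)) (ig_abs (jg2 w))).
by congr (_%:E); apply: eq_I2 => x; rewrite FF2.
Qed.
Lemma ig_unfold : ig (fun x => cellf 1 0 x * chi x * per g x).
Proof.
apply: eq_ig (ig_inner mF fF ig1) => x; rewrite /F I2Z//; exact: sg.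
Qed.
(** Unfolding a lattice sum. [F] integrates over the cell and over the lattice; the translation of
    [x] by the lattice point of [w] turns it into [F2], in which [w] only runs through the cell
    attached to [x] and contributes the factor 1. *)
Lemma I2_unfold : I2 (fun x => cellf 1 0 x * chi x * per g x) = I2 (fun x => chi x * g x).
Proof.
rewrite -(@eq_I2 _ (fun x => I2 (F x))); last by move=> x; rewrite /F I2Z//; exact: sg.
rewrite (I2_swap mF fF ig1 ig2).
rewrite (@eq_I2 _ _ (fun w => I2 (F2^~ w))); last first.
  by move=> w; rewrite -(I2_trans (zr (fl w)) (jg2 w)); apply: eq_I2 => x; rewrite FF2.
rewrite -(I2_swap mF2 fF2 jg1 jg2); apply: eq_I2 => x.
rewrite (eq_I2 (_ : _ =1 (fun w => (chi x * g x) * cellf 1 0 (w - zr (fl x))))).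
  by rewrite I2Z; [rewrite (icell (fl x)).2 mulr1|exact: (icell (fl x)).1].
by move=> w; rewrite /F2 mulrC.
Qed.
End unfold.

Lemma lint_periodic g : periodic g -> ig (fun x => cellf 1 0 x * g x) -> lint g.
Proof.
move=> pg hg f hf; have [C C0 fC] := goodC hf; have [s [us hs]] := big_box 0 (2 * C).
have e x : f x * g x = \sum_(D <- s) f x * (cellf 1 D x * g x).
  rewrite -big_distrr /= -big_distrl /= cell_sum// invr1 sc1.
  have [->|fx] := eqVneq (f x) 0; first by rewrite !mul0r.
  rewrite hs ?mul1r// subr0; apply: nrm_bx; apply: contrapT => h; move/negP: fx; apply.
  by have := fC C (lexx C) x; rewrite indF// mulr0 normr_le0.
apply: (eq_ig (fun x => esym (e x))); apply: ig_sum => D.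
apply: (@ig_mulb _ _ C); first exact: good_meas.
  by move=> x; apply: (le_trans (fC C (lexx C) x)); rewrite ler_piMr ?ind_le1// ltW.
by apply: eq_ig (ig_trans (- zr D) hg) => x; rewrite cell_zr -zrN pg.
Qed.

End LatticeSums.

(** * Averages over finite blocks of the lattice *)

Section Cesaro.
Context {R : realType}.
Local Notation R2 := (R * R)%type.
Implicit Types (x y z w u : R2) (V f g : R2 -> R) (D r : int * int).

(** A Fejer weight: the proportion of indices [r] of the block for which [r - fl w] is again in the
    block ([thk_count]). It lies between 0 and 1 and tends to 1. *)
Definition thk k w : R := ((2 * k)%:R ^+ 2)^-1 * \sum_(r <- gidx k) \sum_(r' <- gidx k) cellf 1 (r - r') w.
Lemma thk_count k w : thk k w = ((2 * k)%:R ^+ 2)^-1 * (size [seq r <- gidx k | r - fl w \in gidx k])%:R.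
Proof.
rewrite /thk; congr (_ * _); rewrite size_filter -sum1_count natr_sum [RHS]big_mkcond /=.
apply: eq_bigr => r _; have [h|h] := boolP (_ \in _).
  rewrite (bigD1_seq _ h (uniq_gidx k)) /= cell1 subKr eqxx big1 ?addr0// => r' hr'.
  by rewrite cell1; case: eqP => // e; rewrite e subKr eqxx in hr'.
rewrite big_seq big1// => r' hr'; rewrite cell1; case: eqP => // e.
by rewrite e subKr hr' in h.
Qed.
Lemma thk_bounds k w d : fl w \in gidx d -> (0 < k)%N ->
  1 - 2 * d%:R / k%:R <= thk k w <= 1.
Proof.
move=> hd k0; have k0' : 0 < k%:R :> R by rewrite ltr0n.
have p0 : 0 < (2 * k)%:R ^+ 2 :> R by rewrite exprn_gt0// ltr0n muln_gt0.
rewrite thk_count [X in _ <= X <= _]mulrC; apply/andP; split; last first.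
  rewrite ler_pdivrMr// mul1r -natrX ler_nat (leq_trans (size_subseq (filter_subseq _ _)))//.
  by rewrite size_gidx expnS expn1.
rewrite ler_pdivlMr//; have [dk|kd] := leqP d k; last first.
  apply: (@le_trans _ _ 0); last by rewrite ler0n.
  rewrite pmulr_lle0// subr_le0 ler_pdivlMr// mul1r -natrM ler_nat (leq_trans (ltnW kd))// leq_pmull//.
have : (size (gidx (k - d)) <= size [seq r <- gidx k | (r - fl w)%R \in gidx k])%N.
  apply: uniq_leq_size; first exact: uniq_gidx.
  move=> [a b]; move: hd; rewrite mem_filter !mem_gidx /=; move: (fl w) => [u v] /=.
  by move=> /and4P[h1 h2 h3 h4] /and4P[h5 h6 h7 h8]; do 2?[apply/andP; split]; lia.
rewrite -(ler_nat R) size_gidx; apply: le_trans.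
rewrite !natrM natrB//; have d0 : 0 <= d%:R :> R by [].
have -> : (1 - 2 * d%:R / k%:R) * (2 * k%:R) ^+ 2 = 4 * (k%:R ^+ 2 - 2 * d%:R * k%:R) :> R.
  by field; rewrite gt_eqF.
by have := sqr_ge0 (d%:R : R); nra.
Qed.

(** Summing over pairs of a finite block and dividing by the number of its cells weights the
    integrand by [thk]; dominated convergence removes the weight. This is how energies of finite
    crystals become lattice sums. *)
Lemma cesaro V : ig V ->
  (((2 * k)%:R ^+ 2)^-1 * \sum_(r <- gidx k) \sum_(r' <- gidx k) I2 (fun w => cellf 1 (r - r') w * V w)) @[k --> \oo]
    --> I2 V.
Proof.
move=> iV; have iC D : ig (fun w => cellf 1 D w * V w).
  by apply: (@ig_mulb _ _ _ 1) => //; [exact: measurable_cell|exact: cell_le1].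
have e k : ((2 * k)%:R ^+ 2)^-1 * \sum_(r <- gidx k) \sum_(r' <- gidx k) I2 (fun w => cellf 1 (r - r') w * V w) =
    I2 (fun w => thk k w * V w).
  rewrite (@eq_I2 _ _ (fun w => ((2 * k)%:R ^+ 2)^-1 * \sum_(r <- gidx k) \sum_(r' <- gidx k) cellf 1 (r - r') w * V w)).
    rewrite I2Z; last by apply: ig_sum => r; apply: ig_sum => r'.
    by rewrite I2_sum; [congr (_ * _); apply: eq_bigr => r _; rewrite I2_sum|move=> r; exact: ig_sum].
  move=> w; rewrite /thk -mulrA mulr_suml; congr (_ * _); apply: eq_bigr => r _; by rewrite mulr_suml.
under eq_fun do rewrite e.
have hd w : exists d, fl w \in gidx d.
  exists (`|(fl w).1| + `|(fl w).2|).+1; rewrite mem_gidx; move: (fl w) => [a b] /=.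
  by do 2?[apply/andP; split]; lia.
apply: (@I2_dct _ _ _ (fun w => `|V w|) _ (ig_abs iV) _ _).2.
- move=> k; apply: measurable_funM; last exact: ig_meas.
  apply: measurable_funM => //; apply: measurable_sum => r; apply: measurable_sum => r'; exact: measurable_cell.
- move=> k w; rewrite normrM ler_piMl//; have [->|k0] := posnP k.
    by rewrite /thk muln0 expr0n invr0 mul0r normr0.
  rewrite ger0_norm; first by have [d h] := hd w; case/andP: (thk_bounds h k0).
  rewrite thk_count mulr_ge0// invr_ge0 sqr_ge0//.
move=> w; have [d h] := hd w.
rewrite -[X in _ --> X]mul1r; apply: cvgM; last exact: cvg_cst.
apply/cvgrPdist_le => eps eps0; near=> k.
have k0 : (0 < k)%N by near: k; exact: nbhs_infty_gt.
have /andP[h1 h2] := thk_bounds h k0.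
rewrite ger0_norm ?subr_ge0//; have : 2 * d%:R / k%:R <= eps; last by lra.
rewrite ler_pdivrMr ?ltr0n// [eps * _]mulrC -ler_pdivrMr//.
near: k; exact: nbhs_infty_ger.
Unshelve. all: by end_near.
Qed.

Lemma cesaro_per g x : summ g ->
  (((2 * k)%:R ^+ 2)^-1 * \sum_(r <- gidx k) \sum_(r' <- gidx k) g (x + zr (r - r'))) @[k --> \oo] --> per g x.
Proof.
move=> sg; have := cesaro (sg x); apply: cvg_trans; apply: near_eq_cvg; apply: nearW => k /=.
congr (_ * _); apply: eq_bigr => r _; apply: eq_bigr => r' _.
rewrite (@eq_I2 _ _ (fun w => g (x + zr (r - r')) * cellf 1 (r - r') w)); last first.
  by move=> w; rewrite cell1; case: eqP => [->|]; rewrite ?mul1r ?mulr1// mul0r mulr0.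
by rewrite I2Z; [rewrite I2_cell// expr1n mulr1|apply: good_ig; exact: good_cell].
Qed.
(** [floor] is not symmetric, so the integral form hides this. The finite sums over differences
    [r - r'] are symmetric under exchange of [r] and [r']. *)
Lemma per_even g x : summ g -> (forall y, g (- y) = g y) -> per g (- x) = per g x.
Proof.
move=> sg eg; have h := cesaro_per (x := - x) sg; apply: (cvg_unique _ h); first exact: norm_hausdorff.
have := cesaro_per (x := x) sg; apply: cvg_trans; apply: near_eq_cvg; apply: nearW => k /=.
congr (_ * _); rewrite exchange_big /=; apply: eq_bigr => r _; apply: eq_bigr => r' _.
by rewrite -eg opprD -zrN opprB.
Qed.

Definition ctsat g x := forall e, 0 < e -> exists2 d : R, 0 < d & forall x', nrm (x' - x) < d -> `|g x' - g x| <= e.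
Lemma ctsD f g x : ctsat f x -> ctsat g x -> ctsat (fun y => f y + g y) x.
Proof.
move=> hf hg e e0; have e2 : 0 < e / 2 by rewrite divr_gt0.
have [d1 d10 h1] := hf _ e2; have [d2 d20 h2] := hg _ e2.
exists (Num.min d1 d2); first by rewrite lt_min d10.
move=> x'; rewrite lt_min => /andP[a b]; have := h1 _ a; have := h2 _ b.
rewrite opprD addrACA => k1 k2; apply: (le_trans (ler_normD _ _)); lra.
Qed.
Lemma ctsZ c g x : ctsat g x -> ctsat (fun y => c * g y) x.
Proof.
move=> hg e e0; have c0 : 0 < `|c| + 1 by have := normr_ge0 c; lra.
have [d d0 h] := hg (e / (`|c| + 1)) (divr_gt0 e0 c0); exists d => // x' /h.
rewrite -mulrBr normrM ler_pdivlMr// => k; apply: le_trans k; rewrite mulrC ler_wpM2l//; lra.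
Qed.
Lemma ctsB f g x : ctsat f x -> ctsat g x -> ctsat (fun y => f y - g y) x.
Proof.
move=> hf /(ctsZ (-1)) hg; have := ctsD hf hg; congr ctsat.
by apply/funext => y; rewrite mulN1r.
Qed.
Lemma cts_cst (c : R) x : ctsat (fun=> c) x.
Proof. by move=> e e0; exists 1 => // x' _; rewrite subrr normr0 ltW. Qed.
Lemma cts_sum (I : Type) (s : seq I) (F : I -> R2 -> R) x : (forall i, ctsat (F i) x) ->
  ctsat (fun y => \sum_(i <- s) F i y) x.
Proof.
move=> h; elim: s => [|i s ih].
  by have := @cts_cst 0 x; congr ctsat; apply/funext => y; rewrite big_nil.
have := ctsD (h i) ih; congr ctsat; by apply/funext => y; rewrite big_cons.
Qed.
Lemma cts_trans g b x : ctsat g (x + b) -> ctsat (fun y => g (y + b)) x.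
Proof.
move=> h e e0; have [d d0 hd] := h e e0; exists d => // x' hx; apply: hd.
by rewrite opprD addrACA subrr addr0.
Qed.
Lemma cts_near f g x : (forall y, nrm (y - x) <= 1 -> f y = g y) -> ctsat f x -> ctsat g x.
Proof.
move=> fg h e e0; have [d d0 hd] := h e e0; exists (Num.min d 1); first by rewrite lt_min d0 ltr01.
move=> x'; rewrite lt_min => /andP[a b]; rewrite -!fg ?subrr ?nrm0//; last exact: ltW.
exact: hd.
Qed.
Lemma cts_lip g L x : 0 < L -> (forall y z, `|g y - g z| <= L * nrm (y - z)) -> ctsat g x.
Proof.
move=> L0 h e e0; exists (e / L) => [|x']; first exact: divr_gt0.
by rewrite ltr_pdivlMr// mulrC => /ltW k; exact: le_trans (h _ _) k.
Qed.
Lemma cts_lg x : x != 0 -> ctsat lg x.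
Proof.
move=> x0 e e0; have n0 : 0 < nrm x by rewrite nrm_gt0.
exists (Num.min (nrm x / 2) (e * nrm x / 3)); first by rewrite lt_min !divr_gt0// mulr_gt0.
move=> x'; rewrite lt_min => /andP[a b].
have h := nrm_lb x x'; rewrite nrmBC in h.
have n1 : 0 < nrm x' by lra.
have x'0 : x' != 0 by rewrite -nrm_gt0.
apply: le_trans (lg_lip_abs x'0 x0) _.
have r1 : rinv x' <= 2 * rinv x.
  rewrite /rinv -[X in X * _]invrK -invfM lef_pV2 ?posrE ?mulr_gt0 ?invr_gt0//; lra.
have r0 := rinv_ge0 x.
apply: (@le_trans _ _ (e * nrm x / 3 * (3 * rinv x))).
  by apply: ler_pM; [exact: nrm_ge0|rewrite addr_ge0// rinv_ge0|exact: ltW|lra].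
by rewrite /rinv mulrA divfK// mulfK// gt_eqF.
Qed.
End Cesaro.

(** * The periodized potential of a neutral cell *)

Section PeriodicKernel.
Context {R : realType}.
Local Notation R2 := (R * R)%type.
Implicit Types (x y z w u : R2) (D : int * int).
Local Notation phi := (@phi R). Local Notation phr := (@phr R). Local Notation lgm := (@lgm R).

Lemma measurable_lgp : measurable_fun setT (@lgp R).
Proof.
apply: (measurableT_comp (@measurable_ln R)); apply: measurable_maxr => //; exact: measurable_nrm.
Qed.
Lemma measurable_phr : measurable_fun setT phr.
Proof.
apply: measurable_funB; last exact: measurable_lgp.
exact: lint_meas (pot_lint (@ker_lg R) (good_Q (R := R))).
Qed.
Lemma summ_phr : summ phr.
Proof. exact: summ_pg measurable_phr (@phr_bound R). Qed.
Lemma lgm_box x : exists s, uniq s /\ forall y, nrm (y - x) <= 1 ->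
  forall D, D \notin s -> lgm (y + zr D) = 0.
Proof.
have [s [us hs]] := big_box (- x) 2; exists s; split => // y hy D hD.
apply: lgm_far; rewrite leNgt; apply: contra hD => /ltW h.
have -> : D = fl (zr D : R2) by rewrite -[zr D]add0r fl_zr /fl /= floor0 add0r.
apply: hs; rewrite (_ : zr D - - x = (y + zr D) - (y - x)); last by rewrite opprB addrC; ring.
apply: (le_trans (nrmB _ _)); lra.
Qed.
Lemma summ_lgm : summ lgm.
Proof.
move=> x; have [s [us hs]] := lgm_box x.
by have [] := summ_fin us (hs x _); rewrite ?subrr ?nrm0.
Qed.
Lemma summ_phi : summ phi.
Proof.
move=> x; apply: eq_ig (igB (summ_phr x) (summ_lgm x)) => w; by rewrite phi_split.
Qed.
Definition Phi : R2 -> R := per phi.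
Lemma Phi_split x : Phi x = per phr x - per lgm x.
Proof.
rewrite /Phi /per -I2B; [|exact: summ_phr|exact: summ_lgm].
by apply: eq_I2 => w; rewrite phi_split.
Qed.
Lemma Phi_periodic : periodic Phi. Proof. by move=> x D; exact: per_periodic summ_phi. Qed.
Lemma Phi_even x : Phi (- x) = Phi x. Proof. exact: per_even summ_phi (@phi_even R). Qed.

(** Under a displacement below [1 / (n + 1)] each summand changes by at most the Lipschitz bound and
    also by at most its decay. The minimum [m n] of the two is dominated and tends to 0, so its
    integral does. *)
Lemma cts_per_phr x : ctsat (per phr) x.
Proof.
pose r := nrm x + 1; pose B : R := 2 * (@Cp R) * (2 * (1 + (r + 1) ^+ 2)) ^+ 2.
have L0 := @Lp_gt0 R.
have C0 : 0 <= @Cp R by rewrite /Cp; have := normr_ge0 (phr 0); lra.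
have B0 : 0 <= B by rewrite /B; apply: mulr_ge0; [exact: mulr_ge0|exact: sqr_ge0].
pose m n w := Num.min (@Lp R / n.+1%:R) (B * pg w).
have m0 n w : 0 <= m n w by rewrite le_min divr_ge0 ?(ltW L0)//= mulr_ge0// pg_ge0.
have mm n : measurable_fun setT (m n).
  by apply: measurable_minr => //; apply: measurable_funM => //; exact: measurable_pg.
have iB : ig (fun w : R2 => B * pg w) by apply: igZ; exact: ig_pg.
have mB n w : `|m n w| <= B * pg w by rewrite ger0_norm// ge_min lexx orbT.
have [w|_ hm] := @I2_dct R m (fun=> 0) _ mm iB mB.
  apply: (@squeeze_cvgr _ _ _ _ (fun=> 0) (fun n => @Lp R / n.+1%:R)).
  - by apply: nearW => n; rewrite m0 /= ge_min lexx.
  - exact: cvg_cst.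
  - by rewrite -[X in _ --> X](mulr0 (@Lp R)); apply: cvgM; [exact: cvg_cst|exact: cvg_harmonic].
rewrite I20 in hm => e e0; move/cvgrPdist_le: hm => /(_ e e0)[n _ /(_ n (leqnn n))] /=.
rewrite sub0r normrN ger0_norm; last by apply: I2_ge0.
move=> hn; exists (n.+1%:R^-1); first by rewrite invr_gt0.
move=> x' hx'; apply: le_trans hn.
rewrite /per -I2B; [|exact: summ_phr..].
have iD := igB (summ_phr x') (summ_phr x).
have im : ig (m n) by exact: ig_le iB.
apply: le_trans (I2_abs iD) _; apply: I2_le => //; first exact: ig_abs.
have n1 : n.+1%:R^-1 <= 1 :> R by rewrite invf_le1// ler1n.
have xr : nrm x <= r by rewrite lerDl.
have xr' : nrm x' <= r by rewrite -[x'](subrK x); apply: (le_trans (nrmD _ _)); rewrite /r addrC lerD2l; exact: le_trans (ltW hx') n1.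
move=> w; rewrite le_min; apply/andP; split.
  apply: (le_trans (phr_lip _ _)); rewrite ler_pM2l// opprD addrACA subrr addr0; exact: ltW.
apply: (le_trans (ler_normB _ _)).
have h z : nrm z <= r -> `|phr (z + zr (fl w))| <= @Cp R * ((2 * (1 + (r + 1) ^+ 2)) ^+ 2 * pg w).
  by move=> zr'; apply: (le_trans (phr_bound _)); apply: ler_wpM2l => //; exact: pg_fl.
have := h _ xr; have := h _ xr'; rewrite /B; move: (phr _) (phr _) => a b; rewrite -!mulrA; lra.
Qed.

Lemma per_phr_bounded : exists C, forall x, `|per phr x| <= C.
Proof.
pose C : R := I2 (fun w : R2 => @Cp R * ((2 * (1 + (2 + 1) ^+ 2)) ^+ 2 * pg w)).
have C0 : 0 <= @Cp R by rewrite /Cp; have := normr_ge0 (phr 0); have := @Lp_gt0 R; lra.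
exists C => x; have := @per_periodic _ phr x (- fl x) summ_phr.
rewrite zrN => <-; have hx : nrm (x - zr (fl x)) <= 2.
  apply: le_trans (nrm_le _) _; rewrite (_ : 2 = 1 + 1 :> R)//.
  by apply: lerD; rewrite distrC /=; exact: fl_frac.
apply: le_trans (I2_abs (summ_phr _)) _; apply: I2_le; [apply: ig_abs; exact: summ_phr|by do 2!apply: igZ; exact: ig_pg|].
by move=> w; apply: (le_trans (phr_bound _)); apply: ler_wpM2l => //; exact: pg_fl.
Qed.
(** The periodized regular part is bounded, and the singular part enters with the sign of
    [- lgm >= 0]. *)
Lemma Phi_lower : exists C, forall x, - C <= Phi x.
Proof.
have [C hC] := per_phr_bounded; exists C => x; rewrite Phi_split.
have := hC x; rewrite ler_norml => /andP[h _].
have : 0 <= - per lgm x.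
  rewrite /per -I2N; last exact: summ_lgm.
  by apply: I2_ge0 => w; rewrite oppr_ge0 lgm_le0.
lra.
Qed.

Definition offl x := forall D, x + zr D != 0.
Lemma cts_lgm x : x != 0 -> ctsat lgm x.
Proof.
by move=> x0; apply: ctsB; [exact: cts_lg|apply: (@cts_lip _ _ 1) => // y z; rewrite mul1r lgp_lip].
Qed.
Lemma cts_Phi x : offl x -> ctsat Phi x.
Proof.
move=> hx; have [s [us hs]] := lgm_box x.
apply: (@cts_near _ (fun y => per phr y - \sum_(D <- s) lgm (y + zr D))).
  by move=> y hy; rewrite Phi_split (summ_fin us (hs y hy)).2.
apply: ctsB; first exact: cts_per_phr.
by apply: cts_sum => D; apply: cts_trans; apply: cts_lgm; exact: hx.
Qed.
Lemma zr_eq0 D : (zr D == 0 :> R2) = (D == 0).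
Proof.
by case: D => a b; rewrite /zr; apply/eqP/eqP => [[] /eqP + /eqP +|[-> ->]//]; rewrite !intr_eq0 => /eqP -> /eqP ->.
Qed.
Lemma cts_Phi0 : ctsat (fun x => Phi x + lg x) 0.
Proof.
have [s [us hs]] := lgm_box (0 : R2).
(* The singular term [D = 0] must be among the finitely many listed, since [lgm] does not vanish at
   [(1/2, 0)]. Added to [lg] it leaves the Lipschitz function [lgp]. *)
have h0 : 0 \in s.
  apply/negPn/negP => h; have h1 : nrm ((2^-1, 0) - 0 : R2) <= 1.
    apply: (le_trans (nrm_le _)); rewrite /= !subr0 normr0 addr0 ger0_norm; lra.
  have := hs _ h1 0 h; rewrite zr0 addr0 /lgm lgp_near; last by rewrite subr0 in h1.
  rewrite subr0 /lg (_ : nrm _ = 2^-1); last by rewrite /nrm /nsq /= expr0n addr0 sqrtr_sqr ger0_norm; lra.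
  by rewrite lnV ?posrE// => /eqP; rewrite oppr_eq0 gt_eqF// ln_gt0//; lra.
apply: (@cts_near _ (fun y => (per phr y - \sum_(D <- s | D != 0) lgm (y + zr D)) + lgp y)).
  move=> y hy; rewrite Phi_split (summ_fin us (hs y hy)).2 (bigD1_seq _ h0 us)/=.
  by rewrite zr0 addr0 {2}/lgm; ring.
apply: ctsD; last by apply: (@cts_lip _ _ 1) => // y z; rewrite mul1r lgp_lip.
apply: ctsB; first exact: cts_per_phr.
have := @cts_sum R _ [seq D <- s | D != 0] (fun D y => if D == 0 then 0 else lgm (y + zr D)) 0 _.
have -> : (fun y : R2 => \sum_(i <- [seq D <- s | D != 0]) (if i == 0 then 0 else lgm (y + zr i))) =
   (fun y : R2 => \sum_(D <- s | D != 0) lgm (y + zr D)).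
  by apply/funext => y; rewrite big_filter; apply: eq_bigr => D /negbTE ->.
apply => D; case: eqP => [_|/eqP D0]; first exact: cts_cst.
by apply: cts_trans; apply: cts_lgm; rewrite add0r zr_eq0.
Qed.

(** By unfolding this is the mean of [Phi] over a cell ([ig_Phi]), the constant that has to be
    subtracted for mean zero. *)
Definition kph : R := I2 phi.
Lemma Phi_cell (chi : R2 -> R) c : measurable_fun setT chi -> (forall x, `|chi x| <= c) -> periodic chi ->
  ig (fun x => cellf 1 0 x * chi x * Phi x) /\
  I2 (fun x => cellf 1 0 x * chi x * Phi x) = I2 (fun x => chi x * phi x).
Proof.
move=> m b p; split; [exact: ig_unfold (@ig_phi R) summ_phi m b p|exact: I2_unfold (@ig_phi R) summ_phi m b p].
Qed.
Lemma ig_Phi : ig (fun x => cellf 1 0 x * Phi x) /\ I2 (fun x => cellf 1 0 x * Phi x) = kph.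
Proof.
have [] := @Phi_cell (fun=> 1) 1 _ _ _ => //; first by move=> x; rewrite normr1.
move=> i e; split; first by apply: eq_ig i => x; rewrite mulr1.
rewrite -(eq_I2 (_ : (fun x => cellf 1 0 x * 1 * Phi x) =1 _)) ?e; last by move=> x; rewrite mulr1.
by apply: eq_I2 => x; rewrite mul1r.
Qed.
Lemma lint_Phi : lint Phi.
Proof. exact: lint_periodic Phi_periodic ig_Phi.1. Qed.
End PeriodicKernel.

(** * Fourier coefficients and uniqueness *)

Section Fourier.
Context {R : realType}.
Local Notation R2 := (R * R)%type.
Implicit Types (x y z w u xi : R2) (f g h chi : R2 -> R) (m D : int * int).

Definition th xi x : R := 2 * pi * (xi.1 * x.1 + xi.2 * x.2).
Definition ch xi x : R := cos (th xi x).
Definition sh xi x : R := sin (th xi x).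
Lemma thD xi x y : th xi (x + y) = th xi x + th xi y.
Proof. by rewrite /th /=; ring. Qed.
Lemma thN xi x : th xi (- x) = - th xi x.
Proof. by rewrite /th /=; ring. Qed.
Lemma chD xi x y : ch xi (x + y) = ch xi x * ch xi y - sh xi x * sh xi y.
Proof. by rewrite /ch /sh thD cosD. Qed.
Lemma shN xi x : sh xi (- x) = - sh xi x.
Proof. by rewrite /sh thN sinN. Qed.
Lemma ch_le1 xi x : `|ch xi x| <= 1.
Proof. by rewrite ler_norml cos_geN1 cos_le1. Qed.
Lemma sh_le1 xi x : `|sh xi x| <= 1.
Proof. by rewrite ler_norml sin_geN1 sin_le1. Qed.
Lemma measurable_th xi : measurable_fun setT (th xi).
Proof. by apply: measurable_funM => //; apply: measurable_funD; apply: measurable_funM. Qed.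
Lemma measurable_ch xi : measurable_fun setT (ch xi).
Proof.
apply: (@measurableT_comp _ _ _ _ _ _ (@cos R)); last exact: measurable_th.
by apply: continuous_measurable_fun; exact: continuous_cos.
Qed.
Lemma measurable_sh xi : measurable_fun setT (sh xi).
Proof.
apply: (@measurableT_comp _ _ _ _ _ _ (@sin R)); last exact: measurable_th.
by apply: continuous_measurable_fun; exact: continuous_sin.
Qed.
Lemma trig_int (a : R) (n : int) : cos (a + 2 * pi * n%:~R) = cos a /\ sin (a + 2 * pi * n%:~R) = sin a.
Proof.
have p (b : R) (k : nat) : cos (b + 2 * pi * k%:R) = cos b /\ sin (b + 2 * pi * k%:R) = sin b.
  have -> : 2 * pi * k%:R = pi *+ 2 *+ k :> R by rewrite mulr_natr [2 * _]mulr_natl.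
  by split; [exact: (periodicn (@cosD2pi R))|exact: (periodicn (@sinD2pi R))].
case: n => k; first exact: p.
rewrite NegzE mulrNz mulrN -pmulrn; have [e1 e2] := p (a - 2 * pi * k.+1%:R) k.+1.
by rewrite subrK in e1 e2.
Qed.
Lemma th_zr m x D : th (zr m) (x + zr D) = th (zr m) x + 2 * pi * (m.1 * D.1 + m.2 * D.2)%:~R.
Proof. by rewrite thD; congr (_ + _); rewrite /th /zr /= intrD !intrM. Qed.
Lemma ch_periodic m : periodic (ch (zr m)).
Proof. by move=> x D; rewrite /ch th_zr; case: (trig_int (th (zr m) x) (m.1 * D.1 + m.2 * D.2)). Qed.
Lemma sh_periodic m : periodic (sh (zr m)).
Proof. by move=> x D; rewrite /sh th_zr; case: (trig_int (th (zr m) x) (m.1 * D.1 + m.2 * D.2)). Qed.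

Lemma sh_even f xi : ig f -> (forall x, f (- x) = f x) -> I2 (fun x => sh xi x * f x) = 0.
Proof.
move=> hf ef; have i : ig (fun x => sh xi x * f x).
  exact: ig_mulb (measurable_sh xi) (sh_le1 xi) hf.
have := I2_opp i; rewrite (@eq_I2 _ _ (fun x => - (sh xi x * f x))); last by move=> x; rewrite shN ef mulNr.
rewrite I2N//; lra.
Qed.
Lemma igch f xi : ig f -> ig (fun x => ch xi x * f x).
Proof. exact: ig_mulb (measurable_ch xi) (ch_le1 xi). Qed.
Lemma igsh f xi : ig f -> ig (fun x => sh xi x * f x).
Proof. exact: ig_mulb (measurable_sh xi) (sh_le1 xi). Qed.
Lemma ch_shift f xi y : ig f -> (forall x, f (- x) = f x) ->
  I2 (fun x => ch xi (x + y) * f x) = ch xi y * I2 (fun x => ch xi x * f x).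
Proof.
move=> hf ef; rewrite (@eq_I2 _ _ (fun x => ch xi y * (ch xi x * f x) - sh xi y * (sh xi x * f x))); last first.
  by move=> x; rewrite chD; ring.
rewrite I2B; [|by apply: igZ; exact: igch|by apply: igZ; exact: igsh].
by rewrite I2Z ?I2Z; [rewrite (sh_even _ hf ef) mulr0 subr0|exact: igsh|exact: igch].
Qed.

Lemma I2_conv f g chi c : ig f -> good g -> measurable_fun setT chi -> (forall x, `|chi x| <= c) ->
  ig (fun x => chi x * pot f g x) /\
  I2 (fun x => chi x * pot f g x) = I2 (fun y => g y * I2 (fun x => chi (x + y) * f x)).
Proof.
move=> hf hg mchi chic; have [C C0 gC] := goodC hg.
have gb y : `|g y| <= C by apply: (le_trans (gC C (lexx _) y)); rewrite ler_piMr ?ind_le1// ltW.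
have mg := good_meas hg; have mf := ig_meas hf.
have iy x : ig (fun y => f (x - y) * g y).
  apply: (@eq_ig _ (fun y => g y * f (x - y))); first by move=> y; rewrite mulrC.
  by apply: (ig_mulb mg gb); exact: (I2_reflect x hf).1.
pose F x y := chi x * (f (x - y) * g y).
have iF1 x : ig (F x) by exact: igZ.
have ix y : ig (fun x => chi x * f (x - y)) by apply: (ig_mulb mchi chic); exact: (ig_trans (- y) hf).
have iF2 y : ig (F^~ y).
  by apply: eq_ig (igZ (g y) (ix y)) => x; rewrite /F; ring.
have mF : measurable_fun setT (fun p : R2 * R2 => F p.1 p.2).
  have mB : measurable_fun setT (fun p : R2 * R2 => p.1 - p.2).
    apply: measurable_fun_pair => /=; apply: measurable_funB;
      by apply: measurableT_comp => //; exact: measurableT_comp.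
  apply: measurable_funM; first exact: (measurableT_comp mchi measurable_fst).
  by apply: measurable_funM; [exact: (measurableT_comp mf mB)|exact: (measurableT_comp mg measurable_snd)].
pose M := c * I2 (fun x => `|f x|).
have fF : (\int[@leb2 R]_x \int[@leb2 R]_y `|F x y|%:E < +oo)%E.
  rewrite (tonelli_abs mF); apply: (@le_lt_trans _ _ (\int[@leb2 R]_y (M * `|g y|)%:E)%E); last first.
    by rewrite (I2E (igZ M (ig_abs (good_ig hg)))) ltry.
  apply: ge0_le_integral => //.
  - by move=> y _; apply: integral_ge0 => x _; rewrite lee_fin.
  - apply: (@measurable_fun_fubini_tonelli_G _ _ _ _ _ (@leb2 R) (fun p => `|F p.1 p.2|%:E)).
      by apply/measurable_EFinP/measurableT_comp.
    by move=> p; rewrite lee_fin.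
  - by apply/measurable_EFinP; apply: measurable_funM => //; exact: measurableT_comp.
  - move=> y _; rewrite (I2E (ig_abs (iF2 y))) lee_fin /M.
    rewrite mulrAC -I2Z; last exact: ig_abs.
    rewrite -(I2_trans (- y) (igZ _ (ig_abs hf))); apply: I2_le; [exact: ig_abs|by apply: (ig_trans (- y) (igZ _ (ig_abs hf)))|].
    move=> x; rewrite /F !normrM mulrA mulrAC; apply: ler_wpM2r => //; apply: ler_wpM2r => //.
have e x : I2 (F x) = chi x * pot f g x by rewrite /F I2Z.
split; first exact: eq_ig e (ig_inner mF fF iF1).
rewrite -(eq_I2 e) (I2_swap mF fF iF1 iF2); apply: eq_I2 => y.
rewrite (@eq_I2 _ _ (fun x => g y * (chi x * f (x - y)))); last by move=> x; rewrite /F; ring.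
rewrite I2Z//; congr (_ * _); rewrite -(I2_trans y (ix y)); apply: eq_I2 => x.
by rewrite addrK.
Qed.

(* Passing from the charge at the origin to the average over its quarter turns by [u]
   makes the potential of the background disappear up to a convolution. *)
Lemma phi_average u x :
  phi x - 4^-1 * \sum_(v <- qr) phi (x - cm v u) = fq u x - pot (fq u) Qf x.
Proof.
have kl := @ker_lg R; have gQ := good_Q (R := R).
have e : pot (fq u) Qf x = 4^-1 * \sum_(v <- qr) PQ (x - cm v u) - PQ x.
  have i v : ig (fun y => lg (x - cm v u - y) * Qf y) by exact: ig_pot.
  rewrite /pot (@eq_I2 _ _ (fun y => 4^-1 * (lg (x - cm (1, 0) u - y) * Qf y + lg (x - cm (-1, 0) u - y) * Qf y
     + lg (x - cm (0, 1) u - y) * Qf y + lg (x - cm (0, -1) u - y) * Qf y) - lg (x - y) * Qf y)); last first.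
    by move=> y; rewrite /fq sum_qr ![x - y - _]addrAC; ring.
  have j2 := igD (i (1, 0)) (i (-1, 0)); have j3 := igD j2 (i (0, 1)); have j4 := igD j3 (i (0, -1)).
  rewrite (I2B (igZ _ j4) (ig_pot kl x gQ)) (I2Z _ j4) (I2D j3 (i _)) (I2D j2 (i _)) (I2D (i _) (i _)).
  by rewrite sum_qr /PQ /pot.
by rewrite e /phi /fq !sum_qr; ring.
Qed.

(** A shift by some [b] with phase [pi] changes the sign of the character, while the integral over a
    cell does not depend on shifts; hence it is zero. *)
Lemma cell_ch m : m != 0 -> ig (fun x : R2 => cellf 1 0 x * ch (zr m) x) /\
  I2 (fun x : R2 => cellf 1 0 x * ch (zr m) x) = 0 /\ I2 (fun x : R2 => cellf 1 0 x * sh (zr m) x) = 0.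
Proof.
move=> m0; have gc : good (cellf 1 0 : R2 -> R) by exact: good_cell.
have i1 : ig (fun x : R2 => cellf 1 0 x * ch (zr m) x).
  by apply: eq_ig (igch (zr m) (good_ig gc)) => x; rewrite mulrC.
have i2 : ig (fun x : R2 => cellf 1 0 x * sh (zr m) x).
  by apply: eq_ig (igsh (zr m) (good_ig gc)) => x; rewrite mulrC.
have [b hb] : exists b : R2, th (zr m) b = pi.
  have [m1|m1] := eqVneq m.1 0.
    have m2 : m.2 != 0 by apply: contraNneq m0 => m2; case: m m1 m2 {i1 i2} => a c /= -> ->.
    have m2' : m.2%:~R != 0 :> R by rewrite intr_eq0.
    by exists (0, 2^-1 / m.2%:~R); rewrite /th /zr /=; field.
  have m1' : m.1%:~R != 0 :> R by rewrite intr_eq0.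
  by exists (2^-1 / m.1%:~R, 0); rewrite /th /zr /=; field.
split => //; split.
  have [_] := cell_shift b (@ch_periodic m) i1.
  rewrite (@eq_I2 _ _ (fun x => - (cellf 1 0 x * ch (zr m) x))); last first.
    by move=> x; rewrite /ch thD hb cosDpi mulrN.
  by rewrite I2N//; lra.
have [_] := cell_shift b (@sh_periodic m) i2.
rewrite (@eq_I2 _ _ (fun x => - (cellf 1 0 x * sh (zr m) x))); last first.
  by move=> x; rewrite /sh thD hb sinDpi mulrN.
by rewrite I2N//; lra.
Qed.

Lemma I2_null f g h : good f -> good g -> (forall x, f x <= g x) -> I2 f = I2 g ->
  ig (fun x => f x * h x) -> ig (fun x => g x * h x) -> I2 (fun x => f x * h x) = I2 (fun x => g x * h x).
Proof.
move=> gf gg fg e i1 i2; apply/eqP; rewrite eq_sym -subr_eq0 -I2B//; apply/eqP.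
rewrite (@eq_I2 _ _ (fun x => (g x - f x) * h x)); last by move=> x; rewrite mulrBl.
apply: I2_zero; [exact: goodB|by move=> x; rewrite subr_ge0| |].
  by rewrite I2B ?e ?subrr//; exact: good_ig.
by apply: eq_ig (igB i2 i1) => x; rewrite mulrBl.
Qed.
Definition c0 : R2 := (2^-1, 2^-1).
(** The half-open version of the centred square [Qf], a translate of a lattice cell; the two differ
    by a null set. *)
Definition hQ x : R := cellf 1 0 (x + c0).
Lemma good_hQ : good hQ. Proof. by apply: good_trans; exact: good_cell. Qed.
Lemma hQ_le x : hQ x <= Qf x.
Proof.
rewrite /hQ cell1; case: eqP => h; last by case/andP: (Q01 x).
rewrite /Qf indT//; move: h; rewrite /fl /= => -[] /eqP + /eqP; rewrite !floor_eq /bx /= add0r !ler_norml.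
by move=> /andP[a1 a2] /andP[a3 a4]; split; apply/andP; split; lra.
Qed.
Lemma I2_hQ : I2 hQ = 1.
Proof. by rewrite /hQ (I2_trans c0 (good_ig (good_cell 0 ltr01))) I2_cell// expr1n. Qed.
Lemma hQ_Q h : ig (fun x => Qf x * h x) -> ig (fun x => hQ x * h x) /\ I2 (fun x => hQ x * h x) = I2 (fun x => Qf x * h x).
Proof.
move=> i; have j : ig (fun x => hQ x * h x).
  have e x : hQ x * (Qf x * h x) = hQ x * h x.
    have := hQ_le x; have /andP[_ q1] := Q01 x; rewrite /hQ cell1; case: eqP => _; rewrite ?mul0r// !mul1r => q.
    by rewrite (_ : Qf x = 1) ?mul1r//; apply/eqP; rewrite eq_le q1.
  apply: (eq_ig e); apply: (@ig_mulb _ _ _ 1) => //; first exact: good_meas good_hQ.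
  by move=> x; exact: cell_le1.
split => //; apply: I2_null => //; [exact: good_hQ|exact: good_Q|exact: hQ_le|by rewrite I2_hQ I2_Q].
Qed.
Lemma Q_cell g : periodic g -> ig (fun x => Qf x * g x) ->
  ig (fun x => cellf 1 0 x * g x) /\ I2 (fun x => Qf x * g x) = I2 (fun x => cellf 1 0 x * g x).
Proof.
move=> pg hg; have [iE e] := hQ_Q hg.
have pg' : periodic (fun x => g (x - c0)) by move=> x D; rewrite addrAC pg.
have i' : ig (fun x => cellf 1 0 x * g (x - c0)).
  by apply: eq_ig (ig_trans (- c0) iE) => x; rewrite /hQ subrK.
have [i2 e2] := cell_shift c0 pg' i'.
split; first by apply: eq_ig i2 => x; rewrite addrK.
rewrite -e (@eq_I2 _ (fun x => cellf 1 0 x * g x) (fun x => cellf 1 0 x * g (x + c0 - c0))); last by move=> x; rewrite addrK.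
by rewrite e2 -(I2_trans c0 i'); apply: eq_I2 => x; rewrite addrK.
Qed.

(** The Fourier transform of [phi_average] at a nonzero integer frequency, where the transform of
    the unit square vanishes and the convolution term with it. *)
Lemma phi_hat_step m u : m != 0 ->
  (1 - 4^-1 * \sum_(v <- qr) ch (zr m) (cm v u)) * I2 (fun x => ch (zr m) x * phi x) =
  I2 (fun x => ch (zr m) x * fq u x).
Proof.
move=> m0; have ip := @ig_phi R; have ep := @phi_even R; have gQ := good_Q (R := R).
set X := zr m; set P := I2 (fun x => ch X x * phi x).
have iv v : ig (fun x => ch X x * phi (x - cm v u)) by apply: igch; exact: (ig_trans (- cm v u) ip).
have ev v : I2 (fun x => ch X x * phi (x - cm v u)) = ch X (cm v u) * P.
  rewrite -(I2_trans (cm v u) (iv v)) /P -ch_shift//; apply: eq_I2 => x; by rewrite addrK.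
have [ic ec] := I2_conv (ig_fq u) gQ (measurable_ch X) (ch_le1 X).
have ec0 : I2 (fun x => ch X x * pot (fq u) Qf x) = 0.
  rewrite ec (@eq_I2 _ _ (fun y => I2 (fun x => ch X x * fq u x) * (Qf y * ch X y))); last first.
    by move=> y; rewrite ch_shift; [ring|exact: ig_fq|exact: fq_even].
  have iQ : ig (fun y => Qf y * ch X y).
    by apply: eq_ig (igch X (good_ig gQ)) => y; rewrite mulrC.
  by rewrite I2Z// (Q_cell (@ch_periodic m) iQ).2 (cell_ch m0).2.1 mulr0.
have -> : I2 (fun x => ch X x * fq u x) = I2 (fun x => ch X x * fq u x - ch X x * pot (fq u) Qf x).
  by rewrite I2B ?ec0 ?subr0//; apply: igch; exact: ig_fq.
rewrite (@eq_I2 _ (fun x => ch X x * fq u x - _) (fun x => ch X x * phi x -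
  4^-1 * (ch X x * phi (x - cm (1, 0) u) + ch X x * phi (x - cm (-1, 0) u) +
  ch X x * phi (x - cm (0, 1) u) + ch X x * phi (x - cm (0, -1) u)))); last first.
  by move=> x; rewrite -mulrBr -phi_average sum_qr; ring.
have j2 := igD (iv (1, 0)) (iv (-1, 0)); have j3 := igD j2 (iv (0, 1)); have j4 := igD j3 (iv (0, -1)).
rewrite (I2B (igch X ip) (igZ _ j4)) (I2Z _ j4) (I2D j3 (iv _)) (I2D j2 (iv _)) (I2D (iv _) (iv _)).
have [F hF] : exists F, forall v, ch X (cm v u) = F v by exists (fun v => ch X (cm v u)).
have ev' v : I2 (fun x => ch X x * phi (x - cm v u)) = F v * P by rewrite ev hF.
have -> : \sum_(v <- qr) ch X (cm v u) = \sum_(v <- qr) F v by apply: eq_bigr => v _; exact: hF.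
rewrite sum_qr (ev' (1, 0)) (ev' (-1, 0)) (ev' (0, 1)) (ev' (0, -1)) -/P.
by clearbody P; clear; ring.
Qed.

Lemma sinc_lim (b : R) : (n.+1%:R * sin (b / n.+1%:R)) @[n --> \oo] --> b.
Proof.
have d0 := @is_derive_sin R 0.
have : h^-1 * sin h @[h --> (0 : R)^'] --> (1 : R).
  have dv := @ex_derive _ _ _ _ _ _ _ d0; have := @derive_val _ _ _ _ _ _ _ d0.
  rewrite /derive cos0 => e; rewrite -e.
  have : h^-1 *: ((sin \o shift (0 : R)) (h *: (1 : R)) - sin 0) @[h --> (0 : R)^'] -->
     lim (h^-1 *: ((sin \o shift (0 : R)) (h *: (1 : R)) - sin 0) @[h --> (0 : R)^']) by exact: dv.
  apply: cvg_trans; apply: near_eq_cvg; apply: nearW => h /=.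
  by rewrite sin0 subr0 addr0 /GRing.scale /= mulr1.
move=> hs; have [->|b0] := eqVneq b 0.
  by under eq_fun do rewrite mul0r sin0 mulr0; exact: cvg_cst.
apply/cvgrPdist_le => e e0; have be : 0 < e / `|b| by rewrite divr_gt0// normr_gt0.
move/cvgrPdist_le: hs => /(_ _ be); rewrite near_withinE => -[d /= dd0 hd].
exists (Num.trunc (`|b| / d)).+1 => // n /= hn.
have n0 : 0 < n.+1%:R :> R by rewrite ltr0n.
have := hd (b / n.+1%:R); rewrite /ball /= sub0r normrN normrM [`|n.+1%:R^-1|]ger0_norm ?invr_ge0 ?(ltW n0)//.
have hb : `|b| / n.+1%:R < d.
  rewrite ltr_pdivrMr// -ltr_pdivrMl// mulrC; apply: (lt_le_trans (truncnS_gt _)).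
  by rewrite ler_nat leqW.
move=> /(_ hb) /(_ _)/wrap[]; first by rewrite mulf_neq0// invr_eq0 gt_eqF.
rewrite ler_pdivlMr ?normr_gt0// -normrM; apply: le_trans; rewrite le_eqVlt; apply/orP; left; apply/eqP.
by congr (`|_|); field; rewrite b0 gt_eqF.
Qed.

(** Take [u = (1 / (n + 1), 0)], multiply by [(n + 1)^2] and let [n] grow. On the left the factor is
    the sum of [sin^2 (pi m.i / (n + 1))], giving [pi^2 |m|^2]; on the right scaling flattens the
    character and leaves the integral of [fq (1, 0)]. *)
Lemma phi_hat m : m != 0 ->
  pi ^+ 2 * (m.1%:~R ^+ 2 + m.2%:~R ^+ 2) * I2 (fun x => ch (zr m) x * phi x) = alpha (1, 0).
Proof.
move=> m0; set P := I2 _.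
pose u n : R2 := (n.+1%:R^-1, 0).
have n0 n : n.+1%:R != 0 :> R by rewrite pnatr_eq0.
have nu n : nsq (u n) = n.+1%:R ^- 2 by rewrite /nsq /= expr0n addr0 exprVn.
have cmu n x : cm (u n) x = sc n.+1%:R^-1 x by rewrite sc_cm.
have A n : n.+1%:R ^+ 2 * ((1 - 4^-1 * \sum_(v <- qr) ch (zr m) (cm v (u n))) * P) =
    I2 (fun x => ch (zr m) (sc n.+1%:R^-1 x) * fq (1, 0) x).
  rewrite phi_hat_step//; have i := igch (zr m) (ig_fq (u n)).
  have nz : nsq (u n) != 0 by rewrite nu invr_eq0 expf_neq0.
  have := I2_cm nz i; rewrite nu invrK => <-.
  apply: (@I2_eq_off _ (0 :: qr)); first exact: (ig_cm nz i).
    apply: (@ig_mulb _ _ _ 1); [|by move=> x; exact: ch_le1|exact: ig_fq].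
    exact: measurableT_comp (measurable_ch _) (measurable_sc _).
  move=> x; rewrite in_cons negb_or => /andP[x0 xq]; rewrite fq_scale ?cmu//.
  by apply: contra_neq nz => ->; rewrite /nsq /= expr0n addr0.
have B n : n.+1%:R ^+ 2 * ((1 - 4^-1 * \sum_(v <- qr) ch (zr m) (cm v (u n))) * P) =
   ((n.+1%:R * sin (pi * m.1%:~R / n.+1%:R)) ^+ 2 + (n.+1%:R * sin (pi * m.2%:~R / n.+1%:R)) ^+ 2) * P.
  have c2 (t : R) : cos (t *+ 2) = 1 - 2 * sin t ^+ 2 by rewrite cos_mulr2n cos2sin2; ring.
  have e1 : ch (zr m) (cm (1, 0) (u n)) = 1 - 2 * sin (pi * m.1%:~R / n.+1%:R) ^+ 2.
    by rewrite -c2 /ch; congr cos; rewrite /th /cm /zr /u /=; move: (_^-1) => q; ring.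
  have e2 : ch (zr m) (cm (-1, 0) (u n)) = 1 - 2 * sin (pi * m.1%:~R / n.+1%:R) ^+ 2.
    by rewrite -c2 /ch -cosN; congr cos; rewrite /th /cm /zr /u /=; move: (_^-1) => q; ring.
  have e3 : ch (zr m) (cm (0, 1) (u n)) = 1 - 2 * sin (pi * m.2%:~R / n.+1%:R) ^+ 2.
    by rewrite -c2 /ch; congr cos; rewrite /th /cm /zr /u /=; move: (_^-1) => q; ring.
  have e4 : ch (zr m) (cm (0, -1) (u n)) = 1 - 2 * sin (pi * m.2%:~R / n.+1%:R) ^+ 2.
    by rewrite -c2 /ch -cosN; congr cos; rewrite /th /cm /zr /u /=; move: (_^-1) => q; ring.
  by rewrite sum_qr e1 e2 e3 e4; field.
have L1 : (((n.+1%:R * sin (pi * m.1%:~R / n.+1%:R)) ^+ 2 + (n.+1%:R * sin (pi * m.2%:~R / n.+1%:R)) ^+ 2) * P)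
    @[n --> \oo] --> (((pi * m.1%:~R) ^+ 2 + (pi * m.2%:~R) ^+ 2) * P : R).
  apply: cvgM; last exact: cvg_cst.
  by apply: cvgD; rewrite !expr2; apply: cvgM; exact: sinc_lim.
have L2 : I2 (fun x => ch (zr m) (sc n.+1%:R^-1 x) * fq (1, 0) x) @[n --> \oo] --> alpha (1, 0).
  apply: (@I2_dct _ _ _ (fun x => `|fq (1, 0) x|) _ (ig_abs (ig_fq (1, 0))) _ _).2.
  - move=> n; apply: measurable_funM; last exact: ig_meas (ig_fq _).
    exact: measurableT_comp (measurable_ch _) (measurable_sc _).
  - by move=> n x; rewrite normrM ler_piMl// ch_le1.
  move=> x; rewrite -[X in _ --> X]mul1r; apply: cvgM; last exact: cvg_cst.
  rewrite /ch (_ : (fun n : nat => _) = (fun n => cos (th (zr m) x * n.+1%:R^-1))); last first.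
    by apply/funext => n; congr cos; rewrite /th /sc /=; ring.
  rewrite -[X in _ --> X]cos0 -[X in _ --> cos X](mulr0 (th (zr m) x)).
  apply: continuous_cvg; first exact: continuous_cos.
  by apply: cvgM; [exact: cvg_cst|exact: cvg_harmonic].
have -> : pi ^+ 2 * (m.1%:~R ^+ 2 + m.2%:~R ^+ 2) * P = ((pi * m.1%:~R) ^+ 2 + (pi * m.2%:~R) ^+ 2) * P.
  by rewrite !exprMn mulrDr.
apply: (cvg_unique _ L1); first exact: norm_hausdorff.
by move: L2; apply: cvg_trans; apply: near_eq_cvg; apply: nearW => n; rewrite -A B.
Qed.
End Fourier.

(** * Uniqueness of a periodic function with given Fourier coefficients *)

Section Uniqueness.
Context {R : realType}.
Local Notation R2 := (R * R)%type.
Implicit Types (x y z w u xi : R2) (f g chi : R2 -> R) (m D e : int * int).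

Definition zig f := ig f /\ I2 f = 0.
Lemma zigD f g : zig f -> zig g -> zig (fun x => f x + g x).
Proof. by move=> [i1 e1] [i2 e2]; split; [exact: igD|rewrite I2D// e1 e2 addr0]. Qed.
Lemma zigZ c f : zig f -> zig (fun x => c * f x).
Proof. by move=> [i1 e1]; split; [exact: igZ|rewrite I2Z// e1 mulr0]. Qed.
Lemma eq_zig f g : f =1 g -> zig f -> zig g.
Proof. by move=> e [i1 e1]; split; [exact: eq_ig i1|rewrite -(eq_I2 e)]. Qed.

Section unique.
Variable H : R2 -> R.
Hypotheses (pH : periodic H) (cH : forall x, offl x -> ctsat H x).
Hypothesis hH : forall m, zig (fun x => cellf 1 0 x * H x * ch (zr m) x) /\
  zig (fun x => cellf 1 0 x * H x * sh (zr m) x).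
Local Notation W := (fun x : R2 => cellf 1 0 x * H x).
Let Z chi := forall m, zig (fun x => W x * chi x * ch (zr m) x) /\ zig (fun x => W x * chi x * sh (zr m) x).

(** The product formulas move the frequency [m] to [m + e] and [m - e], at which the coefficients
    also vanish. With [c] and [s] the values of the character at [x0], the factor is
    [(1 + ch (x - x0)) / 2]. *)
Let step chi e (c s : R) : Z chi -> Z (fun x => chi x * ((1 + c * ch (zr e) x + s * sh (zr e) x) / 2)).
Proof.
move=> hZ m; have thz m' x : th (zr (m + m')) x = th (zr m) x + th (zr m') x.
  by rewrite /th /zr /= !intrD; ring.
have thn x : th (zr (- e)) x = - th (zr e) x by rewrite /th /zr /= !mulrNz; ring.
have [z1 z2] := hZ m; have [p1 p2] := hZ (m + e); have [n1 n2] := hZ (m + - e).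
split.
  apply: (eq_zig _ (zigD (zigZ 2^-1 z1) (zigD (zigZ (c / 4) (zigD p1 n1)) (zigZ (s / 4) (zigD p2 (zigZ (-1) n2)))))).
  by move=> x; rewrite /ch /sh !thz thn !cosD !sinD cosN sinN; field.
apply: (eq_zig _ (zigD (zigZ 2^-1 z2) (zigD (zigZ (c / 4) (zigD p2 n2)) (zigZ (s / 4) (zigD n1 (zigZ (-1) p1)))))).
by move=> x; rewrite /ch /sh !thz thn !cosD !sinD cosN sinN; field.
Qed.

Let E1 : int * int := (1, 0). Let E2 : int * int := (0, 1).
(** [cos^2 (pi x.1) cos^2 (pi x.2)]: a nonnegative trigonometric polynomial equal to 1 exactly on
    the lattice, whose powers serve as a peaked kernel. *)
Let kk x : R := (1 + ch (zr E1) x) / 2 * ((1 + ch (zr E2) x) / 2).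
Let Zk x0 n : Z (fun x => kk (x - x0) ^+ n).
Proof.
elim: n => [|n ih].
  by move=> m; have [h1 h2] := hH m; split; [apply: eq_zig h1|apply: eq_zig h2] => x; rewrite expr0 mulr1.
have h1 := step E1 (ch (zr E1) x0) (sh (zr E1) x0) ih.
have h2 := step E2 (ch (zr E2) x0) (sh (zr E2) x0) h1.
have e m x : ch (zr m) (x - x0) = ch (zr m) x0 * ch (zr m) x + sh (zr m) x0 * sh (zr m) x.
  by rewrite chD shN /ch thN cosN; ring.
by move=> m; have [a1 a2] := h2 m; split; [apply: eq_zig a1|apply: eq_zig a2] => x; rewrite exprSr /kk !e; ring.
Qed.
Let kk_shift x0 n : zig (fun x => cellf 1 0 x * (H (x + x0) * kk x ^+ n)).
Proof.
pose g x := H x * kk (x - x0) ^+ n.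
have pg : periodic g.
  by move=> x D; rewrite /g pH addrAC /kk !ch_periodic.
have [i e] := (Zk x0 n 0).1.
have c0 x : ch (zr 0) x = 1 by rewrite zr0 /ch /th /= !mul0r addr0 mulr0 cos0.
have ig' : ig (fun x => cellf 1 0 x * g x) by apply: eq_ig i => x; rewrite c0 /g mulr1 mulrA.
have [i2 e2] := cell_shift x0 pg ig'.
split; first by apply: eq_ig i2 => x; rewrite /g addrK.
rewrite (@eq_I2 _ _ (fun x => cellf 1 0 x * g (x + x0))); last by move=> x; rewrite /g addrK.
by rewrite e2 -[RHS]e; apply: eq_I2 => x; rewrite c0 /g mulr1 mulrA.
Qed.

Let kkE x : kk x = cos (pi * x.1) ^+ 2 * cos (pi * x.2) ^+ 2.
Proof.
have c2 (t : R) : (1 + cos (t *+ 2)) / 2 = cos t ^+ 2 by rewrite cos_mulr2n; field.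
by rewrite /kk -!c2; congr ((1 + cos _) / 2 * ((1 + cos _) / 2)); rewrite /th /zr /=; ring.
Qed.

Let numer (h A C q1 q2 : R) : 0 < h -> 0 <= q2 -> q2 < q1 -> ~ (forall n : nat, h * q1 ^+ n <= q2 ^+ n * C).
Proof.
move=> h0 q20 q12 hn; have q10 : 0 < q1 := le_lt_trans q20 q12.
have z1 : `|q2 / q1| < 1 by rewrite ger0_norm ?divr_ge0// ?(ltW q10)// ltr_pdivrMr// mul1r.
have /cvgrPdist_lt /(_ h h0)[n _ /(_ n (leqnn n))] := cvg_geometric C z1.
rewrite /geometric /= sub0r normrN ltNge => /negP; apply.
apply: le_trans (ler_norm _); rewrite expr_div_n mulrA ler_pdivlMr ?exprn_gt0//.
by rewrite [C * _]mulrC.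
Qed.

Let near_int (r t : R) : 0 < r -> 0 <= t -> t < 1 ->
  (exists k : int, `|t - k%:~R| <= r) \/ (r <= t /\ t <= 1 - r).
Proof.
move=> r0 t0 t1; have [k1|k1] := leP r t; last by left; exists 0; rewrite subr0 ger0_norm// ltW.
have [k2|k2] := leP t (1 - r); first by right.
by left; exists 1; rewrite ler_norml; apply/andP; split; lra.
Qed.
Let sub_small (r : R) (x : R2) : r <= 1 / 8 -> (0 <= x.1 < r / 2) && (0 <= x.2 < r / 2) ->
  [/\ x.1 < r, x.2 < r & (0 <= x.1 < 1) && (0 <= x.2 < 1)].
Proof.
move=> r8 /andP[/andP[k1 k2] /andP[k3 k4]]; rewrite k1 k3 /=; split; lra.
Qed.
Let far_bound (G k q A : R) : 0 <= k -> k <= q -> `|G| = A -> - (q * A) <= G * k.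
Proof.
move=> k0 kq <-; have : `|G * k| <= q * `|G| by rewrite normrM (ger0_norm k0) mulrC ler_wpM2r.
by rewrite ler_norml => /andP[].
Qed.

(** If [H x0] were nonzero, [H] would keep its sign near [x0] by continuity. Against the powers of
    [kk] centred at [x0], this neighbourhood contributes at least a constant times [q1^n] and the
    rest at most a constant times [q2^n] with [q2 < q1], while the integral vanishes. Only
    integrability is used at the singularities. *)
Lemma fourier_unique x0 : offl x0 -> H x0 = 0.
Proof.
move=> hx0; apply/eqP/negPn/negP => Hx0.
have a0 : 0 < `|H x0| by rewrite normr_gt0.
have [d d0 hd] := cH hx0 (divr_gt0 a0 (ltr0n R 2)).
pose G x := H x0 * H (x + x0).
pose h := H x0 ^+ 2 / 2; have h0 : 0 < h by rewrite divr_gt0// exprn_even_gt0.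
have Gh x D : nrm (x - zr D) < d -> h <= G x.
  move=> hx; have := hd (x - zr D + x0); rewrite addrK => /(_ hx).
  have -> : H (x - zr D + x0) = H (x + x0) by rewrite addrAC -zrN pH.
  move=> k; rewrite /G; have : `|H x0 * (H (x + x0) - H x0)| <= h.
    by rewrite normrM /h -[H x0 ^+ 2]real_normK ?num_real// expr2 -mulrA ler_pM2l.
  rewrite ler_norml => /andP[k1 _]; move: k1; rewrite mulrBr -expr2.
  by move: h0; rewrite /h; move: (H x0 ^+ 2) (H x0 * _) => a b; lra.
pose r : R := Num.min d 1 / 8.
have m1 : Num.min d 1 <= d by rewrite ge_min lexx.
have m2 : Num.min d 1 <= 1 by rewrite ge_min lexx orbT.
have m0 : 0 < Num.min d 1 by rewrite lt_min d0 ltr01.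
have r0 : 0 < r by rewrite divr_gt0.
have r8 : r <= 1 / 8 by rewrite /r; lra.
have rd : 2 * r < d by rewrite /r; lra.
(* Below, [q1] bounds [kk] from below on the square [[0, r/2)^2], and [q2] bounds it from above
   where some coordinate is at distance at least [r] from the integers. Between the two regions the
   sign of [G] suffices. *)
have pi0 := @pi_gt0 R.
pose c := cos (pi * r); pose q2 := c ^+ 2; pose q1 := ((1 + c) / 2) ^+ 2.
have in0pi (t : R) : 0 <= t -> t <= 1 -> pi * t \in `[0, pi].
  by move=> t0 t1; rewrite in_itv /= mulr_ge0 ?(ltW pi0)//= ler_piMr// ltW.
have cos_le (s t : R) : 0 <= s -> s <= t -> t <= 1 -> cos (pi * t) <= cos (pi * s).
  move=> s0 st t1; rewrite le_eqVlt; have [->|ne] := eqVneq s t; first by rewrite eqxx.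
  apply/orP; right; rewrite ltr_cos ?ltr_pM2l//; [by rewrite lt_neqAle ne|..]; apply: in0pi => //; lra.
have c1 : c < 1.
  by rewrite -cos0 -(mulr0 pi) ltr_cos ?ltr_pM2l//; apply: in0pi => //; lra.
have c0 : 0 <= c by apply: cos_ge0_pihalf; apply/andP; split; nra.
have q20 : 0 <= q2 by exact: sqr_ge0.
have q12 : q2 < q1 by rewrite /q1 /q2 ltrXn2r// ?nnegrE; lra.
have kk0 x : 0 <= kk x by rewrite kkE mulr_ge0 ?sqr_ge0.
have cs1 (t : R) : cos t ^+ 2 <= 1 by rewrite cos2sin2; have := sqr_ge0 (sin t); lra.
have far (t : R) : r <= t -> t <= 1 - r -> cos (pi * t) ^+ 2 <= q2.
  move=> t1 t2; have a1 : cos (pi * t) <= c by apply: cos_le => //; lra.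
  have a2 : - c <= cos (pi * t).
    have -> : - c = cos (pi * (1 - r)).
      by rewrite mulrBr mulr1 addrC cosDpi cosN.
    by apply: cos_le; lra.
  by rewrite /q2; nra.
have close (t : R) : 0 <= t -> t <= r / 2 -> (1 + c) / 2 <= cos (pi * t) ^+ 2.
  move=> t0 t1; have -> : (1 + c) / 2 = cos (pi * (r / 2)) ^+ 2.
    by rewrite /c (_ : pi * r = pi * (r / 2) *+ 2); [rewrite cos_mulr2n; field|rewrite -mulr_natr; field].
  have k1 : cos (pi * (r / 2)) <= cos (pi * t) by apply: cos_le; lra.
  have k2 : 0 <= cos (pi * (r / 2)) by apply: cos_ge0_pihalf; apply/andP; split; nra.
  by rewrite lerXn2r ?nnegrE//; exact: le_trans k1.
have r2 : 0 < r / 2 by rewrite divr_gt0.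
have nearn x (D : int * int) : `|x.1 - D.1%:~R| <= r -> `|x.2 - D.2%:~R| <= r -> h <= G x.
  move=> k1 k2; apply: (Gh x D); apply: le_lt_trans rd; apply: (le_trans (nrm_le _)).
  by rewrite /= mulrDl mul1r; exact: lerD.
pose V x := cellf 1 0 x * G x.
have iV : ig V.
  have [i _] := kk_shift x0 0; apply: eq_ig (igZ (H x0) i) => x.
  by rewrite /V /G expr0 mulr1 mulrCA.
pose small x := (0 <= x.1 < r / 2) && (0 <= x.2 < r / 2).
have cs x : cellf (r / 2) 0 x = (small x)%:R :> R.
  by rewrite /cellf fl_eq /= !add0r !ler_pdivlMl// !ltr_pdivrMl// !mulr0 !mulr1.
have VE x : V x = ((0 <= x.1 < 1) && (0 <= x.2 < 1))%:R * G x by rewrite /V cell1 fl_eq /= !add0r.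
have ptw n x : cellf (r / 2) 0 x * (h * q1 ^+ n) - q2 ^+ n * `|V x| <= H x0 * (cellf 1 0 x * (H (x + x0) * kk x ^+ n)).
  have -> : H x0 * (cellf 1 0 x * (H (x + x0) * kk x ^+ n)) = V x * kk x ^+ n by rewrite /V /G; ring.
  have q2n : 0 <= q2 ^+ n by exact: exprn_ge0.
  have kn : 0 <= kk x ^+ n by exact: exprn_ge0.
  have n0 : 0 <= q2 ^+ n * `|V x| by exact: mulr_ge0.
  rewrite cs; have [/andP[/andP[b1 b2] /andP[b3 b4]]|hin] := boolP ((0 <= x.1 < 1) && (0 <= x.2 < 1)); last first.
    have sF : ~~ small x.
      by apply: contra hin => /(sub_small r8)[].
    by rewrite (negbTE sF) VE (negbTE hin) !mul0r normr0 mulr0 subr0.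
  have VG : V x = G x by rewrite VE b1 b2 b3 b4 mul1r.
  rewrite VG in n0 *.
  have [[k1 hk1]|[f1 f2]] := near_int r0 b1 b2; last first.
    have sF : ~~ small x by apply/negP => /(sub_small r8)[s1 _ _]; move: s1; rewrite ltNge f1.
    rewrite (negbTE sF) mul0r sub0r.
    have hk : kk x ^+ n <= q2 ^+ n.
      rewrite lerXn2r ?nnegrE//; rewrite kkE -[X in _ <= X]mulr1; apply: ler_pM; rewrite ?sqr_ge0//.
      exact: far.
    exact: far_bound.
  have [[k2 hk2]|[f1 f2]] := near_int r0 b3 b4; last first.
    have sF : ~~ small x by apply/negP => /(sub_small r8)[_ s1 _]; move: s1; rewrite ltNge f1.
    rewrite (negbTE sF) mul0r sub0r.
    have hk : kk x ^+ n <= q2 ^+ n.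
      rewrite lerXn2r ?nnegrE//; rewrite kkE -[X in _ <= X]mul1r; apply: ler_pM; rewrite ?sqr_ge0//.
      exact: far.
    exact: far_bound.
  have Gx : h <= G x by exact: (nearn x (k1, k2)).
  case: (boolP (small x)) => [/andP[s1 s2]|_]; last first.
    rewrite mul0r sub0r; apply: (@le_trans _ _ 0); first by rewrite oppr_le0.
    by apply: mulr_ge0 => //; exact: le_trans (ltW h0) Gx.
  rewrite mul1r; apply: (@le_trans _ _ (h * q1 ^+ n)); first by rewrite gerBl.
  apply: ler_pM; [exact: ltW|by apply: exprn_ge0; exact: sqr_ge0|exact: Gx|].
  rewrite lerXn2r ?nnegrE ?sqr_ge0// kkE /q1 expr2.
  have p1 : 0 <= (1 + c) / 2 by lra.
  by move: s1 s2 => /andP[u1 u2] /andP[u3 u4]; apply: ler_pM => //; apply: close => //; exact: ltW.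
apply: (@numer (h * (r / 2) ^+ 2) 0 (I2 (fun x => `|V x|)) q1 q2) => //; first by rewrite mulr_gt0// exprn_gt0.
move=> n; have [i e] := kk_shift x0 n.
have ic : ig (fun x => cellf (r / 2) 0 x * (h * q1 ^+ n)).
  by apply: (@eq_ig _ (fun x => (h * q1 ^+ n) * cellf (r / 2) 0 x)); [move=> x; rewrite mulrC|apply: igZ; apply: good_ig; exact: good_cell].
have iq : ig (fun x => q2 ^+ n * `|V x|) by apply: igZ; exact: ig_abs.
have := I2_le (igB ic iq) (igZ (H x0) i) (ptw n).
rewrite I2Z// e mulr0 I2B// I2Z; last exact: ig_abs.
rewrite (@eq_I2 _ _ (fun x => (h * q1 ^+ n) * cellf (r / 2) 0 x)); last by move=> x; rewrite mulrC.
rewrite I2Z; last by apply: good_ig; exact: good_cell.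
rewrite I2_cell// subr_le0; apply: le_trans.
by rewrite mulrAC.
Qed.
End unique.
End Uniqueness.

(** * Identification of the lattice sum with the periodic Green function *)

Section Identification.
Context {R : realType}.
Local Notation R2 := (R * R)%type.
Lemma offl_small (x : R2) : x != 0 -> `|x.1| < 1 -> `|x.2| < 1 -> offl x.
Proof.
move=> x0 x1 x2 D; apply/negP; rewrite addr_eq0 => /eqP e; rewrite e in x0 x1 x2.
have n2 (a : int) : `|- a%:~R| < 1 :> R -> a = 0.
  by rewrite normrN -intr_norm -[1]/(1%:~R) ltr_int => h; lia.
by move: x0; case: D x1 x2 {e} => a b /= /n2 -> /n2 ->; rewrite zr0 oppr0 eqxx.
Qed.

Variables (G1 : R2 -> R) (Cmad : R).
Hypotheses (hG : IsG1 G1) (hC : IsCmad G1 Cmad).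

Let pG : periodic G1. Proof. by move=> x D; case: hG => p _ _ _ _; exact: p. Qed.
Let cG x : offl x -> ctsat G1 x.
Proof.
move=> hx e e0; have [_ cont _ _ _] := hG.
have hl : ~ on_lattice x.
  move=> [m1 [m2 E]]; have := hx (- (m1, m2)); rewrite zrN E => /eqP; apply.
  by rewrite /zr /= subrr.
have /cvgrPdist_le /(_ e e0) := cont x hl; move/nbhs_ballP => -[d /= d0 hd].
exists d => // x' hx'; rewrite distrC; apply: hd; split; rewrite /ball /= distrC.
  exact: le_lt_trans (nrm_ge1 (x' - x)) hx'.
exact: le_lt_trans (nrm_ge2 (x' - x)) hx'.
Qed.
Let cellQ (f : R2 -> R) : Rint2 (@cell R) f = I2 (fun x => Qf x * f x).
Proof. by rewrite Rint2_I2 /cell sqE mul1r. Qed.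
Let iG : ig (fun x => Qf x * G1 x).
Proof.
have [_ _ i _ _] := hG; move: i; rewrite /cell sqE mul1r => /integrable_mkcond.
move=> /(_ (measurable_bx _)); rewrite /ig; congr (integrable _ _ _); apply/funext => x.
rewrite patchE /= /Qf indicE; case: ifP => _; by rewrite ?mul1r ?mul0r.
Qed.
Let hatG m : ig (fun x => cellf 1 0 x * (ch (zr m) x * G1 x)) /\
  I2 (fun x => cellf 1 0 x * (ch (zr m) x * G1 x)) =
  (if m == 0 then 0 else (2 * pi * (m.1%:~R ^+ 2 + m.2%:~R ^+ 2))^-1).
Proof.
have [_ _ _ h _] := hG.
have p : periodic (fun x => ch (zr m) x * G1 x) by move=> x D; rewrite ch_periodic pG.
have i : ig (fun x => Qf x * (ch (zr m) x * G1 x)).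
  by apply: eq_ig (igch (zr m) iG) => x; rewrite mulrCA.
have [i1 e1] := Q_cell p i; split => //; rewrite -e1.
have := h m.1 m.2; rewrite cellQ; have -> : (m.1 == 0) && (m.2 == 0) = (m == 0) by case: m {p i i1 e1} => a b.
by move=> <-; apply: eq_I2 => x; rewrite [G1 x * _]mulrC.
Qed.
Let hatGs m : ig (fun x => cellf 1 0 x * (sh (zr m) x * G1 x)) /\
  I2 (fun x => cellf 1 0 x * (sh (zr m) x * G1 x)) = 0.
Proof.
have [_ _ _ _ h] := hG.
have p : periodic (fun x => sh (zr m) x * G1 x) by move=> x D; rewrite sh_periodic pG.
have i : ig (fun x => Qf x * (sh (zr m) x * G1 x)).
  by apply: eq_ig (igsh (zr m) iG) => x; rewrite mulrCA.
have [i1 e1] := Q_cell p i; split => //; rewrite -e1.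
by have := h m.1 m.2; rewrite cellQ => <-; apply: eq_I2 => x; rewrite [G1 x * _]mulrC.
Qed.

(** The ratio of the Fourier coefficients: by [phi_hat] those of [Phi] are
    [alpha (1, 0) / (pi^2 |m|^2)], those of [G1] are [1 / (2 pi |m|^2)]. *)
Let t : R := 2 * alpha (1, 0) / pi.
Let H x : R := Phi x - kph - t * G1 x.
Let gcell : ig (cellf 1 0 : R2 -> R). Proof. by apply: good_ig; exact: good_cell. Qed.
Let H_zero x : offl x -> H x = 0.
Proof.
apply: fourier_unique.
- by move=> y D; rewrite /H Phi_periodic pG.
- by move=> y hy; apply: ctsB; [apply: ctsB; [exact: cts_Phi|exact: cts_cst]|apply: ctsZ; exact: cG].
move=> m; have zc : ig (fun y : R2 => cellf 1 0 y * ch (zr m) y) /\ I2 (fun y : R2 => cellf 1 0 y * ch (zr m) y) = (m == 0)%:R.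
  have [->|m0] := eqVneq m 0; last by have [i [e _]] := cell_ch (R := R) m0.
  have e (y : R2) : cellf 1 0 y * ch (zr 0) y = cellf 1 0 y.
    by rewrite zr0 /ch /th /= !mul0r addr0 mulr0 cos0 mulr1.
  by split; [apply: (eq_ig (fun y => esym (e y)))|rewrite (eq_I2 e) I2_cell// expr1n].
have zs : ig (fun y : R2 => cellf 1 0 y * sh (zr m) y) /\ I2 (fun y : R2 => cellf 1 0 y * sh (zr m) y) = 0.
  split; first by apply: eq_ig (igsh (zr m) gcell) => y; rewrite mulrC.
  have [->|m0] := eqVneq m 0; last by have [i [_ e]] := cell_ch (R := R) m0.
  rewrite (@eq_I2 _ _ (fun=> 0)) ?I20// => y; by rewrite zr0 /sh /th /= !mul0r addr0 mulr0 sin0 mulr0.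
have [gc1 gc2] := hatG m; have [gs1 gs2] := hatGs m.
have [pc1 pc2] := Phi_cell (measurable_ch (zr m)) (ch_le1 (R := R) (zr m)) (@ch_periodic R m).
have [ps1 ps2] := Phi_cell (measurable_sh (zr m)) (sh_le1 (R := R) (zr m)) (@sh_periodic R m).
rewrite (sh_even _ (@ig_phi R) (@phi_even R)) in ps2.
split; split.
- by apply: eq_ig (igB (igB pc1 (igZ kph zc.1)) (igZ t gc1)) => y; rewrite /H; ring.
- rewrite (@eq_I2 _ _ (fun y => cellf 1 0 y * ch (zr m) y * Phi y - kph * (cellf 1 0 y * ch (zr m) y) -
    t * (cellf 1 0 y * (ch (zr m) y * G1 y)))); last by move=> y; rewrite /H; ring.
  rewrite (I2B (igB pc1 (igZ kph zc.1)) (igZ t gc1)) (I2B pc1 (igZ kph zc.1)) (I2Z _ zc.1) (I2Z _ gc1) pc2 zc.2 gc2.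
  have [->|m0] := eqVneq m 0.
    rewrite mulr1 mulr0 subr0 (@eq_I2 _ _ phi) ?subrr// => y.
    by rewrite zr0 /ch /th /= !mul0r addr0 mulr0 cos0 mul1r.
  rewrite mulr0 subr0 /t -(phi_hat m0); apply/eqP; rewrite subr_eq0; apply/eqP.
  have pi0 : pi != 0 :> R by rewrite gt_eqF// pi_gt0.
  have s0 : m.1%:~R ^+ 2 + m.2%:~R ^+ 2 != 0 :> R.
    by have := nsq_eq0 (zr m : R2); rewrite /nsq /= => ->; rewrite zr_eq0.
  by move: pi0 s0; move: (pi : R) (_ + _) (I2 _) => p q P p0 q0; field; rewrite p0 q0.
- by apply: eq_ig (igB (igB ps1 (igZ kph zs.1)) (igZ t gs1)) => y; rewrite /H; ring.
rewrite (@eq_I2 _ _ (fun y => cellf 1 0 y * sh (zr m) y * Phi y - kph * (cellf 1 0 y * sh (zr m) y) -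
    t * (cellf 1 0 y * (sh (zr m) y * G1 y)))); last by move=> y; rewrite /H; ring.
rewrite (I2B (igB ps1 (igZ kph zs.1)) (igZ t gs1)) (I2B ps1 (igZ kph zs.1)) (I2Z _ zs.1) (I2Z _ gs1) ps2 zs.2 gs2.
by rewrite !mulr0 !subr0.
Qed.

Let nearC e : 0 < e -> exists2 d : R, 0 < d & forall x, x != 0 -> nrm x < d -> `|G1 x + lg x - Cmad| <= e.
Proof.
move=> e0; move: hC; rewrite /IsCmad => /cvgrPdist_le /(_ e e0).
rewrite near_withinE => /nbhs_ballP[d /= d0 hd]; exists d => // x x0 hx.
have := hd x; rewrite /= distrC (_ : ln (dist2 x (0, 0)) = lg x); last by rewrite /lg /nrm /nsq /dist2 /= !subr0.
apply => //; split; rewrite /ball /= sub0r normrN.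
  exact: le_lt_trans (nrm_ge1 x) hx.
exact: le_lt_trans (nrm_ge2 x) hx.
Qed.
Let small_offl (x : R2) : x != 0 -> nrm x < 1 -> offl x.
Proof. by move=> x0 x1; apply: offl_small x0 _ _; apply: le_lt_trans x1; [exact: nrm_ge1|exact: nrm_ge2]. Qed.
Let pick_x (d M : R) : 0 < d -> exists x : R2, [/\ x != 0, nrm x < d & lg x < M].
Proof.
move=> d0; pose s := expR (Num.min (ln d) M - 1).
have s0 : 0 < s by exact: expR_gt0.
have m1 : Num.min (ln d) M <= ln d by rewrite ge_min lexx.
have m2 : Num.min (ln d) M <= M by rewrite ge_min lexx orbT.
have ns : nrm (s, 0) = s by rewrite /nrm /nsq /= expr0n addr0 sqrtr_sqr ger0_norm// ltW.
exists (s, 0); split; first by rewrite -nrm_gt0 ns.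
  rewrite ns -[X in _ < X](@lnK _ d) ?posrE// ltr_expR; lra.
by rewrite /lg ns expRK; lra.
Qed.

(** Both [Phi + lg] and [G1 + lg] stay bounded near the origin, and [Phi - kph = t G1] there; hence
    [(1 - t) lg] is bounded near 0, although [lg] is not. *)
Let t1 : t = 1.
Proof.
apply/eqP/negPn/negP => t1; have [d1 d10 h1] := nearC ltr01; have [d2 d20 h2] := @cts_Phi0 R 1 ltr01.
have n0 : 0 < `|1 - t| by rewrite normr_gt0 subr_eq0 eq_sym.
pose B := 1 + `|t| + `|Phi (0 : R2) - kph - t * Cmad|.
have [|x [x0 xd xM]] := @pick_x (Num.min 1 (Num.min d1 d2)) (- ((B + 1) / `|1 - t|)).
  by rewrite !lt_min ltr01 d10.
move: xd; rewrite !lt_min => /and3P[xd xd1 xd2].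
have := H_zero (small_offl x0 xd); rewrite /H => hz.
have k1 := h1 x x0 xd1; have := h2 x; rewrite subr0 lg0 addr0 => /(_ xd2) k2.
have e : (1 - t) * lg x = (Phi x + lg x - Phi 0) - t * (G1 x + lg x - Cmad) + (Phi 0 - kph - t * Cmad).
  have -> : Phi x = kph + t * G1 x by lra.
  ring.
have : `|1 - t| * `|lg x| <= B.
  rewrite -normrM e /B; apply: (le_trans (ler_normD _ _)); rewrite lerD2r.
  apply: (le_trans (ler_normB _ _)); apply: lerD => //; rewrite normrM ler_piMr//.
have B0 : 0 <= B by rewrite /B addr_ge0// addr_ge0.
have l0 : lg x < 0 by apply: (lt_le_trans xM); rewrite oppr_le0 divr_ge0 ?(ltW n0)//; lra.
rewrite (ltr0_norm l0) mulrC -ler_pdivlMr//.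
have : B / `|1 - t| < (B + 1) / `|1 - t| by rewrite ltr_pM2r ?invr_gt0//; lra.
by move: xM; move: (lg x) (B / _) ((B + 1) / _) => p q s; lra.
Qed.

Lemma G1_Phi x : offl x -> G1 x = Phi x - kph.
Proof. by move=> /H_zero; rewrite /H t1 mul1r; lra. Qed.
Lemma Cmad_Phi : Cmad = Phi (0 : R2) - kph.
Proof.
apply/eqP; rewrite -subr_eq0 -normr_le0; apply/ler_addgt0Pr => e e0; rewrite add0r.
have e2 : 0 < e / 2 by rewrite divr_gt0.
have [d1 d10 h1] := nearC e2; have [d2 d20 h2] := @cts_Phi0 R _ e2.
have [|x [x0 xd xM]] := @pick_x (Num.min 1 (Num.min d1 d2)) 0.
  by rewrite !lt_min ltr01 d10.
move: xd; rewrite !lt_min => /and3P[xd xd1 xd2].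
have k1 := h1 x x0 xd1; have := h2 x; rewrite subr0 lg0 addr0 => /(_ xd2) k2.
have := G1_Phi (small_offl x0 xd) => g.
have -> : Cmad - (Phi 0 - kph) = (Phi x + lg x - Phi 0) - (G1 x + lg x - Cmad) by rewrite g; ring.
by apply: (le_trans (ler_normB _ _)); lra.
Qed.
End Identification.

(** * Finite pieces of a crystal *)

Section Scaling.
Context {R : realType}.
Local Notation R2 := (R * R)%type.
Implicit Types (x y z w u : R2) (f g h : R2 -> R).
Let kl := @ker_lg R.

Lemma pot_null f g x : good f -> good g -> (forall x, f x <= g x) -> I2 f = I2 g -> pot lg f x = pot lg g x.
Proof.
move=> gf gg fg e; have := I2_null gf gg fg e (ig_potC kl x gf) (ig_potC kl x gg).
by move=> e2; rewrite /pot; under eq_I2 do rewrite mulrC; rewrite e2; apply: eq_I2 => y; rewrite mulrC.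
Qed.

Section scale.
Variable l : R.
Hypothesis l0 : 0 < l.
Lemma I2_sc f : ig f -> ig (fun x => f (sc l x)) /\ I2 f = l ^+ 2 * I2 (fun x => f (sc l x)).
Proof.
move=> hf; have nl : nsq (l, 0) = l ^+ 2 by rewrite /nsq /= expr0n addr0.
have n0 : nsq (l, 0) != 0 by rewrite nl expf_neq0// gt_eqF.
have e x : f (cm (l, 0) x) = f (sc l x) by rewrite sc_cm.
split; first exact: eq_ig e (ig_cm n0 hf).
by rewrite -(eq_I2 e) (I2_cm n0 hf) nl mulVKf// expf_neq0// gt_eqF.
Qed.
Lemma good_sc g : good g -> good (fun x => g (sc l x)).
Proof.
move=> hg; have [C C0 gC] := goodC hg.
split; first exact: (measurableT_comp (good_meas hg) (measurable_sc l)).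
pose D := Num.max C (C / l); exists D => x.
have h1 : C <= D by rewrite le_max lexx.
have h2 : C / l <= D by rewrite le_max lexx orbT.
apply: (le_trans (gC C (lexx _) _)); apply: ler_pM; rewrite ?ind_ge0 ?(ltW C0)//.
have [[b1 b2]|hb] := pselect (bx C (sc l x)); last by rewrite (indF hb) ind_ge0.
rewrite [in X in _ <= X]indT ?ind_le1//; move: b1 b2; rewrite /bx /sc /= !normrM (gtr0_norm l0) => b1 b2.
by split; apply: le_trans h2; rewrite ler_pdivlMr// mulrC.
Qed.
Lemma pot_sc g p : good g -> pot lg g (sc l p) =
  l ^+ 2 * (ln l * I2 (fun x => g (sc l x)) + pot lg (fun x => g (sc l x)) p).
Proof.
move=> hg; have hg' := good_sc hg.
have [i e] := I2_sc (ig_pot kl (sc l p) hg); rewrite /pot e -(I2Z _ (good_ig hg')).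
rewrite -I2D; [|by apply: igZ; exact: good_ig|exact: (ig_pot kl)].
congr (_ * _); apply: (@I2_eq_off _ [:: p]) => //.
  by apply: igD; [apply: igZ; exact: good_ig|exact: (ig_pot kl)].
move=> x; rewrite inE => xp; rewrite -scB lg_sc//; first by rewrite mulrDl.
by rewrite subr_eq0 eq_sym.
Qed.
Lemma I4_sc g : good g -> I4 lg g g = l ^+ 4 *
  (ln l * I2 (fun x => g (sc l x)) ^+ 2 + I4 lg (fun x => g (sc l x)) (fun x => g (sc l x))).
Proof.
move=> hg; have hg' := good_sc hg; have [_ _ ll] := kl.
rewrite !I4E; have [i e] := I2_sc (pot_lint kl hg hg); rewrite e.
rewrite (@eq_I2 _ _ (fun x => (l ^+ 2 * ln l * I2 (fun x => g (sc l x))) * g (sc l x) +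
  l ^+ 2 * (g (sc l x) * pot lg (fun x => g (sc l x)) x))); last by move=> x; rewrite pot_sc//; ring.
have j := pot_lint kl hg' hg'.
rewrite I2D; [|by apply: igZ; exact: good_ig|exact: igZ].
by rewrite I2Z ?I2Z//; [ring|exact: good_ig].
Qed.
End scale.

Lemma PQ_hQ x : pot lg hQ x = PQ x.
Proof. by apply: pot_null; [exact: good_hQ|exact: good_Q|exact: hQ_le|rewrite I2_hQ I2_Q]. Qed.
Lemma cell_hQ (r : int * int) x : cellf 1 r x = hQ (x + - (zr r + c0)).
Proof. by rewrite /hQ opprD addrA subrK cell_zr. Qed.
Lemma pot_cell (r : int * int) (p : R2) : pot lg (cellf 1 r) p = PQ (p - zr r - c0).
Proof.
rewrite (_ : cellf 1 r = fun x => hQ (x + - (zr r + c0))); last by apply/funext => x; exact: cell_hQ.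
by rewrite (pot_trans kl _ _ good_hQ) PQ_hQ opprD addrA.
Qed.

Section box.
Variable k : nat.
Definition Bx : R2 -> R := \1_(bx k%:R).
Lemma good_Bx : good Bx. Proof. exact: good_bx. Qed.
Lemma I2_Bx : I2 Bx = (2 * k)%:R ^+ 2.
Proof. by rewrite I2_ind ?leb2_bx//=; [rewrite natrM|exact: measurable_bx]. Qed.
Let cs x : R := \sum_(r <- gidx k) cellf 1 r x.
Let gcs : good cs. Proof. by apply: good_sum => r; exact: good_cell. Qed.
Let csB x : cs x <= Bx x.
Proof.
rewrite /cs cell_sum ?uniq_gidx// invr1 sc1.
case: (boolP (_ \in _)) => [h|_]; last by rewrite ind_ge0.
rewrite /Bx indT//; move: h; rewrite mem_gidx /fl /= !floor_ge_int !floor_lt_int !intrN -!pmulrn /bx /= => /and4P[a1 a2 a3 a4].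
by rewrite !ler_norml; split; apply/andP; split => //; exact: ltW.
Qed.
Let I2_cs : I2 cs = I2 Bx.
Proof.
rewrite I2_sum; last by move=> r; apply: good_ig; exact: good_cell.
under eq_bigr => r _ do rewrite I2_cell// expr1n.
by rewrite sum_seq_const size_gidx mulr1 I2_Bx natrM expr2.
Qed.
Lemma pot_Bx p : pot lg Bx p = \sum_(r <- gidx k) PQ (p - zr r - c0).
Proof.
rewrite -(pot_null p gcs good_Bx csB I2_cs) /cs (pot_sum kl) => [|r]; last exact: good_cell.
by apply: eq_bigr => r _; rewrite pot_cell.
Qed.
Lemma lint_PQ b : lint (fun x => PQ (x + b)).
Proof. by apply: lint_trans; exact: (pot_lint kl (good_Q (R := R))). Qed.
Lemma I4_Bx : I4 lg Bx Bx = \sum_(r <- gidx k) \sum_(r' <- gidx k) I2 (fun y => Qf y * PQ (y + zr (r - r'))).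
Proof.
have gc (r : int * int) : good (cellf 1 r : R2 -> R) by exact: good_cell.
have i (r r' : int * int) : ig (fun y : R2 => cellf 1 r y * PQ (y + - (zr r' + c0))) by apply: lint_PQ.
rewrite I4E -(I2_null gcs good_Bx csB I2_cs (pot_lint kl good_Bx gcs) (pot_lint kl good_Bx good_Bx)).
rewrite (@eq_I2 _ _ (fun x => \sum_(r <- gidx k) \sum_(r' <- gidx k) cellf 1 r x * PQ (x + - (zr r' + c0)))); last first.
  move=> x; rewrite pot_Bx /cs big_distrl /=; apply: eq_bigr => r _; rewrite big_distrr /=.
  by apply: eq_bigr => r' _; rewrite opprD addrA.
rewrite I2_sum; last by move=> r; exact: ig_sum.
apply: eq_bigr => r _; rewrite I2_sum//; apply: eq_bigr => r' _.
have [j <-] := hQ_Q (lint_PQ (zr (r - r')) (good_Q (R := R))).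
rewrite -(I2_trans (- (zr r + c0)) j); apply: eq_I2 => y; rewrite cell_hQ; congr (_ * PQ _).
by rewrite zrB !opprD !addrA [y - zr r - c0 + zr r]addrAC subrK addrAC.
Qed.
End box.
End Scaling.

(** * Quarter turns of a block of the lattice *)

Section Symmetrization.
Context {R : realType}.
Local Notation R2 := (R * R)%type.
Implicit Types (x y z w u v : R2) (f g h : R2 -> R) (r D : int * int).

(** A quarter turn maps the block to itself, but cells are indexed by their lower left corners,
    whence the [- 1]. It disappears in differences of indices. *)
Lemma gidx_turn k (F : int * int -> R) :
  \sum_(r <- gidx k) F r = \sum_(r <- gidx k) F (- 1 - r.2, r.1).
Proof.
rewrite -(big_map (fun r : int * int => (- 1 - r.2, r.1)) predT F); apply: perm_big.
apply: uniq_perm; [exact: uniq_gidx|rewrite map_inj_uniq ?uniq_gidx//|].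
  by move=> [a b] [c d] /= [h1 ->]; congr pair; lia.
move=> [a b]; apply/idP/mapP => [h|[[c d] h [-> ->]]].
  exists (b, - 1 - a); last by rewrite /=; congr pair; lia.
  by move: h; rewrite !mem_gidx /= => /and4P[h1 h2 h3 h4]; do 2?[apply/andP; split]; lia.
by move: h; rewrite !mem_gidx /= => /and4P[h1 h2 h3 h4]; do 2?[apply/andP; split]; lia.
Qed.
Lemma turn_sum k f : \sum_(r <- gidx k) \sum_(r' <- gidx k) f (zr (r - r')) =
  \sum_(r <- gidx k) \sum_(r' <- gidx k) f (cm (0, 1) (zr (r - r'))) :> R.
Proof.
rewrite gidx_turn; apply: eq_bigr => r _; rewrite gidx_turn; apply: eq_bigr => r' _.
by congr f; rewrite /cm /zr /= !intrD !intrN; congr pair; rewrite /=; ring.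
Qed.
Lemma sym_sum k f : \sum_(r <- gidx k) \sum_(r' <- gidx k) f (zr (r - r')) =
  \sum_(r <- gidx k) \sum_(r' <- gidx k) 4^-1 * (\sum_(v <- qr) f (cm v (zr (r - r')))) :> R.
Proof.
pose S v := \sum_(r <- gidx k) \sum_(r' <- gidx k) f (cm v (zr (r - r'))).
have e1 : S (1, 0) = \sum_(r <- gidx k) \sum_(r' <- gidx k) f (zr (r - r')).
  by apply: eq_bigr => r _; apply: eq_bigr => r' _; rewrite cm1.
have st v : S (cm v (0, 1)) = S v.
  rewrite /S (turn_sum k (fun w => f (cm v w))); apply: eq_bigr => r _; apply: eq_bigr => r' _.
  by rewrite cmA.
have e2 : S (0, 1) = S (1, 0) by rewrite -(st (1, 0)) cm1.
have e3 : S (-1, 0) = S (1, 0) by rewrite -e2 -(st (0, 1)); congr S; rewrite /cm /=; congr pair; ring.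
have e4 : S (0, -1) = S (1, 0) by rewrite -e3 -(st (-1, 0)); congr S; rewrite /cm /=; congr pair; ring.
transitivity (4^-1 * (S (1, 0) + S (-1, 0) + S (0, 1) + S (0, -1))).
  by rewrite e2 e3 e4 -e1; lra.
rewrite /S -!big_split /= mulr_sumr; apply: eq_bigr => r _; rewrite -!big_split /= mulr_sumr.
by apply: eq_bigr => r' _; rewrite sum_qr.
Qed.

(** As [PQ] is invariant, turning [w] about the origin amounts to turning [z] the other way, and
    [phi_average] applies. *)
Lemma PQ_average z w : 4^-1 * \sum_(v <- qr) PQ (z + cm v w) = PQ w + pot (fq z) Qf w.
Proof.
have := phi_average z w; rewrite /phi => e.
have e1 : 4^-1 * \sum_(v <- qr) PQ (w - cm v z) = PQ w + pot (fq z) Qf w.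
  by move: e; rewrite !sum_qr /fq sum_qr; lra.
rewrite -e1; congr (_ * _).
have t v v' : v \in qr -> cm (conj v) z = - cm v' z -> PQ (z + cm v w) = PQ (w - cm v' z).
  move=> vq ez; rewrite -(PQ_rot _ (conj_qr vq)) cmDr cm_uK ?qr_nsq// ez addrC//.
rewrite !sum_qr (t (1, 0) (-1, 0)) ?(t (-1, 0) (1, 0)) ?(t (0, 1) (0, 1)) ?(t (0, -1) (0, -1));
  try by [rewrite !inE eqxx ?orbT|rewrite /cm /conj /=; congr pair; rewrite /=; ring].
by ring.
Qed.
Lemma PQ_self w : I2 (fun y => Qf y * PQ (y + w)) = PQ w + pot phi Qf w.
Proof.
have kl := @ker_lg R; have gQ := good_Q (R := R).
have i : ig (fun y => Qf y * PQ (y + w)) by exact: lint_PQ.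
have i' : ig (fun y => PQ (w - y) * Qf y).
  apply: eq_ig (ig_opp i) => y; rewrite mulrC addrC; congr (_ * _).
  by rewrite -cmN1 Q_rot// !inE eqxx ?orbT.
have il := ig_pot kl w gQ.
have -> : pot phi Qf w = I2 (fun y => PQ (w - y) * Qf y) - PQ w.
  rewrite [PQ w]/PQ /pot -I2B//; apply: eq_I2 => y; by rewrite /phi mulrBl.
rewrite addrC subrK -(I2_opp i); apply: eq_I2 => y; rewrite mulrC addrC; congr (_ * _).
by rewrite -cmN1 Q_rot// !inE eqxx ?orbT.
Qed.
End Symmetrization.

Section LatticeAverages.
Context {R : realType}.
Local Notation R2 := (R * R)%type.
Implicit Types (x y z w : R2) (f : R2 -> R) (r D : int * int) (u : int * int -> R).

(** The normalization is by the number of cells, not of pairs: an energy per cell. *)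
Definition avk k u : R := ((2 * k)%:R ^+ 2)^-1 * \sum_(r <- gidx k) \sum_(r' <- gidx k) u (r - r').
Definition avlim u (L : R) := avk k u @[k --> \oo] --> L.
Lemma avlim_ext u u' L : u =1 u' -> avlim u L -> avlim u' L.
Proof. by move=> /funext ->. Qed.
Lemma avlimD u u' L L' : avlim u L -> avlim u' L' -> avlim (fun D => u D + u' D) (L + L').
Proof.
move=> h h'; rewrite /avlim (_ : (fun k => _) = (fun k => avk k u + avk k u')); first exact: cvgD.
apply/funext => k; rewrite /avk -mulrDr -big_split /=; congr (_ * _); apply: eq_bigr => r _; by rewrite -big_split.
Qed.
Lemma avlimZ c u L : avlim u L -> avlim (fun D => c * u D) (c * L).
Proof.
move=> h; rewrite /avlim (_ : (fun k => _) = (fun k => c * avk k u)); first exact: cvgM (cvg_cst c) h.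
apply/funext => k; rewrite /avk [RHS]mulrCA; congr (_ * _); rewrite mulr_sumr; apply: eq_bigr => r _; by rewrite mulr_sumr.
Qed.
Lemma avlim_sum (I : Type) (s : seq I) (F : I -> int * int -> R) (L : I -> R) :
  (forall i, avlim (F i) (L i)) -> avlim (fun D => \sum_(i <- s) F i D) (\sum_(i <- s) L i).
Proof.
move=> h; elim: s => [|i s ih].
  rewrite big_nil /avlim (_ : (fun k => _) = fun=> 0); first exact: cvg_cst.
  by apply/funext => k; rewrite /avk big1 ?mulr0// => r _; rewrite big1// => r' _; rewrite big_nil.
by rewrite big_cons; apply: avlim_ext (avlimD (h i) ih) => D; rewrite big_cons.
Qed.
Lemma avlim_pot f : ig f -> (forall x, f (- x) = f x) -> avlim (fun D => pot f Qf (zr D)) (I2 f).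
Proof.
move=> hf ef; have := cesaro (ig_trans (- c0) hf); rewrite (I2_trans (- c0) hf).
apply: cvg_trans; apply: near_eq_cvg; apply: nearW => k /=; congr (_ * _); apply: eq_bigr => r _; apply: eq_bigr => r' _.
set D := r - r'; have iQ : ig (fun y => Qf y * f (y + zr D)).
  apply: (@ig_mulb _ _ _ 1) (ig_trans (zr D) hf); first exact: good_meas (good_Q (R := R)).
  by move=> x; have /andP[q0 q1] := Q01 x; rewrite ger0_norm.
have [i e] := hQ_Q iQ.
transitivity (I2 (fun y => Qf y * f (y + zr D))); last first.
  rewrite /pot -(I2_opp iQ); apply: eq_I2 => y; rewrite mulrC -cmN1 Q_rot ?inE ?eqxx ?orbT//.
  by rewrite cmN1 [_ + zr D]addrC.
rewrite -e -(I2_trans (- (zr D + c0)) i); apply: eq_I2 => w; rewrite -cell_hQ; congr (_ * f _).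
by rewrite opprD addrA [RHS]addrAC subrK.
Qed.
(** The differences of a square block are invariant under quarter turns, so the limit only sees the
    average of [f] over the turns. This gives a limit to summands that are not summable by
    themselves. *)
Lemma avlim_turn f L : avlim (fun D => 4^-1 * \sum_(v <- qr) f (cm v (zr D))) L -> avlim (fun D => f (zr D)) L.
Proof.
by apply: cvg_trans; apply: near_eq_cvg; apply: nearW => k /=; rewrite /avk sym_sum.
Qed.
End LatticeAverages.

Lemma sub_shift (V : zmodType) (A B A' B' c : V) : (A + c + B) - (A' + c + B') = B - B' + (A - A').
Proof. by rewrite opprD addrACA [A' + c]addrC addrKA addrC. Qed.

(* Finite pieces of a crystal with vanishing dipole moment: the lattice symmetry of the
   piece removes the quadrupole, and the energy per cell converges to the periodic energy. *)
Section Cluster.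
Context {R : realType}.
Local Notation R2 := (R * R)%type.
Implicit Types (x y z w : R2) (r D : int * int).
Let kl := @ker_lg R.
Variables (s : seq R2).
Hypotheses (us : uniq s) (s0 : (0 < size s)%N).
Hypothesis off : forall x y, x \in s -> y \in s -> x != y -> offl (x - y).
Local Notation M := (size s).
(** The crystal has [M] points per unit cell; dilation by [l] brings it to density 1. *)
Let l : R := Num.sqrt M%:R.
Let l0 : 0 < l. Proof. by rewrite sqrtr_gt0 ltr0n. Qed.
Let l2 : l ^+ 2 = M%:R. Proof. exact: sqr_sqrtN. Qed.
Let P k := [seq zr r + c0 + x | r <- gidx k, x <- s].
Let N k := ((2 * k) ^ 2 * M)%N.
Let size_P k : size (P k) = N k.
Proof. by rewrite size_allpairs size_gidx /N expnS expn1. Qed.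
Let uniq_P k : uniq (P k).
Proof.
apply: allpairs_uniq; [exact: uniq_gidx|exact: us|].
move=> [r x] [r' x'] /allpairsP[[a b] [_ hb [-> ->]]] /allpairsP[[a' b'] [_ hb' [-> ->]]] /= e.
have [eb|nb] := eqVneq b b'.
  move: e; rewrite eb => /addIr /addIr ea; congr pair; apply/eqP; rewrite -subr_eq0 -(zr_eq0 (R := R)) zrB ea subrr//.
by have := off hb hb' nb (a - a'); rewrite zrB -(sub_shift _ _ _ _ c0) e subrr eqxx.
Qed.
Let sumP k (F : R2 -> R) : \sum_(p <- P k) F p = \sum_(r <- gidx k) \sum_(x <- s) F (zr r + c0 + x).
Proof. by rewrite big_allpairs_dep. Qed.

(** The coupling of the points and background of one cell with those of the cell at offset [D].
    Summed over ordered pairs of cells it gives twice the energy before dilation; the diagonal pairs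
    contribute [nlg 0 = 0]. *)
Let T D : R := \sum_(x <- s) \sum_(y <- s) nlg (x - y + zr D) + 2 * M%:R * \sum_(x <- s) PQ (x + zr D)
  - M%:R ^+ 2 * I2 (fun y => Qf y * PQ (y + zr D)).

Let sNE k : Num.sqrt (N k)%:R / 2 = k%:R * l :> R.
Proof.
rewrite /N natrM natrX sqrtrM ?sqr_ge0// sqrtr_sqr ger0_norm// natrM -/l; by field.
Qed.
Let bsq_sc k x : bsq (N k) (sc l x) = Bx k x.
Proof.
rewrite /bsq sNE /Bx !indicE; congr (nat_of_bool _)%:R; apply/idP/idP; rewrite !inE /bx /sc /= !normrM (gtr0_norm l0) ![l * _]mulrC !ler_pM2r//.
Qed.
(** Dilation adds [- ln l] per pair of particles and [+ ln l] for the background terms; by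
    neutrality the terms quadratic in the number of particles cancel and [N ln l] remains in twice
    the energy. *)
Lemma energy_scaled k : 2 * eJ (bsq (N k)) [seq sc l p | p <- P k] = (N k)%:R * ln l +
  \sum_(r <- gidx k) \sum_(r' <- gidx k) T (r - r').
Proof.
have gb := good_bsq (R := R) (N k).
have fB : (fun x => bsq (N k) (sc l x)) = Bx k by apply/funext => x; exact: bsq_sc.
have NE : (N k)%:R = (2 * k)%:R ^+ 2 * M%:R :> R by rewrite /N natrM natrX.
have e1 : 2 * pEs nlg [seq sc l p | p <- P k] =
    \sum_(p <- P k) \sum_(q <- P k) nlg (p - q) - ln l * ((N k)%:R ^+ 2 - (N k)%:R).
  have := pEs_double [seq sc l p | p <- P k] (let: And3 _ e _ := @ker_nlg R in e).
  have -> : nlg (0 : R2) = 0 by rewrite /nlg lg0 oppr0.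
  rewrite mulr0 addr0 big_map => <-.
  have e p q : nlg (sc l p - sc l q) = nlg (p - q) - ln l * (1 - (q == p)%:R).
    have [->|pq] := eqVneq q p; first by rewrite !subrr mulr0 subr0.
    by rewrite -scB /nlg lg_sc ?subr_eq0 1?eq_sym// subr0 mulr1 opprD addrC.
  transitivity (\sum_(p <- P k) (\sum_(q <- P k) nlg (p - q) - ln l * ((N k)%:R - 1))).
    rewrite big_seq [RHS]big_seq; apply: eq_bigr => p hp; rewrite big_map.
    under eq_bigr => q _ do rewrite e.
    rewrite sumrB -mulr_sumr sumrB sum_seq_const size_P mulr1; congr (_ - _ * (_ - _)).
    rewrite (bigD1_seq p)//= eqxx big1 ?addr0// => q /negbTE -> //.
  by rewrite sumrB sum_seq_const size_P; congr (_ - _); ring.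
have e2 : \sum_(p <- P k) pot lg (bsq (N k)) (sc l p) =
   M%:R * (ln l * (2 * k)%:R ^+ 2 * (N k)%:R + \sum_(p <- P k) pot lg (Bx k) p).
  under eq_bigr => p _ do rewrite (pot_sc l0 p gb) fB I2_Bx l2.
  by rewrite -mulr_sumr big_split /= sum_seq_const size_P; ring.
have e3 : I4 lg (bsq (N k)) (bsq (N k)) = M%:R ^+ 2 * (ln l * (2 * k)%:R ^+ 4 + I4 lg (Bx k) (Bx k)).
  by rewrite (I4_sc l0 gb) fB I2_Bx -l2; ring.
have e4 : \sum_(p <- P k) \sum_(q <- P k) nlg (p - q) =
  \sum_(r <- gidx k) \sum_(r' <- gidx k) \sum_(x <- s) \sum_(y <- s) nlg (x - y + zr (r - r')).
  rewrite sumP; apply: eq_bigr => r _; rewrite [RHS]exchange_big /=; apply: eq_bigr => x _.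
  rewrite sumP; apply: eq_bigr => r' _; apply: eq_bigr => y _; congr nlg.
  by rewrite zrB sub_shift.
have e5 : \sum_(p <- P k) pot lg (Bx k) p =
  \sum_(r <- gidx k) \sum_(r' <- gidx k) \sum_(x <- s) PQ (x + zr (r - r')).
  rewrite sumP; apply: eq_bigr => r _; rewrite [RHS]exchange_big /=; apply: eq_bigr => x _.
  rewrite pot_Bx; apply: eq_bigr => r' _; congr PQ; rewrite zrB.
  by have := sub_shift (zr r) x (zr r') 0 c0; rewrite addr0 subr0 opprD addrA.
rewrite /eJ big_map mulrBr mulrDr e1 e2 e3 e4 e5 I4_Bx /T.
under [X in _ = _ + X]eq_bigr => r _ do rewrite sumrB big_split /= -!mulr_sumr.
rewrite sumrB big_split /= -!mulr_sumr NE.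
set X1 := \sum_(r <- gidx k) _; set X2 := \sum_(r <- gidx k) _; set X3 := \sum_(r <- gidx k) _.
clearbody X1 X2 X3; move: ((2 * k)%:R : R) (M%:R : R) (ln l) => a b c; by field.
Qed.

Hypothesis cen1 : \sum_(x <- s) x.1 = 0.
Hypothesis cen2 : \sum_(x <- s) x.2 = 0.
(** With centre of mass at the origin, the sum of [|x - y|^2] over ordered pairs is [2 M] times the
    sum of [|x|^2]. So the second moments of particle pairs and of particle-background pairs
    compensate. *)
Let alpha_sum : \sum_(x <- s) \sum_(y <- s) alpha (x - y) = 2 * M%:R * \sum_(x <- s) alpha x.
Proof.
have e x y : alpha (x - y) = alpha x + alpha y - 2 * alpha (1, 0) * (x.1 * y.1) - 2 * alpha (1, 0) * (x.2 * y.2).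
  by rewrite !(alphaE (_ - _)) (alphaE x) (alphaE y) /nsq /=; ring.
transitivity (\sum_(x <- s) (M%:R * alpha x + \sum_(y <- s) alpha y)).
  apply: eq_bigr => x _; under eq_bigr => y _ do rewrite e.
  rewrite !sumrB big_split /= -!mulr_sumr cen1 cen2 !mulr0 !subr0 sum_seq_const//.
by rewrite big_split /= sum_seq_const -mulr_sumr; ring.
Qed.

(** [T] is a summable part made of [phi (x - y + D)] plus a rest in which only [PQ] occurs. In the
    average of the rest over quarter turns the slowly decaying [PQ w] has coefficient
    [- M^2 + 2 M M - M^2 = 0]; what is left are convolutions of the integrable [fq] and [phi], whose
    limits are [alpha] and [kph]. *)
Let T_lim : avlim T (\sum_(x <- s) \sum_(y <- s) Phi (x - y) - M%:R ^+ 2 * kph).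
Proof.
pose rr w : R := - (\sum_(x <- s) \sum_(y <- s) PQ (x - y + w)) + 2 * M%:R * \sum_(x <- s) PQ (x + w)
  - M%:R ^+ 2 * I2 (fun y => Qf y * PQ (y + w)).
have TE D : \sum_(x <- s) \sum_(y <- s) phi (x - y + zr D) + rr (zr D) = T D.
  rewrite /T /rr addrA addrA -sumrB; congr (_ + _ - _); apply: eq_bigr => x _.
  by rewrite -sumrB; apply: eq_bigr => y _; rewrite /phi /nlg; ring.
apply: (avlim_ext TE); apply: avlimD.
  apply: avlim_sum => x; apply: avlim_sum => y; exact: cesaro_per (@summ_phi R).
apply: avlim_turn.
have rE w : - 1 * (\sum_(x <- s) \sum_(y <- s) pot (fq (x - y)) Qf w) + 2 * M%:R * \sum_(x <- s) pot (fq x) Qf w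
   + - M%:R ^+ 2 * pot phi Qf w = 4^-1 * \sum_(v <- qr) rr (cm v w).
  have q v : v \in qr -> I2 (fun y => Qf y * PQ (y + cm v w)) = PQ w + pot phi Qf w.
    move=> vq; rewrite -PQ_self.
    have i : ig (fun y => Qf y * PQ (y + cm v w)) by apply: lint_PQ; exact: good_Q.
    by rewrite -(I2_u (qr_nsq vq) i); apply: eq_I2 => y; rewrite Q_rot// -cmDr PQ_rot.
  have e2 : 4^-1 * (\sum_(v <- qr) \sum_(x <- s) PQ (x + cm v w)) = M%:R * PQ w + \sum_(x <- s) pot (fq x) Qf w.
    rewrite exchange_big mulr_sumr /=; under eq_bigr => x _ do rewrite PQ_average.
    by rewrite big_split /= sum_seq_const.
  have e3 : 4^-1 * (\sum_(v <- qr) \sum_(x <- s) \sum_(y <- s) PQ (x - y + cm v w)) =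
      M%:R ^+ 2 * PQ w + \sum_(x <- s) \sum_(y <- s) pot (fq (x - y)) Qf w.
    rewrite exchange_big mulr_sumr /=.
    transitivity (\sum_(x <- s) (M%:R * PQ w + \sum_(y <- s) pot (fq (x - y)) Qf w)).
      apply: eq_bigr => x _; rewrite exchange_big mulr_sumr /=; under eq_bigr => y _ do rewrite PQ_average.
      by rewrite big_split /= sum_seq_const.
    by rewrite big_split /= sum_seq_const; ring.
  have e4 : \sum_(v <- qr) I2 (fun y => Qf y * PQ (y + cm v w)) = 4 * (PQ w + pot phi Qf w).
    rewrite big_seq (eq_bigr (fun=> PQ w + pot phi Qf w)) => [|v vq]; last exact: q.
    by rewrite -big_seq sum_seq_const.
  rewrite /rr sumrB big_split /= -!mulr_sumr sumrN e4 mulrBr mulrDr mulrN e3 mulrCA e2.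
  move: (\sum_(x <- s) _) (\sum_(x <- s) _) (PQ w) (pot phi Qf w) => a b c d; by field.
apply: (avlim_ext (fun D => rE (zr D))).
have -> : - (M%:R ^+ 2 * kph) = - 1 * (\sum_(x <- s) \sum_(y <- s) alpha (x - y)) +
    2 * M%:R * (\sum_(x <- s) alpha x) + - M%:R ^+ 2 * kph :> R.
  by rewrite alpha_sum; ring.
apply: avlimD; [apply: avlimD|]; apply: avlimZ.
- by apply: avlim_sum => x; apply: avlim_sum => y; apply: avlim_pot; [exact: ig_fq|exact: fq_even].
- by apply: avlim_sum => x; apply: avlim_pot; [exact: ig_fq|exact: fq_even].
- by apply: avlim_pot; [exact: ig_phi|exact: phi_even].
Qed.

(** [jel_lower] applied to large blocks of the crystal and divided by the number of cells. The
    tolerance there is divided by [4 M], since a cell holds [M] particles. *)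
Lemma crystal_lower : 2 * e0 * M%:R <= M%:R * ln l + (\sum_(x <- s) \sum_(y <- s) Phi (x - y) - M%:R ^+ 2 * kph).
Proof.
apply/ler_addgt0Pr => d d0; have M0 : 0 < M%:R :> R by rewrite ltr0n.
have d1 : 0 < d / (4 * M%:R) by rewrite divr_gt0// mulr_gt0.
have [N0 hN] := jel_lower d1.
move/cvgrPdist_le: T_lim => /(_ (d / 2) (divr_gt0 d0 (ltr0n R 2)))[n _ hn].
pose k := (maxn n N0).+1; have nk : (n <= k)%N by rewrite ltnW// ltnS leq_maxl.
have k0 : 0 < (2 * k)%:R ^+ 2 :> R by rewrite exprn_gt0// ltr0n.
have kN : (k <= N k)%N by rewrite /N; nia.
have uk : uniq [seq sc l p | p <- P k].
  rewrite map_inj_uniq ?uniq_P// => x y /(congr1 (sc l^-1)); rewrite !scA mulVf ?gt_eqF// !sc1//.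
have := hN (N k) (leq_trans (leq_trans (leq_maxr n N0) (leqnSn _)) kN) (leq_trans (ltn0Sn _) kN) _ _ uk.
rewrite size_map size_P => /(_ erefl) hJ.
have := hn k nk; rewrite /= /avk => hT.
have eT : \sum_(r <- gidx k) \sum_(r' <- gidx k) T (r - r') = (2 * k)%:R ^+ 2 * avk k T.
  by rewrite /avk mulVKf// gt_eqF.
have : 2 * ((e0 - d / (4 * M%:R)) * M%:R) <= M%:R * ln l + avk k T.
  rewrite -(ler_pM2l k0); have := energy_scaled k; rewrite eT; move: hJ.
  have -> : (N k)%:R = (2 * k)%:R ^+ 2 * M%:R :> R by rewrite /N natrM natrX.
  move: ((2 * k)%:R ^+ 2 : R) (eJ _ _) (avk k T) (M%:R : R) (_ / _) (ln l) => a b c m q L; nra.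
have -> : 2 * ((e0 - d / (4 * M%:R)) * M%:R) = 2 * e0 * M%:R - d / 2 by field; rewrite gt_eqF.
move: hT; rewrite -/(avk k T) ler_norml => /andP[h1 h2].
by move: (avk k T) (\sum_(x <- s) _ - _) h1 h2 => a b h1 h2; lra.
Qed.
End Cluster.

(** * The torus *)

Section Torus.
Context {R : realType}.
Local Notation R2 := (R * R)%type.
Implicit Types (x y z : R2) (l : R).

Definition Kl l x : R := Phi (sc l^-1 x) - kph.
Lemma Kl_even l x : Kl l (- x) = Kl l x.
Proof. by rewrite /Kl scN Phi_even. Qed.
Lemma ker_Kl l : 0 < l -> ker (Kl l).
Proof.
move=> l0; have li : 0 < l^-1 by rewrite invr_gt0.
have lK : lint (Kl l).
  have h : lint (fun x => Phi (sc l^-1 x) + (- kph)).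
    apply: lintD; last exact: lint_cst.
    move=> f hf; have := (I2_sc li (lint_Phi (good_sc l0 hf))).1.
    by apply: eq_ig => x; rewrite scA mulfV ?gt_eqF// sc1.
  exact: h.
by split => //; [exact: lint_meas|exact: Kl_even].
Qed.
Lemma cell_sc l x : cellf l 0 x = cellf 1 0 (sc l^-1 x) :> R.
Proof. by rewrite cell1. Qed.
Lemma pot_Kl l x : 0 < l -> pot (Kl l) (cellf l 0) x = 0.
Proof.
move=> l0; have kK := ker_Kl l0; have gc := good_cell (0 : int * int) l0.
have [_ e] := I2_sc l0 (ig_pot kK x gc); rewrite /pot e.
have pP : periodic (@Phi R) := @Phi_periodic R.
have [i1 e1] := cell_shift (- sc l^-1 x) pP (ig_Phi (R := R)).1.
rewrite (@eq_I2 _ _ (fun y => cellf 1 0 y * Phi (y + - sc l^-1 x) - kph * cellf 1 0 y)); last first.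
  move=> y; rewrite cell_sc /Kl scB !scA mulVf ?gt_eqF// sc1 -Phi_even opprB mulrBl; congr (_ - _).
  by rewrite mulrC.
have ic : ig (cellf 1 0 : R2 -> R) by apply: good_ig; exact: good_cell.
rewrite I2B//; last exact: igZ.
by rewrite e1 (ig_Phi (R := R)).2 I2Z// I2_cell// expr1n mulr1 subrr mulr0.
Qed.
Lemma I4_Kl l : 0 < l -> I4 (Kl l) (cellf l 0) (cellf l 0) = 0.
Proof.
move=> l0; rewrite I4E (@eq_I2 _ _ (fun=> 0)) ?I20// => x; by rewrite pot_Kl// mulr0.
Qed.
Lemma Kl_near dl : 0 < dl -> exists2 rho : R, 0 < rho & forall l x, 0 < l -> x != 0 -> nrm x < rho * l ->
  `|Kl l x - (nlg x + (ln l + (Phi (0 : R2) - kph)))| <= dl.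
Proof.
move=> dl0; have [rho rho0 h] := @cts_Phi0 R dl dl0; exists rho => // l x l0 x0 hx.
have := h (sc l^-1 x); rewrite subr0 lg0 addr0 nrm_sc ger0_norm ?invr_ge0 ?(ltW l0)// mulrC ltr_pdivrMr// => /(_ hx).
rewrite lg_sc ?invr_gt0// lnV ?posrE//; congr (`|_| <= _).
by rewrite /Kl /nlg; ring.
Qed.

(** On a square of fixed side in a large torus the kernel is [nlg + L] up to [dl]. With [n = m^2],
    the constant [L] enters [n (n - 1) / 2] times through pairs, [- n^2] and [n^2 / 2] times through
    the background: [- n L / 2] in all, which the self-energy term of [Eper] compensates. *)
Lemma state_torus m j dl : exS m j -> 0 < dl -> exists l1 : R, forall l, l1 <= l -> 0 < l ->
  JA (Kl l) (m ^ 2) (cellf m%:R 0) (cellf m%:R 0)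
    (j - (m ^ 2)%:R / 2 * (ln l + (Phi (0 : R2) - kph)) + dl * (m ^ 2)%:R ^+ 2).
Proof.
move=> [m0 [E [hA hj]]] dl0; have m0' : 0 < m%:R :> R by rewrite ltr0n.
have [rho rho0 hr] := Kl_near dl0.
exists (2 * m%:R / rho + 1) => l l1 l0; have kK := ker_Kl l0; have kn := @ker_nlg R.
have gc : good (cellf m%:R 0 : R2 -> R) by exact: good_cell.
pose L := ln l + (Phi (0 : R2) - kph).
have near x y : cellf m%:R 0 x != 0 :> R -> cellf m%:R 0 y != 0 :> R -> x != y ->
    `|Kl l (x - y) - (nlg (x - y) + L)| <= dl.
  move=> hx hy xy; apply: hr; rewrite ?subr_eq0//; apply: (le_lt_trans (cell_nrm m0' hx hy)).
  by rewrite [rho * l]mulrC -ltr_pdivrMr//; lra.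
have a1 : E (Kl l) <= E nlg + (L + dl) * prs (m ^ 2).
  by apply: (Ach_le hA kK kn) => x y hx hy xy; have := near x y hx hy xy; rewrite ler_norml => /andP[]; lra.
have a2 : I4 nlg (cellf m%:R 0) (cellf m%:R 0) + (L - dl) * (m ^ 2)%:R ^+ 2 <= I4 (Kl l) (cellf m%:R 0) (cellf m%:R 0).
  have kc := ker_cst (L - dl : R).
  have I1 : I2 (cellf m%:R 0 : R2 -> R) = (m ^ 2)%:R by rewrite I2_cell// natrX.
  rewrite expr2 mulrA -{1}I1 -{1}I1 -I4_cst// -I4_kerD//.
  apply: (I4_le (kerD kn kc) kK gc gc); [by move=> x; exact: cell_ge0|by move=> x; exact: cell_ge0|].
  by move=> x y hx hy xy; have := near x y hx hy xy; rewrite ler_norml => /andP[]; lra.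
exists E; split => //; rewrite -/L.
move: hj a1 a2; rewrite /prs; have n0 : 0 <= (m ^ 2)%:R :> R by [].
move: (E _) (E _) (I4 _ _ _) (I4 _ _ _) ((m ^ 2)%:R : R) n0 => e1 e2 i1 i2 n n0 hj a1 a2.
have : 0 <= dl * n by rewrite mulr_ge0// ltW.
move: (mulrC dl n) => _; nra.
Qed.

Lemma fill_torus m j N : (0 < m)%N -> (0 < N)%N -> forall l, l = Num.sqrt N%:R -> forall c, 0 <= c ->
  (forall x, - c <= Kl l x) -> JA (Kl l) (m ^ 2) (cellf m%:R 0) (cellf m%:R 0) j ->
  JA (Kl l) N (cellf l 0) (cellf l 0)
    (j / (m ^ 2)%:R * N%:R + (`|j| / (m ^ 2)%:R + c) * (4 * m%:R * l)).
Proof.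
move=> m0 N0 l lE c c00 hK h; have m0' : 0 < m%:R :> R by rewrite ltr0n.
have l0 : 0 < l by rewrite lE sqrtr_gt0 ltr0n.
have [k [k1 k2 k3]] := @grid_count R m N m0; rewrite -lE in k2 k3.
have gA : good (cellf l 0 : R2 -> R) by exact: good_cell.
have IA : I2 (cellf l 0 : R2 -> R) = N%:R by rewrite I2_cell// lE sqr_sqrtN.
have hs x : (fl (sc m%:R^-1 x) \in zidx (2 * k))%:R <= cellf l 0 x :> R.
  case: (boolP (_ \in _)) => [|_]; last exact: cell_ge0.
  rewrite mem_zidx /cellf /fl /= => /andP[/andP[a1 a2] /andP[a3 a4]].
  have b (t : R) : (0 <= Num.floor (m%:R^-1 * t))%R -> (Num.floor (m%:R^-1 * t) < (2 * k)%:Z)%R -> Num.floor (l^-1 * t) = 0.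
    rewrite floor_ge_int floor_lt_int -pmulrn natrM => b1 b2; apply/eqP; rewrite floor_eq add0r.
    rewrite ltr_pdivrMl// in b2; rewrite pmulr_rge0 ?invr_gt0// in b1.
    by rewrite mulr_ge0 ?invr_ge0 ?(ltW l0)//= ltr_pdivrMl// mulr1; apply: (lt_le_trans b2); lra.
  by rewrite (b _ a1 a2) (b _ a3 a4) eqxx.
have := JA_fill (ker_Kl l0) m0' gA (uniq_zidx (2 * k)) c00 hs IA _ _ _ h.
rewrite size_zidx -natrX => /(_ erefl k1 (fun x y _ _ _ => hK _)).
have n0 : 0 < (m ^ 2)%:R :> R by rewrite ltr0n expn_gt0 m0.
move=> H; apply: JA_le H _; set q := (2 * k * (2 * k))%N in k1 k3 *.
have eN : N%:R = (m ^ 2)%:R * q%:R + (N - m ^ 2 * q)%:R :> R by rewrite -natrM -natrD subnKC.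
have r0 : 0 <= (N - m ^ 2 * q)%:R :> R by [].
have j1 : - (j / (m ^ 2)%:R) <= `|j| / (m ^ 2)%:R by rewrite -mulNr ler_pM2r ?invr_gt0// -normrN ler_norm.
have -> : q%:R * j = j / (m ^ 2)%:R * N%:R - j / (m ^ 2)%:R * (N - m ^ 2 * q)%:R.
  by rewrite eN; field; rewrite gt_eqF.
have p0 : 0 <= `|j| / (m ^ 2)%:R by rewrite divr_ge0// ltW.
move: k3 r0 j1 p0; clear eN; move: ((N - m ^ 2 * q)%:R : R) (4 * m%:R * l) (`|j| / _) (j / _) => r X a b k3 r0 j1 p0.
have h1 : - b * r <= a * r by exact: ler_wpM2r.
have h2 : a * r <= a * X by exact: ler_wpM2l.
have h3 : c * r <= c * X by exact: ler_wpM2l.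
have h4 : r / 2 * c = c * r / 2 by ring.
have h5 : 0 <= c * r by exact: mulr_ge0.
by rewrite mulNr in h1; rewrite h4 mulrDl; lra.
Qed.

Lemma ln_double l : 1 <= l -> 0 <= ln l /\ ln l <= ln (2 * l + 1).
Proof. by move=> l1; split; [exact: ln_ge0|rewrite ler_ln ?posrE; lra]. Qed.

Section periodic.
Variables (G1 : R2 -> R) (Cmad : R).
Hypotheses (hG : IsG1 G1) (hC : IsCmad G1 Cmad).

Lemma torus_off n (x : 'I_n -> R2) : (0 < n)%N -> torus_conf x ->
  forall j k, j != k -> offl (sc (Num.sqrt n%:R)^-1 (x j - x k)).
Proof.
move=> n0 [dx hx] j k jk; have l0 : 0 < Num.sqrt n%:R :> R by rewrite sqrtr_gt0 ltr0n.
move: (hx j) (hx k); rewrite !inE /= !in_itv /=.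
move=> [/andP[a1 a2] /andP[b1 b2]] [/andP[c1 c2] /andP[d1 d2]].
apply: offl_small; rewrite -?nrm_eq0 ?nrm_sc ?mulf_neq0 ?normr_eq0 ?invr_eq0 ?gt_eqF//=.
- by rewrite nrm_gt0 subr_eq0; apply/eqP => /(dx j k jk).
- by rewrite normrM gtr0_norm ?invr_gt0// ltr_pdivrMl// mulr1 ltr_norml; apply/andP; split; lra.
- by rewrite normrM gtr0_norm ?invr_gt0// ltr_pdivrMl// mulr1 ltr_norml; apply/andP; split; lra.
Qed.
Lemma Eper_pEs n (x : 'I_n -> R2) : (0 < n)%N -> torus_conf x ->
  Eper G1 Cmad x = pEs (Kl (Num.sqrt n%:R)) [seq x j | j <- enum 'I_n] +
    n%:R / 2 * (ln (Num.sqrt n%:R) + (Phi (0 : R2) - kph)).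
Proof.
move=> n0 hx; rewrite /Eper pEs_ord -(Cmad_Phi hG hC); congr (_ + _).
apply: eq_bigr => j _; apply: eq_bigr => k jk.
rewrite -[X in _ = X](G1_Phi hG hC); first by rewrite /Gl /psub /sc /= ![_ / Num.sqrt _]mulrC.
by apply: (torus_off n0 hx); rewrite -val_eqE neq_ltn jk.
Qed.

(** The configuration, rescaled to the unit torus, generates the crystal of [crystal_lower]. The
    diagonal terms there are [Phi 0 - kph], which is [Cmad] and accounts for the self-energy in
    [Eper]. *)
Lemma minPer_lower n : (0 < n)%N -> ((e0 * n%:R)%:E <= minPer G1 Cmad n)%E.
Proof.
move=> n0; apply: le_ereal_inf_tmp => _ /= [x hx <-]; rewrite lee_fin (Eper_pEs n0 hx).
set l := Num.sqrt n%:R; have n1 : 0 < n%:R :> R by rewrite ltr0n.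
have li : l^-1 != 0 by rewrite invr_eq0 gt_eqF// sqrtr_gt0.
pose y j := sc l^-1 (x j).
(* The centre of mass is subtracted to cancel the dipole; the energy only sees differences. *)
pose c : R2 := (n%:R^-1 * \sum_j (y j).1, n%:R^-1 * \sum_j (y j).2).
pose s := [seq y j - c | j <- enum 'I_n].
have ss : size s = n by rewrite size_map size_enum_ord.
have off j k : j != k -> offl (y j - y k) by move=> jk; rewrite /y -scB; exact: (torus_off n0 hx).
have d j k : (y j - c) - (y k - c) = y j - y k by rewrite opprB addrA subrK.
have us : uniq s.
  rewrite map_inj_uniq ?enum_uniq// => j k /eqP; rewrite -subr_eq0 d => e; apply/eqP; apply: contraTT e => jk.
  by have := off j k jk 0; rewrite zr0 addr0.
have offs u v : u \in s -> v \in s -> u != v -> offl (u - v).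
  move=> /mapP[j _ ->] /mapP[k _ ->] e; rewrite d; apply: off; by apply: contra_neq e => ->.
have sumc (p : R2 -> R) : \sum_(u <- s) p u = \sum_j p (y j - c) by rewrite big_map big_enum.
have c1 : \sum_(u <- s) u.1 = 0.
  by rewrite (sumc fst) /c /= sumrB sumr_const card_ord -[X in _ - X = _]mulr_natl mulVKf ?gt_eqF// subrr.
have c2 : \sum_(u <- s) u.2 = 0.
  by rewrite (sumc snd) /c /= sumrB sumr_const card_ord -[X in _ - X = _]mulr_natl mulVKf ?gt_eqF// subrr.
have s0 : (0 < size s)%N by rewrite ss.
have := crystal_lower us s0 offs c1 c2; rewrite ss -/l.
have := pEs_double [seq x j | j <- enum 'I_n] (Kl_even l).
have K0 : Kl l (0 : R2) = Phi (0 : R2) - kph by rewrite /Kl /sc /= !mulr0.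
rewrite size_map size_enum_ord K0 => e.
have -> : \sum_(u <- s) \sum_(v <- s) Phi (u - v) - n%:R ^+ 2 * kph =
    \sum_(u <- [seq x j | j <- enum 'I_n]) \sum_(v <- [seq x j | j <- enum 'I_n]) Kl l (u - v).
  rewrite sumc big_map big_enum /=.
  transitivity (\sum_(j < n) (\sum_(v <- s) Phi (y j - c - v) - n%:R * kph)).
    by rewrite sumrB sumr_const card_ord -[X in _ = _ - X]mulr_natl mulrA expr2.
  apply: eq_bigr => j _; have -> : n%:R * kph = \sum_(k < n) kph :> R by rewrite sumr_const card_ord mulr_natl.
  rewrite sumc big_map big_enum /= -sumrB.
  by apply: eq_bigr => k _; rewrite d /Kl /y -scB.
rewrite e; move: (pEs _ _) (Phi _) => p P; lra.
Qed.

(** The filled torus has no background terms since the kernel has mean zero, and [derandomize] with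
    [V = 0] selects points in the half-open cell. The terms [ln l + Cmad] of the filling and of
    [Eper] cancel. *)
Lemma minPer_upper (d : R) : 0 < d -> exists N0 : nat, forall N, (N0 <= N)%N -> (0 < N)%N ->
  (minPer G1 Cmad N <= ((e0 + d) * N%:R)%:E)%E.
Proof.
move=> d0; have d4 : 0 < d / 4 by rewrite divr_gt0.
have [m [j [hm hj]]] := e0_near (@e0_bounded R) d4.
have m0 : (0 < m)%N by case: hm.
have n0 : 0 < (m ^ 2)%:R :> R by rewrite ltr0n expn_gt0 m0.
pose n : R := (m ^ 2)%:R; pose dl := d / 4 / n; have dl0 : 0 < dl by rewrite divr_gt0.
have [l1 hl1] := state_torus hm dl0.
(* Unlike [- ln] on growing squares, the kernel of the torus is bounded below uniformly in [l], so
   the independent particles of the frame cost a constant each. *)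
have [Cl hCl] := @Phi_lower R; pose c := `|Cl| + `|@kph R|.
have c00 : 0 <= c by rewrite addr_ge0.
pose P0 : R := Phi (0 : R2) - kph.
pose B := `|j| / n + `|P0| / 2 + d / 4 + c; have B0 : 0 <= B.
  by rewrite /B !addr_ge0// ?divr_ge0// ?ltW.
pose C := 4 * m%:R * (B + 1) + 1; have C0 : 0 <= C by rewrite /C addr_ge0// !mulr_ge0// addr_ge0.
have [a0 a1 ha] := ln_le_lin C0 (divr_gt0 d0 (ltr0n R 2)).
exists (Num.trunc ((`|l1| + a0) ^+ 2)).+1 => N hN N0.
pose l : R := Num.sqrt N%:R; have l2 : l ^+ 2 = N%:R by exact: sqr_sqrtN.
have l0 : 0 < l by rewrite sqrtr_gt0 ltr0n.
have hl : `|l1| + a0 <= l.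
  have q0 : 0 <= `|l1| + a0 by have := normr_ge0 l1; lra.
  rewrite -(@ler_pXn2r _ 2) ?nnegrE ?(ltW l0)// l2; apply: (le_trans (ltW (truncnS_gt _))); by rewrite ler_nat.
have nl1 := normr_ge0 l1; have l1l : l1 <= l by have := ler_norm l1; lra.
have al : a0 <= l by lra.
have hK x : - c <= Kl l x.
  rewrite /Kl /c; have := hCl (sc l^-1 x); have := ler_norm (@kph R); have := ler_norm Cl; lra.
have [E [hA hE]] := fill_torus m0 N0 erefl c00 hK (hl1 l l1l l0).
move: hE; rewrite (I4_Kl l0) mulr0 addr0 subr0 -/n -/P0 => hE.
have [s [ss us hs hp]] := derandomize hA (ker_Kl l0) [::] (@lint_cst R 0) (ltr01).
rewrite big1 // addr0 in hp; rewrite (@eq_I2 _ _ (fun=> 0)) ?I20 ?addr0 in hp; last by move=> x; rewrite mulr0.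
pose x (i : 'I_N) : R2 := nth 0 s i.
have xs : [seq x i | i <- enum 'I_N] = s.
  by have := mkseq_nth 0 s; rewrite /mkseq ss -val_enum_ord -map_comp.
have hx : torus_conf x.
  split=> [i k ik e|i].
    have : nth 0 s i == nth 0 s k by apply/eqP; exact: e.
    by rewrite nth_uniq ?ss// => /eqP /val_inj ik'; rewrite ik' eqxx in ik.
  have xi : x i \in s by apply: mem_nth; rewrite ss.
  have [+ _] := hs _ xi.
  rewrite /cellf pnatr_eq0 eqb0 negbK fl_eq /= !add0r !ler_pdivlMl// !ltr_pdivrMl// !mulr0 !mulr1.
  by move=> /andP[h1 h2]; rewrite inE; split; rewrite /= in_itv.
apply: (le_trans (ereal_inf_lbound _)); first by exists x.
rewrite lee_fin (Eper_pEs N0 hx) xs -/l -/P0.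
have L1 : 1 <= l := le_trans a1 al.
have [ll0 lnl] := ln_double L1.
set J := j - n / 2 * (ln l + P0) + dl * n ^+ 2 in hE.
have nz : n != 0 by rewrite gt_eqF.
have JE : J / n = j / n - (ln l + P0) / 2 + d / 4 by rewrite /J /dl; move: (n) nz => q nz; field.
have jn : j / n <= e0 + d / 4 by rewrite ler_pdivrMr.
have aJ : `|J| / n <= `|j| / n + ln l / 2 + `|P0| / 2 + d / 4.
  rewrite -[X in _ / X](gtr0_norm n0) -normf_div JE.
  apply: le_trans (ler_normD _ _) _; rewrite (gtr0_norm d4) lerD2r.
  apply: le_trans (ler_normB _ _) _; rewrite normf_div (gtr0_norm n0) -!addrA lerD2l.
  rewrite normf_div (@gtr0_norm _ 2)// -mulrDl ler_pM2r//; apply: (le_trans (ler_normD _ _)).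
  by rewrite ger0_norm.
have b1 : (`|J| / n + c) * (4 * m%:R * l) + 1 <= d / 2 * l ^+ 2.
  have hl2 := ha l al.
  have k1 : `|J| / n + c <= B + ln l by rewrite /B; lra.
  apply: (@le_trans _ _ ((C + C * ln (2 * l + 1)) * l)); last by rewrite expr2 mulrA ler_pM2r.
  have m1 : 0 <= 4 * m%:R :> R by [].
  apply: (@le_trans _ _ ((B + ln l) * (4 * m%:R) * l + 1 * l)).
    rewrite mul1r -[X in _ <= X + _]mulrA; apply: lerD => //; apply: ler_wpM2r => //.
    by rewrite mulr_ge0// ltW.
  rewrite -mulrDl ler_pM2r// /C.
  have k2 : 4 * m%:R * ln l <= 4 * m%:R * ln (2 * l + 1) by exact: ler_wpM2l.
  have q0 : 0 <= ln (2 * l + 1) := le_trans ll0 lnl.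
  have k3 : 0 <= 4 * m%:R * B * ln (2 * l + 1) by rewrite !mulr_ge0.
  move: k2 k3 q0 m1; move: (ln (2 * l + 1)) (ln l) (4 * m%:R) => u v w k2 k3 q0 m1; nra.
apply: (@le_trans _ _ (J / n * N%:R + d / 2 * l ^+ 2 + N%:R / 2 * (ln l + P0))).
  rewrite lerD2r; apply: (le_trans hp); apply: (le_trans (lerD hE (lexx 1))).
  by rewrite -addrA lerD2l.
rewrite JE l2; have N1 : 0 <= N%:R :> R by [].
have k4 := ler_wpM2r N1 jn; move: k4; move: (j / n) (ln l + P0) (N%:R : R) (e0 : R) N1 => a b q e N1 k4; lra.
Qed.

Lemma cvg_per : per_seq G1 Cmad @ \oo --> (e0 : R)%:E.
Proof.
apply: cvg_of_bounds => d d0; have [N0 hN] := minPer_upper d0.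
exists N0 => N h1 h2; split; last exact: hN.
by apply: le_trans (minPer_lower h2); rewrite lee_fin ler_wpM2r// gerBl ltW.
Qed.
End periodic.
End Torus.

Unset Implicit Arguments.

Theorem theorem2p1 (R : realType) (G1 : R * R -> R) (Cmad : R) :
  IsG1 G1 -> IsCmad G1 Cmad ->
  exists e : R,
    [/\ @jel_seq R @ \oo --> e%:E,
        per_seq G1 Cmad @ \oo --> e%:E
      & @ueg_seq R @ \oo --> e%:E].
Proof.
move=> hG hC; have [hJ hU] := @cvg_jel_ueg R.
by exists e0; split; [exact: hJ|exact: cvg_per|exact: hU].
Qed.
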